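(* Let $\Omega\subset\mathbb{R}^N$ be a smooth bounded connected open set, let $V:\Omega\to[0,+\infty]$ be a Borel function, and let $Z\subset\Omega$ be the universal zero-set associated to $-\Delta+V$. If the Hausdorff measure $\mathcal{H}^{N-1}(Z)=0$, then $\Omega\setminus Z$ is Sobolev-connected. Hence, the zero-set of any $w\in W_0^{1,2}(\Omega)\cap L^\infty(\Omega)$ such that $Vw\in L^1(\Omega)$ and $-\Delta w+Vw=f$ in the sense of distributions in $\Omega$, with $f\in L^\infty(\Omega)$ nonnegative and $\int_\Omega f>0$, does not depend on $w$, and for every $x\in\Omega$: $\widehat w(x)=0$ if and only if $x\in Z$.
   Context: Products $Vw$ use the convention $0\cdot\infty=0$. Precise representative: a point $x\in\Omega$ is a Lebesgue point of $v\in L^1(\Omega)$ if there is $c\in\mathbb{R}$ with $\lim_{r\to0}\frac{1}{|B_r|}\int_{B_r(x)}|v-c|=0$; then $\widehat v(x):=c$. For $w$ as in the statement every point of $\Omega$ is a Lebesgue point of $w$. Universal zero-set: $Z$ is the set of points $x\in\Omega$ such that $\widehat w(x)=0$ for every $w\in W_0^{1,2}(\Omega)\cap L^\infty(\Omega)$ with $Vw\in L^1(\Omega)$ that satisfies $-\Delta w+Vw=f$ in the sense of distributions in $\Omega$ for some nonnegative $f\in L^\infty(\Omega)$. A set $O\subset\Omega$ is Sobolev-open if there exists a nonnegative $\xi\in W_0^{1,2}(\Omega)$ such that every point of $\Omega$ is a Lebesgue point of $\xi$ and $O=\{x\in\Omega:\widehat\xi(x)>0\}$. A set $D\subset\Omega$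 is Sobolev-connected if for all disjoint Sobolev-open sets $A,B\subset\Omega$ with $D\subset A\cup B$ one has $D\subset A$ or $D\subset B$. *)

(* Defs.v *)
From HB Require Import structures.
From mathcomp Require Import all_boot all_order all_algebra.
From mathcomp Require Import all_classical all_reals all_analysis measurable_realfun.

Set Implicit Arguments.
Unset Strict Implicit.
Unset Printing Implicit Defensive.

Import Order.TTheory GRing.Theory Num.Theory.
Import numFieldNormedType.Exports.

Local Open Scope classical_set_scope.
Local Open Scope ring_scope.

(* R^N is 'rV[R]_N with its Borel sigma-algebra.  The library's topology on
   'rV[R]_N is the usual one, but its norm is the sup norm: Euclidean distances
   are written out below wherever the metric matters. *)
Section borel.
Context {R : realType} {m n : nat}.

Definition mx_borel : set (set 'M[R]_(m, n)) := <<s (@open 'M[R]_(m, n)) >>.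

Lemma mx_borel0 : mx_borel set0.
Proof. exact: sigma_algebra0. Qed.

Lemma mx_borelC A : mx_borel A -> mx_borel (~` A).
Proof. exact: sigma_algebraC. Qed.

Lemma mx_borel_bigcup (F : (set 'M[R]_(m, n))^nat) :
  (forall i, mx_borel (F i)) -> mx_borel (\bigcup_i F i).
Proof. exact: sigma_algebra_bigcup. Qed.

HB.instance Definition _ :=
  @isMeasurable.Build (sigma_display (@open 'M[R]_(m, n))) 'M[R]_(m, n)
    mx_borel mx_borel0 mx_borelC mx_borel_bigcup.

End borel.

Section lebesgue.
Context {R : realType}.

Lemma measurable_fun_rV d (T : measurableType d) n (f : T -> 'rV[R]_n) :
  (forall j, measurable_fun setT (fun x => f x 0 j)) -> measurable_fun setT f.
Proof.
move=> mf; apply: (measurability (@open 'rV[R]_n)) => //.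
move=> _ [U oU <-]; rewrite setTI.
pose B (qk : 'rV[rat]_n * nat) : set 'rV[R]_n :=
  [set y | forall j, `|ratr (qk.1 0 j) - y 0 j| < qk.2.+1%:R^-1].
have UE : U = \bigcup_(qk in [set qk | B qk `<=` U]) B qk.
  apply/seteqP; split => [x Ux|x [qk /= + Bx]]; last exact.
  have /nbhs_ballP[e /= e0 eU] : nbhs x U by exact: open_nbhs_nbhs.
  have [k ke] : exists k : nat, k.+1%:R^-1 < e / 2.
    have e20 : 0 < e / 2 by rewrite divr_gt0.
    near \oo => k; exists k; near: k.
    by have := near_infty_natSinv_lt (PosNum e20).
  have k0 : (0 : R) < k.+1%:R^-1 by rewrite invr_gt0.
  have xq j : exists q : rat, `|ratr q - x 0 j| < k.+1%:R^-1.
    have [q] : exists q : rat, ratr q \in `]x 0 j - k.+1%:R^-1, x 0 j + k.+1%:R^-1[.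
      by apply: rat_in_itvoo; rewrite ltrD2l gtrN.
    by rewrite in_itv/= => qx; exists q; rewrite ltr_distl.
  have [q qx] := choice xq.
  exists (\row_j q j, k) => /=; last by move=> j /=; rewrite mxE.
  move=> y By; apply: eU; split => // i j; rewrite !ord1.
  have := By j; rewrite /= mxE => yq.
  rewrite /ball/= (le_lt_trans (ler_distD (ratr (q j)) _ _))//.
  by rewrite [e]splitr ltrD// (lt_trans _ ke)// distrC.
rewrite UE preimage_bigcup bigcup_mkcond.
apply: countable_bigcupT_measurable => [|qk]; first exact: countableP.
case: ifP => // _.
have -> : f @^-1` B qk = \bigcap_(j in [set: 'I_n])
    (fun x => f x 0 j) @^-1` ball (ratr (qk.1 0 j) : R) qk.2.+1%:R^-1.
  by apply/seteqP; split => x /= Hx j; [move=> _|]; exact: Hx.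
apply: fin_bigcap_measurable => // j _; rewrite -[X in measurable X]setTI.
by apply: mf => //; exact: measurable_ball.
Unshelve. all: by end_near.
Qed.

Lemma measurable_rV_coord n (j : 'I_n) :
  measurable_fun setT (fun x : 'rV[R]_n => x 0 j).
Proof.
apply: (measurability _ (RGenOpens.measurableE R)) => //.
move=> _ [_ [a [b ->]] <-]; rewrite setTI; apply: sub_sigma_algebra.
by move/continuousP : (@coord_continuous R 1 n 0 j); apply; exact: interval_open.
Qed.

Definition rV_cons n (p : 'rV[R]_n * R) : 'rV[R]_n.+1 :=
  row_mx p.2%:M p.1 : 'rV[R]_(1 + n).

Lemma rV_cons0 n (p : 'rV[R]_n * R) : rV_cons p 0 ord0 = p.2.
Proof.
rewrite /rV_cons (_ : ord0 = lshift n (ord0 : 'I_1)); last exact: val_inj.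
by apply: (etrans (@row_mxEl R 1 1 n _ _ _ _)); rewrite mxE eqxx.
Qed.

Lemma rV_consS n (p : 'rV[R]_n * R) j : rV_cons p 0 (lift ord0 j) = p.1 0 j.
Proof.
rewrite /rV_cons (_ : lift ord0 j = rshift 1 j); last exact: val_inj.
exact: (@row_mxEr R 1 1 n).
Qed.

Lemma measurable_rV_cons n : measurable_fun setT (@rV_cons n).
Proof.
apply: measurable_fun_rV => j; have [k ->|->] := unliftP ord0 j.
  under eq_fun do rewrite rV_consS.
  exact: measurableT_comp (measurable_rV_coord k) _.
under eq_fun do rewrite rV_cons0.
exact: measurable_snd.
Qed.

(* The measure mu (x) dt on R^n x R, transported to R^(n+1). *)
Definition leb_step n (mu : {measure set 'rV[R]_n -> \bar R}) :
    set 'rV[R]_n.+1 -> \bar R :=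
  pushforward (product_measure1 mu (@lebesgue_measure R)) (@rV_cons n).

Section leb_step_measure.
Variables (n : nat) (mu : {measure set 'rV[R]_n -> \bar R}).

Let preim_rV_cons A : measurable A -> measurable (@rV_cons n @^-1` A).
Proof.
by move=> mA; rewrite -[X in measurable X]setTI; exact: measurable_rV_cons.
Qed.

Let leb_step0 : leb_step mu set0 = 0%E.
Proof. by rewrite /leb_step /pushforward preimage_set0 measure0. Qed.

Let leb_step_ge0 A : (0 <= leb_step mu A)%E.
Proof. by rewrite /leb_step /pushforward measure_ge0. Qed.

Let leb_step_sigma_additive : semi_sigma_additive (leb_step mu).
Proof.
move=> F mF tF mUF; rewrite /leb_step /pushforward preimage_bigcup.
apply: measure_semi_sigma_additive.
- by move=> k; exact: preim_rV_cons.
- apply/trivIsetP => /= i j _ _ ij; rewrite -preimage_setI.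
  by move/trivIsetP : tF => /(_ _ _ _ _ ij) ->//; rewrite preimage_set0.
- by rewrite -preimage_bigcup; exact: preim_rV_cons.
Qed.

HB.instance Definition _ := isMeasure.Build _ _ _ (leb_step mu)
  leb_step0 leb_step_ge0 leb_step_sigma_additive.

End leb_step_measure.

Fixpoint lebesgueN n : {measure set 'rV[R]_n -> \bar R} :=
  if n is k.+1 then leb_step (lebesgueN k) else \d_(0 : 'rV[R]_0).

Lemma lebesgueN_box n (a b : 'I_n -> R) : (forall i, a i <= b i) ->
  lebesgueN n [set x | forall i, a i <= x 0 i <= b i] =
  (\prod_(i < n) (b i - a i))%:E.
Proof.
elim: n a b => [|n ih] a b ab.
  rewrite big_ord0/= diracE (_ : _ \in _)//.
  by rewrite inE => -[].
rewrite /= /leb_step /pushforward/=.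
have -> : @rV_cons n @^-1` [set x | forall i, a i <= x 0 i <= b i] =
    [set x : 'rV[R]_n | forall i, a (lift ord0 i) <= x 0 i <= b (lift ord0 i)] `*`
    `[a ord0, b ord0].
  apply/seteqP; split=> [p abp|p [/= p1 p2] j].
    split=> [i|] /=; first by have := abp (lift ord0 i); rewrite rV_consS.
    by rewrite in_itv/=; have := abp ord0; rewrite rV_cons0.
  have [k ->|->] := unliftP ord0 j; first by rewrite rV_consS.
  by rewrite rV_cons0; move: p2; rewrite in_itv.
rewrite product_measure1E//.
  rewrite ih// [X in (_ * X)%E]lebesgue_measure_itv/= lte_fin big_ord_recl mulrC EFinM.
  congr (_ * _)%E; case: ltP => // ba.
  have -> : b ord0 = a ord0 by apply/eqP; rewrite eq_le ba ab.
  by rewrite subrr.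
have -> : [set x : 'rV[R]_n |
      forall i, a (lift ord0 i) <= x 0 i <= b (lift ord0 i)] =
    \bigcap_(i in [set: 'I_n])
      (fun x => x 0 i) @^-1` `[a (lift ord0 i), b (lift ord0 i)].
  apply/seteqP; split => x /= Hx i; [move=> _|]; move: (Hx i);
    by rewrite ?in_itv//= ?in_itv/=; apply.
apply: fin_bigcap_measurable => // i _; rewrite -[X in measurable X]setTI.
exact: measurable_rV_coord.
Qed.

End lebesgue.

Section euclidean.
Context {R : realType} {N : nat}.
Implicit Types (x y : 'rV[R]_N) (A : set 'rV[R]_N).

Definition eucl_dist x y : R := Num.sqrt (\sum_(i < N) (x 0 i - y 0 i) ^+ 2).

Definition eucl_ball x (r : R) : set 'rV[R]_N := [set y | eucl_dist x y < r].

(* -oo on the empty set *)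
Definition eucl_diam A : \bar R :=
  ereal_sup [set (eucl_dist x y)%:E | x in A & y in A].

(* The empty set is singled out because t ^+ 0 = 1. *)
Definition hausdorff_gauge (m : nat) A : \bar R :=
  if A == set0 then 0%E else (eucl_diam A ^+ m)%E.

Definition hausdorff_content (m : nat) (delta : R) A : \bar R :=
  ereal_inf [set (\sum_(0 <= k <oo) hausdorff_gauge m (F k))%E |
    F in [set F : (set 'rV[R]_N)^nat |
      A `<=` \bigcup_k F k /\ forall k, (eucl_diam (F k) <= delta%:E)%E]].

(* m-dimensional Hausdorff outer measure, without the conventional positive
   factor that normalizes it to Lebesgue measure; null sets are the same. *)
Definition hausdorff (m : nat) A : \bar R :=
  ereal_sup [set hausdorff_content m delta A | delta in [set d : R | 0 < d]].

End euclidean.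

Section smooth.
Context {R : realType} {N : nat}.
Implicit Types (Omega : set 'rV[R]_N) (phi : 'rV[R]_N -> R).

Definition partial (i : 'I_N) phi : 'rV[R]_N -> R :=
  fun x => 'D_(delta_mx 0 i) phi x.

Definition laplacian phi : 'rV[R]_N -> R :=
  fun x => \sum_(i < N) partial i (partial i phi) x.

Definition smooth phi := forall s : seq 'I_N,
  continuous (foldr partial phi s) /\
  forall i x, derivable (foldr partial phi s) x (delta_mx 0 i).

Definition test_function Omega phi :=
  let supp := closure [set x | phi x != 0] in
  [/\ smooth phi, compact supp & supp `<=` Omega].

(* Near each boundary point, Omega is {phi < 0} for some smooth phi whose
   gradient does not vanish at that point. *)
Definition smooth_boundary Omega :=
  forall x, (closure Omega `\` Omega) x ->
    exists (phi : 'rV[R]_N -> R) (U : set 'rV[R]_N),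
      [/\ smooth phi, nbhs x U, exists i, partial i phi x != 0 &
          Omega `&` U = [set y | phi y < 0] `&` U].

Definition smooth_domain Omega :=
  [/\ open Omega, bounded_set Omega, connected Omega & smooth_boundary Omega].

End smooth.

(* Functions on Omega are represented by functions on R^N; their values outside
   Omega play no role. *)
Section sobolev.
Context {R : realType} {N : nat}.
Local Notation mu := (@lebesgueN R N).
Implicit Types (Omega A B D : set 'rV[R]_N) (v w f xi : 'rV[R]_N -> R).
Implicit Types (V : 'rV[R]_N -> \bar R).

Definition Lp Omega (p : \bar R) v := (v \_ Omega) \in Lfun mu p.

Definition weak_partial Omega (i : 'I_N) v g :=
  forall phi, test_function Omega phi ->
    (\int[mu]_(x in Omega) (v x * partial i phi x)%:E =
     - (\int[mu]_(x in Omega) (g x * phi x)%:E))%E.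

(* v is in W^{1,2}(Omega), with weak gradient (g_i)_i. *)
Definition W12 Omega v (g : 'I_N -> 'rV[R]_N -> R) :=
  Lp Omega 2%:E v /\
  forall i, Lp Omega 2%:E (g i) /\ weak_partial Omega i v (g i).

Definition W12_0 Omega v := exists2 g, W12 Omega v g &
  forall eps : R, 0 < eps -> exists2 phi, test_function Omega phi &
    ((\int[mu]_(x in Omega) ((v x - phi x) ^+ 2)%:E) +
     \sum_(i < N) \int[mu]_(x in Omega) ((g i x - partial i phi x) ^+ 2)%:E
     < eps%:E)%E.

Definition nonneg_on Omega v := {ae mu, forall x, Omega x -> 0 <= v x}.

(* x is a Lebesgue point of v, with precise representative c at x. *)
Definition precise_value v (x : 'rV[R]_N) (c : R) :=
  ((mu (eucl_ball x r))^-1 * \int[mu]_(y in eucl_ball x r) (`|v y - c|)%:E)%E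
    @[r --> 0^'+] --> 0%E.

(* V * w relies on the library's convention +oo * 0 = 0. *)
Definition times_potential V w : 'rV[R]_N -> \bar R :=
  fun x => (V x * (w x)%:E)%E.

Definition distributional_solution Omega V w f :=
  forall phi, test_function Omega phi ->
    (- (\int[mu]_(x in Omega) (w x * laplacian phi x)%:E)
     + (\int[mu]_(x in Omega) (times_potential V w x * (phi x)%:E)) =
     \int[mu]_(x in Omega) (f x * phi x)%:E)%E.

Definition solution Omega V w f :=
  [/\ W12_0 Omega w, Lp Omega +oo%E w,
      mu.-integrable Omega (times_potential V w) &
      distributional_solution Omega V w f].

Definition zero_set Omega w := [set x | Omega x /\ precise_value w x 0].

Definition universal_zero_set Omega V := [set x | Omega x /\
  forall w f, Lp Omega +oo%E f -> nonneg_on Omega f -> solution Omega V w f ->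
    precise_value w x 0].

Definition sobolev_open Omega A := A `<=` Omega /\
  exists xi, [/\ W12_0 Omega xi, nonneg_on Omega xi,
    forall x, Omega x -> exists c, precise_value xi x c &
    A = [set x | Omega x /\ exists2 c, precise_value xi x c & 0 < c]].

Definition sobolev_connected Omega D := D `<=` Omega /\
  forall A B, sobolev_open Omega A -> sobolev_open Omega B ->
    A `&` B = set0 -> D `<=` A `|` B -> D `<=` A \/ D `<=` B.

End sobolev.

(* Main.v *)
(* Connectedness.  On almost every line parallel to a coordinate axis, test functions
   converging fast in H^1 converge uniformly, and their limit is the precise representative.
   A Sobolev-open set therefore meets almost every such line in a relatively open set.  If
   H^(N-1)(Z) = 0, the projections of Z on coordinate hyperplanes are null, so almost every
   line misses Z.  If disjoint Sobolev-open A and B cover the complement of Z, a segment of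
   such a line inside Omega lies in A or misses it; hence the averages of the indicator of A
   on small cubes do not change when the cubes are translated, and A or B is empty because
   Omega is connected.

   Zero sets.  Fix a solution w with nonnegative data.  Sums of solutions are solutions, so
   there is a nondecreasing sequence of solutions v_n such that every solution vanishes a.e.
   outside the union of the {v_n > 0}.  Split v_n = z_n + y_n, where z_n = v_n on {w > 0} and
   y_n = v_n on {w = 0}.  The supersolutions min(v_n, k w) increase to z_n with bounded
   energy, so z_n, hence y_n, has a weak gradient, and both are again solutions.  Averages
   against a kernel K_r with d/dr K_r = Laplacian (L_r) are almost monotone in r for functions
   with Laplacian bounded on one side; consequently every point is a Lebesgue point of a
   solution, and w(x) = 0 forces z_n(x) = 0.  The same argument with k v_k in place of k w
   gives v_n(x) > 0 for some n at each x outside Z.  Thus A = {w > 0} and the union B of the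
   {y_n > 0} are disjoint and cover the complement of Z, and since w is not 0 the first part
   gives B empty, that is, w > 0 outside Z. *)
Require Import Defs.
From HB Require Import structures.
From mathcomp Require Import all_boot all_order all_algebra.
From mathcomp Require Import all_classical all_reals all_analysis measurable_realfun.
From mathcomp Require Import ring lra.

Set Implicit Arguments.
Unset Strict Implicit.
Unset Printing Implicit Defensive.

Import Order.TTheory GRing.Theory Num.Theory.
Import numFieldNormedType.Exports.

Local Open Scope classical_set_scope.
Local Open Scope ring_scope.

(** * Lebesgue measure on R^N and Lebesgue points *)

(** The main difficulty is that [1_{w > 0} v] has no evident weak gradient, since [{w > 0}] is a
    mere measurable set. The gradients of the minima converge in L^2 because minima of
    supersolutions are supersolutions: their energies then increase, and bounded energy becomes a
    Cauchy condition. Both this closure under minima and the equations of the two pieces of [v] rest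
    on one estimate, [core]: testing with (phi - k p)^+ and letting k tend to infinity concentrates
    everything on {p = 0}, where the gradient of p vanishes too. Pointwise values need no surface
    integral and no fundamental solution: K_r is a dilated bump of constant mass, so its derivative
    in r is the divergence of a radial field, and that field is the gradient of the explicit L_r. An
    infinite potential is replaced by its finite part, with solutions required to vanish where it is
    infinite. Truncations are built from the square root of 1 + t^2, which sends test functions to
    test functions. *)

Section lam.
Context {R : realType}.

(** A separate name for [lebesgueN n], to which the sigma-finiteness instance required by Fubini is
    attached. *)
Definition lam n : set 'rV[R]_n -> \bar R := lebesgueN n.
Arguments lam n : clear implicits.
HB.instance Definition _ n := Measure.on (lam n).

Definition cube n (x : 'rV[R]_n) (r : R) : set 'rV[R]_n :=
  [set y | forall i, x 0 i - r <= y 0 i <= x 0 i + r].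

Lemma measurable_cube n (x : 'rV[R]_n) r : measurable (cube x r).
Proof.
have -> : cube x r = \bigcap_(i in [set: 'I_n])
    (fun y => y 0 i) @^-1` `[x 0 i - r, x 0 i + r].
  apply/seteqP; split => y /= Hy i; [move=> _|]; move: (Hy i);
    by rewrite ?in_itv//= ?in_itv/=; apply.
apply: fin_bigcap_measurable => // i _; rewrite -[X in measurable X]setTI.
exact: measurable_rV_coord.
Qed.

Lemma lam_cube n (x : 'rV[R]_n) r : 0 <= r ->
  lam n (cube x r) = ((2 * r) ^+ n)%:E.
Proof.
move=> r0.
have -> : lam n (cube x r) = (\prod_(i < n) ((x 0 i + r) - (x 0 i - r)))%:E.
  by rewrite -lebesgueN_box// => i; rewrite lerD2l; lra.
rewrite (eq_bigr (fun=> 2 * r)) => [|i _]; last by ring.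
by rewrite prodr_const card_ord.
Qed.

Lemma sigma_finite_lam n : sigma_finite setT (lam n).
Proof.
exists (fun k => cube 0 k%:R).
  apply/seteqP; split => // x _.
  have [k kx] : exists k : nat, forall i, `|x 0 i| <= k%:R.
    exists (Num.truncn (\sum_i `|x 0 i|)).+1 => i.
    apply: (le_trans _ (ltW (truncnS_gt _))).
    by rewrite (bigD1 i)//= lerDl sumr_ge0.
  exists k => // i; rewrite !mxE; have := kx i; rewrite ler_norml; lra.
by move=> k; split; [exact: measurable_cube|rewrite lam_cube ?ltry].
Qed.

HB.instance Definition _ n := @Measure_isSigmaFinite.Build _ _ _ (lam n)
  (@sigma_finite_lam n).

End lam.
Arguments lam {R} n.

(** * Slicing along coordinate lines, translation invariance *)

Section tonelli.
Context {R : realType}.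

Lemma tonelli_cons n (f : 'rV[R]_n.+1 -> \bar R) :
  measurable_fun setT f -> (forall x, (0 <= f x)%E) ->
  (\int[lam n.+1]_x f x =
   \int[lam n]_y \int[lebesgue_measure]_t f (rV_cons (y, t)))%E.
Proof.
move=> mf f0; rewrite {1}/lam /= /leb_step ge0_integral_pushforward//=.
- rewrite (@fubini_tonelli1 _ _ _ _ R (lam n) (@lebesgue_measure R) (f \o @rV_cons R n))//.
    exact: measurableT_comp mf (@measurable_rV_cons R n).
  by move=> x; exact: f0.
- exact: measurable_rV_cons.
Qed.

(** [ins i y] parametrizes the line parallel to axis [i] that projects to [y]; [del i] is this
    projection. *)
Definition ins n (i : 'I_n.+1) (y : 'rV[R]_n) (t : R) : 'rV[R]_n.+1 :=
  \row_j (if unlift i j is Some k then y 0 k else t).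

Definition del n (i : 'I_n.+1) (x : 'rV[R]_n.+1) : 'rV[R]_n :=
  \row_k x 0 (lift i k).

Lemma ins_at n (i : 'I_n.+1) y t : ins i y t 0 i = t.
Proof. by rewrite mxE unlift_none. Qed.

Lemma ins_lift n (i : 'I_n.+1) y t k : ins i y t 0 (lift i k) = y 0 k.
Proof. by rewrite mxE liftK. Qed.

Lemma del_ins n (i : 'I_n.+1) y t : del i (ins i y t) = y.
Proof. by apply/rowP => k; rewrite mxE ins_lift. Qed.

Lemma insD n (i : 'I_n.+1) y t s : ins i y (t + s) = ins i y t + s *: delta_mx 0 i.
Proof.
apply/rowP => j; rewrite !mxE; have [k ->|->] := unliftP i j.
  by rewrite eq_sym (negbTE (neq_lift _ _)) mulr0 addr0.
by rewrite !eqxx mulr1.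
Qed.

Lemma cons_ins n y (t : R) : rV_cons (y, t) = ins (ord0 : 'I_n.+1) y t.
Proof.
apply/rowP => j; have [k ->|->] := unliftP ord0 j.
  by rewrite rV_consS ins_lift.
by rewrite rV_cons0 ins_at.
Qed.

Lemma ins_cons n (j : 'I_n.+1) z (s t : R) :
  ins (lift ord0 j) (rV_cons (z, t)) s = rV_cons (ins j z s, t).
Proof.
apply/rowP => k; have [l ->|->] := unliftP ord0 k; last first.
  rewrite rV_cons0 mxE; case: unliftP => [k' kE|/eqP].
    have -> : k' = ord0.
      apply: (@lift_inj _ (lift ord0 j)); rewrite -kE; exact/val_inj.
    by rewrite rV_cons0.
  by rewrite (negbTE (neq_lift _ _)).
rewrite rV_consS; have [m ->|->] := unliftP j l; last by rewrite !ins_at.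
rewrite ins_lift; have -> : lift ord0 (lift j m) = lift (lift ord0 j) (lift ord0 m).
  by apply: val_inj; rewrite /= /bump /= !add1n ltnS addnS.
by rewrite ins_lift rV_consS.
Qed.

Lemma measurable_ins n (i : 'I_n.+1) :
  measurable_fun setT (fun p : 'rV[R]_n * R => ins i p.1 p.2).
Proof.
apply: measurable_fun_rV => j; have [k ->|->] := unliftP i j.
  under eq_fun do rewrite ins_lift.
  exact: measurableT_comp (measurable_rV_coord k) _.
under eq_fun do rewrite ins_at.
exact: measurable_snd.
Qed.

Lemma measurable_ins2 n (i : 'I_n.+1) y : measurable_fun setT (ins i y).
Proof.
exact: measurableT_comp (@measurable_ins n i) (pair1_measurable y).
Qed.

Lemma tonelli_RR (g : R -> R -> \bar R) :
  measurable_fun setT (fun p : R * R => g p.1 p.2) -> (forall s t, (0 <= g s t)%E) ->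
  (\int[lebesgue_measure]_s \int[lebesgue_measure]_t g s t =
   \int[lebesgue_measure]_t \int[lebesgue_measure]_s g s t)%E.
Proof.
move=> mg g0.
exact: (fubini_tonelli (m1 := lebesgue_measure) (m2 := lebesgue_measure)
  (fun p : R * R => g p.1 p.2) mg (fun=> g0 _ _)).
Qed.

Lemma measurable_line n (i : 'I_n.+1) (f : 'rV[R]_n.+1 -> \bar R) :
  measurable_fun setT f -> (forall x, (0 <= f x)%E) ->
  measurable_fun setT (fun y => \int[lebesgue_measure]_t f (ins i y t))%E.
Proof.
move=> mf f0.
apply: (measurable_fun_fubini_tonelli_F (m2 := lebesgue_measure)
    (fun p => f (ins i p.1 p.2))) => [|p]; last exact: f0.
exact: measurableT_comp mf (measurable_ins i).
Qed.

(** The measure is built by adding the coordinate 0 each time. For another direction, the induction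
    hypothesis slices the remaining coordinates, and [ins_cons] with the two-dimensional Tonelli
    theorem exchanges the two scalar integrals. *)
Lemma tonelli_ins n (i : 'I_n.+1) (f : 'rV[R]_n.+1 -> \bar R) :
  measurable_fun setT f -> (forall x, (0 <= f x)%E) ->
  (\int[lam n.+1]_x f x =
   \int[lam n]_y \int[lebesgue_measure]_t f (ins i y t))%E.
Proof.
elim: n i f => [|n IH] i f mf f0.
  rewrite ord1 (tonelli_cons mf f0); apply: eq_integral => y _.
  by apply: eq_integral => t _; rewrite cons_ins.
have [j ->|->] := unliftP ord0 i; last first.
  rewrite (tonelli_cons mf f0); apply: eq_integral => y _.
  by apply: eq_integral => t _; rewrite cons_ins.
have mfins : measurable_fun setT (fun p => f (ins (lift ord0 j) p.1 p.2)).
  exact: measurableT_comp mf (measurable_ins _).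
rewrite (tonelli_cons mf f0) (IH j); last 2 first.
- apply: (measurable_fun_fubini_tonelli_F (m2 := lebesgue_measure) (f \o @rV_cons R n.+1)).
    exact: (measurableT_comp mf (@measurable_rV_cons _ _)).
  by move=> x; exact: f0.
- by move=> y; exact: integral_ge0.
rewrite [RHS]tonelli_cons; last 2 first.
- apply: (measurable_fun_fubini_tonelli_F (m2 := lebesgue_measure)
    (fun p => f (ins (lift ord0 j) p.1 p.2))) => //.
- by move=> y; exact: integral_ge0.
apply: eq_integral => z _.
apply: etrans; first apply: (@tonelli_RR (fun s t => f (rV_cons (ins j z s, t)))) => //.
  apply: measurableT_comp => //.
  apply: (measurableT_comp (@measurable_rV_cons R n.+1)).
  apply: measurable_fun_pair => //.
  exact: measurableT_comp (measurable_ins2 j z) (@measurable_fst _ _ _ _).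
apply: eq_integral => t _; apply: eq_integral => s _.
by rewrite -ins_cons.
Qed.

Definition translation (a : R) : measurableTypeR R -> measurableTypeR R :=
  fun t : R => t + a.

Lemma measurable_translation a : measurable_fun setT (translation a).
Proof. exact: measurable_funD. Qed.

HB.instance Definition _ a :=
  isMeasurableFun.Build _ _ _ _ _ (measurable_translation a).

Lemma lebesgue_measureD (a : R) (A : set R) : measurable A ->
  pushforward lebesgue_measure (translation a) A = lebesgue_measure A.
Proof.
move=> mA.
apply/esym/lebesgue_measure_unique => //= _ [[b c]] _ <-.
rewrite /pushforward/=.
have -> : translation a @^-1` `]b, c] = `]b - a, c - a]%classic.
  apply/seteqP; split => x /=; rewrite !in_itv/= /translation.
    by move=> /andP[? ?]; apply/andP; split; lra.
  by move=> /andP[? ?]; apply/andP; split; lra.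
rewrite !lebesgue_measure_itv/= !lte_fin ltrD2r; case: ifP => // _.
by rewrite -!EFinD; congr EFin; lra.
Qed.

Lemma integral_translation (a : R) (f : R -> \bar R) : measurable_fun setT f ->
  (forall t, (0 <= f t)%E) ->
  (\int[lebesgue_measure]_t f (t + a)%R = \int[lebesgue_measure]_t f t)%E.
Proof.
move=> mf f0.
apply: (etrans (esym (@ge0_integral_pushforward _ _ _ _ R (translation a)
  (@measurable_translation a) lebesgue_measure setT f measurableT mf _))) => [x _|]; first exact: f0.
by apply: eq_measure_integral => //= A mA AS; exact: lebesgue_measureD.
Qed.

Lemma lam_translation n (a : 'rV[R]_n) (f : 'rV[R]_n -> \bar R) :
  measurable_fun setT f -> (forall x, (0 <= f x)%E) ->
  (\int[lam n]_x f (x + a)%R = \int[lam n]_x f x)%E.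
Proof.
elim: n a f => [|n IH] a f mf f0.
  by apply: eq_integral => x _; congr f; apply/rowP => -[].
have mD : measurable_fun setT (fun x : 'rV[R]_n.+1 => x + a).
  apply: measurable_fun_rV => j; under eq_fun do rewrite mxE.
  by apply: measurable_funD => //; exact: measurable_rV_coord.
have mfD : measurable_fun setT (fun x : 'rV[R]_n.+1 => f (x + a)) by exact: measurableT_comp.
have f0D x : (0 <= f (x + a)%R)%E by exact: f0.
rewrite (tonelli_ins ord0 mfD f0D) (tonelli_ins ord0 mf f0).
rewrite -[RHS](IH (del ord0 a)); last 2 first.
- exact: measurable_line.
- by move=> y; exact: integral_ge0.
apply: eq_integral => y _.
rewrite -[RHS](integral_translation (a 0 ord0))//; last first.
  exact: measurableT_comp mf (measurable_ins2 _ _).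
apply: eq_integral => t _; congr f; apply/rowP => j; rewrite mxE.
by have [k ->|->] := unliftP ord0 j; rewrite ?ins_lift ?ins_at// !mxE.
Qed.

Lemma continuous_measurable n (f : 'rV[R]_n -> R) :
  continuous f -> measurable_fun setT f.
Proof.
move=> cf; apply: (measurability _ (RGenOpens.measurableE R)) => //.
move=> _ [_ [a [b ->]] <-]; rewrite setTI; apply: sub_sigma_algebra.
by move/continuousP : cf; apply; exact: interval_open.
Qed.

Lemma open_measurable_rV n (A : set 'rV[R]_n) : open A -> measurable A.
Proof. by move=> oA; exact: sub_sigma_algebra. Qed.

End tonelli.

(** * Euclidean balls and cubes *)

Section balls.
Context {R : realType} {N : nat}.
Implicit Types (x y : 'rV[R]_N) (v : 'rV[R]_N -> R).

(** Since N < (N + 1)^2, the divisor N + 1 gives a strict inequality without a square root, and it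
    is nonzero even for N = 0. *)
Lemma cube_sub_ball x r : 0 < r -> cube x (r / N.+1%:R) `<=` eucl_ball x r.
Proof.
move=> r0 y xy; rewrite /eucl_ball/= /eucl_dist.
rewrite -(ltr_pXn2r (ltn0Sn 1)) ?nnegrE ?sqrtr_ge0 ?ltW//.
rewrite sqr_sqrtr; last by apply: sumr_ge0 => i _; exact: sqr_ge0.
apply: (@le_lt_trans _ _ (\sum_(i < N) (r / N.+1%:R) ^+ 2)).
  apply: ler_sum => i _; rewrite -[X in X <= _]real_normK ?num_real// lerXn2r ?nnegrE//.
    by rewrite divr_ge0// ltW.
  by have := xy i; move: (r / _) => q; rewrite ler_norml; lra.
rewrite sumr_const card_ord -[X in X < _]mulr_natr expr_div_n -mulrA gtr_pMr ?exprn_gt0//.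
rewrite mulrC ltr_pdivrMr ?exprn_gt0// mul1r expr2 -natrM ltr_nat.
by rewrite mulSn ltn_addr.
Qed.

Lemma ball_sub_cube x r : eucl_ball x r `<=` cube x r.
Proof.
move=> y xy i; suff : `|x 0 i - y 0 i| <= r by rewrite ler_norml; lra.
apply: (le_trans _ (ltW xy)); rewrite /eucl_dist -sqrtr_sqr ler_wsqrtr//.
by rewrite (bigD1 i)//= lerDl; apply: sumr_ge0 => j _; exact: sqr_ge0.
Qed.

Lemma measurable_eucl_dist x : measurable_fun setT (eucl_dist x).
Proof.
have ms : measurable_fun setT (@Num.sqrt R).
  by apply: measurable_realfun.continuous_measurable_fun; exact: sqrt_continuous.
apply: (measurableT_comp ms).
apply: measurable_sum => i; apply: measurable_funX; apply: measurable_funB => //.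
exact: measurable_rV_coord.
Qed.

Lemma measurable_eucl_ball x r : measurable (eucl_ball x r).
Proof.
rewrite (_ : eucl_ball x r = eucl_dist x @^-1` `]-oo, r[); last first.
  by apply/seteqP; split => y /=; rewrite in_itv.
by rewrite -[X in measurable X]setTI; exact: measurable_eucl_dist.
Qed.

Lemma lam_eucl_ball x r : 0 < r ->
  exists2 b, lam N (eucl_ball x r) = b%:E &
    (2 * (r / N.+1%:R)) ^+ N <= b <= (2 * r) ^+ N.
Proof.
move=> r0; have r1 : 0 <= r / N.+1%:R by rewrite divr_ge0// ltW.
have b1 : (((2 * (r / N.+1%:R)) ^+ N)%:E <= lam N (eucl_ball x r))%E.
  rewrite -(lam_cube x)//; apply: le_measure; rewrite ?inE.
  - exact: measurable_cube.
  - exact: measurable_eucl_ball.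
  - exact: cube_sub_ball.
have b2 : (lam N (eucl_ball x r) <= ((2 * r) ^+ N)%:E)%E.
  rewrite -(lam_cube x (ltW r0)); apply: le_measure; rewrite ?inE.
  - exact: measurable_eucl_ball.
  - exact: measurable_cube.
  - exact: ball_sub_cube.
exists (fine (lam N (eucl_ball x r))).
  by rewrite fineK// ge0_fin_numE ?measure_ge0// (le_lt_trans b2)// ltry.
move: b1 b2; case: (lam N (eucl_ball x r)) => //= b.
by rewrite !lee_fin => -> ->.
Qed.

(* [c] is the value of [v] at the Lebesgue point [x], tested on cubes instead of balls. *)
Definition lpt v x c := forall e, 0 < e -> exists2 d, 0 < d &
  forall r, 0 < r < d -> (\int[lam N]_(y in cube x r) (`|v y - c|)%:E <= (e * r ^+ N)%:E)%E.

Lemma cvg_right0P (g : R -> \bar R) : (forall r, (0 <= g r)%E) ->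
  (g r @[r --> 0^'+] --> 0%E) <->
  (forall e, 0 < e -> exists2 d, 0 < d & forall r, 0 < r < d -> (g r <= e%:E)%E).
Proof.
move=> g0; split=> [/fine_cvgP[fg /cvgrPdist_le gc] e e0|H].
  have : \forall r \near 0^'+, (g r <= e%:E)%E.
    apply: filterS2 fg (gc _ e0) => r fr; rewrite sub0r normrN ger0_norm; last exact: fine_ge0.
    by rewrite -lee_fin fineK.
  move=> /nbhs_ballP[d /= d0 dP]; exists d => // r /andP[r0 rd].
  by apply: dP => //; rewrite /ball/= sub0r normrN gtr0_norm.
have F e : 0 < e -> \forall r \near 0^'+, (g r <= e%:E)%E.
  move=> /H[d d0 dP]; apply/nbhs_ballP; exists d => // r /=.
  by rewrite /ball/= sub0r normrN => rd r0; apply: dP; rewrite r0 (le_lt_trans (ler_norm _)).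
apply/fine_cvgP; split.
  apply: filterS (F 1 ltr01) => r gr; rewrite ge0_fin_numE//.
  by rewrite (le_lt_trans gr)// ltry.
apply/cvgrPdist_le => e e0; apply: filterS (F e e0) => r gr.
rewrite sub0r normrN ger0_norm; last exact: fine_ge0.
by rewrite -lee_fin fineK// ge0_fin_numE// (le_lt_trans gr)// ltry.
Qed.

(** A ball of radius r lies in the cube of radius r, which lies in the concentric ball of radius s
    for every s > (N + 1) r and, by strictness above, for s = (N + 1) r. All volumes are comparable
    to r^N, so the two normalized integrals tend to 0 together. *)
Lemma lpt_precise v x c : measurable_fun setT v ->
  precise_value v x c <-> lpt v x c.
Proof.
move=> mv.
have m1 (D : set 'rV[R]_N) : measurable_fun D (fun y => (`|v y - c|)%:E).
  apply/measurable_EFinP/measurableT_comp => //.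
  by apply: measurable_funB => //; exact: measurable_funTS.
have sub D1 D2 : measurable D1 -> measurable D2 -> D1 `<=` D2 ->
  (\int[lam N]_(y in D1) (`|v y - c|)%:E <= \int[lam N]_(y in D2) (`|v y - c|)%:E)%E.
  by move=> ? ? ?; apply: ge0_subset_integral => // y _; rewrite lee_fin.
have ige0 D : (0 <= \int[lam N]_(y in D) (`|v y - c|)%:E)%E.
  by apply: integral_ge0 => y _; rewrite lee_fin.
have K0 : (0 : R) < N.+1%:R by rewrite ltr0n.
have -> : precise_value v x c = (((lam N (eucl_ball x r))^-1 *
  \int[lam N]_(y in eucl_ball x r) (`|v y - c|)%:E)%E @[r --> 0^'+] --> 0%E) by [].
rewrite cvg_right0P; last first.
  by move=> r; rewrite mule_ge0 ?ige0// inve_ge0 measure_ge0.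
split=> H e e0.
  have e'0 : 0 < e / (2 * N.+1%:R) ^+ N by rewrite divr_gt0// exprn_gt0// mulr_gt0.
  have [d d0 dP] := H _ e'0; exists (d / N.+1%:R); first by rewrite divr_gt0.
  move=> r /andP[r0 rd]; have rN0 : 0 < r * N.+1%:R by rewrite mulr_gt0.
  have := dP (r * N.+1%:R); rewrite rN0 -ltr_pdivlMr// rd => /(_ isT).
  have [b bE /andP[b1 b2]] := lam_eucl_ball x rN0.
  rewrite mulfK ?gt_eqF// in b1.
  have b0 : 0 < b by rewrite (lt_le_trans _ b1)// exprn_gt0// mulr_gt0.
  rewrite bE inver gt_eqF// lee_pdivrMl// -EFinM => h.
  apply: (le_trans (sub _ (eucl_ball x (r * N.+1%:R)) _ _ _)).
  - exact: measurable_cube.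
  - exact: measurable_eucl_ball.
  - by have := @cube_sub_ball x _ rN0; rewrite mulfK ?gt_eqF.
  apply: (le_trans h); rewrite lee_fin.
  apply: (@le_trans _ _ ((2 * (r * N.+1%:R)) ^+ N * (e / (2 * N.+1%:R) ^+ N))).
    by rewrite ler_wpM2r// ltW.
  rewrite mulrCA [2 * _]mulrCA mulrA exprMn [r ^+ N * _]mulrC -!mulrA.
  by rewrite [X in e * X <= _]mulrC divfK// expf_neq0// mulf_neq0// gt_eqF.
have e'0 : 0 < e * (2 / N.+1%:R) ^+ N by rewrite mulr_gt0// exprn_gt0// divr_gt0.
have [d d0 dP] := H _ e'0; exists d => // r rd; have /andP[r0 _] := rd.
have [b bE /andP[b1 b2]] := lam_eucl_ball x r0.
have b0 : 0 < b by rewrite (lt_le_trans _ b1)// exprn_gt0// mulr_gt0// divr_gt0.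
rewrite bE inver gt_eqF// lee_pdivrMl// -EFinM.
apply: (le_trans (sub _ (cube x r) _ _ (@ball_sub_cube x r))).
- exact: measurable_eucl_ball.
- exact: measurable_cube.
apply: (le_trans (dP _ rd)); rewrite lee_fin.
apply: (@le_trans _ _ ((2 * (r / N.+1%:R)) ^+ N * e)); last by rewrite ler_wpM2r// ltW.
rewrite !exprMn; move: (2 ^+ N) (r ^+ N) (_^-1 ^+ N) => a1 b3 c1.
by rewrite le_eqVlt; apply/orP; left; apply/eqP; ring.
Qed.

End balls.

(** * Smooth functions and test functions *)

Section smooth_calculus.
Context {R : realType} {N : nat}.
Implicit Types (phi psi f g : 'rV[R]_N -> R) (x : 'rV[R]_N) (i : 'I_N).
Local Notation e_ i := (delta_mx 0 i : 'rV[R]_N).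

Definition dable f := forall i x, derivable f x (e_ i).

Lemma partial_cst i (c : R) : partial i (cst c : 'rV[R]_N -> R) = cst 0.
Proof. by apply/funext => x; rewrite /partial derive_cst. Qed.

Lemma partialD i f g : dable f -> dable g ->
  partial i (f \+ g) = partial i f \+ partial i g.
Proof. by move=> df dg; apply/funext => x; rewrite /partial deriveD. Qed.

Lemma partialM i f g : dable f -> dable g ->
  partial i (f \* g) = f \* partial i g \+ g \* partial i f.
Proof. by move=> df dg; apply/funext => x; rewrite /partial deriveM. Qed.

(** Restricting [f] to the line through [x] with direction [v] reduces this to the chain rule in one
    variable. *)
Lemma is_derive_dir_comp f (h : R -> R) (x v : 'rV[R]_N) (dh : R) :
  derivable f x v -> is_derive (f x) 1 h dh ->
  is_derive x v (h \o f) (dh * 'D_v f x).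
Proof.
move=> df hd; pose g := fun t : R => f (t *: v + x).
have g0 : g 0 = f x by rewrite /g scale0r add0r.
have dg : derivable g 0 1 by move/derivable1P : df.
have Dg : 'D_1 g 0 = 'D_v f x.
  rewrite /derive; congr (lim _); rewrite /g.
  have : (fun t : R => t^-1 *: ((g \o shift 0) (t *: 1) - g 0)) =
     (fun t : R => t^-1 *: ((f \o shift x) (t *: v) - f x)).
    by apply/funext => t /=; rewrite g0 /g addr0 /= -[t *: 1]/(t * 1) mulr1.
  by move=> ->.
have ig : is_derive (0 : R) 1 g ('D_v f x) by split.
have hd' : is_derive (g 0) 1 h dh by rewrite g0.
have := is_derive1_comp hd' ig => -[dhg Dhg].
split; first exact/derivable1P.
rewrite -Dhg /derive; congr (lim _).
have : (fun t : R => t^-1 *: (((h \o f) \o shift x) (t *: v) - (h \o f) x)) =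
     (fun t : R => t^-1 *: (((h \o g) \o shift 0) (t *: 1) - (h \o g) 0)).
  by apply/funext => t /=; rewrite g0 /g addr0 /= -[t *: 1]/(t * 1) mulr1.
by move=> ->.
Qed.

(** The algebra generated by [G] and the constants. If the partial derivatives of the generators
    stay in it, the product rule keeps all iterated ones there, so smoothness follows without
    formulas for higher derivatives. *)
Inductive gen (G : ('rV[R]_N -> R) -> Prop) : ('rV[R]_N -> R) -> Prop :=
| gen_base f : G f -> gen G f
| gen_cst c : gen G (cst c)
| gen_add f g : gen G f -> gen G g -> gen G (f \+ g)
| gen_mul f g : gen G f -> gen G g -> gen G (f \* g).

Lemma gen_smooth G : (forall f, G f ->
    [/\ continuous f, dable f & forall i, gen G (partial i f)]) ->
  forall f, gen G f -> smooth f.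
Proof.
move=> HG f.
have H : forall f, gen G f -> [/\ continuous f, dable f & forall i, gen G (partial i f)].
  move=> {}f; elim => {f} [f /HG//|c|f g _ [cf df pf] _ [cg dg pg]|f g Gf [cf df pf] Gg [cg dg pg]].
  - split; [exact: cst_continuous|move=> i x; exact: derivable_cst|].
    by move=> i; rewrite partial_cst; exact: gen_cst.
  - split.
    + by move=> x; exact: (continuousD (cf x) (cg x)).
    + by move=> i x; exact: derivableD.
    + by move=> i; rewrite partialD//; exact: gen_add.
  - split.
    + by move=> x; exact: (continuousM (cf x) (cg x)).
    + by move=> i x; exact: derivableM.
    + by move=> i; rewrite partialM//; apply: gen_add; exact: gen_mul.
move=> Gf s; suff : gen G (foldr partial f s) by move=> /H[].
by elim: s => //= i s /H[].
Qed.

Lemma smooth_partial i f : smooth f -> smooth (partial i f).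
Proof. by move=> sf s; rewrite -foldr_rcons; exact: sf. Qed.

Lemma smooth_dable f : smooth f -> dable f.
Proof. by move=> sf; have [_] := sf [::]. Qed.

Lemma smooth_continuous f : smooth f -> continuous f.
Proof. by move=> sf; have [] := sf [::]. Qed.

Lemma smooth_gen2 f g p : smooth f -> smooth g ->
  gen (fun h => h = f \/ h = g) p -> smooth p.
Proof.
move=> sf sg Gp; pose G h := exists s, h = foldr partial f s \/ h = foldr partial g s.
apply: (@gen_smooth G).
  move=> h [s hs]; split.
  - by case: hs => ->; [have [] := sf s|have [] := sg s].
  - by case: hs => -> i x; [have [_] := sf s|have [_] := sg s]; exact.
  - move=> i; apply: gen_base; exists (i :: s).
    by case: hs => ->; [left|right].
elim: Gp => {p} [h hfg|c|h1 h2 _ G1 _ G2|h1 h2 _ G1 _ G2].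
- by apply: gen_base; exists [::].
- exact: gen_cst.
- exact: gen_add.
- exact: gen_mul.
Qed.

Lemma smoothD f g : smooth f -> smooth g -> smooth (f \+ g).
Proof.
move=> sf sg; apply: (smooth_gen2 sf sg).
by apply: gen_add; apply: gen_base; [left|right].
Qed.

Lemma smoothM f g : smooth f -> smooth g -> smooth (f \* g).
Proof.
move=> sf sg; apply: (smooth_gen2 sf sg).
by apply: gen_mul; apply: gen_base; [left|right].
Qed.

Lemma smooth_cst (c : R) : smooth (cst c : 'rV[R]_N -> R).
Proof.
apply: (@gen_smooth (fun=> False)) => //; exact: gen_cst.
Qed.

(* [rh t = (1 + t^2)^(-1/2)] satisfies [rh' = - t rh^3], so the
   smooth truncations of |t| and t^+ can be chosen polynomial in [t] and [rh t]. *)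
Definition rh (t : R) : R := (Num.sqrt (1 + t ^+ 2))^-1.

Lemma rh_den_gt0 (t : R) : 0 < 1 + t ^+ 2.
Proof. by rewrite ltr_pwDl// sqr_ge0. Qed.

Lemma rh_gt0 t : 0 < rh t.
Proof. by rewrite invr_gt0 sqrtr_gt0 rh_den_gt0. Qed.

Lemma rh_sqr t : rh t ^+ 2 = (1 + t ^+ 2)^-1.
Proof. by rewrite /rh exprVn sqr_sqrtr// ltW// rh_den_gt0. Qed.

Lemma rh_eq t : rh t ^+ 2 * (1 + t ^+ 2) = 1.
Proof. by rewrite rh_sqr mulVf// gt_eqF// rh_den_gt0. Qed.

Lemma is_derive_rh (t : R) : is_derive t (1 : R) rh (- t * rh t ^+ 3).
Proof.
have s0 := rh_den_gt0 t.
have d1 : is_derive t (1 : R) (fun t : R => 1 + t ^+ 2) (2 * t).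
  apply: is_derive_eq; rewrite add0r. rewrite /GRing.scale/=. ring.
have d2 := is_derive1_sqrt s0.
have sn0 : Num.sqrt (1 + t ^+ 2) != 0 by rewrite gt_eqF// sqrtr_gt0.
have d3 : is_derive t (1 : R) (fun t : R => Num.sqrt (1 + t ^+ 2)) (t * rh t).
  have := @is_derive1_comp _ Num.sqrt (fun t : R => 1 + t ^+ 2) _ _ _ d2 d1.
  by move=> /is_derive_eq; apply; rewrite invfM mulrACA mulVf// mul1r mulrC.
have := @is_deriveV _ (fun t : R => Num.sqrt (1 + t ^+ 2)) t (t * rh t) 1 sn0 d3.
move=> /is_derive_eq; apply.
by rewrite -[_ *: _]/(_ * _) -exprVn -/(rh t) !mulNr; congr (- _); ring.
Qed.

Lemma continuous_rh : continuous rh.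
Proof.
by move=> t; apply/differentiable_continuous/derivable1_diffP; have [] := is_derive_rh t.
Qed.

Lemma is_derive_comp_rh f (x : 'rV[R]_N) (v : 'rV[R]_N) : derivable f x v ->
  is_derive x v (rh \o f) (- f x * rh (f x) ^+ 3 * 'D_v f x).
Proof. by move=> df; exact: (is_derive_dir_comp df (is_derive_rh _)). Qed.

(** Because rh' = - t rh^3, the algebra generated by [rh \o f] and the iterated partials of [f] is
    closed under differentiation. *)
Lemma smooth_rh f : smooth f -> smooth (rh \o f).
Proof.
move=> sf; pose G h := h = rh \o f \/ exists s, h = foldr partial f s.
have pE i : partial i (rh \o f) =
    cst (-1) \* (f \* (((rh \o f) \* (rh \o f)) \* (rh \o f)) \* partial i f).
  apply/funext => x; rewrite /partial /=.
  have [_ ->] := is_derive_comp_rh (@smooth_dable f sf i x).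
  by ring.
apply: (@gen_smooth G); last by apply: gen_base; left.
move=> h [->|[s ->]].
  split.
  - move=> x; apply: continuous_comp; [exact: smooth_continuous|exact: continuous_rh].
  - by move=> i x; have [] := is_derive_comp_rh (@smooth_dable f sf i x).
  - move=> i; rewrite pE.
    have Gh : gen G (rh \o f) by apply: gen_base; left.
    apply: gen_mul; first exact: gen_cst.
    apply: gen_mul; last by apply: gen_base; right; exists [:: i].
    apply: gen_mul; first by apply: gen_base; right; exists [::].
    by apply: gen_mul => //; exact: gen_mul.
have [cf df] := sf s; split => // i.
by apply: gen_base; right; exists (i :: s).
Qed.

End smooth_calculus.

Lemma coord_le_norm (R : realType) N (x : 'rV[R]_N) i : `|x 0 i| <= `|x|.
Proof.
have -> : `|x| = mx_norm x by [].
rewrite mx_normrE.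
exact: (@le_bigmax _ _ _ 0 (fun ij : 'I_1 * 'I_N => `|x ij.1 ij.2|) (0, i)).
Qed.

Section test_functions.
Context {R : realType} {N : nat}.
Variable Omega : set 'rV[R]_N.
Implicit Types (phi psi f g : 'rV[R]_N -> R) (x : 'rV[R]_N) (i : 'I_N).
Local Notation test := (test_function Omega).

Lemma test_smooth phi : test phi -> smooth phi.
Proof. by case. Qed.

Lemma test_dable phi : test phi -> dable phi.
Proof. by case => + _ _; exact: smooth_dable. Qed.

Lemma test_continuous phi : test phi -> continuous phi.
Proof. by case => + _ _; exact: smooth_continuous. Qed.

Lemma test_measurable phi : test phi -> measurable_fun setT phi.
Proof. by move/test_continuous/continuous_measurable. Qed.

Lemma test_supp phi x : test phi -> phi x != 0 -> Omega x.
Proof. by case=> _ _ sO px; apply: sO; exact: subset_closure. Qed.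

Lemma test_out phi x : test phi -> ~ Omega x -> phi x = 0.
Proof. by move=> tp Ox; apply/eqP/negPn/negP => /(test_supp tp). Qed.

Lemma smaller_supp_test phi psi : test phi -> smooth psi ->
  (forall x, phi x = 0 -> psi x = 0) -> test psi.
Proof.
move=> [_ cp sp] sps pz.
have sub : closure [set x | psi x != 0] `<=` closure [set x | phi x != 0].
  by apply: closureS => x /=; apply: contra_neq => /pz.
split => //; last exact: subset_trans sub sp.
by apply: subclosed_compact sub => //; exact: closed_closure.
Qed.

Lemma test_partial i phi : test phi -> test (partial i phi).
Proof.
move=> [sp cp spO].
have sub : [set x | partial i phi x != 0] `<=` closure [set x | phi x != 0].
  move=> x /= px; apply: contrapT => xcl; move/eqP : px; apply.
  have : nbhs x (~` closure [set x | phi x != 0]).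
    by apply: open_nbhs_nbhs; split => //; exact/closed_openC/closed_closure.
  move=> nx; have pz : \near x, phi x = (cst 0 : 'rV[R]_N -> R) x.
    apply: filterS nx => z zcl; apply/eqP/negPn/negP => pz; apply: zcl.
    exact: subset_closure.
  by rewrite /partial (near_eq_derive _ pz) derive_cst.
have sub' : closure [set x | partial i phi x != 0] `<=` closure [set x | phi x != 0].
  rewrite [X in _ `<=` X](closure_id _).1; last exact: closed_closure.
  exact: closureS.
split; first exact: smooth_partial.
- by apply: subclosed_compact sub' => //; exact: closed_closure.
- exact: subset_trans sub' spO.
Qed.

Lemma testD phi psi : test phi -> test psi -> test (phi \+ psi).
Proof.
move=> [sp cp pO] [sq cq qO].
have sub : closure [set x | (phi \+ psi) x != 0] `<=`
    closure [set x | phi x != 0] `|` closure [set x | psi x != 0].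
  rewrite -closureU; apply: closureS => x /=; have [->|] := eqVneq (phi x) 0.
    by rewrite add0r; right.
  by left.
split; first exact: smoothD.
- by apply: subclosed_compact sub; [exact: closed_closure|exact: compactU].
- by apply: (subset_trans sub) => x [/pO|/qO].
Qed.

Lemma testMr phi psi : test phi -> smooth psi -> test (phi \* psi).
Proof.
move=> tp sp; apply: (smaller_supp_test tp (smoothM (test_smooth tp) sp)).
by move=> x /= ->; rewrite mul0r.
Qed.

Lemma testZ (c : R) phi : test phi -> test (fun x => c * phi x).
Proof.
move=> tp; have -> : (fun x => c * phi x) = phi \* cst c.
  by apply/funext => x; rewrite /= mulrC.
by apply: testMr => //; exact: smooth_cst.
Qed.

Lemma partialZ i (c : R) phi : dable phi ->
  partial i (fun x => c * phi x) = (fun x => c * partial i phi x).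
Proof.
move=> dp; have dc : dable (cst c : 'rV[R]_N -> R) by move=> j x; exact: derivable_cst.
rewrite -[fun x => c * phi x]/(cst c \* phi) (partialM i dc dp).
by apply/funext => x; rewrite partial_cst /= mulr0 addr0.
Qed.

Lemma testB phi psi : test phi -> test psi -> test (phi \- psi).
Proof.
move=> tp tq; have -> : phi \- psi = phi \+ (fun x => -1 * psi x).
  by apply/funext => x /=; rewrite mulN1r.
by apply: testD => //; exact: testZ.
Qed.

Lemma partialB i phi psi : dable phi -> dable psi ->
  partial i (phi \- psi) = partial i phi \- partial i psi.
Proof. by move=> df dg; apply/funext => x; rewrite /partial deriveB. Qed.

Lemma test0 : test (cst 0).
Proof.
have E : [set x : 'rV[R]_N | cst (0 : R) x != 0] = set0.
  by apply/seteqP; split => x //=; rewrite eqxx.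
by split; rewrite ?E ?closure0; [exact: smooth_cst|exact: compact0|].
Qed.

Lemma test_bounded phi : test phi -> exists M, forall x, `|phi x| <= M.
Proof.
move=> [sp cp _]; set K := closure _ in cp.
have : compact (phi @` K).
  apply: continuous_compact => //; apply: continuous_subspaceT.
  exact: smooth_continuous.
move=> /compact_bounded [M [Mr HM]]; exists (Num.max (M + 1) 0) => x.
have [xK|xK] := pselect (K x).
  rewrite le_max; apply/orP; left; apply: HM; first by rewrite ltrDl.
  by exists x.
rewrite (_ : phi x = 0) ?normr0 ?le_max ?lexx ?orbT//.
by apply/eqP/negPn/negP => px; apply: xK; exact: subset_closure.
Qed.

Lemma continuous_insD (y : 'rV[R]_N) (v : 'rV[R]_N) : continuous (fun t : R => y + t *: v).
Proof.
move=> t; apply: cvgD; first exact: cvg_cst.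
by apply: cvgZl; exact: cvg_id.
Qed.

End test_functions.

Section lines.
Context {R : realType} {n : nat}.
Variable Omega : set 'rV[R]_n.+1.
Implicit Types (phi psi f g : 'rV[R]_n.+1 -> R) (i : 'I_n.+1).
Local Notation test := (test_function Omega).

Lemma continuous_ins2 i y : continuous (ins i y : R -> _).
Proof.
have -> : ins i y = (fun t : R => ins i y 0 + t *: delta_mx 0 i).
  by apply/funext => t; rewrite -insD add0r.
exact: continuous_insD.
Qed.

Lemma is_derive_line i phi y (t : R) : dable phi ->
  is_derive t (1 : R) (fun t => phi (ins i y t)) (partial i phi (ins i y t)).
Proof.
move=> dp.
have E : (fun h : R => h^-1 *: (((fun t => phi (ins i y t)) \o shift t) (h *: 1) - phi (ins i y t))) =
    (fun h : R => h^-1 *: ((phi \o shift (ins i y t)) (h *: delta_mx 0 i) - phi (ins i y t))).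
  apply/funext => h; congr (_ *: (_ - _)) => /=.
  have -> : h%:A = h :> R by rewrite -[LHS]/(h * 1) mulr1.
  by rewrite [h + t]addrC insD; congr phi; exact: addrC.
split; first by rewrite /derivable E; exact: dp.
by rewrite /partial /derive E.
Qed.

Local Notation leb := (@lebesgue_measure R).

Lemma line_FTC i phi y (a b : R) : smooth phi -> a < b ->
  (\int[leb]_(t in `[a, b]) (partial i phi (ins i y t))%:E =
   (phi (ins i y b))%:E - (phi (ins i y a))%:E)%E.
Proof.
move=> sp ab.
have cl f : smooth f -> continuous (fun t => f (ins i y t)).
  by move=> sf t; apply: continuous_comp; [exact: continuous_ins2|exact: smooth_continuous].
apply: (@continuous_FTC2 _ _ (fun t => phi (ins i y t))) => //.
- by apply: continuous_subspaceT; apply: cl; exact: smooth_partial.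
- split.
  + by move=> t _; have [] := is_derive_line i y t (smooth_dable sp).
  + by apply: cvg_at_right_filter; exact: cl.
  + by apply: cvg_at_left_filter; exact: cl.
- move=> t _; rewrite derive1E.
  by have [_ ->] := is_derive_line i y t (smooth_dable sp).
Qed.

Variables (M : R) (M0 : 0 < M) (OM : Omega `<=` cube 0 M).

Lemma test_line_out i phi y t : test phi -> M < `|t| -> phi (ins i y t) = 0.
Proof.
move=> tp Mt; apply: (test_out tp) => /OM/(_ i).
by rewrite ins_at mxE sub0r add0r -ler_norml leNgt Mt.
Qed.

Lemma measurable_on_line i y (f : 'rV[R]_n.+1 -> R) (D : set R) :
  measurable_fun setT f -> measurable_fun D (fun t => f (ins i y t)).
Proof.
move=> mf; apply: measurable_funTS.
exact: measurableT_comp mf (measurable_ins2 i y).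
Qed.

Lemma test_line_sup i phi y t : test phi ->
  ((`|phi (ins i y t)|)%:E <=
   \int[leb]_s (`|partial i phi (ins i y s)|)%:E)%E.
Proof.
(* The point [a] lies to the left of [t] and outside the cube, so [phi] vanishes there and the
   increment from [a] to [t] is the value at [t]. *)
move=> tp; pose a := Num.min t (- M) - 1.
have at_ : a < t by rewrite /a; have := ge_min t t (- M); rewrite lexx; lra.
have aM : M < `|a|.
  have : Num.min t (- M) <= - M by rewrite ge_min lexx orbT.
  move=> h; apply: (@lt_le_trans _ _ (- a)); last by rewrite -normrN ler_norm.
  rewrite /a; lra.
have sp := test_smooth tp.
have mp := test_measurable (test_partial i tp).
have mab (D : set R) : measurable_fun D (fun s => (partial i phi (ins i y s))%:E).
  by apply/measurable_EFinP; exact: measurable_on_line.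
rewrite [X in (X <= _)%E](_ : _ = `| \int[leb]_(s in `[a, t]) (partial i phi (ins i y s))%:E |%E); last first.
  by rewrite line_FTC// (test_line_out i y tp aM) sube0.
apply: (le_trans (le_abse_integral leb (measurable_itv _) (mab _))).
apply: ge0_subset_integral => //; exact: measurableT_comp (mab _).
Qed.

Lemma test_line_int0 i phi y : test phi ->
  leb.-integrable setT (fun t => (partial i phi (ins i y t))%:E) /\
  (\int[leb]_t (partial i phi (ins i y t))%:E = 0)%E.
Proof.
move=> tp; have tpi := test_partial i tp.
have MM : - (M + 1) < M + 1 by have := M0; lra.
have sub : (fun t => (partial i phi (ins i y t))%:E) =
  ((fun t => (partial i phi (ins i y t))%:E) \_ `[- (M + 1), M + 1]).
  apply/funext => t; rewrite patchE; case: ifPn => //.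
  rewrite notin_setE /= in_itv/= => /negP Mt.
  rewrite (test_line_out i y tpi)//; move: Mt; rewrite -ler_norml -ltNge; apply: le_lt_trans; lra.
have mp := test_measurable tpi.
split.
  have [B HB] := test_bounded tpi.
  rewrite sub -integrable_mkcond//.
  apply: measurable_bounded_integrable => //.
  - by rewrite [X in (X < _)%E]lebesgue_measure_itv/= lte_fin MM ltry.
  - exact: measurable_on_line.
  - exists B; split; first exact: num_real.
    by move=> c /ltW Bc t _ /=; rewrite (le_trans (HB _)).
rewrite sub -integral_mkcond (line_FTC i y (test_smooth tp) MM).
rewrite !(test_line_out i y tp) ?subee//.
- by have := M0; rewrite normrN ger0_norm; lra.
- by have := M0; rewrite ger0_norm; lra.
Qed.

End lines.

(** * Real-valued integrals *)

Section real_integral.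
Context d (T : measurableType d) (R : realType).
Variable mu : {measure set T -> \bar R}.
Implicit Types (f g h : T -> R).

Definition rintegrable f := mu.-integrable setT (EFin \o f).
(** An infinite integral is given the value 0 here, which is why the lemmas below carry
    integrability hypotheses. *)
Definition rint f : R := \int[mu]_x f x.

Lemma Int_meas f : rintegrable f -> measurable_fun setT f.
Proof. by move=> /(measurable_int mu)/measurable_EFinP. Qed.

Lemma IE f : rintegrable f -> (\int[mu]_x (f x)%:E)%E = (rint f)%:E.
Proof. by move=> If; rewrite /rint /Rintegral fineK//; exact: integrable_fin_num. Qed.

Lemma IntD f g : rintegrable f -> rintegrable g -> rintegrable (fun x => f x + g x).
Proof. by move=> If Ig; exact: (integrableD measurableT If Ig). Qed.

Lemma IntB f g : rintegrable f -> rintegrable g -> rintegrable (fun x => f x - g x).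
Proof. by move=> If Ig; exact: (integrableB measurableT If Ig). Qed.

Lemma IntZ c f : rintegrable f -> rintegrable (fun x => c * f x).
Proof. by move=> If; exact: (integrableZl measurableT c If). Qed.

Lemma IntN f : rintegrable f -> rintegrable (fun x => - f x).
Proof. by move=> If; exact: (integrableN If). Qed.

Lemma Int0 : rintegrable (fun=> 0).
Proof. exact: integrable0. Qed.

Lemma IntAbs f : rintegrable f -> rintegrable (fun x => `|f x|).
Proof. by move=> If; exact: (integrable_abse If). Qed.

Lemma ID f g : rintegrable f -> rintegrable g -> rint (fun x => f x + g x) = rint f + rint g.
Proof. by move=> If Ig; exact: RintegralD. Qed.

Lemma IB f g : rintegrable f -> rintegrable g -> rint (fun x => f x - g x) = rint f - rint g.
Proof. by move=> If Ig; exact: RintegralB. Qed.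

Lemma IZ c f : rintegrable f -> rint (fun x => c * f x) = c * rint f.
Proof. by move=> If; exact: RintegralZl. Qed.

Lemma I0 : rint (fun=> 0) = 0.
Proof. by rewrite /rint Rintegral_cst// mul0r. Qed.

Lemma IN f : rintegrable f -> rint (fun x => - f x) = - rint f.
Proof.
by move=> If; rewrite -mulN1r -IZ//; congr rint; apply/funext => x; rewrite mulN1r.
Qed.

Lemma I_ge0 f : (forall x, 0 <= f x) -> 0 <= rint f.
Proof. by move=> f0; apply: Rintegral_ge0. Qed.

Lemma Int_sum n (F : 'I_n -> T -> R) : (forall i, rintegrable (F i)) ->
  rintegrable (fun x => \sum_i F i x).
Proof.
move=> HF; have := @integrable_sum _ _ _ mu setT measurableT _ (index_enum 'I_n) xpredT
  (fun i x => (F i x)%:E) (fun i _ => HF i).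
by apply: eq_integrable => // x _; rewrite /= sumEFin.
Qed.

Lemma I_sum n (F : 'I_n -> T -> R) : (forall i, rintegrable (F i)) ->
  rint (fun x => \sum_i F i x) = \sum_i rint (F i).
Proof.
elim: n F => [|n IHn] F HF.
  rewrite big_ord0; transitivity (rint (fun=> 0)); last exact: I0.
  by congr rint; apply/funext => x; rewrite big_ord0.
rewrite big_ord_recl -IHn// -ID//; last exact: Int_sum.
by congr rint; apply/funext => x; rewrite big_ord_recl.
Qed.

Lemma ae_eq_I f g : measurable_fun setT f -> measurable_fun setT g ->
  {ae mu, forall x, f x = g x} -> rint f = rint g.
Proof.
move=> mf mg fg; rewrite /rint /Rintegral; congr fine; apply: ae_eq_integral => //.
- exact/measurable_EFinP.
- exact/measurable_EFinP.
- by apply: filterS fg => x /= -> _.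
Qed.

Lemma Int_dom f g : measurable_fun setT f -> rintegrable g ->
  {ae mu, forall x, `|f x| <= g x} -> rintegrable f.
Proof.
move=> mf Ig fg; have mg := Int_meas Ig; apply/integrableP; split; first exact/measurable_EFinP.
have [_] := integrableP _ _ _ Ig; apply: le_lt_trans.
apply: ae_ge0_le_integral => //.
- by apply/measurable_EFinP/measurableT_comp.
- by apply/measurable_EFinP/measurableT_comp.
- by apply: filterS fg => x /= fx _; rewrite lee_fin (le_trans fx)// ler_norm.
Qed.

Lemma ae_le_I f g : rintegrable f -> rintegrable g -> {ae mu, forall x, f x <= g x} -> rint f <= rint g.
Proof.
move=> If Ig fg; rewrite -subr_ge0 -IB//.
have mgf : measurable_fun setT (fun x => g x - f x) by exact: Int_meas (IntB _ _).
rewrite (@ae_eq_I _ (fun x => `|g x - f x|))//; first by apply: I_ge0.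
  exact: measurableT_comp.
by apply: filterS fg => x fgx; rewrite ger0_norm// subr_ge0.
Qed.

Lemma le_I f g : rintegrable f -> rintegrable g -> (forall x, f x <= g x) -> rint f <= rint g.
Proof. by move=> If Ig fg; apply: ae_le_I => //; exact: aeW. Qed.

Lemma ler_norm_I f : rintegrable f -> `|rint f| <= rint (fun x => `|f x|).
Proof. by move=> If; exact: le_normr_Rintegral. Qed.

Lemma I_eq0 f : rintegrable f -> {ae mu, forall x, 0 <= f x} -> rint f <= 0 ->
  {ae mu, forall x, f x = 0}.
Proof.
move=> If f0 If0; have mf := Int_meas If.
have E : rint (fun x => `|f x|) = rint f.
  apply: ae_eq_I => //; first exact: measurableT_comp.
  by apply: filterS f0 => x /ger0_norm.
have : (\int[mu]_x `|(f x)%:E| = 0)%E.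
  transitivity (rint (fun x => `|f x|))%:E; first exact: (IE (IntAbs If)).
  by rewrite E; congr EFin; apply/eqP; rewrite eq_le If0 -E I_ge0.
move/(ae_eq_integral_abs _ measurableT) => H.
have {}H := H (proj2 (measurable_EFinP _ _) mf).
by apply: filterS H => x /(_ Logic.I) /= [].
Qed.

Lemma DCT (f_ : nat -> T -> R) f g : (forall n, measurable_fun setT (f_ n)) ->
  measurable_fun setT f -> rintegrable g ->
  {ae mu, forall x, forall n, `|f_ n x| <= g x} ->
  {ae mu, forall x, f_ n x @[n --> \oo] --> f x} ->
  rintegrable f /\ rint (f_ n) @[n --> \oo] --> rint f.
Proof.
move=> mf_ mf Ig fg ff.
have [||||If _ cv] := @dominated_convergence _ _ _ mu setT measurableT
  (fun n => EFin \o f_ n) (EFin \o f) (EFin \o g) _ _ _ Ig _.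
- by move=> n; exact/measurable_EFinP.
- exact/measurable_EFinP.
- by apply: filterS ff => x /= fx _; apply: cvg_EFin => //; exact: nearW.
- by apply: filterS fg => x /= fx n _; rewrite lee_fin.
split => //.
have In n : rintegrable (f_ n) by apply: (Int_dom (mf_ n) Ig); apply: filterS fg => x.
by apply: fine_cvg; move: cv; rewrite /= (IE If).
Qed.

(** The sum of the [|f_n|] has integral at most 2, so it is finite almost everywhere and its terms
    tend to 0. *)
Lemma fast_ae_cvg0 (f_ : nat -> T -> R) : (forall n, rintegrable (f_ n)) ->
  (forall n, rint (fun x => `|f_ n x|) <= 2^-1 ^+ n) ->
  {ae mu, forall x, f_ n x @[n --> \oo] --> 0}.
Proof.
move=> If Ib; have mf n := Int_meas (If n).
have mfa n : measurable_fun setT (fun x => `|f_ n x|%:E).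
  by apply/measurable_EFinP/measurableT_comp.
pose S x := (\sum_(n <oo) `|f_ n x|%:E)%E.
have mS : measurable_fun setT S by apply: ge0_emeasurable_sum.
have IS : mu.-integrable setT S.
  apply/integrableP; split => //.
  under eq_integral do rewrite gee0_abs ?nneseries_ge0//.
  rewrite integral_nneseries//.
  apply: (@le_lt_trans _ _ 2%:E); last exact: ltry.
  apply: lime_le; first by apply: is_cvg_nneseries => n _ _; exact: integral_ge0.
  apply: nearW => n; rewrite big_mkord.
  apply: (@le_trans _ _ (\sum_(i < n) (2^-1 ^+ i)%:E)%E).
    by apply: lee_sum => i _; rewrite (IE (IntAbs (If i))) lee_fin.
  rewrite sumEFin lee_fin.
  have -> : \sum_(i < n) (2^-1 : R) ^+ i = 2 - 2 * 2^-1 ^+ n.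
    elim: n => [|n IHn]; first by rewrite big_ord0 expr0; lra.
    by rewrite big_ord_recr/= IHn exprS; lra.
  by rewrite gerBl mulr_ge0// exprn_ge0.
apply: filterS (integrable_ae measurableT IS) => x /(_ Logic.I) Sx.
suff : cvgn (series (fun n => `|f_ n x|)).
  by move=> /cvg_series_cvg_0 /norm_cvg0P.
apply: nondecreasing_is_cvgn.
  by apply: nondecreasing_series.
exists (fine (S x)) => _ [n _ <-]; rewrite -lee_fin fineK//.
rewrite /series/= -sumEFin.
by apply: nneseries_lim_ge.
Qed.

Definition L2 f := measurable_fun setT f /\ rintegrable (fun x => f x ^+ 2).

Lemma L2_meas f : L2 f -> measurable_fun setT f. Proof. by case. Qed.

Lemma L2_mul f g : L2 f -> L2 g -> rintegrable (fun x => f x * g x).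
Proof.
move=> [mf If] [mg Ig]; apply: (Int_dom _ (IntD If Ig)).
  exact: measurable_funM.
apply: aeW => x; rewrite normrM.
have := sqr_ge0 (`|f x| - `|g x|); rewrite sqrrB !real_normK ?num_real//.
have : 0 <= `|f x| * `|g x| by rewrite mulr_ge0.
lra.
Qed.

Lemma L2D f g : L2 f -> L2 g -> L2 (fun x => f x + g x).
Proof.
move=> Lf Lg; have [mf If] := Lf; have [mg Ig] := Lg.
split; first exact: measurable_funD.
have -> : (fun x => (f x + g x) ^+ 2) = (fun x => f x ^+ 2 + (2 * (f x * g x) + g x ^+ 2)).
  by apply/funext => x; ring.
by apply: IntD => //; apply: IntD => //; apply: IntZ; exact: L2_mul.
Qed.

Lemma L2Z c f : L2 f -> L2 (fun x => c * f x).
Proof.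
move=> [mf If]; split; first exact: measurable_funM.
have -> : (fun x => (c * f x) ^+ 2) = (fun x => c ^+ 2 * f x ^+ 2).
  by apply/funext => x; ring.
exact: IntZ.
Qed.

Lemma L2B f g : L2 f -> L2 g -> L2 (fun x => f x - g x).
Proof.
move=> Lf Lg; have -> : (fun x => f x - g x) = (fun x => f x + (-1) * g x).
  by apply/funext => x; rewrite mulN1r.
by apply: L2D => //; exact: L2Z.
Qed.

Lemma L2_dom f g : measurable_fun setT f -> L2 g ->
  {ae mu, forall x, `|f x| <= `|g x|} -> L2 f.
Proof.
move=> mf [mg Ig] fg; split => //; apply: (Int_dom _ Ig).
  exact: measurable_funX.
apply: filterS fg => x fx.
by rewrite ger0_norm ?sqr_ge0// -[leLHS]real_normK ?num_real// -[leRHS]real_normK ?num_real// lerXn2r ?nnegrE.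
Qed.

Lemma CS f g : L2 f -> L2 g ->
  (rint (fun x => f x * g x)) ^+ 2 <= rint (fun x => f x ^+ 2) * rint (fun x => g x ^+ 2).
Proof.
move=> Lf Lg; have [mf If] := Lf; have [mg Ig] := Lg; have Ifg := L2_mul Lf Lg.
set a := rint _; set b := rint _; set c := rint _.
have H t : 0 <= b - 2 * t * a + t ^+ 2 * c.
  have <- : rint (fun x => (f x - t * g x) ^+ 2) = b - 2 * t * a + t ^+ 2 * c.
    have -> : (fun x => (f x - t * g x) ^+ 2) =
        (fun x => (f x ^+ 2 - (2 * t) * (f x * g x)) + t ^+ 2 * g x ^+ 2).
      by apply/funext => x; ring.
    rewrite ID ?IB ?IZ//; last exact: IntZ.
      exact: IntZ.
    by apply: IntB => //; exact: IntZ.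
  by apply: I_ge0 => x; exact: sqr_ge0.
have c0 : 0 <= c by apply: I_ge0 => x; exact: sqr_ge0.
have b0 : 0 <= b by apply: I_ge0 => x; exact: sqr_ge0.
have [c_0|cN0] := eqVneq c 0.
  have [a_0|aN0] := eqVneq a 0; first by rewrite a_0 expr0n/= mulr_ge0.
  (* At this value of t the affine function b - 2 t a equals -1, although it should be
     nonnegative. *)
  exfalso; have := H ((b + 1) / (2 * a)).
  rewrite c_0 mulr0 addr0.
  rewrite (_ : 2 * _ * a = b + 1); last by field.
  lra.
have c1 : 0 < c by rewrite lt_neqAle eq_sym cN0.
have := H (a / c).
have -> : b - 2 * (a / c) * a + (a / c) ^+ 2 * c = (b * c - a ^+ 2) / c by field.
by rewrite pmulr_lge0 ?invr_gt0// subr_ge0.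
Qed.

End real_integral.

(** * The closure of the test functions in H^1 *)

Section test_integrals.
Context {R : realType} {n : nat}.
Variables (Omega : set 'rV[R]_n.+1) (M : R) (M0 : 0 < M) (OM : Omega `<=` cube 0 M).
Implicit Types (phi psi f g : 'rV[R]_n.+1 -> R) (i : 'I_n.+1).
Local Notation test := (test_function Omega).
Local Notation mu := (lam n.+1).
Local Notation Int := (rintegrable mu).
Local Notation I := (rint mu).
Local Notation L2 := (L2 mu).

Lemma Int_bounded f B : measurable_fun setT f -> (forall x, `|f x| <= B) ->
  (forall x, ~ cube 0 M x -> f x = 0) -> Int f.
Proof.
move=> mf fB f0.
have E : EFin \o f = (EFin \o f) \_ (cube 0 M).
  apply/funext => x; rewrite patchE; case: ifPn => //=.
  by rewrite notin_setE => /f0 ->.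
rewrite /rintegrable E -integrable_mkcond; last exact: measurable_cube.
apply: measurable_bounded_integrable.
- exact: measurable_cube.
- by rewrite [X in (X < _)%E]lam_cube ?ltry// ltW.
- exact: measurable_funTS.
- exists B; split; first exact: num_real.
  by move=> c /ltW Bc x _ /=; rewrite (le_trans (fB _)).
Qed.

(** It stands for the constant 1 on [Omega] inside L^2(R^N); pairing with it turns L^2 bounds into
    L^1 bounds. *)
Definition cutoff : 'rV[R]_n.+1 -> R := \1_(cube 0 M).

Lemma L2_cutoff : L2 cutoff.
Proof.
have mc : measurable_fun setT cutoff.
  by apply: measurable_indic; exact: measurable_cube.
split => //; apply: (@Int_bounded _ 1).
- exact: measurable_funX.
- by move=> x; rewrite /cutoff indicE; case: (_ \in _); rewrite ?expr1n ?expr0n/= ?normr1 ?normr0.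
- by move=> x cx; rewrite /cutoff indicE memNset// expr0n.
Qed.

Lemma cutoffE x : Omega x -> cutoff x = 1.
Proof. by move=> /OM cx; rewrite /cutoff indicE mem_set. Qed.

Lemma test_Int phi : test phi -> Int phi.
Proof.
move=> tp; have [B HB] := test_bounded tp; apply: (Int_bounded (test_measurable tp) HB).
by move=> x cx; apply: (test_out tp) => /OM.
Qed.

Lemma test_L2 phi : test phi -> L2 phi.
Proof.
move=> tp; split; first exact: (test_measurable tp).
exact: (test_Int (testMr tp (test_smooth tp))).
Qed.

(** On each line the positive and negative parts of the derivative have equal integrals. Tonelli is
    applied to the two parts separately, which keeps all integrands nonnegative. *)
Lemma test_I_partial i phi : test phi -> I (partial i phi) = 0.
Proof.
move=> tp; have mp := test_measurable (test_partial i tp).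
have mE : measurable_fun setT (fun x => (partial i phi x)%:E) by exact/measurable_EFinP.
suff E : (\int[mu]_x ((fun x => (partial i phi x)%:E) ^\+ x) =
          \int[mu]_x ((fun x => (partial i phi x)%:E) ^\- x))%E.
  have := IE (test_Int (test_partial i tp)).
  rewrite integralE E subee; first by move=> [].
  by apply: integrable_fin_num => //; apply: integrable_funeneg => //;
    exact: test_Int (test_partial i tp).
rewrite (tonelli_ins i (measurable_funepos mE) (fun=> funepos_ge0 _ _)).
rewrite (tonelli_ins i (measurable_funeneg mE) (fun=> funeneg_ge0 _ _)).
apply: eq_integral => y _.
have [li l0] := test_line_int0 M0 OM i y tp.
have lp := integrable_fin_num measurableT (integrable_funepos measurableT li).
have ln := integrable_fin_num measurableT (integrable_funeneg measurableT li).
move: l0; rewrite integralE -(fineK lp) -(fineK ln) -EFinB => -[/eqP].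
rewrite subr_eq0 => /eqP E; have := congr1 (@EFin R) E.
rewrite (fineK lp) (fineK ln) => E2.
apply: (etrans _ (etrans E2 _)).
  by apply: eq_integral => t _; rewrite !unlock.
by apply: eq_integral => t _; rewrite !unlock.
Qed.

Lemma test_ibp i phi psi : test phi -> smooth psi ->
  I (fun x => partial i phi x * psi x) = - I (fun x => phi x * partial i psi x).
Proof.
move=> tp sq; have := test_I_partial i (testMr tp sq).
rewrite (partialM i (test_dable tp) (smooth_dable sq)) /=.
have I1 : Int (fun x => phi x * partial i psi x).
  exact: test_Int (testMr tp (smooth_partial i sq)).
have I2 : Int (fun x => psi x * partial i phi x).
  have := test_Int (testMr (test_partial i tp) sq).
  by congr rintegrable; apply/funext => x; rewrite /= mulrC.
rewrite -[X in rint _ X]/(fun x => phi x * partial i psi x + psi x * partial i phi x).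
rewrite ID// addrC => /eqP; rewrite addr_eq0 => /eqP <-.
by congr rint; apply/funext => x; rewrite mulrC.
Qed.

(** On a line, |phi| is bounded by the total variation along that line, and the line meets the cube
    in a segment of length at most 2 M. *)
Lemma test_poincare i phi : test phi ->
  I (fun x => `|phi x|) <= 2 * M * I (fun x => `|partial i phi x|).
Proof.
move=> tp; have tpi := test_partial i tp.
have IA := IntAbs (test_Int tp); have IB := IntAbs (test_Int tpi).
have mA : measurable_fun setT (fun x => `|phi x|%:E) by exact: (measurable_int _ IA).
have mB : measurable_fun setT (fun x => `|partial i phi x|%:E) by exact: (measurable_int _ IB).
rewrite -lee_fin EFinM -(IE IA) -(IE IB).
have M20 : 0 <= 2 * M by have := M0; lra.
rewrite (tonelli_ins i mA)//.
rewrite (tonelli_ins i mB)//.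
have a0 x : (0 <= `|phi x|%:E)%E by rewrite lee_fin.
have b0 x : (0 <= `|partial i phi x|%:E)%E by rewrite lee_fin.
have mlA := measurable_line i mA a0; have mlB := measurable_line i mB b0.
rewrite -ge0_integralZl//; last by move=> y _; exact: integral_ge0.
apply: ge0_le_integral => //.
- by move=> y _; exact: integral_ge0.
- exact: measurable_funeM.
move=> y _.
have -> : (\int[lebesgue_measure]_t `|phi (ins i y t)|%:E =
           \int[lebesgue_measure]_(t in `[(- M)%R, M]) `|phi (ins i y t)|%:E)%E.
  rewrite [RHS]integral_mkcond; apply: eq_integral => t _; rewrite patchE.
  case: ifPn => //; rewrite notin_setE /= in_itv/= => /negP; rewrite -ler_norml -ltNge => Mt.
  by rewrite (test_line_out OM i y tp Mt) normr0.
apply: (@le_trans _ _ (\int[lebesgue_measure]_(t in `[(- M)%R, M])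
  cst (\int[lebesgue_measure]_s `|partial i phi (ins i y s)|%:E) t)%E).
  apply: ge0_le_integral.
  - exact: measurable_itv.
  - by move=> t _; exact: a0.
  - by apply: measurable_funTS; exact: measurableT_comp mA (measurable_ins2 i y).
  - exact: measurable_cst.
  - by move=> t _; exact: (test_line_sup OM i y t tp).
rewrite integral_cst// [X in (_ * X <= _)%E]lebesgue_measure_itv/= lte_fin.
case: ifPn => _; last by rewrite mule0 mule_ge0 ?lee_fin// integral_ge0.
by rewrite muleC -EFinD opprK mulr_natl mulr2n.
Qed.

End test_integrals.

Section H10.
Context {R : realType} {n : nat}.
Variables (Omega : set 'rV[R]_n.+1) (M : R) (M0 : 0 < M) (OM : Omega `<=` cube 0 M).
Local Notation test := (test_function Omega).
Local Notation mu := (lam n.+1).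
Local Notation Int := (rintegrable mu).
Local Notation I := (rint mu).
Local Notation L2 := (L2 mu).
Implicit Types (phi psi f g u v : 'rV[R]_n.+1 -> R) (i : 'I_n.+1).
Implicit Types (G H : 'I_n.+1 -> 'rV[R]_n.+1 -> R).

Definition sqd f g := I (fun x => (f x - g x) ^+ 2).
Definition err u G v H := sqd u v + \sum_i sqd (G i) (H i).
Definition grad phi : 'I_n.+1 -> 'rV[R]_n.+1 -> R := fun i => partial i phi.

(* [(u, G)] is in the closure of [{(phi, grad phi)}] in L^2; functions are extended by 0
   outside [Omega], so all integrals are over R^N. *)
Definition H10 u G := [/\ L2 u, forall i, L2 (G i) &
  forall eps, 0 < eps -> exists2 phi, test phi & err u G phi (grad phi) < eps].

Lemma sqd_ge0 f g : 0 <= sqd f g.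
Proof. by apply: I_ge0 => x; exact: sqr_ge0. Qed.

Lemma sqd_Int f g : L2 f -> L2 g -> Int (fun x => (f x - g x) ^+ 2).
Proof. by move=> Lf Lg; have [] := L2B Lf Lg. Qed.

Lemma sqd_tri f g h : L2 f -> L2 g -> L2 h -> sqd f h <= 2 * sqd f g + 2 * sqd g h.
Proof.
move=> Lf Lg Lh; have I1 := sqd_Int Lf Lg; have I2 := sqd_Int Lg Lh.
rewrite /sqd -!IZ// -ID; [|exact: IntZ|exact: IntZ].
apply: le_I; [exact: sqd_Int|by apply: IntD; exact: IntZ|move=> x].
have := sqr_ge0 ((f x - g x) - (g x - h x)).
move: (f x) (g x) (h x) => a b c abc; rewrite -subr_ge0.
by have -> : 2 * (a - b) ^+ 2 + 2 * (b - c) ^+ 2 - (a - c) ^+ 2 = (a - b - (b - c)) ^+ 2 by ring.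
Qed.

Lemma err_tri u G v H w K : L2 u -> L2 v -> L2 w -> (forall i, L2 (G i)) ->
  (forall i, L2 (H i)) -> (forall i, L2 (K i)) ->
  err u G w K <= 2 * err u G v H + 2 * err v H w K.
Proof.
move=> Lu Lv Lw LG LH LK; rewrite /err !mulrDr !mulr_sumr addrACA -big_split/= lerD//.
  exact: sqd_tri.
by apply: ler_sum => i _; exact: sqd_tri.
Qed.

Lemma err_ge0 u G v H : 0 <= err u G v H.
Proof. by rewrite addr_ge0 ?sqd_ge0// sumr_ge0// => i _; exact: sqd_ge0. Qed.

Lemma sqd_le_err u G v H : sqd u v <= err u G v H.
Proof. by rewrite lerDl sumr_ge0// => i _; exact: sqd_ge0. Qed.

Lemma sqd_le_err_grad u G v H i : sqd (G i) (H i) <= err u G v H.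
Proof.
rewrite /err (bigD1 i)//= addrCA lerDl addr_ge0 ?sqd_ge0// sumr_ge0// => j _.
exact: sqd_ge0.
Qed.

Lemma grad_L2 phi i : test phi -> L2 (grad phi i).
Proof. by move=> tp; exact: (test_L2 M0 OM (test_partial i tp)). Qed.

Lemma H10_test phi : test phi -> H10 phi (grad phi).
Proof.
move=> tp; split; [exact: (test_L2 M0 OM)|by move=> i; exact: grad_L2|].
move=> e e0; exists phi => //; rewrite /err /sqd.
have E f : rint mu (fun x => (f x - f x) ^+ 2) = 0.
  by rewrite -[RHS](I0 mu); congr rint; apply/funext => x; rewrite subrr expr0n.
by rewrite E big1 ?addr0.
Qed.

Lemma H10_closed u G : L2 u -> (forall i, L2 (G i)) ->
  (forall eps, 0 < eps -> exists v, exists2 H, H10 v H & err u G v H < eps) -> H10 u G.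
Proof.
move=> Lu LG HH; split => // e e0; have e4 : 0 < e / 4 by lra.
have [v [H [Lv LH vH] uv]] := HH _ e4; have [phi tp vphi] := vH _ e4.
exists phi => //; apply: (le_lt_trans (@err_tri _ _ v H _ _ _ _ _ _ _ _)) => //; [exact: (test_L2 M0 OM)|by move=> i; exact: grad_L2|lra].
Qed.

Lemma sqr_cvg0 (a : nat -> R) : a k ^+ 2 @[k --> \oo] --> 0 -> a k @[k --> \oo] --> 0.
Proof.
move=> /cvgrPdist_lt H; apply/cvgrPdist_lt => e e0.
have e20 : 0 < e ^+ 2 by rewrite exprn_gt0.
apply: filterS (H _ e20) => k; rewrite !sub0r !normrN normrX.
by rewrite ltr_pXn2r// nnegrE// ltW.
Qed.

Lemma sqd_ae f (f_ : nat -> 'rV[R]_n.+1 -> R) : L2 f -> (forall k, L2 (f_ k)) ->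
  (forall k, sqd f (f_ k) <= 2^-1 ^+ k) -> {ae mu, forall x, f_ k x @[k --> \oo] --> f x}.
Proof.
move=> Lf Lf_ Hk.
have := @fast_ae_cvg0 _ _ _ mu (fun k x => (f x - f_ k x) ^+ 2) _ _.
move=> /(_ (fun k => sqd_Int Lf (Lf_ k))) H.
have {}H := H _; apply: filterS (H _).
  move=> x /sqr_cvg0 fx.
  have -> : f_ ^~ x = (fun k => f x - (f x - f_ k x)) by apply/funext => k; ring.
  by rewrite -[X in _ --> X]subr0; apply: cvgB => //; exact: cvg_cst.
move=> k; apply: le_trans (Hk k); apply: le_I.
- exact/IntAbs/sqd_Int.
- exact: sqd_Int.
- by move=> x; rewrite ger0_norm// sqr_ge0.
Qed.

(** The geometric rate gives almost everywhere convergence of the whole sequence, with no extraction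
    of subsequences. *)
Lemma H10_seq u G : H10 u G -> exists phi_ : nat -> _,
  [/\ forall k, test (phi_ k), forall k, err u G (phi_ k) (grad (phi_ k)) <= 2^-1 ^+ k,
    {ae mu, forall x, phi_ k x @[k --> \oo] --> u x} &
    forall i, {ae mu, forall x, grad (phi_ k) i x @[k --> \oo] --> G i x}].
Proof.
move=> [Lu LG HH].
have HH' k : exists phi, test phi /\ err u G phi (grad phi) <= 2^-1 ^+ k.
  have k0 : 0 < 2^-1 ^+ k :> R by rewrite exprn_gt0.
  by have [phi tp /ltW up] := HH _ k0; exists phi.
have [phi_ Hphi] := choice HH'; exists phi_; split.
- by move=> k; have [] := Hphi k.
- by move=> k; have [] := Hphi k.
- apply: sqd_ae => // [k|k]; have [tp ep] := Hphi k; first exact: (test_L2 M0 OM).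
  exact: le_trans (sqd_le_err _ _ _ _) ep.
- move=> i; apply: sqd_ae => // [k|k]; have [tp ep] := Hphi k; first exact: grad_L2.
  exact: le_trans (sqd_le_err_grad _ _ _ _ i) ep.
Qed.

End H10.

Lemma lt_quarters (R : realFieldType) (a b e : R) :
  a < e / 4 -> b < e / 4 -> 2 * a + 2 * b < e.
Proof. lra. Qed.

Lemma sum_bound2 (R : realFieldType) k (a b c : R) (A B C : 'I_k -> R) :
  a <= 2 * b + 2 * c -> (forall i, A i <= 2 * B i + 2 * C i) ->
  a + \sum_i A i <= 2 * (b + \sum_i B i) + 2 * (c + \sum_i C i).
Proof.
move=> abc ABC; rewrite !mulrDr !mulr_sumr addrACA -big_split/=.
by apply: lerD => //; apply: ler_sum.
Qed.

Lemma cvg_fin_sum (R : realType) k (F : nat -> 'I_k -> R) (L : 'I_k -> R) :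
  (forall i, F m i @[m --> \oo] --> L i) ->
  \sum_i F m i @[m --> \oo] --> \sum_i L i.
Proof.
elim: k F L => [|k IH] F L FL.
  by rewrite big_ord0; under eq_fun do rewrite big_ord0; exact: cvg_cst.
rewrite big_ord_recl; under eq_fun do rewrite big_ord_recl.
by apply: cvgD; [exact: FL|exact: (IH (fun m i => F m (lift ord0 i)))].
Qed.

Section H10_calculus.
Context {R : realType} {n : nat}.
Variables (Omega : set 'rV[R]_n.+1) (M : R) (M0 : 0 < M) (OM : Omega `<=` cube 0 M).
Local Notation test := (test_function Omega).
Local Notation mu := (lam n.+1).
Local Notation I := (rint mu).
Local Notation L2 := (L2 mu).
Local Notation H10 := (H10 Omega).
Implicit Types (phi psi f g u v : 'rV[R]_n.+1 -> R) (i : 'I_n.+1).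
Implicit Types (G H : 'I_n.+1 -> 'rV[R]_n.+1 -> R).

Lemma H10_L2 u G : H10 u G -> L2 u. Proof. by case. Qed.
Lemma H10_L2g u G i : H10 u G -> L2 (G i). Proof. by case. Qed.
Lemma H10_meas u G : H10 u G -> measurable_fun setT u.
Proof. by move/H10_L2/L2_meas. Qed.
Lemma H10_measg u G i : H10 u G -> measurable_fun setT (G i).
Proof. by move/(H10_L2g i)/L2_meas. Qed.

Lemma H10_ae u G v H : H10 u G -> measurable_fun setT v ->
  (forall i, measurable_fun setT (H i)) ->
  {ae mu, forall x, v x = u x} -> (forall i, {ae mu, forall x, H i x = G i x}) -> H10 v H.
Proof.
move=> [Lu LG uG] mv mH vu HG.
have Lv : L2 v by apply: (L2_dom mv Lu); apply: filterS vu => x ->.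
have LH i : L2 (H i) by apply: (L2_dom (mH i) (LG i)); apply: filterS (HG i) => x ->.
split => // e e0; have [phi tp e1] := uG _ e0; exists phi => //; apply: le_lt_trans e1.
have E f g h : L2 f -> L2 g -> L2 h -> {ae mu, forall x, f x = g x} -> sqd f h = sqd g h.
  move=> Lf Lg Lh fg; apply: ae_eq_I.
  - by have [+ _] := L2B Lf Lh; exact: measurable_funX.
  - by have [+ _] := L2B Lg Lh; exact: measurable_funX.
  - by apply: filterS fg => x ->.
rewrite /err (E v u)//; last exact: (test_L2 M0 OM).
rewrite lerD2l; apply: ler_sum => i _.
by rewrite (E (H i) (G i))//; exact: (grad_L2 M0 OM).
Qed.

Lemma sqdD f g h k : L2 f -> L2 g -> L2 h -> L2 k ->
  sqd (fun x => f x + g x) (fun x => h x + k x) <= 2 * sqd f h + 2 * sqd g k.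
Proof.
move=> Lf Lg Lh Lk; have I1 := sqd_Int Lf Lh; have I2 := sqd_Int Lg Lk.
rewrite /sqd -!IZ// -ID; [|exact: IntZ|exact: IntZ].
apply: le_I; [by apply: sqd_Int; exact: L2D|by apply: IntD; exact: IntZ|move=> x].
move: (f x) (g x) (h x) (k x) => a b c e; rewrite -subr_ge0.
have -> : 2 * (a - c) ^+ 2 + 2 * (b - e) ^+ 2 - (a + b - (c + e)) ^+ 2 = (a - c - (b - e)) ^+ 2 by ring.
exact: sqr_ge0.
Qed.

Lemma sqdZ c f g : L2 f -> L2 g ->
  sqd (fun x => c * f x) (fun x => c * g x) = c ^+ 2 * sqd f g.
Proof.
move=> Lf Lg; rewrite /sqd -IZ; last exact: sqd_Int.
by congr rint; apply/funext => x; ring.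
Qed.

Lemma H10D u G v H : H10 u G -> H10 v H ->
  H10 (fun x => u x + v x) (fun i x => G i x + H i x).
Proof.
move=> [Lu LG uG] [Lv LH vH]; split => [|i|e e0]; [exact: L2D|exact: L2D|].
have e4 : 0 < e / 4 by lra.
have [phi tp e1] := uG _ e4; have [psi tq e2] := vH _ e4.
exists (phi \+ psi); first exact: testD.
have Lp := test_L2 M0 OM tp; have Lq := test_L2 M0 OM tq.
have Lpi i := grad_L2 M0 OM i tp; have Lqi i := grad_L2 M0 OM i tq.
apply: le_lt_trans (lt_quarters e1 e2).
apply: (sum_bound2 (sqdD Lu Lv Lp Lq)) => i.
rewrite {1}/grad (partialD i (test_dable tp) (test_dable tq)).
exact: (sqdD (LG i) (LH i) (Lpi i) (Lqi i)).
Qed.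

Lemma H10Z c u G : H10 u G -> H10 (fun x => c * u x) (fun i x => c * G i x).
Proof.
move=> [Lu LG uG]; split => [|i|e e0]; [exact: L2Z|exact: L2Z|].
have e' : 0 < e / (c ^+ 2 + 1) by rewrite divr_gt0// ltr_wpDl// sqr_ge0.
have [phi tp e1] := uG _ e'; exists (fun x => c * phi x); first exact: testZ.
have Lp := test_L2 M0 OM tp; have Lpi i := grad_L2 M0 OM i tp.
have -> : err (fun x => c * u x) (fun i x => c * G i x) (fun x => c * phi x) (grad (fun x => c * phi x)) =
   c ^+ 2 * err u G phi (grad phi).
  rewrite /err mulrDr mulr_sumr sqdZ//; congr (_ + _); apply: eq_bigr => i _.
  rewrite (_ : grad (fun x => c * phi x) i = (fun x => c * grad phi i x)).
    exact: (sqdZ c (LG i) (Lpi i)).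
  exact: (partialZ i c (test_dable tp)).
apply: le_lt_trans (_ : (c ^+ 2 + 1) * err u G phi (grad phi) < _).
  by rewrite ler_wpM2r ?err_ge0// lerDl.
by rewrite mulrC -ltr_pdivlMr// ltr_wpDl// sqr_ge0.
Qed.

Lemma H10B u G v H : H10 u G -> H10 v H ->
  H10 (fun x => u x - v x) (fun i x => G i x - H i x).
Proof.
move=> uG vH; have := H10D uG (H10Z (-1) vH).
by congr (H10 _ _); [apply/funext => x|apply/funext => i; apply/funext => x]; rewrite mulN1r.
Qed.

Lemma sqd_cvg (f_ : nat -> 'rV[R]_n.+1 -> R) f g : L2 f -> L2 g ->
  (forall k, measurable_fun setT (f_ k)) ->
  {ae mu, forall x, forall k, `|f_ k x| <= `|g x|} ->
  {ae mu, forall x, f_ k x @[k --> \oo] --> f x} ->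
  sqd f (f_ k) @[k --> \oo] --> 0.
Proof.
move=> Lf Lg mf_ fg ff; have [mf If] := Lf; have [mg Ig] := Lg.
have [|||||_] := @DCT _ _ _ mu (fun k x => (f x - f_ k x) ^+ 2) (fun=> 0)
  (fun x => 2 * f x ^+ 2 + 2 * g x ^+ 2).
- by move=> k; apply: measurable_funX; exact: measurable_funB.
- by [].
- by apply: IntD; exact: IntZ.
- apply: filterS fg => x fgx k; rewrite ger0_norm ?sqr_ge0//.
  have : f_ k x ^+ 2 <= g x ^+ 2.
    by rewrite -[leLHS]real_normK ?num_real// -[leRHS]real_normK ?num_real// lerXn2r ?nnegrE.
  have := sqr_ge0 (f x + f_ k x).
  move: (f x) (f_ k x) (g x) => a b c; rewrite sqrrB sqrrD; lra.
- apply: filterS ff => x fx.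
  rewrite (_ : 0 = (f x - f x) * (f x - f x)); last by rewrite subrr mul0r.
  by apply: cvgM; apply: cvgB => //; exact: cvg_cst.
- by rewrite I0.
Qed.

Lemma H10_cvg (u_ : nat -> _) (G_ : nat -> _) u G : (forall k, H10 (u_ k) (G_ k)) ->
  L2 u -> (forall i, L2 (G i)) ->
  sqd u (u_ k) @[k --> \oo] --> 0 ->
  (forall i, sqd (G i) (G_ k i) @[k --> \oo] --> 0) -> H10 u G.
Proof.
move=> Hk Lu LG cu cG; apply: (H10_closed M0 OM Lu LG) => e e0.
have : err u G (u_ k) (G_ k) @[k --> \oo] --> 0.
  rewrite [X in _ --> X](_ : 0 = 0 + \sum_(i < n.+1) 0); last by rewrite big1 ?addr0.
  apply: cvgD => //.
  by apply: (@cvg_fin_sum _ _ (fun k i => sqd (G i) (G_ k i))).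
move=> /cvgrPdist_lt/(_ _ e0)[k _ /(_ k (leqnn k))] /=.
rewrite sub0r normrN ger0_norm ?err_ge0// => ek.
by exists (u_ k), (G_ k).
Qed.

Lemma H10_dct (u_ : nat -> _) (G_ : nat -> _) u G U (W : 'I_n.+1 -> _) :
  (forall k, H10 (u_ k) (G_ k)) -> measurable_fun setT u ->
  (forall i, measurable_fun setT (G i)) ->
  L2 U -> (forall i, L2 (W i)) ->
  {ae mu, forall x, forall k, `|u_ k x| <= `|U x|} ->
  (forall i, {ae mu, forall x, forall k, `|G_ k i x| <= `|W i x|}) ->
  {ae mu, forall x, u_ k x @[k --> \oo] --> u x} ->
  (forall i, {ae mu, forall x, G_ k i x @[k --> \oo] --> G i x}) -> H10 u G.
Proof.
move=> Hk mu_ mG LU LW bu bG cu cG.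
have lim_le f g (f_ : nat -> _) : {ae mu, forall x, forall k, `|f_ k x| <= `|g x|} ->
    {ae mu, forall x, f_ k x @[k --> \oo] --> (f x : R)} -> {ae mu, forall x, `|f x| <= `|g x : R|}.
  move=> b c; apply: filterS2 b c => x bx cx.
  have cn : `|f_ k x| @[k --> \oo] --> `|f x| by exact: cvg_norm.
  rewrite -(cvg_lim (@Rhausdorff R) cn).
  by apply: limr_le; [exact: cvgP cn|exact: nearW].
have Lu : L2 u by exact: (L2_dom mu_ LU (lim_le _ _ _ bu cu)).
have LG i : L2 (G i) by exact: (L2_dom (mG i) (LW i) (lim_le _ _ _ (bG i) (cG i))).
apply: (H10_cvg Hk Lu LG).
- by apply: (sqd_cvg Lu LU) => // k; exact: H10_meas (Hk k).
- by move=> i; apply: (sqd_cvg (LG i) (LW i)) => // k; exact: H10_measg (Hk k).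
Qed.

Lemma I_mul_cvg (f_ : nat -> 'rV[R]_n.+1 -> R) f g : (forall k, L2 (f_ k)) -> L2 f -> L2 g ->
  sqd f (f_ k) @[k --> \oo] --> 0 ->
  I (fun x => f_ k x * g x) @[k --> \oo] --> I (fun x => f x * g x).
Proof.
move=> Lf_ Lf Lg c.
have : (I (fun x => f x * g x) - I (fun x => f_ k x * g x)) ^+ 2 @[k --> \oo] --> 0.
  have c' : sqd f (f_ k) * I (fun x => g x ^+ 2) @[k --> \oo] --> 0.
    by rewrite -(mul0r (I (fun x => g x ^+ 2))); apply: cvgM => //; exact: cvg_cst.
  apply: (squeeze_cvgr _ _ c'); last exact: (cvg_cst 0).
  apply: nearW => k; rewrite sqr_ge0/=; apply: le_trans (CS (L2B Lf (Lf_ k)) Lg).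
  rewrite -IB; [|exact: L2_mul|exact: L2_mul].
  by rewrite le_eqVlt; apply/orP; left; apply/eqP; congr (_ ^+ 2); congr rint; apply/funext => x; ring.
move=> /sqr_cvg0 h.
have -> : (fun k => I (fun x => f_ k x * g x)) = (fun k => I (fun x => f x * g x) -
   (I (fun x => f x * g x) - I (fun x => f_ k x * g x))).
  by apply/funext => k; ring.
by rewrite -[X in _ --> X]subr0; apply: cvgB => //; exact: cvg_cst.
Qed.

Lemma half_cvg0 : (2^-1 : R) ^+ k @[k --> \oo] --> 0.
Proof.
have -> : (fun k => (2^-1 : R) ^+ k) = geometric 1 2^-1.
  by apply/funext => k; rewrite /= mul1r.
by apply: cvg_geometric; rewrite ger0_norm ?invf_lt1 ?ltr1n.
Qed.

Lemma H10_seq_sqd u G (phi_ : nat -> 'rV[R]_n.+1 -> R) : (forall k, err u G (phi_ k) (grad (phi_ k)) <= 2^-1 ^+ k) ->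
  sqd u (phi_ k) @[k --> \oo] --> 0 /\ forall i, sqd (G i) (grad (phi_ k) i) @[k --> \oo] --> 0.
Proof.
move=> ek; split=> [|i]; apply: (squeeze_cvgr _ (cvg_cst 0) half_cvg0); apply: nearW => k;
  rewrite sqd_ge0/=; apply: le_trans (ek k).
- exact: sqd_le_err.
- exact: sqd_le_err_grad.
Qed.

Lemma H10_ibp u G i psi : H10 u G -> test psi ->
  I (fun x => G i x * psi x) = - I (fun x => u x * partial i psi x).
Proof.
move=> uG tq; have [phi_ [tp ek _ _]] := H10_seq M0 OM uG.
have [cu cG] := H10_seq_sqd ek.
have Lp k := test_L2 M0 OM (tp k); have Lg k := grad_L2 M0 OM i (tp k).
have c1 := I_mul_cvg Lg (H10_L2g i uG) (test_L2 M0 OM tq) (cG i).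
have c2 := I_mul_cvg Lp (H10_L2 uG) (grad_L2 M0 OM i tq) cu.
apply: (cvg_unique _ c1); first exact: Rhausdorff.
rewrite (_ : (fun k => _) = (fun k => - I (fun x => phi_ k x * grad psi i x))); first exact: cvgN.
apply/funext => k.
exact: (test_ibp M0 OM i (tp k) (test_smooth tq)).
Qed.

(** Integrating by parts against the approximations [grad (phi_ k) i] gives 0, and these converge to
    [G i]; hence [G i] has zero square integral. This is the uniqueness of weak gradients. *)
Lemma H10_0 G i : H10 (fun=> 0) G -> {ae mu, forall x, G i x = 0}.
Proof.
move=> uG; have [phi_ [tp ek _ _]] := H10_seq M0 OM uG.
have [_ cG] := H10_seq_sqd ek.
have LG := H10_L2g i uG.
have c1 := I_mul_cvg (fun k => grad_L2 M0 OM i (tp k)) LG LG (cG i).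
have E : (fun k => I (fun x => grad (phi_ k) i x * G i x)) = (fun=> 0).
  apply/funext => k; have := H10_ibp i uG (test_partial i (tp k)).
  rewrite (_ : (fun x => 0 * _) = (fun=> 0)); last by apply/funext => x; rewrite mul0r.
  rewrite I0 oppr0 => E; rewrite -[RHS]E.
  by congr rint; apply/funext => x; rewrite mulrC.
rewrite E in c1; have {}c1 := cvg_unique (@Rhausdorff R) c1 (cvg_cst 0).
have [_ I2] := LG.
have : {ae mu, forall x, G i x ^+ 2 = 0}.
  apply: I_eq0 => //; first by apply: aeW => x; exact: sqr_ge0.
  by rewrite (_ : I _ = 0)//; rewrite -[RHS]c1; congr rint; apply/funext => x; rewrite expr2.
by apply: filterS => x /eqP; rewrite sqrf_eq0 => /eqP.
Qed.

Lemma H10_out u G : H10 u G -> {ae mu, forall x, ~ Omega x -> u x = 0}.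
Proof.
move=> uG; have [phi_ [tp _ cu _]] := H10_seq M0 OM uG.
apply: filterS cu => x cx Ox; apply: (cvg_unique (@Rhausdorff R) cx).
rewrite (_ : phi_ ^~ x = fun=> 0); first exact: cvg_cst.
by apply/funext => k; rewrite (test_out (tp k)).
Qed.

Lemma lipschitz_of_derive (F F' : R -> R) C : (forall t, is_derive t (1 : R) F (F' t)) ->
  (forall t, `|F' t| <= C) -> forall a b, `|F a - F b| <= C * `|a - b|.
Proof.
move=> dF bF.
have H a b : a <= b -> `|F b - F a| <= C * `|b - a|.
  move=> ab.
  have cF : {within `[a, b], continuous F}.
    apply: continuous_subspaceT => x; apply/differentiable_continuous/derivable1_diffP.
    by have [] := dF x.
  have [c _ ->] := MVT_segment ab (fun x _ => dF x) cF.
  by rewrite normrM ler_wpM2r.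
move=> a b; have [ab|/ltW ba] := leP a b; last exact: H.
by rewrite distrC [`|a - b|]distrC; exact: H.
Qed.

(** The chain rule together with the convergence of the composed approximations; the latter is
    needed again in [Sol_test], where the equation is known for test functions only. *)
Lemma H10_comp_cvg (F F' : R -> R) C u G (phi_ : nat -> 'rV[R]_n.+1 -> R) :
  (forall t, is_derive t (1 : R) F (F' t)) -> (forall t, `|F' t| <= C) ->
  continuous F' -> F 0 = 0 -> (forall phi, test phi -> test (F \o phi)) ->
  H10 u G -> (forall k, test (phi_ k)) ->
  {ae mu, forall x, phi_ k x @[k --> \oo] --> u x} ->
  sqd u (phi_ k) @[k --> \oo] --> 0 ->
  (forall i, sqd (G i) (grad (phi_ k) i) @[k --> \oo] --> 0) ->
  [/\ L2 (F \o u), forall i, L2 (fun x => F' (u x) * G i x),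
   sqd (F \o u) (F \o phi_ k) @[k --> \oo] --> 0 &
   forall i, sqd (fun x => F' (u x) * G i x) (grad (F \o phi_ k) i) @[k --> \oo] --> 0].
Proof.
move=> dF bF cF' F0 tF uG tp cu su sG; have [Lu LG _] := uG.
have C0 : 0 <= C by exact: le_trans (bF 0).
have cF : continuous F.
  by move=> x; apply/differentiable_continuous/derivable1_diffP; have [] := dF x.
have lip := lipschitz_of_derive dF bF.
have mF : measurable_fun setT F by exact: measurable_realfun.continuous_measurable_fun.
have mF' : measurable_fun setT F' by exact: measurable_realfun.continuous_measurable_fun.
have mFu : measurable_fun setT (F \o u) by exact: measurableT_comp mF (L2_meas Lu).
have mF'u : measurable_fun setT (fun x => F' (u x)) by exact: measurableT_comp mF' (L2_meas Lu).
have LFu : L2 (F \o u).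
  apply: (L2_dom mFu (L2Z C Lu)); apply: aeW => x /=.
  by rewrite normrM (ger0_norm C0) -[F (u x)]subr0 -F0 -[u x in leRHS]subr0.
have LbG i f : measurable_fun setT f -> (forall x, `|f x| <= C) -> L2 (fun x => f x * G i x).
  move=> mf fC; apply: (L2_dom _ (L2Z C (LG i))).
    by apply: measurable_funM => //; exact: L2_meas.
  by apply: aeW => x; rewrite !normrM (ger0_norm C0) ler_wpM2r.
have LFG i : L2 (fun x => F' (u x) * G i x) by exact: LbG.
have Lp k := test_L2 M0 OM (tp k); have Lg i k := grad_L2 M0 OM i (tp k).
have gE k i : grad (F \o phi_ k) i = (fun x => F' (phi_ k x) * grad (phi_ k) i x).
  apply/funext => x; rewrite /grad /partial.
  have dk : dable (phi_ k) := test_dable (tp k).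
  by have [_ ->] := is_derive_dir_comp (dk i x) (dF (phi_ k x)).
have HFk k : H10 (F \o phi_ k) (grad (F \o phi_ k)).
  by apply: (H10_test M0 OM); exact: tF.
split; [exact: LFu|exact: LFG| |].
- have c' : C ^+ 2 * sqd u (phi_ k) @[k --> \oo] --> 0.
    by rewrite -(mulr0 (C ^+ 2)); apply: cvgM => //; exact: cvg_cst.
  apply: (squeeze_cvgr _ (cvg_cst 0) c'); apply: nearW => k; rewrite sqd_ge0/=.
  rewrite /sqd -IZ; last exact: sqd_Int.
  apply: le_I.
  + exact: (sqd_Int LFu (H10_L2 (HFk k))).
  + by apply: IntZ; exact: sqd_Int.
  + move=> x; rewrite -exprMn -[leLHS]real_normK ?num_real// -[leRHS]real_normK ?num_real//.
    by rewrite normrM (ger0_norm C0); apply: lerXn2r; rewrite ?nnegrE ?mulr_ge0//; exact: lip.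
- move=> i.
  (* [K k] is intermediate: it differs from the limit by a dominated convergence argument and from
     the true gradient by at most C times the error on gradients. *)
  pose K k x := F' (phi_ k x) * G i x.
  have mFp k : measurable_fun setT (fun x => F' (phi_ k x)).
    exact: measurableT_comp mF' (L2_meas (Lp k)).
  have LK k : L2 (K k) by apply: LbG => //.
  have c1 : sqd (fun x => F' (u x) * G i x) (K k) @[k --> \oo] --> 0.
    apply: (sqd_cvg (LFG i) (L2Z C (LG i))) => [k||].
    - exact: L2_meas (LK k).
    - by apply: aeW => x k; rewrite !normrM (ger0_norm C0) ler_wpM2r.
    - apply: filterS cu => x cx; apply: cvgM; last exact: cvg_cst.
      exact: (cvg_comp _ _ cx (cF' (u x))).
  have c2 : 2 * sqd (fun x => F' (u x) * G i x) (K k) + 2 * (C ^+ 2 * sqd (G i) (grad (phi_ k) i))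
      @[k --> \oo] --> 0.
    rewrite [X in _ --> X](_ : 0 = 2 * 0 + 2 * (C ^+ 2 * 0)); last by rewrite !mulr0 addr0.
    by apply: cvgD; apply: cvgM => //; [exact: cvg_cst..|apply: cvgM => //; exact: cvg_cst].
  apply: (squeeze_cvgr _ (cvg_cst 0) c2); apply: nearW => k; rewrite sqd_ge0/=.
  have LFp : L2 (grad (F \o phi_ k) i) by exact: (grad_L2 M0 OM i (tF _ (tp k))).
  apply: (le_trans (sqd_tri (LFG i) (LK k) LFp)).
  rewrite lerD2l ler_pM2l//.
  rewrite /sqd -IZ; last exact: sqd_Int.
  apply: le_I.
  + exact: sqd_Int.
  + by apply: IntZ; exact: sqd_Int.
  + move=> x; rewrite gE /K -mulrBr exprMn ler_wpM2r ?sqr_ge0//.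
    by rewrite -[leLHS]real_normK ?num_real// lerXn2r ?nnegrE.
Qed.

Lemma H10_comp (F F' : R -> R) C u G :
  (forall t, is_derive t (1 : R) F (F' t)) -> (forall t, `|F' t| <= C) ->
  continuous F' -> F 0 = 0 -> (forall phi, test phi -> test (F \o phi)) ->
  H10 u G -> H10 (F \o u) (fun i x => F' (u x) * G i x).
Proof.
move=> dF bF cF' F0 tF uG.
have [phi_ [tp ek cu cG]] := H10_seq M0 OM uG; have [su sG] := H10_seq_sqd ek.
have [LF LFG cF cFG] := H10_comp_cvg dF bF cF' F0 tF uG tp cu su sG.
have HFk k : H10 (F \o phi_ k) (grad (F \o phi_ k)).
  by apply: (H10_test M0 OM); exact: tF.
exact: (@H10_cvg (fun k => F \o phi_ k) (fun k => grad (F \o phi_ k)) _ _ HFk LF LFG).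
Qed.

End H10_calculus.

Definition ind {R : realType} (b : bool) : R := b%:R.

(** * Smooth truncations *)

Section rh_limits.
Context {R : realType}.
Implicit Types (t c : R).

Lemma rh0 : rh (0 : R) = 1.
Proof. by rewrite /rh expr0n/= addr0 sqrtr1 invr1. Qed.

Lemma rh_le1 t : rh t <= 1.
Proof.
rewrite -(ler_pXn2r (ltn0Sn 1)) ?nnegrE ?(ltW (rh_gt0 _))// expr1n.
have := rh_eq t; have := sqr_ge0 t; have := sqr_ge0 (rh t).
move: (rh t ^+ 2) (t ^+ 2) => a b; nra.
Qed.

Lemma rh_mul_sqr t : (t * rh t) ^+ 2 = 1 - rh t ^+ 2.
Proof. by have := rh_eq t; rewrite exprMn; move: (rh t ^+ 2) (t ^+ 2) => a b; lra. Qed.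

Lemma rh_mul_le1 t : `|t * rh t| <= 1.
Proof.
rewrite -(ler_pXn2r (ltn0Sn 1)) ?nnegrE// expr1n real_normK ?num_real// rh_mul_sqr.
by have := sqr_ge0 (rh t); lra.
Qed.

Lemma rh_cvg0 t : t != 0 -> rh (k.+1%:R * t) @[k --> \oo] --> 0.
Proof.
move=> t0.
have c : `|t|^-1 * k.+1%:R^-1 @[k --> \oo] --> 0.
  rewrite -(mulr0 (`|t|^-1)); apply: cvgM; [exact: cvg_cst|exact: cvg_harmonic].
apply: (squeeze_cvgr _ (cvg_cst 0) c); apply: nearW => k.
rewrite ltW ?rh_gt0//= -invfM -[X in _ <= X^-1](ger0_norm (mulr_ge0 _ _))//.
have k0 : 0 < `|t| * k.+1%:R by rewrite mulr_gt0// normr_gt0.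
rewrite ger0_norm ?(ltW k0)// -[leRHS]mul1r ler_pdivlMr// mulrC.
have := rh_mul_le1 (k.+1%:R * t).
by rewrite !normrM (gtr0_norm (rh_gt0 _)) (ger0_norm (ler0n _ _)) [k.+1%:R * `|_|]mulrC.
Qed.

(** t / sqrt(1 + c^2 t^2), bounded by 1/c. For c tending to infinity it tends to 0 while its
    derivative tends to the indicator of {t = 0}; for c tending to 0 it tends to the identity and
    its derivative to 1. Both regimes are used. *)
Definition vfun c t : R := t * rh (c * t).
Definition vfun' c t : R := rh (c * t) ^+ 3.

Lemma is_derive_scale_rh c t : is_derive t (1 : R) (fun t => rh (c * t)) (- (c * t) * rh (c * t) ^+ 3 * c).
Proof.
have d1 : is_derive t (1 : R) (fun t : R => c * t) c.
  apply: (is_derive_eq (is_deriveM (is_derive_cst c t 1) (is_derive_id t 1))).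
  by rewrite /GRing.scale/= mulr1 mulr0 addr0.
exact: (@is_derive1_comp _ rh (fun t : R => c * t) _ _ _ (is_derive_rh (c * t)) d1).
Qed.

Lemma is_derive_vfun c t : is_derive t (1 : R) (vfun c) (vfun' c t).
Proof.
have d2 := is_derive_scale_rh c t.
have d3 := @is_deriveM _ _ (fun t : R => t) (fun t => rh (c * t)) t 1 _ _ (is_derive_id t 1) d2.
apply: (is_derive_eq d3); rewrite /GRing.scale/= /vfun'.
have := rh_eq (c * t); move: (rh (c * t)) => r E.
have -> : r * 1 = r * (r ^+ 2 * (1 + (c * t) ^+ 2)) by rewrite E.
ring.
Qed.

Lemma continuous_rh_scale c : continuous (fun t => rh (c * t)).
Proof.
by move=> t; apply/differentiable_continuous/derivable1_diffP; have [] := is_derive_scale_rh c t.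
Qed.

Lemma continuous_vfun' c : continuous (vfun' c).
Proof. by move=> t; apply: cvgM; [|apply: cvgM]; exact: continuous_rh_scale. Qed.

Lemma vfun'_le1 c t : `|vfun' c t| <= 1.
Proof.
have r0 := ltW (rh_gt0 (c * t)); have r1 := rh_le1 (c * t).
by rewrite /vfun' ger0_norm ?exprn_ge0// exprn_ile1.
Qed.

Lemma vfun_le c t : `|vfun c t| <= `|t|.
Proof. by rewrite normrM ler_piMr// gtr0_norm ?rh_gt0// rh_le1. Qed.

Lemma vfun_le_inv c t : 0 < c -> `|vfun c t| <= c^-1.
Proof.
move=> c0; rewrite -[leRHS]mul1r ler_pdivlMr// -[X in _ * X](gtr0_norm c0) -normrM.
by rewrite (_ : _ * c = c * t * rh (c * t)) ?rh_mul_le1// /vfun; ring.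
Qed.

(** c t^2 / sqrt(1 + c^2 t^2), a smooth approximation of |t|. With s = c t rh(c t) in [-1, 1] its
    derivative is 2 s - s^3, which is bounded by 3 and tends to the sign of t. *)
Definition afun c t : R := t * (c * t * rh (c * t)).
Definition afun' c t : R := 2 * (c * t * rh (c * t)) - (c * t * rh (c * t)) ^+ 3.

Lemma is_derive_afun c t : is_derive t (1 : R) (afun c) (afun' c t).
Proof.
have d2 := is_derive_vfun c t.
have d3 := @is_deriveM _ _ (fun t : R => c * t) (vfun c) t 1 _ _ (is_deriveM (is_derive_cst c t 1) (is_derive_id t 1)) d2.
have -> : afun c = (fun t : R => c * t) * vfun c.
  by apply/funext => s; rewrite /afun /vfun /= mulrA [s * (c * s)]mulrC !mulrA.
apply: (is_derive_eq d3); rewrite /GRing.scale/= /afun' /vfun /vfun'.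
have := rh_eq (c * t); move: (rh (c * t)) => r E.
rewrite mulr0 addr0 mulr1.
have -> : c * t * r ^+ 3 = (c * t * r) * (1 - (c * t) ^+ 2 * r ^+ 2).
  have -> : r ^+ 3 = r * r ^+ 2 by ring.
  have -> : 1 - (c * t) ^+ 2 * r ^+ 2 = r ^+ 2 by rewrite -E; ring.
  ring.
ring.
Qed.

Lemma continuous_afun' c : continuous (afun' c).
Proof.
have H : continuous (fun t => c * t * rh (c * t)).
  move=> t; apply: cvgM; last exact: continuous_rh_scale.
  by apply: cvgM; [exact: cvg_cst|exact: cvg_id].
move=> t; apply: cvgB; first by apply: cvgM; [exact: cvg_cst|exact: H].
by apply: cvgM; [exact: H|apply: cvgM; exact: H].
Qed.

Lemma afun'_le c t : `|afun' c t| <= 3.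
Proof.
have := rh_mul_le1 (c * t); rewrite /afun'; move: (c * t * rh (c * t)) => r r1.
apply: (le_trans (ler_normB _ _)); rewrite normrM normrX (ger0_norm (ler0n _ 2)).
have : `|r| ^+ 3 <= 1 by rewrite exprn_ile1.
lra.
Qed.

Lemma afun_le c t : `|afun c t| <= `|t|.
Proof. by rewrite normrM ler_piMr// rh_mul_le1. Qed.

Lemma rh_mul_cvg t : k.+1%:R * t * rh (k.+1%:R * t) @[k --> \oo] --> Num.sg t.
Proof.
have pos s : 0 < s -> k.+1%:R * s * rh (k.+1%:R * s) @[k --> \oo] --> (1 : R).
  move=> s0; have r0 := rh_cvg0 (lt0r_neq0 s0).
  (* For a = s rh(s) in [0, 1] one has a^2 <= a <= 1, and a^2 = 1 - rh(s)^2: this is the lower bound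
     of the squeeze. *)
  have c : 1 - rh (k.+1%:R * s) * rh (k.+1%:R * s) @[k --> \oo] --> (1 : R).
    by rewrite -[X in _ --> X]subr0 -[X in _ - X](mulr0 0); apply: cvgB; [exact: cvg_cst|exact: cvgM].
  apply: (squeeze_cvgr _ c (cvg_cst (1 : R))); apply: nearW => k.
  have := rh_mul_sqr (k.+1%:R * s); have := rh_mul_le1 (k.+1%:R * s).
  have : 0 <= k.+1%:R * s * rh (k.+1%:R * s) by rewrite !mulr_ge0// ltW// rh_gt0.
  rewrite expr2; move: (k.+1%:R * s * rh (k.+1%:R * s)) (rh (k.+1%:R * s)) => a r a0.
  by rewrite ger0_norm// => a1 E; apply/andP; split => //; nra.
have [t0|t0|->] := ltgtP t 0.
- rewrite ltr0_sg//; have := pos (- t); rewrite oppr_gt0 => /(_ t0) c.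
  rewrite (_ : (fun k : nat => k.+1%:R * t * rh (k.+1%:R * t)) =
    (fun k : nat => - (k.+1%:R * (- t) * rh (k.+1%:R * (- t))))); first exact: cvgN.
  apply/funext => k; rewrite !mulrN !mulNr opprK; congr (_ * _).
  by rewrite /rh sqrrN.
- by rewrite gtr0_sg//; exact: pos.
- rewrite sgr0; rewrite (_ : (fun k => _) = fun=> 0); first exact: cvg_cst.
  by apply/funext => k; rewrite mulr0 mul0r.
Qed.

End rh_limits.

(** * Absolute value, positive part and vanishing gradients *)

Section lattice.
Context {R : realType} {n : nat}.
Variables (Omega : set 'rV[R]_n.+1) (M : R) (M0 : 0 < M) (OM : Omega `<=` cube 0 M).
Local Notation test := (test_function Omega).
Local Notation mu := (lam n.+1).
Local Notation I := (rint mu).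
Local Notation L2 := (L2 mu).
Local Notation H10 := (H10 Omega).
Implicit Types (phi psi f g u v : 'rV[R]_n.+1 -> R) (i : 'I_n.+1).
Implicit Types (G H : 'I_n.+1 -> 'rV[R]_n.+1 -> R).

Lemma test_rh_scale c phi : test phi -> smooth (fun x => rh (c * phi x)).
Proof.
move=> tp; apply: (smooth_rh (f := fun x => c * phi x)).
exact: (test_smooth (testZ c tp)).
Qed.

Lemma test_vfun c phi : test phi -> test (vfun c \o phi).
Proof. by move=> tp; exact: (testMr tp (test_rh_scale c tp)). Qed.

Lemma test_afun c phi : test phi -> test (afun c \o phi).
Proof.
move=> tp; apply: (testMr tp (psi := fun x => c * phi x * rh (c * phi x))).
exact: (smoothM (test_smooth (testZ c tp)) (test_rh_scale c tp)).
Qed.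

Lemma H10_vfun c u G : H10 u G -> H10 (vfun c \o u) (fun i x => vfun' c (u x) * G i x).
Proof.
apply: (H10_comp M0 OM (is_derive_vfun c) (vfun'_le1 c) (@continuous_vfun' _ c)) => [|phi].
  by rewrite /vfun mul0r.
exact: test_vfun.
Qed.

Lemma H10_afun c u G : H10 u G -> H10 (afun c \o u) (fun i x => afun' c (u x) * G i x).
Proof.
apply: (H10_comp M0 OM (is_derive_afun c) (afun'_le c) (@continuous_afun' _ c)) => [|phi].
  by rewrite /afun mul0r.
exact: test_afun.
Qed.

Lemma measurable_eq0 u : measurable_fun setT u -> measurable_fun setT (fun x => ind (u x == 0) : R).
Proof.
move=> mu_; rewrite (_ : (fun x => _) = \1_(u @^-1` [set 0])).
  apply: measurable_indic; rewrite -[X in measurable X]setTI; exact: mu_.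
by apply/funext => x; rewrite indicE; congr (ind _); apply/eqP/idP; rewrite inE.
Qed.

Lemma measurable_pos u : measurable_fun setT u -> measurable_fun setT (fun x => ind (0 < u x) : R).
Proof.
move=> mu_; rewrite (_ : (fun x => _) = \1_(u @^-1` `]0, +oo[%classic)).
  apply: measurable_indic; rewrite -[X in measurable X]setTI; apply: mu_ => //.
by apply/funext => x; rewrite indicE; congr (ind _); apply/idP/idP; rewrite inE/= in_itv/= andbT.
Qed.

(** As c tends to infinity, [vfun c \o u] tends to 0 and its gradient to [1_{u = 0} G]; so this
    limit is a gradient of the zero function and vanishes by [H10_0]. *)
Lemma H10_grad0 u G i : H10 u G -> {ae mu, forall x, u x = 0 -> G i x = 0}.
Proof.
move=> uG; have Lu := H10_L2 uG; have LG j := H10_L2g j uG.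
have mG j : measurable_fun setT (fun x => ind (u x == 0) * G j x).
  by apply: measurable_funM; [exact: measurable_eq0 (L2_meas Lu)|exact: L2_meas (LG j)].
have H : H10 (fun=> 0) (fun i x => ind (u x == 0) * G i x).
  apply: (H10_dct M0 OM (fun k => H10_vfun k.+1%:R uG) (measurable_cst _) mG Lu LG).
  - by apply: aeW => x k; exact: vfun_le.
  - by move=> j; apply: aeW => x k; rewrite normrM ler_piMl// vfun'_le1.
  - apply: aeW => x; apply: norm_cvg0.
    apply: (squeeze_cvgr _ (cvg_cst 0) (@cvg_harmonic R)); apply: nearW => k.
    by rewrite normr_ge0/= vfun_le_inv.
  - move=> j; apply: aeW => x; apply: cvgM; last exact: cvg_cst.
    have [->|u0] := eqVneq (u x) 0.
      rewrite (_ : (fun k => _) = fun=> ind true); first exact: cvg_cst.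
      by apply/funext => k; rewrite /vfun' mulr0 rh0 expr1n.
    rewrite (_ : ind false = 0 * (0 * 0)); last by rewrite mul0r.
    by apply: cvgM; [|apply: cvgM]; exact: rh_cvg0.
have := H10_0 M0 OM i H; apply: filterS => x /= Hx u0; move: Hx.
by rewrite u0 eqxx /ind mul1r.
Qed.

Lemma measurable_sg u : measurable_fun setT u -> measurable_fun setT (fun x => Num.sg (u x)).
Proof.
move=> mu_; rewrite (_ : (fun x => _) = (fun x => ind (0 < u x) - ind (0 < - u x))).
  apply: measurable_funB; first exact: measurable_pos mu_.
  by apply: (measurable_pos (u := fun x => - u x)); exact: measurableT_comp.
by apply/funext => x; rewrite oppr_gt0 /ind; case: sgrP => ?; rewrite ?subr0 ?sub0r ?subrr.
Qed.

Lemma H10_abs u G : H10 u G -> H10 (fun x => `|u x|) (fun i x => Num.sg (u x) * G i x).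
Proof.
move=> uG; have Lu := H10_L2 uG; have LG j := H10_L2g j uG.
have msg := measurable_sg (L2_meas Lu).
have mG j : measurable_fun setT (fun x => Num.sg (u x) * G j x).
  by apply: measurable_funM => //; exact: L2_meas (LG j).
apply: (H10_dct M0 OM (fun k => H10_afun k.+1%:R uG) _ mG Lu (fun i => L2Z 3 (LG i))).
- by apply: measurableT_comp => //; exact: L2_meas Lu.
- by apply: aeW => x k; exact: afun_le.
- by move=> j; apply: aeW => x k; rewrite !normrM ler_wpM2r// (ger0_norm (ler0n _ 3)) afun'_le.
- apply: aeW => x; rewrite normrEsg mulrC; apply: cvgM; first exact: cvg_cst.
  exact: rh_mul_cvg.
- move=> j; apply: aeW => x; apply: cvgM; last exact: cvg_cst.
  rewrite (_ : Num.sg (u x) = 2 * Num.sg (u x) - Num.sg (u x) * (Num.sg (u x) * Num.sg (u x))); last first.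
    by case: sgrP => _; lra.
  have c := @rh_mul_cvg R (u x).
  by apply: cvgB; [apply: cvgM => //; exact: cvg_cst|apply: cvgM => //; exact: cvgM].
Qed.

(** u^+ is half of u + |u|. The gradients of the two expressions agree off {u = 0} by inspection,
    and on {u = 0} by [H10_grad0]. *)
Lemma H10_pos u G : H10 u G ->
  H10 (fun x => Num.max (u x) 0) (fun i x => ind (0 < u x) * G i x).
Proof.
move=> uG; have Lu := H10_L2 uG; have LG j := H10_L2g j uG.
have H := H10Z M0 OM 2^-1 (H10D M0 OM uG (H10_abs uG)).
apply: (H10_ae M0 OM H).
- by apply: measurable_maxr => //; exact: L2_meas Lu.
- by move=> i; apply: measurable_funM; [exact: measurable_pos (L2_meas Lu)|exact: L2_meas (LG i)].
- by apply: aeW => x; case: (ltrgt0P (u x)) => h; lra.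
- move=> i; apply: filterS (H10_grad0 i uG) => x Hx.
  have [h|h|h] := ltrgt0P (u x).
    + by rewrite gtr0_sg// /ind mul1r; lra.
    + by rewrite ltr0_sg// /ind mul0r; lra.
    + by rewrite Hx// !mulr0 addr0 mulr0.
Qed.

(** A single direction suffices: the L^1 inequality makes the approximations tend to 0 in L^1, while
    they tend to [u] in L^2. *)
Lemma H10_poincare u G i : H10 u G -> {ae mu, forall x, G i x = 0} -> {ae mu, forall x, u x = 0}.
Proof.
move=> uG G0; have [phi_ [tp ek cu _]] := H10_seq M0 OM uG; have [su sG] := H10_seq_sqd ek.
have Lc : L2 (cutoff M) := L2_cutoff M0; have LG := H10_L2g i uG; have Lu := H10_L2 uG.
have Lp k := test_L2 M0 OM (tp k); have Lg k := grad_L2 M0 OM i (tp k).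
have cA : I (fun x => `|grad (phi_ k) i x|) @[k --> \oo] --> 0.
  apply: sqr_cvg0.
  have c' : sqd (G i) (grad (phi_ k) i) * I (fun x => cutoff M x ^+ 2) @[k --> \oo] --> 0.
    by rewrite -(mul0r (I (fun x => cutoff M x ^+ 2))); apply: cvgM => //; exact: cvg_cst.
  apply: (squeeze_cvgr _ (cvg_cst 0) c'); apply: nearW => k; rewrite sqr_ge0/=.
  have LD : L2 (fun x => `|G i x - grad (phi_ k) i x|).
    have LB := L2B LG (Lg k).
    by apply: (L2_dom _ LB); [apply: measurableT_comp => //; exact: L2_meas LB|apply: aeW => x; rewrite normr_id].
  apply: le_trans (_ : (I (fun x => `|G i x - grad (phi_ k) i x| * cutoff M x)) ^+ 2 <= _); last first.
    apply: (le_trans (CS LD Lc)); rewrite le_eqVlt; apply/orP; left; apply/eqP; congr (_ * _).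
    by congr rint; apply/funext => x; rewrite real_normK ?num_real.
  rewrite le_eqVlt; apply/orP; left; apply/eqP; congr (_ ^+ 2); apply: ae_eq_I.
  - by apply: measurableT_comp => //; exact: L2_meas (Lg k).
  - by apply: measurable_funM; [exact: L2_meas LD|exact: L2_meas Lc].
  - apply: filterS G0 => x ->; rewrite sub0r normrN.
    have [Ox|Ox] := pselect (Omega x); first by rewrite (cutoffE OM Ox) mulr1.
    by rewrite /grad (test_out (test_partial i (tp k)) Ox) normr0 mul0r.
have cB : I (fun x => `|phi_ k x|) @[k --> \oo] --> 0.
  have c' : 2 * M * I (fun x => `|grad (phi_ k) i x|) @[k --> \oo] --> 0.
    by rewrite -(mulr0 (2 * M)); apply: cvgM => //; exact: cvg_cst.
  apply: (squeeze_cvgr _ (cvg_cst 0) c'); apply: nearW => k; rewrite I_ge0//=.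
  exact: (test_poincare M0 OM i (tp k)).
(* A bounded L^2 multiplier with u g = |u| on [Omega]: boundedness allows the L^1 limit, square
   integrability the L^2 limit. *)
pose g x := Num.sg (u x) * cutoff M x.
have mg : measurable_fun setT g.
  by apply: measurable_funM; [exact: measurable_sg (L2_meas Lu)|exact: L2_meas Lc].
have sg1 x : `|Num.sg (u x)| <= 1 by case: sgrP; rewrite ?normr0 ?normr1 ?normrN1.
have c01 (x : 'rV[R]_n.+1) : 0 <= cutoff M x <= 1.
  by rewrite /cutoff indicE; case: (_ \in _); rewrite ?lexx ?ler01.
have g1 x : `|g x| <= 1.
  by have /andP[c0 c1] := c01 x; rewrite normrM (ger0_norm c0) mulr_ile1.
have Lg' : L2 g.
  apply: (L2_dom mg Lc); apply: aeW => x.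
  by rewrite normrM ler_piMl.
have c1 := I_mul_cvg Lp Lu Lg' su.
have c2 : I (fun x => phi_ k x * g x) @[k --> \oo] --> 0.
  apply: norm_cvg0; apply: (squeeze_cvgr _ (cvg_cst 0) cB); apply: nearW => k.
  have Ik := L2_mul (Lp k) Lg'.
  rewrite normr_ge0/=; apply: (le_trans (ler_norm_I Ik)); apply: le_I; [exact: IntAbs Ik|exact: IntAbs (test_Int M0 OM (tp k))|].
  by move=> x; rewrite normrM ler_piMr.
have E : I (fun x => u x * g x) = 0 by exact: (cvg_unique (@Rhausdorff R) c1 c2).
have pE x : u x * g x = `|u x| * cutoff M x by rewrite /g mulrA [u x * _]mulrC -normrEsg.
have Z : {ae mu, forall x, u x * g x = 0}.
  apply: I_eq0; [exact: L2_mul|apply: aeW => x|by rewrite E].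
  by have /andP[c0 _] := c01 x; rewrite pE mulr_ge0.
apply: filterS2 Z (H10_out M0 OM uG) => x zx ox.
have [Ox|/ox//] := pselect (Omega x).
by move: zx; rewrite pE (cutoffE OM Ox) mulr1 => /eqP; rewrite normr_eq0 => /eqP.
Qed.

End lattice.

Lemma ae_fin_forall (R : realType) n k (P : 'I_k -> 'rV[R]_n -> Prop) :
  (forall i, {ae lam n, forall x, P i x}) -> {ae lam n, forall x, forall i, P i x}.
Proof.
move=> HP; have : {ae lam n, forall x, forall m : nat, forall mk : (m < k)%N, P (Ordinal mk) x}.
  apply: ae_foralln => m; have [mk|mk] := pselect (m < k)%N; last first.
    by apply: aeW => x mk'; case: (mk mk').
  apply: filterS (HP (Ordinal mk)) => x Px mk'.
  by rewrite (_ : Ordinal mk' = Ordinal mk)//; exact: val_inj.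
by apply: filterS => x Px [m mk]; exact: Px.
Qed.

Lemma ae_conj d (T : measurableType d) (R : realType) (mu : {measure set T -> \bar R})
    (P Q : T -> Prop) :
  {ae mu, forall x, P x} -> {ae mu, forall x, Q x} -> {ae mu, forall x, P x /\ Q x}.
Proof. by move=> HP HQ; apply: filterS2 HP HQ. Qed.

Lemma Fatou_I d (T : measurableType d) (R : realType) (mu : {measure set T -> \bar R})
    (f_ : nat -> T -> R) (f : T -> R) (c : R) : (forall k, rintegrable mu (f_ k)) -> (forall k x, 0 <= f_ k x) ->
  measurable_fun setT f -> {ae mu, forall x, f_ k x @[k --> \oo] --> f x} ->
  (forall k, rint mu (f_ k) <= c) -> rintegrable mu f /\ rint mu f <= c.
Proof.
move=> If f0 mf ff fc.
have mfk k : measurable_fun setT (EFin \o f_ k) by exact: measurable_int (If k).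
have ml : measurable_fun setT (fun x => limn_einf ((fun k => (f_ k x)%:E))).
  rewrite (_ : (fun x => _) = (fun x => - limn_esup (fun k => - (f_ k x)%:E))%E).
    apply: measurableT_comp => //; apply: measurable_fun_limn_esup => k.
    exact: (measurableT_comp (@oppe_measurable R setT) (mfk k)).
  apply/funext => x; have := @limn_esupN R (fun k => (f_ k x)%:E); rewrite /comp => ->.
  by rewrite oppeK.
have ffx : {ae mu, forall x, setT x -> limn_einf ((fun k => (f_ k x)%:E)) = (`|f x|)%:E}.
  apply: filterS ff => x fx _.
  have fx0 : 0 <= f x.
    rewrite -(cvg_lim (@Rhausdorff R) fx); apply: limr_ge; first exact: cvgP fx.
    exact: nearW.
  rewrite ger0_norm//; have : (f_ k x)%:E @[k --> \oo] --> (f x)%:E.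
    by apply: cvg_EFin => //; exact: nearW.
  by move=> /cvg_limn_einf_sup[].
have mabs : measurable_fun setT (fun x => (`|f x|)%:E) by apply/measurable_EFinP/measurableT_comp.
have le_c : (\int[mu]_x (`|f x|)%:E <= c%:E)%E.
  rewrite -(@ae_eq_integral _ _ _ mu _ _ _ measurableT ml mabs ffx).
  have := @fatou _ _ _ mu setT measurableT (fun k x => (f_ k x)%:E) mfk.
  move=> Ft; apply: le_trans (Ft _) _.
  - by move=> k x _; rewrite lee_fin.
  - rewrite limn_einf_lim; apply: lime_le; first exact: is_cvg_einfs.
    apply: nearW => k; apply: (@le_trans _ _ (\int[mu]_x (f_ k x)%:E)%E).
      by apply: ereal_inf_lbound; exists k => /=.
    by rewrite (IE (If k)) lee_fin.
have IIf : rintegrable mu f.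
  apply/integrableP; split; first exact/measurable_EFinP.
  by apply: le_lt_trans le_c _; exact: ltry.
split => //; apply: le_trans (_ : rint mu (fun x => `|f x|) <= _).
  by apply: le_I; [exact: IIf|exact: IntAbs|move=> x; exact: ler_norm].
by rewrite -lee_fin -(IE (IntAbs IIf)).
Qed.

(** * Solutions and supersolutions *)

Section energy.
Context {R : realType} {n : nat}.
Variables (Omega : set 'rV[R]_n.+1) (M : R) (M0 : 0 < M) (OM : Omega `<=` cube 0 M).
Variables (q : 'rV[R]_n.+1 -> R) (mq : measurable_fun setT q) (q0 : forall x, 0 <= q x).
Local Notation test := (test_function Omega).
Local Notation mu := (lam n.+1).
Local Notation Int := (rintegrable mu).
Local Notation I := (rint mu).
Local Notation L2 := (L2 mu).
Local Notation H10 := (H10 Omega).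
Local Notation fn := ('rV[R]_n.+1 -> R).
Local Notation vf := ('I_n.+1 -> 'rV[R]_n.+1 -> R).
Implicit Types (phi psi f g u v w p : fn) (i : 'I_n.+1) (G H K P : vf).

Definition subf u v : fn := fun x => u x - v x.
Definition subg G H : vf := fun i x => G i x - H i x.
Definition scf (c : R) u : fn := fun x => c * u x.
Definition scg (c : R) G : vf := fun i x => c * G i x.
Definition posf u : fn := fun x => Num.max (u x) 0.
Definition posg u G : vf := fun i x => ind (0 < u x) * G i x.

Definition Bd u := exists B, {ae mu, forall x, `|u x| <= B}.
Definition HB u H := H10 u H /\ Bd u.
Definition adm w G := [/\ H10 w G, Bd w & Int (fun x => q x * w x)].
(** The bilinear form of - Laplacian + q. The arguments play different roles: [q w] is integrable
    for an admissible [w], so the second argument need only be bounded. *)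
Definition energy w G u H :=
  \sum_i I (fun x => G i x * H i x) + I (fun x => q x * w x * u x).

Local Notation E := energy.

Lemma posf_ge0 u x : 0 <= posf u x.
Proof. by rewrite /posf le_max lexx orbT. Qed.

Lemma posf_le u x : `|posf u x| <= `|u x|.
Proof. by rewrite /posf; case: (leP (u x) 0) => h; rewrite ?normr0. Qed.

Lemma Bd_le u v : {ae mu, forall x, `|u x| <= `|v x|} -> Bd v -> Bd u.
Proof. by move=> uv [B vB]; exists B; apply: filterS2 uv vB => x; exact: le_trans. Qed.

Lemma BdB u v : Bd u -> Bd v -> Bd (subf u v).
Proof.
move=> [B uB] [C vC]; exists (B + C); apply: filterS2 uB vC => x ux vx.
by rewrite (le_trans (ler_normB _ _))// lerD.
Qed.

Lemma BdZ c u : Bd u -> Bd (scf c u).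
Proof. by move=> [B uB]; exists (`|c| * B); apply: filterS uB => x ux; rewrite normrM ler_wpM2l. Qed.

Lemma Bd_pos u : Bd u -> Bd (posf u).
Proof. by apply: Bd_le; apply: aeW => x; exact: posf_le. Qed.

Lemma HB_sub u G v H : HB u G -> HB v H -> HB (subf u v) (subg G H).
Proof. by move=> [uG bu] [vH bv]; split; [exact (H10B M0 OM uG vH)|exact: BdB]. Qed.

Lemma HB_sc c u G : HB u G -> HB (scf c u) (scg c G).
Proof. by move=> [uG bu]; split; [exact (H10Z M0 OM c uG)|exact: BdZ]. Qed.

Lemma HB_pos u G : HB u G -> HB (posf u) (posg u G).
Proof. by move=> [uG bu]; split; [exact (H10_pos M0 OM uG)|exact: Bd_pos]. Qed.

Lemma HB_test phi : test phi -> HB phi (grad phi).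
Proof.
move=> tp; split; first exact: (H10_test M0 OM tp).
by have [B HB] := test_bounded tp; exists B; apply: aeW.
Qed.

Lemma adm_HB w G : adm w G -> HB w G. Proof. by case. Qed.
Lemma HB_meas u G : HB u G -> measurable_fun setT u.
Proof. by case=> uG _; exact: H10_meas uG. Qed.
Lemma HB_L2g u G i : HB u G -> L2 (G i).
Proof. by case=> uG _; exact: H10_L2g uG. Qed.

Lemma adm_sub u G v H : adm u G -> adm v H -> adm (subf u v) (subg G H).
Proof.
move=> [uG bu iu] [vH bv iv]; have [H1 H2] := HB_sub (conj uG bu) (conj vH bv).
split => //; have := IntB iu iv; congr rintegrable; apply/funext => x.
by rewrite /subf mulrBr.
Qed.

Lemma adm_le u G w K : adm w K -> HB u G -> {ae mu, forall x, `|u x| <= `|w x|} -> adm u G.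
Proof.
move=> [wK bw iw] uG uw; have [H1 H2] := uG; split => //.
apply: (Int_dom _ (IntAbs iw)); first by apply: measurable_funM => //; exact: HB_meas uG.
by apply: filterS uw => x ux; rewrite !normrM ler_wpM2l.
Qed.

Lemma adm_pos u G : adm u G -> adm (posf u) (posg u G).
Proof.
move=> au; apply: (adm_le au (HB_pos (adm_HB au))).
by apply: aeW => x; exact: posf_le.
Qed.

Lemma adm_sc c u G : adm u G -> adm (scf c u) (scg c G).
Proof.
move=> [uG bu iu]; have [H1 H2] := HB_sc c (conj uG bu).
split => //; have := IntZ c iu; congr rintegrable; apply/funext => x.
by rewrite /scf mulrCA.
Qed.

Lemma ind2 b : ind b * ind b = ind b :> R.
Proof. by case: b; rewrite /ind ?mulr1 ?mulr0. Qed.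

Lemma posfE u x : posf u x = ind (0 < u x) * u x.
Proof. by rewrite /posf /ind; case: (leP (u x) 0); rewrite ?mul0r ?mul1r. Qed.

Lemma posf_mul u x : posf u x * posf u x = u x * posf u x.
Proof. by rewrite posfE mulrACA ind2 mulrCA. Qed.

Lemma Int_mul_Bd f u : Int f -> measurable_fun setT u -> Bd u -> Int (fun x => f x * u x).
Proof.
move=> If mu_ [B uB]; apply: (Int_dom _ (IntZ B (IntAbs If))).
  by apply: measurable_funM => //; exact: Int_meas If.
by apply: filterS uB => x ux; rewrite normrM mulrC ler_wpM2r.
Qed.

Lemma qInt w G u H : adm w G -> HB u H -> Int (fun x => q x * w x * u x).
Proof. by move=> [_ _ iw] uH; apply: Int_mul_Bd => //; [exact: HB_meas uH|case: uH]. Qed.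

Lemma gInt w G u H i : HB w G -> HB u H -> Int (fun x => G i x * H i x).
Proof. by move=> wG uH; apply: L2_mul; [exact: HB_L2g wG|exact: HB_L2g uH]. Qed.

Lemma E_subr w G u H v K : adm w G -> HB u H -> HB v K ->
  E w G (subf u v) (subg H K) = E w G u H - E w G v K.
Proof.
move=> aw uH vK; have wG := adm_HB aw; rewrite /energy opprD addrACA -sumrB; congr (_ + _).
  apply: eq_bigr => i _; rewrite -IB; [|exact: gInt wG uH|exact: gInt wG vK].
  by congr rint; apply/funext => x; rewrite /subg mulrBr.
rewrite -IB; [|exact: qInt aw uH|exact: qInt aw vK].
by congr rint; apply/funext => x; rewrite /subf mulrBr.
Qed.

Lemma E_subl w G v K u H : adm w G -> adm v K -> HB u H ->
  E (subf w v) (subg G K) u H = E w G u H - E v K u H.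
Proof.
move=> aw av uH; have wG := adm_HB aw; have vK := adm_HB av.
rewrite /energy opprD addrACA -sumrB; congr (_ + _).
  apply: eq_bigr => i _; rewrite -IB; [|exact: gInt wG uH|exact: gInt vK uH].
  by congr rint; apply/funext => x; rewrite /subg mulrBl.
rewrite -IB; [|exact: qInt aw uH|exact: qInt av uH].
by congr rint; apply/funext => x; rewrite /subf mulrBr mulrBl.
Qed.

Lemma E_scr c w G u H : adm w G -> HB u H -> E w G (scf c u) (scg c H) = c * E w G u H.
Proof.
move=> aw uH; have wG := adm_HB aw; rewrite /energy mulrDr mulr_sumr; congr (_ + _).
  apply: eq_bigr => i _; rewrite -IZ; last exact: gInt wG uH.
  by congr rint; apply/funext => x; rewrite /scg mulrCA.
rewrite -IZ; last exact: qInt aw uH.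
by congr rint; apply/funext => x; rewrite /scf mulrCA.
Qed.

Lemma E_sym w G u H : E w G u H = E u H w G.
Proof.
rewrite /energy; congr (_ + _); last by congr rint; apply/funext => x; rewrite mulrAC.
by apply: eq_bigr => i _; congr rint; apply/funext => x; rewrite mulrC.
Qed.

Lemma E_scl c w G u H : adm w G -> HB u H -> E (scf c w) (scg c G) u H = c * E w G u H.
Proof.
move=> aw uH; have wG := adm_HB aw; rewrite /energy mulrDr mulr_sumr; congr (_ + _).
  apply: eq_bigr => i _; rewrite -IZ; last exact: gInt wG uH.
  by congr rint; apply/funext => x; rewrite /scg mulrA.
rewrite -IZ; last exact: qInt aw uH.
by congr rint; apply/funext => x; rewrite /scf mulrA (mulrA c) mulrCA !mulrA.
Qed.

Lemma E_congr w G u H w' G' u' H' : adm w G -> HB u H -> adm w' G' -> HB u' H' ->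
  (forall i, {ae mu, forall x, G i x * H i x = G' i x * H' i x}) ->
  {ae mu, forall x, w x * u x = w' x * u' x} -> E w G u H = E w' G' u' H'.
Proof.
move=> aw uH aw' uH' g1 g2; have wG := adm_HB aw; have wG' := adm_HB aw'.
rewrite /energy; congr (_ + _).
  apply: eq_bigr => i _; apply: ae_eq_I (g1 i).
    exact: Int_meas (gInt i wG uH).
  exact: Int_meas (gInt i wG' uH').
apply: ae_eq_I; [exact: Int_meas (qInt aw uH)|exact: Int_meas (qInt aw' uH')|].
by apply: filterS g2 => x; rewrite -!mulrA => ->.
Qed.

Lemma E_self_ge_grad w G i : adm w G -> I (fun x => G i x ^+ 2) <= E w G w G.
Proof.
move=> aw; have wG := adm_HB aw.
have s0 j : 0 <= I (fun x => G j x * G j x) by apply: I_ge0 => x; rewrite -expr2 sqr_ge0.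
rewrite /energy (bigD1 i)//= -addrA -[leLHS]addr0; apply: lerD.
  by rewrite le_eqVlt; apply/orP; left; apply/eqP; congr rint; apply/funext => x; rewrite expr2.
rewrite addr_ge0 ?sumr_ge0//.
by apply: I_ge0 => x; rewrite -mulrA mulr_ge0// -expr2 sqr_ge0.
Qed.

Definition data f := [/\ measurable_fun setT f, Bd f & forall x, ~ Omega x -> f x = 0].

Lemma data_Int f : data f -> Int f.
Proof.
move=> [mf [B fB] f0].
have [_ Ic2] : L2 (cutoff M : fn) := L2_cutoff M0.
apply: (Int_dom mf (IntZ `|B| Ic2)); apply: filterS fB => x fx.
have [Ox|Ox] := pselect (Omega x).
  by rewrite (cutoffE OM Ox) expr1n mulr1 (le_trans fx)// ler_norm.
by rewrite f0// normr0 mulr_ge0// sqr_ge0.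
Qed.

Definition Sol w G f := [/\ adm w G, data f &
  forall phi, test phi -> E w G phi (grad phi) = I (fun x => f x * phi x)].

(** Extends the equation from test functions to bounded elements of [H10]. The approximations of [u]
    need not be uniformly bounded, so the potential term does not pass to the limit directly;
    truncation by [vfun c] supplies the bound. *)
Lemma Sol_test w G f u H : Sol w G f -> HB u H -> E w G u H = I (fun x => f x * u x).
Proof.
move=> [aw df Ew] uH; have If := data_Int df; have [uH10 [B uB]] := uH.
have wG := adm_HB aw; have [wG10 bw Iqw] := aw; have mu_ := HB_meas uH.
(* With [c] fixed all truncations are bounded by 1/c, which dominates the potential and data
   terms. *)
have step1 c : 0 < c -> E w G (vfun c \o u) (fun i x => vfun' c (u x) * H i x) =
    I (fun x => f x * vfun c (u x)).
  move=> c0; have [phi_ [tp ek cu cG]] := H10_seq M0 OM uH10; have [su sG] := H10_seq_sqd ek.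
  have vf0 : vfun c 0 = 0 by rewrite /vfun mul0r.
  have [LF LFG cF cFG] := H10_comp_cvg M0 OM (is_derive_vfun c) (vfun'_le1 c)
    (@continuous_vfun' _ c) vf0 (@test_vfun _ _ Omega c) uH10 tp cu su sG.
  have tF k : test (vfun c \o phi_ k) by exact: test_vfun.
  have mF k : measurable_fun setT (vfun c \o phi_ k) by exact: test_measurable (tF k).
  have cae : {ae mu, forall x, vfun c (phi_ k x) @[k --> \oo] --> vfun c (u x)}.
    apply: filterS cu => x cx; apply: (cvg_comp _ _ cx).
    by apply/differentiable_continuous/derivable1_diffP; have [] := is_derive_vfun c (u x).
  have dct h : Int h -> I (fun x => h x * vfun c (phi_ k x)) @[k --> \oo] -->
      I (fun x => h x * vfun c (u x)).
    move=> Ih; have mh := Int_meas Ih.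
    have [|||||_ cX] := @DCT _ _ _ mu (fun k x => h x * vfun c (phi_ k x))
      (fun x => h x * vfun c (u x)) (fun x => c^-1 * `|h x|); last exact: cX.
    - by move=> k; apply: measurable_funM; [exact: mh|exact: mF].
    - by apply: measurable_funM => //; exact: L2_meas LF.
    - exact: IntZ (IntAbs Ih).
    - by apply: aeW => x k; rewrite normrM mulrC ler_wpM2r// vfun_le_inv.
    - by apply: filterS cae => x cx; apply: cvgM => //; exact: cvg_cst.
  have c1 : E w G (vfun c \o phi_ k) (grad (vfun c \o phi_ k)) @[k --> \oo] -->
      E w G (vfun c \o u) (fun i x => vfun' c (u x) * H i x).
    apply: cvgD; last exact: dct.
    apply: (@cvg_fin_sum _ _ (fun k i => I (fun x => G i x * grad (vfun c \o phi_ k) i x))) => i.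
    have := I_mul_cvg (fun k => grad_L2 M0 OM i (tF k)) (LFG i) (HB_L2g i wG) (cFG i).
    rewrite (_ : (fun k => I _) = (fun k => I (fun x => G i x * grad (vfun c \o phi_ k) i x))).
      rewrite (_ : (fun x => _ * G i x) = (fun x => G i x * (vfun' c (u x) * H i x)))//.
      by apply/funext => x; rewrite mulrC.
    by apply/funext => k; congr rint; apply/funext => x; rewrite mulrC.
  have c2 := dct f If.
  rewrite (_ : (fun k => _) = (fun k => I (fun x => f x * vfun c (phi_ k x)))) in c1; last first.
    by apply/funext => k; exact: Ew.
  exact: (cvg_unique (@Rhausdorff R) c1 c2).
(* Now c = 1/(k+1) tends to 0 and the truncation tends to the identity; the bound on [u] itself
   dominates. *)
have cv t : vfun k.+1%:R^-1 t @[k --> \oo] --> t /\ vfun' k.+1%:R^-1 t @[k --> \oo] --> (1 : R).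
  have c1 : rh (k.+1%:R^-1 * t) @[k --> \oo] --> (1 : R).
    have c0 : k.+1%:R^-1 * t @[k --> \oo] --> (0 : R).
      by rewrite -(mul0r t); apply: cvgM; [exact: cvg_harmonic|exact: cvg_cst].
    by have := cvg_comp _ _ c0 (@continuous_rh R 0); rewrite rh0.
  split; first by rewrite -[X in _ --> X]mulr1; apply: cvgM => //; exact: cvg_cst.
  have h : rh (k.+1%:R^-1 * t) * (rh (k.+1%:R^-1 * t) * rh (k.+1%:R^-1 * t))
      @[k --> \oo] --> (1 : R) * (1 * 1) by apply: cvgM => //; exact: cvgM.
  by rewrite !mulr1 in h.
have mv c : measurable_fun setT (vfun c \o u) by exact: H10_meas (H10_vfun M0 OM c uH10).
have dct h : Int h -> I (fun x => h x * vfun k.+1%:R^-1 (u x)) @[k --> \oo] -->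
    I (fun x => h x * u x).
  move=> Ih; have mh := Int_meas Ih.
  have [|||||_ cX] := @DCT _ _ _ mu (fun k x => h x * vfun k.+1%:R^-1 (u x))
      (fun x => h x * u x) (fun x => B * `|h x|); last exact: cX.
  - by move=> k; apply: measurable_funM => //; exact: mv.
  - exact: measurable_funM.
  - exact: IntZ (IntAbs Ih).
  - apply: filterS uB => x ux k; rewrite normrM mulrC ler_wpM2r//.
    exact: le_trans (vfun_le _ _) ux.
  - by apply: aeW => x; apply: cvgM; [exact: cvg_cst|exact: (cv (u x)).1].
have c1 : E w G (vfun k.+1%:R^-1 \o u) (fun i x => vfun' k.+1%:R^-1 (u x) * H i x)
    @[k --> \oo] --> E w G u H.
  apply: cvgD; last exact: dct.
  apply: (@cvg_fin_sum _ _ (fun k i => I (fun x => G i x * (vfun' k.+1%:R^-1 (u x) * H i x)))) => i.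
  have Ii := gInt i wG uH.
  have mHi c : measurable_fun setT (fun x => vfun' c (u x) * H i x).
    exact: L2_meas (H10_L2g i (H10_vfun M0 OM c uH10)).
  have [|||||_ cX] := @DCT _ _ _ mu (fun k x => G i x * (vfun' k.+1%:R^-1 (u x) * H i x))
      (fun x => G i x * H i x) (fun x => `|G i x * H i x|); last exact: cX.
  - by move=> k; apply: measurable_funM => //; exact: L2_meas (HB_L2g i wG).
  - exact: Int_meas Ii.
  - exact: IntAbs Ii.
  - by apply: aeW => x k; rewrite mulrCA normrM ler_piMl// vfun'_le1.
  - apply: aeW => x; apply: cvgM; first exact: cvg_cst.
    rewrite -[X in _ --> X]mul1r; apply: cvgM; last exact: cvg_cst.
    exact: (cv (u x)).2.
have c2 := dct f If.
rewrite (_ : (fun k => _) = (fun k => I (fun x => f x * vfun k.+1%:R^-1 (u x)))) in c1; last first.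
  by apply/funext => k; apply: step1; rewrite invr_gt0.
exact: (cvg_unique (@Rhausdorff R) c1 c2).
Qed.

Lemma Sol_data_Int w G f u H : Sol w G f -> HB u H -> Int (fun x => f x * u x).
Proof.
move=> [_ df _] uH; apply: Int_mul_Bd; [exact: data_Int|exact: HB_meas uH|by case: uH].
Qed.

(** Testing with the negative part u of w gives E(u, u) = - E(w, u) <= 0, so the gradient of u
    vanishes, and Poincare gives u = 0. *)
Lemma max_principle w G f : Sol w G f -> {ae mu, forall x, 0 <= f x} ->
  {ae mu, forall x, 0 <= w x}.
Proof.
move=> S f0; have [aw df _] := S.
have wG := adm_HB aw; pose u := posf (scf (-1) w); pose H := posg (scf (-1) w) (scg (-1) G).
have uH : HB u H by apply: HB_pos; exact: HB_sc.
have au : adm u H.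
  apply: (adm_le aw uH); apply: aeW => x; apply: (le_trans (posf_le _ _)).
  by rewrite /scf mulN1r normrN.
have as_ : adm (scf (-1) w) (scg (-1) G) by exact: adm_sc.
have EE : E u H u H = - E w G u H.
  rewrite -mulN1r [E w G u H]E_sym -(E_scr (-1) au wG).
  apply: (E_congr au uH au (adm_HB as_)) => [i|]; apply: aeW => x.
    by rewrite /H /posg mulrACA ind2 mulrA.
  by rewrite /u posf_mul mulrC.
have Eu : E u H u H <= 0.
  rewrite EE oppr_le0 (Sol_test S uH) -(I0 mu); apply: ae_le_I.
  - exact: Int0.
  - exact: Sol_data_Int S uH.
  - by apply: filterS f0 => x fx; rewrite mulr_ge0// posf_ge0.
have H0 : {ae mu, forall x, H ord0 x = 0}.
  have [_ IH2] := HB_L2g ord0 uH.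
  have : {ae mu, forall x, H ord0 x ^+ 2 = 0}.
    apply: I_eq0 => //; first by apply: aeW => x; exact: sqr_ge0.
    exact: le_trans (E_self_ge_grad ord0 au) Eu.
  by apply: filterS => x /eqP; rewrite sqrf_eq0 => /eqP.
have [uH10 _] := uH.
apply: filterS (H10_poincare M0 OM uH10 H0) => x.
rewrite /u /posf /scf mulN1r; case: (leP (- w x) 0) => h ux; first by rewrite -oppr_le0.
by move: h; rewrite ux ltxx.
Qed.

Definition core_f p phi k := posf (subf phi (scf k%:R p)).
Definition core_g p P phi (H : vf) k := posg (subf phi (scf k%:R p)) (subg H (scg k%:R P)).

Lemma core_HB p P phi H k : HB p P -> HB phi H -> HB (core_f p phi k) (core_g p P phi H k).
Proof. by move=> pP pH; apply: HB_pos; apply: HB_sub => //; exact: HB_sc. Qed.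

Lemma cvg_eventually0 (a : nat -> R) (m : nat) :
  (forall k, (m <= k)%N -> a k = 0) -> a k @[k --> \oo] --> 0.
Proof.
move=> H; apply: cvg_near_cst; exists m => // k /= Kk; exact: H.
Qed.

Lemma archi_le (a b : R) : 0 < a -> exists m : nat, forall k, (m <= k)%N -> b <= k%:R * a.
Proof.
move=> a0; exists (Num.truncn (b / a)).+1 => k Kk.
rewrite -ler_pdivrMr//; apply: le_trans (ltW (truncnS_gt _)) _.
by rewrite ler_nat.
Qed.

(* Testing with (phi - k p)^+ : the cross term  - k |grad p|^2  has a sign, and
   everything else concentrates on {p = 0}, where both p and its gradient vanish. *)
Lemma core p P phi H : adm p P -> HB phi H ->
  {ae mu, forall x, 0 <= p x} -> {ae mu, forall x, 0 <= phi x} ->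
  exists2 a : nat -> R, a k @[k --> \oo] --> 0 &
    forall k, E p P (core_f p phi k) (core_g p P phi H k) <= a k.
Proof.
move=> ap pH p0 ph0; have pP := adm_HB ap; have [pP10 _] := pP.
pose ik k x : R := ind (0 < phi x - k%:R * p x).
exists (fun k => \sum_i I (fun x => ik k x * (P i x * H i x)) +
   I (fun x => q x * p x * core_f p phi k x)).
  have mphi := HB_meas pH; have mp := HB_meas pP.
  have mik k : measurable_fun setT (ik k).
    by apply: (measurable_pos (u := fun x => phi x - k%:R * p x)); apply: measurable_funB => //; exact: measurable_funM.
  rewrite [X in _ --> X](_ : 0 = \sum_(i < n.+1) 0 + 0); last by rewrite big1 ?addr0.
  apply: cvgD.
    apply: (@cvg_fin_sum _ _ (fun k i => I (fun x => ik k x * (P i x * H i x)))) => i.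
    have Ii := gInt i pP pH.
    have [|||||_ cX] := @DCT _ _ _ mu (fun k x => ik k x * (P i x * H i x)) (fun=> 0)
      (fun x => `|P i x * H i x|); last by move: cX; rewrite I0.
    - by move=> k; apply: measurable_funM; [exact: mik|exact: Int_meas Ii].
    - by [].
    - exact: IntAbs Ii.
    - by apply: aeW => x k; rewrite normrM ler_piMl// /ik /ind; case: (_ < _); rewrite ?normr0 ?normr1.
    - apply: filterS2 p0 (H10_grad0 M0 OM i pP10) => x px gx.
      have [p_0|pN0] := eqVneq (p x) 0.
        by apply: (@cvg_eventually0 _ 0) => k _; rewrite gx// mul0r mulr0.
      have pp : 0 < p x by rewrite lt_neqAle eq_sym pN0.
      have [K HK] := archi_le (phi x) pp.
      apply: (@cvg_eventually0 _ K) => k /HK kp.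
      by rewrite /ik /ind ltNge subr_le0 kp mul0r.
  have [|||||_ cX] := @DCT _ _ _ mu (fun k x => q x * p x * core_f p phi k x) (fun=> 0)
      (fun x => `|q x * p x * phi x|); last by move: cX; rewrite I0.
  - by move=> k; exact: Int_meas (qInt ap (core_HB k pP pH)).
  - by [].
  - exact: IntAbs (qInt ap pH).
  - apply: filterS2 p0 ph0 => x px phx k; rewrite !normrM ler_wpM2l ?mulr_ge0//.
    rewrite ger0_norm ?posf_ge0// (ger0_norm phx) /core_f /posf ge_max phx andbT.
    by rewrite gerBl mulr_ge0.
  - apply: filterS2 p0 ph0 => x px phx.
    have [p_0|pN0] := eqVneq (p x) 0.
      by apply: (@cvg_eventually0 _ 0) => k _; rewrite p_0 mulr0 mul0r.
    have pp : 0 < p x by rewrite lt_neqAle eq_sym pN0.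
    have [K HK] := archi_le (phi x) pp.
    apply: (@cvg_eventually0 _ K) => k /HK kp.
    by rewrite /core_f /posf max_r ?mulr0// subr_le0.
move=> k; rewrite /energy lerD2r; apply: ler_sum => i _.
have cH := core_HB k pP pH.
have Lik : L2 (fun x => ik k x * H i x).
  have LH := HB_L2g i pH.
  apply: (L2_dom _ LH).
    apply: measurable_funM; last exact: L2_meas LH.
    apply: (measurable_pos (u := fun x => phi x - k%:R * p x)); apply: measurable_funB; first exact: HB_meas pH.
    by apply: measurable_funM => //; exact: HB_meas pP.
  by apply: aeW => x; rewrite normrM ler_piMl// /ik /ind; case: (_ < _); rewrite ?normr0 ?normr1.
have I2 : Int (fun x => ik k x * (P i x * H i x)).
  have := L2_mul (HB_L2g i pP) Lik.
  by congr rintegrable; apply/funext => x; rewrite mulrCA.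
apply: le_I; [exact: gInt pP cH|exact: I2|move=> x].
rewrite /core_g /posg /subf /subg /scf /scg -/(ik k x) -subr_ge0.
rewrite (_ : _ - _ = ik k x * (k%:R * P i x ^+ 2)); last by ring.
have i0 : 0 <= ik k x by rewrite /ik /ind ler0n.
by rewrite mulr_ge0// mulr_ge0 ?ler0n ?sqr_ge0.
Qed.

Definition Sup m K := adm m K /\
  forall phi H, HB phi H -> {ae mu, forall x, 0 <= phi x} -> 0 <= E m K phi H.

Lemma Sol_Sup w G f : Sol w G f -> {ae mu, forall x, 0 <= f x} -> Sup w G.
Proof.
move=> S f0; split; first by case: S.
move=> phi H pH ph0; rewrite (Sol_test S pH) -(I0 mu); apply: ae_le_I.
- exact: Int0.
- exact: Sol_data_Int S pH.
- by apply: filterS2 f0 ph0 => x fx px; rewrite mulr_ge0.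
Qed.

(** The minimum is written v - (v - w)^+ so that its gradient comes from that of the positive
    part. *)
Definition minf v w := subf v (posf (subf v w)).
Definition ming v w G H := subg G (posg (subf v w) (subg G H)).

Lemma minfE v w x : minf v w x = Num.min (v x) (w x).
Proof.
rewrite /minf /posf /subf; case: (leP (v x - w x) 0) => h.
  by rewrite subr0 min_l// -subr_le0.
by rewrite min_r; [rewrite subKr|rewrite -subr_ge0 ltW].
Qed.

Lemma core_f_le p phi k x : 0 <= p x -> 0 <= phi x -> 0 <= core_f p phi k x <= phi x.
Proof.
move=> px phx; rewrite posf_ge0/= /core_f /posf ge_max phx andbT.
by rewrite gerBl mulr_ge0.
Qed.

(** The remainder phi - (phi - k p)^+ and its gradient vanish where p does. Tested against it, a
    function matters only through its values on {p <> 0}. *)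
Lemma core_rest p P phi H k : HB p P -> HB phi H -> {ae mu, forall x, 0 <= phi x} ->
  {ae mu, forall x, p x = 0 -> subf phi (core_f p phi k) x = 0 /\
    forall i, subg H (core_g p P phi H k) i x = 0}.
Proof.
move=> [pP _] [pH _] ph0.
have gp : {ae mu, forall x, forall i, p x = 0 -> P i x = 0}.
  by apply: ae_fin_forall => i; exact: (H10_grad0 M0 OM i pP).
have gh : {ae mu, forall x, forall i, phi x = 0 -> H i x = 0}.
  by apply: ae_fin_forall => i; exact: (H10_grad0 M0 OM i pH).
apply: filterS3 ph0 gp gh => x phx gpx ghx px; split.
  by rewrite /subf /core_f /posf /subf /scf px mulr0 subr0 max_l ?subrr.
move=> i; rewrite /subg /core_g /posg /subf /subg /scf /scg px gpx// !mulr0 !subr0.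
have [ph_0|phN0] := eqVneq (phi x) 0.
  by rewrite ghx// mulr0 subr0.
by rewrite lt_neqAle eq_sym phN0 phx /ind mul1r subrr.
Qed.

(** Let d = (v - w)^+ and split phi into the remainder and (phi - k d)^+. Against the remainder,
    which lives on {d > 0}, the minimum is w; against the other part it is v - d, and the
    contribution of d is at most a term tending to 0 by [core]. *)
Lemma Sup_min v w G H : Sup v G -> Sup w H -> Sup (minf v w) (ming v w G H).
Proof.
move=> [av Sv] [aw Sw]; have ad : adm (posf (subf v w)) (posg (subf v w) (subg G H)).
  by apply: adm_pos; exact: adm_sub.
have am : adm (minf v w) (ming v w G H) by exact: adm_sub.
split => // phi K pK ph0; set d := posf _ in ad; set D := posg _ _ in ad.
have d0 : {ae mu, forall x, 0 <= d x} by apply: aeW => x; exact: posf_ge0.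
have dD := adm_HB ad.
have [a a0 Ha] := core ad pK d0 ph0.
suff Hk k : - a k <= E (minf v w) (ming v w G H) phi K.
  have c : - a k @[k --> \oo] --> 0 by rewrite -oppr0; exact: cvgN.
  rewrite -(cvg_lim (@Rhausdorff R) c); apply: limr_le; first exact: cvgP c.
  exact: nearW.
have cH := core_HB k dD pK.
have rH := HB_sub pK cH.
have E1 : E (minf v w) (ming v w G H) phi K =
    E w H (subf phi (core_f d phi k)) (subg K (core_g d D phi K k)) +
    E (minf v w) (ming v w G H) (core_f d phi k) (core_g d D phi K k).
  apply/eqP; rewrite -subr_eq; apply/eqP; rewrite -(E_subr am pK cH).
  have rest := core_rest k dD pK ph0.
  apply: (E_congr am rH aw rH) => [i|].
    apply: filterS rest => x rx.
    have [d_0|dN0] := eqVneq (d x) 0; first by rewrite (rx d_0).2 !mulr0.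
    congr (_ * _); rewrite /ming /subg /posg.
    have -> : 0 < subf v w x.
      by move: dN0; rewrite /d /posf; case: (leP (subf v w x) 0) => //; rewrite eqxx.
    by rewrite /ind mul1r subKr.
  apply: filterS rest => x rx.
  have [d_0|dN0] := eqVneq (d x) 0; first by rewrite (rx d_0).1 !mulr0.
  congr (_ * _); rewrite minfE; move: dN0; rewrite /d /posf /subf.
  case: (leP (v x - w x) 0); first by rewrite eqxx.
  by move=> h _; rewrite min_r// -subr_ge0 ltW.
have E2 : E (minf v w) (ming v w G H) (core_f d phi k) (core_g d D phi K k) =
    E v G (core_f d phi k) (core_g d D phi K k) - E d D (core_f d phi k) (core_g d D phi K k).
  exact: E_subl.
have r0 : {ae mu, forall x, 0 <= subf phi (core_f d phi k) x}.
  by apply: filterS2 d0 ph0 => x dx phx; rewrite subr_ge0; have /andP[] := core_f_le k dx phx.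
have c0 : {ae mu, forall x, 0 <= core_f d phi k x} by apply: aeW => x; exact: posf_ge0.
have := Sw _ _ rH r0; have := Sv _ _ cH c0; have := Ha k; rewrite E1 E2.
move: (E w H _ _) (E v G _ _) (E d D _ _) (a k) => b1 b2 b3 b4; lra.
Qed.

Lemma E_ge0 w G : adm w G -> 0 <= E w G w G.
Proof.
by move=> aw; apply: le_trans (E_self_ge_grad ord0 aw); apply: I_ge0 => x; exact: sqr_ge0.
Qed.

(* Since B(z_k, z_l - z_k) >= 0 for supersolutions z_k <= z_l, the energy of z_l - z_k
   is at most the increment of the energies, so (z_k) is Cauchy once they are bounded. *)
Lemma Sup_cauchy w G z Z : Sup z Z -> adm w G -> {ae mu, forall x, z x <= w x} ->
  E (subf w z) (subg G Z) (subf w z) (subg G Z) <= E w G w G - E z Z z Z.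
Proof.
move=> [az Sz] aw zw; have wG := adm_HB aw; have zZ := adm_HB az.
have wz := HB_sub wG zZ.
have pos : 0 <= E z Z (subf w z) (subg G Z).
  by apply: Sz => //; apply: filterS zw => x zx; rewrite subr_ge0.
rewrite (E_subl aw az wz) (E_subr aw wG zZ) (E_sym w G z Z).
by move: pos; rewrite (E_subr az wG zZ); move: (E w G w G) (E z Z w G) (E z Z z Z) => a b c; lra.
Qed.

(** [th] is the indicator of the region where [w_ k] eventually exceeds [v]; elsewhere all [w_ k]
    vanish. The minima of [v] and [w_ k] increase to [th v], and [Sup_cauchy] compares them with
    each other and with [v]. *)
Lemma limit_min v G g (w_ : nat -> fn) (G_ : nat -> vf) (th : fn) :
  Sol v G g -> {ae mu, forall x, 0 <= g x} -> {ae mu, forall x, 0 <= v x} ->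
  (forall k, Sup (w_ k) (G_ k)) ->
  {ae mu, forall x, forall k, 0 <= w_ k x <= w_ k.+1 x} ->
  measurable_fun setT th ->
  {ae mu, forall x, (th x = 0 /\ forall k, w_ k x = 0) \/
     (th x = 1 /\ exists m, forall k, (m <= k)%N -> v x <= w_ k x)} ->
  HB (fun x => th x * v x) (fun i x => th x * G i x).
Proof.
move=> Sv g0 v0 Sw w0 mth thP; have [av dg _] := Sv; have vG := adm_HB av.
have Sv' := Sol_Sup Sv g0.
pose z k := minf v (w_ k); pose Z k := ming v (w_ k) G (G_ k).
have Sz k : Sup (z k) (Z k) by exact: Sup_min.
have az k : adm (z k) (Z k) := (Sz k).1.
have zE k x : z k x = Num.min (v x) (w_ k x) by exact: minfE.
have z0 : {ae mu, forall x, forall k, 0 <= z k x <= v x}.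
  apply: filterS2 v0 w0 => x vx wx k; have /andP[wk _] := wx k.
  by rewrite zE le_min vx wk ge_min lexx.
have zmono : {ae mu, forall x, forall k l, (k <= l)%N -> z k x <= z l x}.
  apply: filterS w0 => x wx k l /subnK <-; elim: (l - k)%N => [|j IH]; first by rewrite add0n.
  apply: (le_trans IH); rewrite addSn !zE.
  have /andP[_ wj] := wx (j + k)%N.
  by rewrite le_min ge_min lexx/= ge_min wj orbT.
pose e k := E (z k) (Z k) (z k) (Z k).
have e_mono k l : (k <= l)%N -> e k <= e l.
  move=> kl; rewrite -subr_ge0; apply: le_trans (Sup_cauchy (Sz k) (az l) _).
    by apply: E_ge0; exact: adm_sub.
  by apply: filterS zmono => x; exact.
pose C := E v G v G.
have e_bd k : e k <= C.
  have : 0 <= C - e k; last by rewrite subr_ge0.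
  apply: le_trans (Sup_cauchy (Sz k) av _); first by apply: E_ge0; exact: adm_sub.
  by apply: filterS z0 => x zx; have /andP[] := zx k.
have ce : cvgn e.
  apply: nondecreasing_is_cvgn; first by move=> k l; exact: e_mono.
  by exists C => _ [k _ <-].
pose L := limn e.
have eL k : e k <= L by apply: nondecreasing_cvgn_le => // a b; exact: e_mono.
have vG10 : H10 v G by case: vG.
have Lv := H10_L2 vG10; have LG i := H10_L2g i vG10.
have th01 : {ae mu, forall x, `|th x| <= 1}.
  by apply: filterS thP => x [[-> _]|[-> _]]; rewrite ?normr0 ?normr1.
have Lth f : L2 f -> L2 (fun x => th x * f x).
  move=> Lf; apply: (L2_dom _ Lf); first by apply: measurable_funM => //; exact: L2_meas Lf.
  by apply: filterS th01 => x tx; rewrite normrM ler_piMl.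
have zcv : {ae mu, forall x, z k x @[k --> \oo] --> th x * v x}.
  apply: filterS2 v0 thP => x vx [[-> wk]|[-> [m Hm]]].
    rewrite mul0r; apply: (@cvg_eventually0 _ 0) => k _.
    by rewrite zE wk min_r.
  rewrite mul1r; apply: cvg_near_cst; exists m => // k /= mk.
  by rewrite zE min_l// Hm.
(* Where th = 1 the minimum eventually equals [v], gradient included. Where th = 0 the minimum is 0,
   and [H10_grad0] kills the gradients involved. *)
have Zcv i : {ae mu, forall x, Z k i x @[k --> \oo] --> th x * G i x}.
  have gw : {ae mu, forall x, forall k, w_ k x = 0 -> G_ k i x = 0}.
    apply: ae_foralln => k; have [[wk _ _] _] := Sw k.
    exact: (H10_grad0 M0 OM i wk).
  have gv := H10_grad0 M0 OM i vG10.
  have vth := ae_conj v0 thP.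
  apply: filterS3 vth gw gv => x [vx [[-> wk]|[-> [m Hm]]]] gwx gvx.
    rewrite mul0r; apply: (@cvg_eventually0 _ 0) => k _.
    rewrite /Z /ming /subg /posg /subf wk gwx ?wk// !subr0.
    have [v_0|vN0] := eqVneq (v x) 0; first by rewrite gvx// mulr0 subr0.
    by rewrite lt_neqAle eq_sym vN0 vx /ind mul1r subrr.
  rewrite mul1r; apply: cvg_near_cst; exists m => // k /= mk.
  by rewrite /Z /ming /subg /posg /subf ltNge subr_le0 Hm// /ind mul0r subr0.
have LZ k i : L2 (Z k i) by exact: HB_L2g (adm_HB (az k)).
(* The distance from [Z l] to [Z k] is at most e l - e k <= L - e k; Fatou in l transfers the bound
   to the almost everywhere limit. *)
have sq k i : sqd (fun x => th x * G i x) (Z k i) <= L - e k.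
  have [] := @Fatou_I _ _ _ mu (fun l x => (Z (l + k)%N i x - Z k i x) ^+ 2)
    (fun x => (th x * G i x - Z k i x) ^+ 2) (L - e k) => //.
  - by move=> l; exact: sqd_Int.
  - by move=> l x; exact: sqr_ge0.
  - by apply: measurable_funX; apply: measurable_funB; [exact: L2_meas (Lth _ (LG i))|exact: L2_meas (LZ k i)].
  - apply: filterS (Zcv i) => x cx.
    have cx' : Z (l + k)%N i x @[l --> \oo] --> th x * G i x.
      by rewrite (cvg_shiftn k (fun l => Z l i x)).
    have c2 : Z (l + k)%N i x - Z k i x @[l --> \oo] --> th x * G i x - Z k i x.
      by apply: cvgB => //; exact: cvg_cst.
    by rewrite expr2; apply: cvgM.
  - move=> l; have alk := adm_sub (az (l + k)%N) (az k).
    apply: (le_trans (E_self_ge_grad i alk)).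
    apply: le_trans (Sup_cauchy (Sz k) (az (l + k)%N) _) _.
      by apply: filterS zmono => x; apply; exact: leq_addl.
    by rewrite lerD2r; exact: eL.
split; last first.
  case: vG => _; apply: Bd_le; apply: filterS th01 => x tx.
  by rewrite normrM ler_piMl.
apply: (@H10_cvg _ _ _ _ M0 OM z Z _ _ (fun k => (adm_HB (az k)).1) (Lth _ Lv) (fun i => Lth _ (LG i))).
- apply: (sqd_cvg (Lth _ Lv) Lv _ _ zcv) => [k|].
    exact: HB_meas (adm_HB (az k)).
  apply: filterS z0 => x zx k; have /andP[zk0 zkv] := zx k.
  by rewrite !ger0_norm// (le_trans zk0).
- move=> i; have c : L - e k @[k --> \oo] --> 0.
    by rewrite -(subrr L); apply: cvgB; [exact: cvg_cst|exact: ce].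
  by apply: (squeeze_cvgr _ (cvg_cst 0) c); apply: nearW => k; rewrite sqd_ge0 sq.
Qed.

(** The piece y = th v is a subsolution for the data restricted to {y > 0}. In phi = remainder +
    (phi - k y)^+, the remainder lives on {y > 0}, where y = v obeys the equation of v, and [core]
    makes the other contribution negligible. *)
Lemma split_sub v G g (th : fn) phi H : Sol v G g -> {ae mu, forall x, 0 <= g x} ->
  {ae mu, forall x, 0 <= v x} -> {ae mu, forall x, th x = 0 \/ th x = 1} ->
  HB (fun x => th x * v x) (fun i x => th x * G i x) ->
  HB phi H -> {ae mu, forall x, 0 <= phi x} ->
  E (fun x => th x * v x) (fun i x => th x * G i x) phi H <=
  I (fun x => g x * ind (0 < th x * v x) * phi x).
Proof.
move=> Sv g0 v0 th01 yY pH ph0; have [av dg _] := Sv.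
set y := fun x => th x * v x in yY *; set Y := fun i x => th x * G i x in yY *.
have ay : adm y Y.
  apply: (adm_le av yY); apply: filterS th01 => x [] t; rewrite /y t ?mul0r ?mul1r ?normr0//.
have y0 : {ae mu, forall x, 0 <= y x}.
  by apply: filterS2 v0 th01 => x vx [] t; rewrite /y t ?mul0r ?mul1r.
have [a a0 Ha] := core ay pH y0 ph0.
have my := HB_meas yY; have mphi := HB_meas pH.
have Ig : Int (fun x => g x * ind (0 < y x) * phi x).
  apply: (Int_dom _ (IntAbs (Sol_data_Int Sv pH))).
    apply: measurable_funM => //; apply: measurable_funM; last exact: measurable_pos my.
    by case: dg.
  by apply: aeW => x; rewrite !normrM ler_wpM2r// ler_piMr// /ind; case: (_ < _); rewrite ?normr0 ?normr1.
suff Hk k : E y Y phi H <= I (fun x => g x * ind (0 < y x) * phi x) + a k.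
  have c : I (fun x => g x * ind (0 < y x) * phi x) + a k @[k --> \oo] -->
      I (fun x => g x * ind (0 < y x) * phi x).
    by rewrite -[X in _ --> X]addr0; apply: cvgD => //; exact: cvg_cst.
  rewrite -(cvg_lim (@Rhausdorff R) c); apply: limr_ge; first exact: cvgP c.
  exact: nearW.
have cH := core_HB k yY pH; have rH := HB_sub pH cH.
have E1 : E y Y phi H = E v G (subf phi (core_f y phi k)) (subg H (core_g y Y phi H k)) +
    E y Y (core_f y phi k) (core_g y Y phi H k).
  apply/eqP; rewrite -subr_eq; apply/eqP; rewrite -(E_subr ay pH cH).
  have rest := core_rest k yY pH ph0.
  have gv : {ae mu, forall x, forall i, v x = 0 -> G i x = 0}.
    by apply: ae_fin_forall => i; apply: (H10_grad0 M0 OM i); case: av.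
  apply: (E_congr ay rH av rH) => [i|].
    apply: filterS2 rest th01 => x rx [] t.
      by rewrite (rx _).2 ?mulr0// /y t mul0r.
    by rewrite /Y t mul1r.
  apply: filterS2 rest th01 => x rx [] t.
    by rewrite (rx _).1 ?mulr0// /y t mul0r.
  by rewrite /y t mul1r.
have Eg : E v G (subf phi (core_f y phi k)) (subg H (core_g y Y phi H k)) <=
    I (fun x => g x * ind (0 < y x) * phi x).
  rewrite (Sol_test Sv rH); apply: ae_le_I => //; first exact: Sol_data_Int Sv rH.
  have rest := core_rest k yY pH ph0.
  have g0y := ae_conj g0 y0.
  apply: filterS3 g0y ph0 rest => x [gx yx] phx rx.
  rewrite -mulrA; apply: ler_wpM2l => //.
  have [y_0|yN0] := eqVneq (y x) 0; first by rewrite (rx y_0).1 mulr_ge0// /ind ler0n.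
  rewrite lt_neqAle eq_sym yN0 yx /ind mul1r /subf gerBl.
  exact: posf_ge0.
have := Ha k; move: Eg; rewrite E1.
move: (E v G _ _) (E y Y _ _) (I _) (a k) => b1 b2 b3 b4; lra.
Qed.

Lemma test_pos_split phi : test phi ->
  HB (posf phi) (posg phi (grad phi)) /\
  HB (posf (scf (-1) phi)) (posg (scf (-1) phi) (scg (-1) (grad phi))).
Proof.
by move=> /HB_test pH; split; apply: HB_pos => //; exact: HB_sc.
Qed.

Lemma Sol_of_nonneg w G f : adm w G -> data f ->
  (forall phi H, HB phi H -> {ae mu, forall x, 0 <= phi x} ->
     E w G phi H = I (fun x => f x * phi x)) -> Sol w G f.
Proof.
move=> aw df Hp; split => // phi tp; have pH := HB_test tp.
have [h1 h2] := test_pos_split tp.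
have If := data_Int df.
have Ifu u H : HB u H -> Int (fun x => f x * u x).
  by move=> uH; apply: Int_mul_Bd => //; [exact: HB_meas uH|case: uH].
have E1 := Hp _ _ h1 (aeW _ (posf_ge0 phi)).
have E2 := Hp _ _ h2 (aeW _ (posf_ge0 (scf (-1) phi))).
have pE x : phi x = posf phi x - posf (scf (-1) phi) x.
  by rewrite /posf /scf mulN1r; case: (ltrgt0P (phi x)) => h; rewrite ?oppr_gt0; case: (ltP (- phi x) 0) => h'; lra.
have hs := HB_sub h1 h2.
have -> : E w G phi (grad phi) = E w G (subf (posf phi) (posf (scf (-1) phi)))
    (subg (posg phi (grad phi)) (posg (scf (-1) phi) (scg (-1) (grad phi)))).
  have gp i : {ae mu, forall x, phi x = 0 -> grad phi i x = 0}.
    by apply: (H10_grad0 M0 OM i); case: pH.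
  apply: (E_congr aw pH aw hs) => [i|].
    apply: filterS (gp i) => x gx; congr (_ * _).
    rewrite /subg /posg /scg /scf !mulN1r oppr_gt0 /ind.
    case: (ltrgt0P (phi x)) => h.
    - by rewrite ?mulr0n ?mulr1n mul1r mul0r subr0.
    - by rewrite ?mulr0n ?mulr1n mul1r mul0r sub0r opprK.
    - by rewrite gx// ?mulr0n !mul0r subrr.
  by apply: aeW => x; rewrite {1}pE.
rewrite (E_subr aw h1 h2) E1 E2 -IB; [|exact: Ifu h1|exact: Ifu h2].
by congr rint; apply/funext => x; rewrite [in RHS]pE mulrBr.
Qed.

(** Both pieces satisfy an upper inequality by [split_sub]. Their energies add up to that of v,
    which is at least the sum of the two data terms, so both inequalities are equalities. *)
Lemma split_Sol v G g (th : fn) : Sol v G g -> {ae mu, forall x, 0 <= g x} ->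
  {ae mu, forall x, 0 <= v x} -> {ae mu, forall x, th x = 0 \/ th x = 1} ->
  HB (fun x => th x * v x) (fun i x => th x * G i x) ->
  Sol (fun x => th x * v x) (fun i x => th x * G i x) (fun x => g x * ind (0 < th x * v x)) /\
  Sol (fun x => (1 - th x) * v x) (fun i x => (1 - th x) * G i x)
      (fun x => g x * ind (0 < (1 - th x) * v x)).
Proof.
move=> Sv g0 v0 th01 yY; have [av dg _] := Sv; have vG := adm_HB av.
pose th' x := 1 - th x.
have th01' : {ae mu, forall x, th' x = 0 \/ th' x = 1}.
  by apply: filterS th01 => x [] t; rewrite /th' t ?subr0 ?subrr; [right|left].
have zZ : HB (fun x => th' x * v x) (fun i x => th' x * G i x).
  have := HB_sub vG yY; congr (HB _ _).
    by apply/funext => x; rewrite /subf /th' mulrBl mul1r.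
  by apply/funext => i; apply/funext => x; rewrite /subg /th' mulrBl mul1r.
have ath t : {ae mu, forall x, t x = 0 \/ t x = 1} ->
   HB (fun x => t x * v x) (fun i x => t x * G i x) ->
   adm (fun x => t x * v x) (fun i x => t x * G i x).
  move=> t01 tH; apply: (adm_le av tH); apply: filterS t01 => x [] ->; rewrite ?mul0r ?mul1r ?normr0//.
have ay := ath _ th01 yY; have az := ath _ th01' zZ.
have dth t : HB (fun x => t x * v x) (fun i x => t x * G i x) ->
    data (fun x => g x * ind (0 < t x * v x)).
  move=> tH; have [mg [B gB] gO] := dg; split.
  - by apply: measurable_funM => //; exact: measurable_pos (HB_meas tH).
  - exists B; apply: filterS gB => x; apply: le_trans.
    by rewrite normrM ler_piMr// /ind; case: (_ < _); rewrite ?normr0 ?normr1.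
  - by move=> x /gO ->; rewrite mul0r.
have Idt t phi H : HB (fun x => t x * v x) (fun i x => t x * G i x) -> HB phi H ->
    Int (fun x => g x * ind (0 < t x * v x) * phi x).
  by move=> tH pH; apply: Int_mul_Bd; [exact: data_Int (dth _ tH)|exact: HB_meas pH|case: pH].
have key phi H : HB phi H -> {ae mu, forall x, 0 <= phi x} ->
  E (fun x => th x * v x) (fun i x => th x * G i x) phi H =
    I (fun x => g x * ind (0 < th x * v x) * phi x) /\
  E (fun x => th' x * v x) (fun i x => th' x * G i x) phi H =
    I (fun x => g x * ind (0 < th' x * v x) * phi x).
  move=> pH ph0.
  have s1 := split_sub Sv g0 v0 th01 yY pH ph0.
  have s2 := split_sub Sv g0 v0 th01' zZ pH ph0.
  have i1 := Idt _ _ _ yY pH; have i2 := Idt _ _ _ zZ pH.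
  have ev : E v G phi H = E (fun x => th x * v x) (fun i x => th x * G i x) phi H +
     E (fun x => th' x * v x) (fun i x => th' x * G i x) phi H.
    apply/eqP; rewrite addrC -subr_eq -(E_subl av ay pH); apply/eqP.
    apply: (E_congr (adm_sub av ay) pH az pH) => [i|]; apply: aeW => x.
      by congr (_ * _); rewrite /subg /th' mulrBl mul1r.
    by congr (_ * _); rewrite /subf /th' mulrBl mul1r.
  have le : I (fun x => g x * ind (0 < th x * v x) * phi x) +
      I (fun x => g x * ind (0 < th' x * v x) * phi x) <= E v G phi H.
    rewrite (Sol_test Sv pH) -ID//; apply: ae_le_I.
    - exact: IntD.
    - exact: Sol_data_Int Sv pH.
    - apply: filterS3 g0 ph0 th01 => x gx px tx.
      rewrite -mulrDl -mulrDr; apply: ler_wpM2r => //.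
      rewrite -[leRHS]mulr1; apply: ler_wpM2l => //.
      by case: tx => t; rewrite /th' t ?subr0 ?subrr !mul0r ?mul1r ltxx /ind ?addr0 ?add0r; case: (_ < _).
  move: s1 s2 le; rewrite ev.
  move: (E (fun x => th x * v x) _ _ _) (E (fun x => th' x * v x) _ _ _).
  move: (I (fun x => g x * ind (0 < th x * v x) * phi x)) (I (fun x => g x * ind (0 < th' x * v x) * phi x)).
  by move=> a b c d s1 s2 le; split; lra.
split; apply: Sol_of_nonneg => //; [exact: dth yY|by move=> phi H pH ph0; have [] := key phi H pH ph0| |].
  exact: (dth th').
by move=> phi H pH ph0; have [] := key phi H pH ph0.
Qed.

Lemma Sol_add w G f v H g : Sol w G f -> Sol v H g ->
  Sol (fun x => w x + v x) (fun i x => G i x + H i x) (fun x => f x + g x).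
Proof.
move=> Sw Sv; have [aw df _] := Sw; have [av dg _] := Sv.
have av' := adm_sc (-1) av; have as_ := adm_sub aw av'.
have e1 : subf w (scf (-1) v) = (fun x => w x + v x).
  by apply/funext => x; rewrite /subf /scf mulN1r opprK.
have e2 : subg G (scg (-1) H) = (fun i x => G i x + H i x).
  by apply/funext => i; apply/funext => x; rewrite /subg /scg mulN1r opprK.
have dfg : data (fun x => f x + g x).
  have [mf [B fB] fO] := df; have [mg [C gC] gO] := dg; split.
  - exact: measurable_funD.
  - exists (B + C); apply: filterS2 fB gC => x fx gx.
    by rewrite (le_trans (ler_normD _ _))// lerD.
  - by move=> x Ox; rewrite fO// gO// addr0.
apply: Sol_of_nonneg => //; first by rewrite -e1 -e2.
move=> phi K pK _; rewrite -e1 -e2 (E_subl aw av' pK).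
rewrite (E_scl _ av pK) (Sol_test Sw pK) (Sol_test Sv pK) mulN1r opprK.
rewrite -ID; [|exact: Sol_data_Int Sw pK|exact: Sol_data_Int Sv pK].
by congr rint; apply/funext => x; rewrite mulrDl.
Qed.

Lemma Sol_sc c w G f : Sol w G f -> Sol (scf c w) (scg c G) (scf c f).
Proof.
move=> Sw; have [aw [mf bf fO] _] := Sw; split; first exact: adm_sc.
  split; [exact: measurable_funM|exact: BdZ|].
  by move=> x Ox; rewrite /scf fO// mulr0.
move=> phi /HB_test pH; rewrite (E_scl _ aw pH) (Sol_test Sw pH) -IZ; last exact: Sol_data_Int Sw pH.
by congr rint; apply/funext => x; rewrite /scf mulrA.
Qed.

End energy.

(** * Smooth averages and Lebesgue points of solutions *)

Section flat.
Context {R : realType}.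
Implicit Types (t h : R) (k : nat).

(** t^-k exp(- 1/t) extended by 0. The family is closed under differentiation, flat_k' = - k
    flat_(k+1) + flat_(k+2), so smoothness of the bumps built from it follows from the algebra
    [gen]. *)
Definition flat k t : R := if 0 < t then t^-1 ^+ k * expR (- t^-1) else 0.

Lemma flat_ge0 k t : 0 <= flat k t.
Proof.
by rewrite /flat; case: ltP => // t0; rewrite mulr_ge0 ?expR_ge0// exprn_ge0// invr_ge0 ltW.
Qed.

Lemma flat_le0 k t : t <= 0 -> flat k t = 0.
Proof. by rewrite /flat ltNge => ->. Qed.

(** With u = 1/t this is u^k / k! <= exp(u). *)
Lemma flat_exp_le k t : 0 < t -> t^-1 ^+ k * expR (- t^-1) <= k`!%:R.
Proof.
move=> t0; have u0 : 0 <= t^-1 by rewrite invr_ge0 ltW.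
rewrite expRN ler_pdivrMr ?expR_gt0//.
case: k => [|k]; first by rewrite expr0 fact0 mul1r -[leLHS]expR0 ler_expR.
rewrite -ler_pdivrMl ?ltr0n ?fact_gt0// mulrC.
by apply: le_trans (expR_ge1Dxn k u0); rewrite lerDr ler01.
Qed.

Lemma flat_le k t : flat k t <= k`!%:R.
Proof.
by rewrite /flat; case: ltP => [|_]; [exact: flat_exp_le|rewrite ler0n].
Qed.

(** The factorial bound for k + 2, multiplied by t^2. Quadratic decay at 0 is what makes the
    derivative of [flat k] vanish there. *)
Lemma flat_le_sqr k t : flat k t <= (k.+2)`!%:R * t ^+ 2.
Proof.
rewrite /flat; case: ltP => [t0|_]; last by rewrite mulr_ge0// sqr_ge0.
rewrite -ler_pdivrMr ?exprn_gt0//; apply: le_trans (flat_exp_le k.+2 t0).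
rewrite le_eqVlt; apply/orP; left; apply/eqP; rewrite -exprVn !exprS expr0; ring.
Qed.

Lemma is_derive_flat k t : is_derive t 1 (flat k) (- k%:R * flat k.+1 t + flat k.+2 t).
Proof.
have [t0|t0|->] := ltrgt0P t.
- have tN0 : t != 0 by rewrite gt_eqF.
  have d1 : is_derive t (1 : R) (fun s : R => s^-1) (- t^-1 ^+ 2).
    have := @is_deriveV R id t 1 1 tN0 (is_derive_id _ _).
    by move=> /is_derive_eq; apply; rewrite -[_ *: _]/(_ * _) mulr1 exprVn.
  have d2 : is_derive t (1 : R) (fun s : R => s^-1 ^+ k * expR (- s^-1))
      (- k%:R * flat k.+1 t + flat k.+2 t).
    have d3 : is_derive t^-1 (1 : R) (fun u : R => u ^+ k * expR (- u))
        (k%:R * t^-1 ^+ k.-1 * expR (- t^-1) - t^-1 ^+ k * expR (- t^-1)).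
      have a1 : is_derive t^-1 (1 : R) (fun u : R => u ^+ k) (k%:R * t^-1 ^+ k.-1).
        apply: DeriveDef; first exact: exprn_derivable.
        by rewrite exp_derive -![_ *: _]/(_ * _) mulr1.
      have a2 : is_derive t^-1 (1 : R) (fun u : R => expR (- u)) (- expR (- t^-1)).
        have aN : is_derive t^-1 (1 : R) (fun u : R => - u) (- 1) by exact: is_deriveN.
        have := is_derive1_comp (is_derive_expR (- t^-1)) aN.
        by move=> /is_derive_eq; apply; rewrite mulrN1.
      have := is_deriveM a1 a2; move=> /is_derive_eq; apply.
      by rewrite -![_ *: _]/(_ * _) mulrN addrC; congr (_ - _); rewrite mulrC.
    have := @is_derive1_comp R _ (fun s : R => s^-1) _ _ _ d3 d1.
    move=> /is_derive_eq; apply; rewrite /flat t0.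
    case: k {d3} => [|k]; first by rewrite !exprS expr0; ring.
    by rewrite /= -natr1 !exprS; ring.
  move: d2; apply: (@near_eq_is_derive R R^o R^o).
  near=> s; rewrite /flat ifT//; near: s; exact: lt_nbhsr.
- rewrite !flat_le0 ?ltW// mulr0 addr0.
  move: (@is_derive_cst R R^o R^o 0 t 1); apply: (@near_eq_is_derive R R^o R^o).
  near=> s; rewrite flat_le0// ltW//; near: s; exact: lt_nbhsl.
- rewrite !flat_le0// mulr0 addr0.
  have c : h^-1 *: ((flat k \o shift 0) (h *: 1) - flat k 0) @[h --> 0^'] --> (0 : R).
    apply/cvgrPdist_le => e e0.
    have b0 : (0 : R) < (k.+2)`!%:R by rewrite ltr0n fact_gt0.
    near=> h; rewrite sub0r normrN /= addr0 (flat_le0 _ (lexx (0 : R))) subr0 -[h *: 1]/(h * 1) mulr1.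
    have hN0 : h != 0 by near: h; exact: nbhs_dnbhs_neq.
    rewrite -[_ *: _]/(_ * _) normrM normfV ger0_norm ?flat_ge0//.
    rewrite mulrC ler_pdivrMr ?normr_gt0//; apply: le_trans (flat_le_sqr _ _) _.
    rewrite -real_normK ?num_real// expr2 mulrA ler_wpM2r//.
    rewrite -ler_pdivlMl// mulrC; near: h.
    by apply: dnbhs0_le; rewrite divr_gt0.
  by apply: DeriveDef; [apply/cvg_ex; exists 0|exact: (cvg_lim (@Rhausdorff R) c)].
Unshelve. all: by end_near.
Qed.

End flat.

(** * The kernels K_r and L_r *)

Section kernels.
Context {R : realType} {n : nat}.
Implicit Types (a x : 'rV[R]_n.+1) (i j : 'I_n.+1) (k : nat) (c rho : R).

Definition diffc a j x : R := x 0 j - a 0 j.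
Definition sqdist a x : R := \sum_j diffc a j x ^+ 2.
(** A radial bump around [a], supported in the ball of radius c^(-1/2); below, c is always
    rho^-2. *)
Definition prof k c a x : R := flat k (1 - c * sqdist a x).

Lemma continuous_coord a j : continuous (diffc a j).
Proof. move=> x; have c := @coord_continuous R 1 n.+1 0 j x.
exact: (@continuousB _ _ _ _ (cst (a 0 j)) _ c (@cst_continuous _ _ _ _)). Qed.

Lemma is_derive_coord a j i x :
  is_derive x (delta_mx 0 i : 'rV[R]_n.+1) (diffc a j) ((j == i)%:R).
Proof.
have c : h^-1 *: ((diffc a j \o shift x) (h *: (delta_mx 0 i : 'rV[R]_n.+1)) - diffc a j x)
    @[h --> 0^'] --> ((j == i)%:R : R).
  apply: cvg_near_cst; near=> h; have hN0 : h != 0 by near: h; exact: nbhs_dnbhs_neq.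
  rewrite /diffc /= !mxE eqxx /= -[_ *: _]/(_ * _).
  by rewrite (_ : _ - _ = h * (j == i)%:R) ?mulKf//; ring.
by apply: DeriveDef; [apply/cvg_ex; exists (j == i)%:R|exact: (cvg_lim (@Rhausdorff R) c)].
Unshelve. all: by end_near.
Qed.

Lemma gen_sum (G : ('rV[R]_n.+1 -> R) -> Prop) (F : 'I_n.+1 -> 'rV[R]_n.+1 -> R) :
  (forall j, gen G (F j)) -> gen G (fun x => \sum_j F j x).
Proof.
move=> HF; elim: (index_enum _) => [|j s IH].
  have -> : (fun x => \sum_(j <- [::]) F j x) = cst 0 by apply/funext => x; rewrite big_nil.
  exact: gen_cst.
have -> : (fun x => \sum_(j <- j :: s) F j x) = F j \+ (fun x => \sum_(j <- s) F j x).
  by apply/funext => x; rewrite big_cons.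
exact: gen_add.
Qed.

Definition coordG a (h : 'rV[R]_n.+1 -> R) := exists j, h = diffc a j.

Lemma gen_coord a (G : ('rV[R]_n.+1 -> R) -> Prop) : (forall j, G (diffc a j)) ->
  gen G (sqdist a).
Proof.
move=> HG; apply: gen_sum => j.
rewrite (_ : (fun x => diffc a j x ^+ 2) = diffc a j \* diffc a j); last first.
  by apply/funext => x; rewrite expr2.
by apply: gen_mul; exact: gen_base.
Qed.

Lemma partial_coord a j i : partial i (diffc a j) = cst (j == i)%:R.
Proof. by apply/funext => x; have [_ <-] := is_derive_coord a j i x. Qed.

Lemma smooth_sqdist a : smooth (sqdist a).
Proof.
apply: (@gen_smooth R _ (coordG a)); last by apply: gen_coord => j; exists j.
move=> _ [j ->]; split; [exact: continuous_coord| |].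
  by move=> i x; have [] := is_derive_coord a j i x.
by move=> i; rewrite partial_coord; exact: gen_cst.
Qed.

Lemma is_derive_sqdist a i x :
  is_derive x (delta_mx 0 i : 'rV[R]_n.+1) (sqdist a) (2 * diffc a i x).
Proof.
have d j : is_derive x (delta_mx 0 i : 'rV[R]_n.+1) (diffc a j ^+ 2) (2 * (diffc a j x * (j == i)%:R)).
  have := is_deriveX 2 (is_derive_coord a j i x).
  by move=> /is_derive_eq; apply; rewrite -[_ *: _]/(_ * _) /= expr1 mulrA.
have := @is_derive_sum R _ _ n.+1 (fun j => diffc a j ^+ 2) x _ _ d.
rewrite (_ : \sum_(j < n.+1) diffc a j ^+ 2 = sqdist a); last first.
  by apply/funext => y; rewrite fct_sumE.
move=> /is_derive_eq; apply; rewrite (bigD1 i)//= eqxx mulr1 big1 ?addr0//.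
by move=> j /negbTE ->; rewrite !mulr0.
Qed.

Lemma partial_prof k c a i : 
  partial i (prof k c a) = (fun x => (- k%:R * prof k.+1 c a x + prof k.+2 c a x) * (- (2 * c) * diffc a i x))
  /\ dable (prof k c a).
Proof.
suff d i' x : is_derive x (delta_mx 0 i' : 'rV[R]_n.+1) (prof k c a)
   ((- k%:R * prof k.+1 c a x + prof k.+2 c a x) * (- (2 * c) * diffc a i' x)).
  split; first by apply/funext => x; have [_ <-] := d i x.
  by move=> i' x; have [] := d i' x.
have d1 : is_derive x (delta_mx 0 i' : 'rV[R]_n.+1) (fun x => 1 - c * sqdist a x) (- (2 * c) * diffc a i' x).
  have d0 := is_deriveZ c (is_derive_sqdist a i' x).
  have := is_deriveB (is_derive_cst (1 : R) x (delta_mx 0 i' : 'rV[R]_n.+1)) d0.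
  move=> /is_derive_eq; apply; rewrite -[_ *: _]/(_ * _); ring.
have [dd <-] := d1.
by have := is_derive_dir_comp dd (is_derive_flat k (1 - c * sqdist a x)).
Qed.

Lemma continuous_flat k : continuous (flat k : R -> R).
Proof.
by move=> t; apply/differentiable_continuous/derivable1_diffP; have [] := is_derive_flat k t.
Qed.

Lemma continuous_prof k c a : continuous (prof k c a).
Proof.
move=> x; apply: (@continuous_comp _ _ _ (fun x => 1 - c * sqdist a x) (flat k)); last exact: continuous_flat.
have cs := @smooth_continuous _ _ _ (smooth_sqdist a) x.
by apply: (@continuousB _ R^o); [exact: cst_continuous|apply: (@continuousM R _ (cst c)); [exact: cst_continuous|exact: cs]].
Qed.

Lemma smooth_prof k c a : smooth (prof k c a).
Proof.
pose G h := coordG a h \/ exists k, h = prof k c a.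
apply: (@gen_smooth R _ G); last by apply: gen_base; right; exists k.
move=> _ [[j ->]|[{}k ->]].
  split; [exact: continuous_coord| |].
    by move=> i x; have [] := is_derive_coord a j i x.
  by move=> i; rewrite partial_coord; exact: gen_cst.
split; first exact: continuous_prof.
  by have [] := partial_prof k c a ord0.
move=> i; have [-> _] := partial_prof k c a i.
apply: (@gen_mul _ _ _ (fun x => - k%:R * prof k.+1 c a x + prof k.+2 c a x) (fun x => - (2 * c) * diffc a i x)).
  apply: (@gen_add _ _ _ (fun x => - k%:R * prof k.+1 c a x) (prof k.+2 c a)).
    apply: (@gen_mul _ _ _ (cst (- k%:R))); first exact: gen_cst.
    by apply: gen_base; right; exists k.+1.
  by apply: gen_base; right; exists k.+2.
apply: (@gen_mul _ _ _ (cst (- (2 * c)))); first exact: gen_cst.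
by apply: gen_base; left; exists i.
Qed.

Lemma laplacian_prof0 c a x : laplacian (prof 0 c a) x =
  (- 2 * prof 3 c a x + prof 4 c a x) * (4 * c ^+ 2 * sqdist a x) - 2 * c * n.+1%:R * prof 2 c a x.
Proof.
have E i : partial i (partial i (prof 0 c a)) x =
    (- 2 * prof 3 c a x + prof 4 c a x) * (4 * c ^+ 2) * diffc a i x ^+ 2 - 2 * c * prof 2 c a x.
  have [-> _] := partial_prof 0 c a i.
  have -> : (fun x => (- 0%:R * prof 1 c a x + prof 2 c a x) * (- (2 * c) * diffc a i x)) =
      prof 2 c a \* (fun x => - (2 * c) * diffc a i x).
    by apply/funext => y /=; rewrite oppr0 mul0r add0r.
  have [p2 d2] := partial_prof 2 c a i.
  have dc : dable (diffc a i) by move=> i' y; have [] := is_derive_coord a i i' y.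
  have dl : dable (fun x => - (2 * c) * diffc a i x).
    by move=> i' y; exact: (@derivableM _ _ (cst (- (2 * c))) _ _ _ (derivable_cst _ _ _) (dc i' y)).
  rewrite (partialM i d2 dl) /= p2 (partialZ _ _ dc) partial_coord /= eqxx mulr1n.
  ring.
rewrite /laplacian (eq_bigr _ (fun i _ => E i)) sumrB sumr_const card_ord.
rewrite -mulr_sumr -/(sqdist a x) -[in LHS]mulr_natr; ring.
Qed.

(** In dimension n + 1 the exponent of [kerK] makes it a dilation of constant mass, so its
    derivative in rho is minus the divergence of ((x - a) / rho) K_rho. Since flat_0' = flat_2, the
    gradient of L_rho is - ((x - a) / rho) K_rho; hence that derivative is the Laplacian of
    L_rho. *)
Definition kerL rho a x : R := rho^-1 ^+ n * prof 0 (rho^-1 ^+ 2) a x.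
Definition kerK rho a x : R := 2 * (rho^-1 ^+ n.+1 * prof 2 (rho^-1 ^+ 2) a x).

Lemma laplacianZ c phi : smooth phi -> 
  laplacian (fun x => c * phi x) = (fun x : 'rV[R]_n.+1 => c * laplacian phi x).
Proof.
move=> sp; apply/funext => x; rewrite /laplacian mulr_sumr; apply: eq_bigr => i _.
by rewrite (partialZ _ _ (smooth_dable sp)) (partialZ _ _ (smooth_dable (smooth_partial i sp))).
Qed.

Lemma is_derive_kerK rho a x : 0 < rho ->
  is_derive rho 1 (fun r => kerK r a x) (laplacian (kerL rho a) x).
Proof.
move=> r0; have rN0 : rho != 0 by rewrite gt_eqF.
have d1 : is_derive rho (1 : R) (fun s : R => s^-1) (- rho^-1 ^+ 2).
  have := @is_deriveV R id rho 1 1 rN0 (is_derive_id _ _).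
  by move=> /is_derive_eq; apply; rewrite -[_ *: _]/(_ * _) mulr1 exprVn.
set u := rho^-1 in d1 *; set s := sqdist a x.
have aX m : is_derive u (1 : R) (fun v : R => v ^+ m) (m%:R * u ^+ m.-1).
  apply: DeriveDef; first exact: exprn_derivable.
  by rewrite exp_derive -![_ *: _]/(_ * _) mulr1.
have d2 : is_derive u (1 : R) (fun v : R => 1 - v ^+ 2 * s) (- (2 * u * s)).
  have e1 := is_deriveM (aX 2) (is_derive_cst s u 1).
  have := is_deriveB (is_derive_cst (1 : R) u 1) e1.
  by move=> /is_derive_eq; apply; rewrite -![_ *: _]/(_ * _) /= expr1; ring.
have d3 := @is_derive1_comp R (flat 2) (fun v : R => 1 - v ^+ 2 * s) _ _ _ (is_derive_flat 2 _) d2.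
have d4 := is_deriveM (aX n.+1) d3.
have d5 := is_deriveZ 2 d4.
have d6 := @is_derive1_comp R (fun v : R => 2 * (v ^+ n.+1 * flat 2 (1 - v ^+ 2 * s))) (fun s : R => s^-1) _ _ _ d5 d1.
move: d6 => /is_derive_eq; apply.
rewrite /kerL (laplacianZ _ (smooth_prof _ _ _)) laplacian_prof0 /prof -/s -/u.
rewrite -![_ *: _]/(_ * _) /= !exprS.
by move: (flat 2 _) (flat 3 _) (flat 4 _) => f2 f3 f4; ring.
Qed.

End kernels.

Section kernel_bounds.
Context {R : realType} {n : nat}.
Variables (Omega : set 'rV[R]_n.+1) (M : R) (M0 : 0 < M) (OM : Omega `<=` cube 0 M).
Implicit Types (a x : 'rV[R]_n.+1) (i j : 'I_n.+1) (k : nat) (c rho : R).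
Local Notation test := (test_function Omega).
Local Notation mu := (lam n.+1).
Local Notation Int := (rintegrable mu).
Local Notation I := (rint mu).
Local Notation "\1_ A" := (\1_A : 'rV[R]_n.+1 -> R).

Lemma sqdist_ge0 a x : 0 <= sqdist a x.
Proof. by apply: sumr_ge0 => i _; exact: sqr_ge0. Qed.

Lemma sqdist_cube rho a x : 0 < rho -> sqdist a x <= rho ^+ 2 -> cube a rho x.
Proof.
move=> r0 sx i; have : diffc a i x ^+ 2 <= rho ^+ 2.
  apply: le_trans sx; rewrite /sqdist (bigD1 i)//= lerDl.
  by apply: sumr_ge0 => j _; exact: sqr_ge0.
rewrite -[diffc _ _ _ ^+ 2]real_normK ?num_real// ler_pXn2r ?nnegrE ?(ltW r0)//.
by rewrite /diffc ler_norml; lra.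
Qed.

Lemma prof_out rho k a x : 0 < rho -> rho ^+ 2 <= sqdist a x -> prof k (rho^-1 ^+ 2) a x = 0.
Proof.
move=> r0 rx; rewrite /prof flat_le0// subr_le0 exprVn ler_pdivlMl ?exprn_gt0//.
by rewrite mulr1.
Qed.

Lemma prof_cube rho k a x : 0 < rho -> ~ cube a rho x -> prof k (rho^-1 ^+ 2) a x = 0.
Proof.
move=> r0 cx; apply: prof_out => //; have [//|/ltW sx] := leP (rho ^+ 2) (sqdist a x).
by case: cx; exact: sqdist_cube.
Qed.

Lemma prof_le rho k a x : 0 < rho -> prof k (rho^-1 ^+ 2) a x <= k`!%:R * \1_(cube a rho) x.
Proof.
move=> r0; have [cx|cx] := pselect (cube a rho x).
  by rewrite indicE mem_set// mulr1; exact: flat_le.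
by rewrite prof_cube// indicE memNset// mulr0.
Qed.

Lemma test_prof rho k a : 0 < rho -> cube a rho `<=` Omega -> test (prof k (rho^-1 ^+ 2) a).
Proof.
move=> r0 aO; pose S := closure [set x | prof k (rho^-1 ^+ 2) a x != 0].
have SS : S `<=` [set x | sqdist a x <= rho ^+ 2].
  have cl : closed [set x | sqdist a x <= rho ^+ 2].
    apply: (@preimage_closed _ _ (sqdist a) [set y | y <= rho ^+ 2]); last exact: closed_le.
    by move=> x _; exact: (@smooth_continuous _ _ _ (smooth_sqdist a) x).
  rewrite /S (closure_id [set x | sqdist a x <= rho ^+ 2]).1//; apply: closureS => x /=.
  by apply: contra_neqT; rewrite -ltNge => /ltW; exact: prof_out.
have SC : S `<=` cube a rho by move=> x /SS; exact: sqdist_cube.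
rewrite /test_function -/S.
split; [exact: smooth_prof| |exact: subset_trans SC aO].
apply: bounded_closed_compact; last exact: closed_closure.
exists (`|a| + rho); split; first exact: num_real.
move=> B aB x /SC cx; have B0 : 0 <= B by apply: le_trans (ltW aB); rewrite addr_ge0// ltW.
rewrite /= (_ : `|x| = mx_norm x)// mx_normrE; apply: bigmax_le => // -[i0 i] _ /=; rewrite (ord1 i0).
apply: le_trans (ltW aB); have := coord_le_norm a i; have := cx i.
by rewrite !ler_norml; lra.
Qed.

Lemma test_kerL rho a : 0 < rho -> cube a rho `<=` Omega -> test (kerL rho a).
Proof. by move=> r0 aO; apply: testZ; exact: test_prof. Qed.

(** From [flat k <= k!] in the formula of [laplacian_prof0]: 144 = 4 (2 * 3! + 4!) and 4 = 2 *
    2!. *)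
Definition lapC (m : nat) : R := 144 + 4 * m.+1%:R.

Lemma lapl_arith (p2 p3 p4 u s N : R) : u * s <= 1 -> 0 <= p2 -> p2 <= 2`!%:R ->
  0 <= p3 -> p3 <= 3`!%:R -> 0 <= p4 -> p4 <= 4`!%:R -> 0 <= u -> 0 <= N -> 0 <= s ->
  `|(- 2 * p3 + p4) * (4 * u ^+ 2 * s) - 2 * u * N * p2| <= (144 + 4 * N) * u.
Proof.
rewrite (_ : 2`!%:R = 2 :> R)// (_ : 3`!%:R = 6 :> R)// (_ : 4`!%:R = 24 :> R)//.
move=> su f2 g2 f3 g3 f4 g4 p0 N0 s0.
apply: (le_trans (ler_normB _ _)).
have -> : (144 + 4 * N) * u = 36 * (4 * u) + (4 * N * u) by ring.
apply: lerD.
  rewrite normrM; apply: ler_pM => //.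
    by rewrite ler_norml; apply/andP; split; lra.
  rewrite ger0_norm; last by rewrite !mulr_ge0// exprn_ge0.
  have -> : 4 * u ^+ 2 * s = 4 * u * (u * s) by ring.
  by rewrite ler_piMr// mulr_ge0.
rewrite ger0_norm; last by rewrite !mulr_ge0.
have -> : 2 * u * N * p2 = (2 * N * u) * p2 by ring.
have -> : 4 * N * u = (2 * N * u) * 2 by ring.
by apply: ler_wpM2l => //; rewrite !mulr_ge0.
Qed.

Lemma laplacian_kerL_bound rho a x : 0 < rho ->
  `|laplacian (kerL rho a) x| <= rho^-1 ^+ n * (lapC n * rho^-1 ^+ 2) * \1_(cube a rho) x.
Proof.
move=> r0; rewrite /kerL (laplacianZ _ (smooth_prof _ _ _)) laplacian_prof0.
have u0 : 0 <= rho^-1 by rewrite invr_ge0 ltW.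
rewrite normrM ger0_norm ?exprn_ge0// -[leRHS]mulrA; apply: ler_wpM2l; first exact: exprn_ge0.
have [cx|cx] := ltP (sqdist a x) (rho ^+ 2); last first.
  rewrite !prof_out// !(mulr0, mul0r, addr0, subr0) normr0.
  apply: mulr_ge0; last by rewrite indicE ler0n.
  by apply: mulr_ge0; [rewrite /lapC addr_ge0// mulr_ge0|exact: exprn_ge0].
rewrite indicE mem_set; last by apply: sqdist_cube => //; exact: ltW.
rewrite mulr1; have su : rho^-1 ^+ 2 * sqdist a x <= 1.
  by rewrite exprVn ler_pdivrMl ?exprn_gt0// mulr1 ltW.
have s0 := sqdist_ge0 a x.
have f2 := flat_ge0 2 (1 - rho^-1 ^+ 2 * sqdist a x); have g2 := flat_le 2 (1 - rho^-1 ^+ 2 * sqdist a x).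
have f3 := flat_ge0 3 (1 - rho^-1 ^+ 2 * sqdist a x); have g3 := flat_le 3 (1 - rho^-1 ^+ 2 * sqdist a x).
have f4 := flat_ge0 4 (1 - rho^-1 ^+ 2 * sqdist a x); have g4 := flat_le 4 (1 - rho^-1 ^+ 2 * sqdist a x).
have p0 : 0 <= rho^-1 ^+ 2 by exact: exprn_ge0.
exact: lapl_arith.
Qed.

Lemma kerK_ge0 rho a x : 0 < rho -> 0 <= kerK rho a x.
Proof.
by move=> r0; rewrite !mulr_ge0// ?flat_ge0// exprn_ge0// invr_ge0 ltW.
Qed.

Lemma kerK_le rho a x : 0 < rho -> kerK rho a x <= 4 * rho^-1 ^+ n.+1 * \1_(cube a rho) x.
Proof.
move=> r0; rewrite /kerK -!mulrA (_ : 4 = 2 * 2 :> R); last by rewrite -natrM.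
rewrite -[leRHS]mulrA ler_wpM2l// [leRHS]mulrCA ler_wpM2l ?exprn_ge0 ?invr_ge0 ?(ltW r0)//.
exact: prof_le.
Qed.

Lemma kerL_ge0 rho a x : 0 < rho -> 0 <= kerL rho a x.
Proof.
by move=> r0; rewrite mulr_ge0// ?flat_ge0// exprn_ge0// invr_ge0 ltW.
Qed.

Lemma Int_cube a r : 0 <= r -> Int (\1_(cube a r)).
Proof.
move=> r0; have mc := measurable_cube a r.
apply/integrableP; split; first exact/measurable_EFinP/measurable_indic.
under eq_integral do rewrite /= ger0_norm//.
rewrite integral_indic// setIT.
have := lam_cube a r0; rewrite /lam => ->.
exact: ltry.
Qed.

Lemma I_cube a r : 0 <= r -> I (\1_(cube a r)) = (2 * r) ^+ n.+1.
Proof.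
move=> r0; have mc := measurable_cube a r.
apply: EFin_inj; rewrite -(IE (Int_cube a r0)) integral_indic// setIT.
exact: lam_cube.
Qed.

(** The factor rho matters: integrated over radii it produces the error r'^2 - r^2 in the
    monotonicity of averages. *)
Lemma I_kerL rho a : 0 < rho -> cube a rho `<=` Omega -> I (kerL rho a) <= 2 ^+ n.+1 * rho.
Proof.
move=> r0 aO; have rN0 : rho != 0 by rewrite gt_eqF.
have Ic := Int_cube a (ltW r0).
have -> : 2 ^+ n.+1 * rho = I (fun x => rho^-1 ^+ n * \1_(cube a rho) x).
  rewrite (IZ _ Ic) (I_cube _ (ltW r0)) exprMn [rho ^+ n.+1]exprSr.
  have E : rho^-1 ^+ n * rho ^+ n = 1 by rewrite -exprMn mulVf// expr1n.
  by rewrite -[LHS]mul1r -E; ring.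
apply: le_I; [exact: (test_Int M0 OM (test_kerL r0 aO))|exact: IntZ|move=> x].
rewrite /kerL ler_wpM2l ?exprn_ge0 ?invr_ge0 ?(ltW r0)//.
by have := prof_le 0 a x r0; rewrite fact0 mul1r.
Qed.

End kernel_bounds.

Section weighted_averages.
Context {R : realType} {n : nat}.
Variables (Omega : set 'rV[R]_n.+1) (M : R) (M0 : 0 < M) (OM : Omega `<=` cube 0 M).
Implicit Types (a x : 'rV[R]_n.+1) (i j : 'I_n.+1) (k : nat) (c rho : R) (t : 'rV[R]_n.+1 -> R).
Local Notation test := (test_function Omega).
Local Notation mu := (lam n.+1).
Local Notation Int := (rintegrable mu).
Local Notation I := (rint mu).
Local Notation H10 := (H10 Omega).
Local Notation "\1_ A" := (\1_A : 'rV[R]_n.+1 -> R).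

Definition locInt t := measurable_fun setT t /\ forall a r, 0 <= r -> Int (fun x => t x * \1_(cube a r) x).

Lemma locInt_cst c : locInt (fun=> c).
Proof. by split => // a r r0; apply: IntZ; exact: Int_cube. Qed.

Lemma Int_locInt t : Int t -> locInt t.
Proof.
move=> It; split; first exact: Int_meas It.
move=> a r r0; apply: (Int_dom _ (IntAbs It)).
  apply: measurable_funM; first exact: Int_meas It.
  by apply: measurable_indic; exact: measurable_cube.
by apply: aeW => x; rewrite normrM ler_piMr// indicE; case: (_ \in _); rewrite ?normr0 ?normr1.
Qed.

Lemma locInt_mul t (F : 'rV[R]_n.+1 -> R) a r C : locInt t -> 0 <= r -> measurable_fun setT F ->
  (forall x, `|F x| <= C * \1_(cube a r) x) -> Int (fun x => t x * F x).
Proof.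
move=> [mt It] r0 mF FC; apply: (Int_dom _ (IntZ C (IntAbs (It a r r0)))).
  exact: measurable_funM.
apply: aeW => x; rewrite normrM (le_trans (ler_wpM2l (normr_ge0 _) (FC x)))//.
by rewrite mulrCA normrM (ger0_norm (_ : 0 <= \1_(cube a r) x))// indicE ler0n.
Qed.

Lemma test_laplacian phi : test phi -> test (laplacian phi).
Proof.
move=> tp; rewrite /laplacian; elim: (index_enum _) => [|j s IH].
  have -> : (fun x => \sum_(i <- [::]) partial i (partial i phi) x) = cst 0.
    by apply/funext => x; rewrite big_nil.
  exact: test0.
have -> : (fun x => \sum_(i <- j :: s) partial i (partial i phi) x) =
    partial j (partial j phi) \+ (fun x => \sum_(i <- s) partial i (partial i phi) x).
  by apply/funext => x; rewrite big_cons.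
by apply: testD => //; do 2 apply: test_partial.
Qed.

Lemma measurable_kerK rho a : measurable_fun setT (kerK rho a).
Proof.
apply: measurable_funM => //; apply: measurable_funM => //.
by apply: continuous_measurable; exact: continuous_prof.
Qed.

Lemma Int_kerK t rho a : locInt t -> 0 < rho -> Int (fun x => t x * kerK rho a x).
Proof.
move=> lt r0; apply: (@locInt_mul _ _ a rho (4 * rho^-1 ^+ n.+1) lt (ltW r0)).
  exact: measurable_kerK.
by move=> x; rewrite ger0_norm ?kerK_ge0//; exact: kerK_le.
Qed.

Lemma is_derive_of_cvg (F : R -> R) (y l : R) :
  h^-1 *: (F (h + y) - F y) @[h --> 0^'] --> l -> is_derive y 1 F l.
Proof.
move=> c; have c' : h^-1 *: ((F \o shift y) (h *: 1) - F y) @[h --> 0^'] --> l.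
  rewrite (_ : (fun h => _) = (fun h => h^-1 *: (F (h + y) - F y)))//.
  by apply/funext => h; rewrite /= -[h *: 1]/(h * 1) mulr1.
by apply: DeriveDef; [apply/cvg_ex; exists l|exact: (cvg_lim (@Rhausdorff R) c')].
Qed.

Lemma is_derive_avg t a rho : locInt t -> 0 < rho ->
  is_derive rho 1 (fun r => I (fun x => t x * kerK r a x))
    (I (fun x => t x * laplacian (kerL rho a) x)).
Proof.
move=> lt r0; have [mt It] := lt.
(* On the window between rho/2 and 2 rho the constant [C] and the cube of radius [v] bound all
   Laplacians at once, which permits differentiation under the integral. *)
pose u := rho / 2; pose v := 2 * rho.
have u0 : 0 < u by rewrite divr_gt0.
have Irho : `]u, v[%classic rho by rewrite /= in_itv /= /u /v; apply/andP; split; lra.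
have Ipos r : `]u, v[%classic r -> 0 < r by rewrite /= in_itv /= => /andP[/(lt_trans u0)].
pose C : R := u^-1 ^+ n * (lapC n * u^-1 ^+ 2).
have iv : 0 <= v by rewrite /v mulr_ge0// ltW.
pose g := fun x => C * `|t x * \1_(cube a v) x|.
have C0 : 0 <= C.
  have ui : 0 <= u^-1 by rewrite invr_ge0 ltW.
  by rewrite /C mulr_ge0 ?exprn_ge0// mulr_ge0 ?exprn_ge0// /lapC addr_ge0// mulr_ge0.
have d (r : R) x : 0 < r -> is_derive r 1 (fun r => t x * kerK r a x) (t x * laplacian (kerL r a) x).
  by move=> rr; exact: (is_deriveZ (t x) (is_derive_kerK a x rr)).
have h1 : forall r, `]u, v[%classic r -> mu.-integrable setT (EFin \o (fun x => t x * kerK r a x)).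
  by move=> r /Ipos rr; exact: Int_kerK.
have h2 : forall r x, `]u, v[%classic r -> setT x -> derivable (fun r => t x * kerK r a x) r 1.
  by move=> r x /Ipos rr _; have [] := d r x rr.
have h3 : forall x, 0 <= g x by move=> x; rewrite mulr_ge0.
have h4 : mu.-integrable setT (EFin \o g) by exact: IntZ (IntAbs (It a v iv)).
have h5 : forall r x, `]u, v[%classic r -> setT x -> `|partial1of2 (fun r x => t x * kerK r a x) r x| <= g x.
  move=> r x Ir _; have rr := Ipos r Ir; rewrite partial1of2E.
  have [_ ->] := d r x rr; rewrite normrM /g normrM mulrCA ler_wpM2l//.
  apply: le_trans (laplacian_kerL_bound a x rr) _.
  move: Ir; rewrite /= in_itv /= => /andP[ur rv].
  have ri : r^-1 <= u^-1 by rewrite lef_pV2 ?posrE// ltW.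
  have r0' : 0 <= r^-1 by rewrite invr_ge0 ltW.
  have l0 : 0 <= lapC n :> R by rewrite /lapC addr_ge0// mulr_ge0.
  apply: ler_pM.
  - by rewrite mulr_ge0 ?exprn_ge0// mulr_ge0 ?exprn_ge0.
  - by rewrite indicE ler0n.
  - rewrite /C; apply: ler_pM; rewrite ?exprn_ge0 ?mulr_ge0 ?exprn_ge0//.
      by apply: lerXn2r; rewrite ?nnegrE// (le_trans r0').
    by apply: ler_wpM2l => //; apply: lerXn2r; rewrite ?nnegrE// (le_trans r0').
  rewrite ger0_norm; last by rewrite indicE ler0n.
  rewrite !indicE ler_nat; case: (boolP (x \in cube a r)) => // /set_mem cx.
  rewrite mem_set// => i; have := cx i; have := ltW rv; move: (x 0 i) (a 0 i) => b e.
  by move=> q /andP[]; lra.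
have EL : \int[mu]_y partial1of2 (fun r x => t x * kerK r a x) rho y =
    I (fun x => t x * laplacian (kerL rho a) x).
  by congr (rint _); apply/funext => x; rewrite partial1of2E; have [_ ->] := d rho x r0.
rewrite -EL; apply: is_derive_of_cvg.
exact: (@cvg_differentiation_under_integral R _ _ mu (fun r x => t x * kerK r a x) setT measurableT
  rho u v Irho h1 h2 g h3 h4 h5).
Qed.

(** By the mean value theorem the increment is at most C y (r' - r) for some y <= r', and y <= r' +
    r. *)
Lemma avg_mono t a s C : locInt t -> 0 <= C ->
  (forall r, 0 < r -> r < s -> I (fun x => t x * laplacian (kerL r a) x) <= C * r) ->
  forall r r', 0 < r -> r <= r' -> r' < s ->
    I (fun x => t x * kerK r' a x) - I (fun x => t x * kerK r a x) <= C * (r' ^+ 2 - r ^+ 2).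
Proof.
move=> lt C0 HC r r' r0 rr' r's.
pose F r := I (fun x => t x * kerK r a x).
have dF (y : R) : 0 < y -> is_derive y 1 F (I (fun x => t x * laplacian (kerL y a) x)).
  by move=> y0; exact: is_derive_avg.
have cF : {within `[r, r'], continuous F}.
  apply: derivable_within_continuous => y; rewrite in_itv /= => /andP[ry _].
  by have [] := dF y (lt_le_trans r0 ry).
have dF' (y : R) : y \in `]r, r'[ -> is_derive y 1 F (I (fun x => t x * laplacian (kerL y a) x)).
  by rewrite in_itv /= => /andP[ry _]; apply: dF; exact: lt_trans ry.
have [y] := MVT_segment rr' dF' cF.
rewrite in_itv /= => /andP[ry yr'].
rewrite -/(F r') -/(F r) => ->.
have y0 := lt_le_trans r0 ry.
apply: le_trans (_ : C * y * (r' - r) <= _).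
  by rewrite ler_wpM2r ?subr_ge0// HC// (le_lt_trans yr').
rewrite -mulrA ler_wpM2l// subr_sqr mulrC ler_wpM2l ?subr_ge0//.
by lra.
Qed.

Lemma H10_lap u G phi : H10 u G -> test phi ->
  I (fun x => u x * laplacian phi x) = - \sum_i I (fun x => G i x * partial i phi x).
Proof.
move=> uG tp; have Lu := H10_L2 uG.
have E i : I (fun x => u x * partial i (partial i phi) x) = - I (fun x => G i x * partial i phi x).
  by rewrite (H10_ibp M0 OM i uG (test_partial i tp)) opprK.
rewrite -sumrN -(eq_bigr _ (fun i _ => E i)) -I_sum.
  by congr rint; apply/funext => x; rewrite /laplacian mulr_sumr.
by move=> i; apply: L2_mul => //; apply: (test_L2 M0 OM); do 2 apply: test_partial.
Qed.

Lemma test_I_laplacian phi : test phi -> I (laplacian phi) = 0.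
Proof.
move=> tp; rewrite /laplacian I_sum; last first.
  by move=> i; apply: (test_Int M0 OM); do 2 apply: test_partial.
by rewrite big1// => i _; apply: (test_I_partial M0 OM); exact: test_partial.
Qed.

End weighted_averages.

Section kernel_averages.
Context {R : realType} {n : nat}.
Implicit Types (a x y : 'rV[R]_n.+1) (k : nat) (c rho r : R) (u v t : 'rV[R]_n.+1 -> R).
Local Notation mu := (lam n.+1).
Local Notation Int := (rintegrable mu).
Local Notation I := (rint mu).
Local Notation "\1_ A" := (\1_A : 'rV[R]_n.+1 -> R).

Definition avg u rho x := I (fun y => u y * kerK rho x y).

Lemma cube_in0 a r : cube a r `<=` cube 0 (`|a| + r).
Proof.
move=> x ax i; rewrite mxE; have := ax i; have := coord_le_norm a i; rewrite ler_norml.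
by move: (x 0 i) (a 0 i) (`|a|) => p q s; lra.
Qed.

Lemma lap_kerL0 r a : 0 < r -> I (laplacian (kerL r a)) = 0.
Proof.
move=> r0; have M0 : 0 < `|a| + r by rewrite ltr_wpDl.
by apply: (test_I_laplacian M0 (@cube_in0 a r)); exact: test_kerL.
Qed.

Lemma Int_kerK1 r a : 0 < r -> Int (kerK r a).
Proof.
move=> r0; have := Int_kerK a (@locInt_cst R n 1) r0.
by congr rintegrable; apply/funext => x; rewrite mul1r.
Qed.

(** [lap_kerL0] makes the Laplacian integral vanish for constant functions, so [avg_mono] applies
    with bound 0 to both 1 and -1. *)
Lemma I_kerK_mono r r' a : 0 < r -> r <= r' -> I (kerK r a) = I (kerK r' a).
Proof.
move=> r0 rr'; have r'0 := lt_le_trans r0 rr'.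
have H c : c * I (kerK r' a) - c * I (kerK r a) <= 0.
  have := @avg_mono R n (fun=> c) a (r' + 1) 0 (@locInt_cst R n c) (lexx 0) _ r r' r0 rr' _.
  have e1 := IZ c (Int_kerK1 a r'0); have e2 := IZ c (Int_kerK1 a r0).
  rewrite e1 e2 mul0r; apply; last by rewrite ltrDl.
  move=> s s0 _; rewrite mul0r (_ : rint _ _ = c * I (laplacian (kerL s a))).
    by rewrite lap_kerL0// mulr0.
  rewrite -IZ//.
  have M0 : 0 < `|a| + s by rewrite ltr_wpDl.
  apply: (test_Int M0 (@cube_in0 a s)); apply: test_laplacian; exact: test_kerL.
have := H 1; have := H (-1); move: (I _) (I _) => p q; lra.
Qed.

Lemma kerK_trans r a x : kerK r a (x + a) = kerK r 0 x.
Proof.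
rewrite /kerK /prof (_ : sqdist a (x + a) = sqdist 0 x)// /sqdist.
by apply: eq_bigr => j _; rewrite /diffc !mxE addrK subr0.
Qed.

(** The kernels are not normalized, so averages of u converge to [mass] times u. *)
Definition mass : R := I (kerK 1 0).

Lemma I_kerK r a : 0 < r -> I (kerK r a) = mass.
Proof.
move=> r0; have E1 : I (kerK r 0) = mass.
  have [r1|/ltW r1] := leP r 1; first exact: I_kerK_mono.
  by rewrite /mass (I_kerK_mono 0 ltr01 r1).
rewrite -E1; apply: EFin_inj.
apply: etrans (esym (IE (Int_kerK1 a r0))) _; apply: etrans _ (IE (Int_kerK1 0 r0)).
rewrite -(@lam_translation R n.+1 a).
- by apply: eq_integral => x _; rewrite kerK_trans.
- by apply/measurable_EFinP; exact: measurable_kerK.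
- by move=> x; rewrite lee_fin kerK_ge0.
Qed.

(** In the cube of radius theta rho the squared distance is at most rho^2 / 2, so the argument of
    the profile lies in [1/2, 1], where [flat 2] is at least exp(-2); this gives [kap]. *)
Definition theta : R := (2 * n.+1%:R)^-1.
Definition kap : R := 2 * expR (- 2).

Lemma theta_gt0 : 0 < theta.
Proof. by rewrite invr_gt0 mulr_gt0. Qed.
Lemma kap_gt0 : 0 < kap.
Proof. by rewrite mulr_gt0 ?expR_gt0. Qed.

Lemma kerK_lower rho a x : 0 < rho -> cube a (theta * rho) x -> kap * rho^-1 ^+ n.+1 <= kerK rho a x.
Proof.
move=> r0 cx; have th0 := theta_gt0.
have sq : sqdist a x <= n.+1%:R * (theta * rho) ^+ 2.
  rewrite -[X in X%:R](card_ord n.+1) -sum1_card natr_sum mulr_suml; apply: ler_sum => j _.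
  rewrite mul1r -[diffc _ _ _ ^+ 2]real_normK ?num_real// ler_pXn2r ?nnegrE ?mulr_ge0 ?(ltW r0) ?(ltW th0)//.
  by have := cx j; rewrite /diffc ler_norml; move: (x 0 j) (a 0 j) (theta * rho) => p q s; lra.
have n1 : 1 <= n.+1%:R :> R by rewrite ler1n.
have thn : n.+1%:R * theta = 2^-1.
  by rewrite /theta invfM mulrCA mulfV ?mulr1// gt_eqF// ltr0n.
have th1 : theta <= 2^-1 by rewrite -thn ler_peMl// ltW.
have s2 : rho^-1 ^+ 2 * sqdist a x <= 2^-1.
  rewrite exprVn ler_pdivrMl ?exprn_gt0//; apply: (le_trans sq).
  have r2 : 0 <= rho ^+ 2 by exact: sqr_ge0.
  have -> : n.+1%:R * (theta * rho) ^+ 2 = (n.+1%:R * theta) * (theta * rho ^+ 2) by ring.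
  by rewrite thn; move: (rho ^+ 2) r2 theta th1 th0 => p p0 q q1 q0; nra.
have s0 : 0 <= rho^-1 ^+ 2 * sqdist a x by rewrite mulr_ge0 ?sqdist_ge0// exprn_ge0// invr_ge0 ltW.
rewrite /kerK /kap -mulrA; apply: ler_wpM2l => //.
rewrite mulrC; apply: ler_wpM2l; first by rewrite exprn_ge0// invr_ge0 ltW.
rewrite /prof /flat; set s := 1 - _.
have sh : 2^-1 <= s <= 1 by rewrite /s; apply/andP; split; lra.
have [s_ s1] := andP sh; have sp : 0 < s by rewrite (lt_le_trans _ s_).
rewrite sp -[leLHS]mul1r; apply: ler_pM; [by []|exact: expR_ge0| |].
  by apply: exprn_ege1; rewrite invf_ge1.
by rewrite ler_expR lerN2 -[leRHS]invrK lef_pV2 ?posrE.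
Qed.

Lemma mass_gt0 : 0 < mass.
Proof.
have t0 := theta_gt0; have k0 := kap_gt0.
have Ic := Int_cube (0 : 'rV[R]_n.+1) (ltW t0).
apply: lt_le_trans (_ : I (fun x => kap * \1_(cube 0 theta) x) <= _).
  by rewrite (IZ _ Ic) (I_cube _ (ltW t0)) mulr_gt0// exprn_gt0// mulr_gt0.
apply: le_I; [exact: IntZ|exact: Int_kerK1|move=> x].
rewrite indicE; case: (boolP (x \in _)) => [/set_mem cx|_]; last by rewrite mulr0 kerK_ge0.
have := @kerK_lower 1 0 x ltr01; rewrite mulr1 invr1 expr1n !mulr1; exact.
Qed.

Lemma locIntB v c : locInt v -> locInt (fun x => v x - c).
Proof.
move=> [mv Iv]; split; first exact: measurable_funB.
move=> a r r0; have := IntB (Iv a r r0) (IntZ c (Int_cube a r0)).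
by congr rintegrable; apply/funext => x; rewrite mulrBl.
Qed.

Lemma locIntAbs v : locInt v -> locInt (fun x => `|v x|).
Proof.
move=> [mv Iv]; split; first exact: measurableT_comp.
move=> a r r0; have := IntAbs (Iv a r r0).
congr rintegrable; apply/funext => x; rewrite normrM (ger0_norm (_ : 0 <= \1_(cube a r) x))//.
Qed.

Lemma lpt_I v a c : locInt v -> lpt v a c <-> forall e, 0 < e -> exists2 d, 0 < d &
  forall r, 0 < r < d -> I (fun x => `|v x - c| * \1_(cube a r) x) <= e * r ^+ n.+1.
Proof.
move=> lv; have [_ Iv] := locIntAbs (locIntB c lv).
suff E r : 0 <= r -> (\int[lam n.+1]_(y in cube a r) (`|v y - c|)%:E)%E =
    (I (fun x => `|v x - c| * \1_(cube a r) x))%:E.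
  split => H e e0; have [d d0 Hd] := H e e0; exists d => // r rd; have := Hd r rd;
    have r0 : 0 <= r by case/andP: rd => /ltW.
    by rewrite E// lee_fin.
  by rewrite E// lee_fin.
move=> r0; transitivity (\int[mu]_x (`|v x - c| * \1_(cube a r) x)%:E)%E; last exact: (IE (Iv a r r0)).
rewrite integral_mkcond; apply: eq_integral => x _ /=.
by rewrite patchE indicE; case: (_ \in _); rewrite ?mulr1 ?mulr0.
Qed.

Lemma lpt_avg v a c : locInt v -> lpt v a c -> forall e, 0 < e -> exists2 d, 0 < d &
  forall r, 0 < r < d -> `|avg v r a - c * mass| <= e.
Proof.
move=> lv /(lpt_I _ _ lv) H e e0; have e4 : 0 < e / 4 by rewrite divr_gt0.
have [d d0 Hd] := H _ e4; exists d => // r rd; have /andP[r0 _] := rd.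
have lvc := locIntB c lv; have [_ Iv] := locIntAbs lvc.
have E : avg v r a - c * mass = I (fun x => (v x - c) * kerK r a x).
  rewrite -(I_kerK a r0) -(IZ c (Int_kerK1 a r0)) /avg -IB; [|exact: Int_kerK|exact/IntZ/Int_kerK1].
  by congr rint; apply/funext => x; rewrite mulrBl.
have Ir := Iv a r (ltW r0).
rewrite E; apply: le_trans (ler_norm_I (Int_kerK a lvc r0)) _.
apply: le_trans (_ : I (fun x => 4 * r^-1 ^+ n.+1 * (`|v x - c| * \1_(cube a r) x)) <= _).
  apply: le_I; [exact: IntAbs (Int_kerK a lvc r0)|exact: IntZ|move=> x].
  rewrite normrM (ger0_norm (kerK_ge0 a x r0)) [leRHS]mulrCA ler_wpM2l//.
  exact: kerK_le.
rewrite (IZ _ Ir); apply: le_trans (ler_wpM2l _ (Hd r rd)) _.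
  by rewrite mulr_ge0// exprn_ge0// invr_ge0 ltW.
have rN : r ^+ n.+1 != 0 by rewrite gt_eqF// exprn_gt0.
have rE : r^-1 ^+ n.+1 * r ^+ n.+1 = 1 by rewrite -exprMn mulVf ?expr1n// gt_eqF.
move: (r^-1 ^+ n.+1) (r ^+ n.+1) rE => p q pq.
have -> : 4 * p * (e / 4 * q) = e * (p * q) by field.
by rewrite pq mulr1.
Qed.

(** On the cube of radius r the kernel of radius r / theta is bounded below by [kerK_lower], so
    kernel averages control cube averages. *)
Lemma avg_lpt v a c : locInt v -> (forall e, 0 < e -> exists2 d, 0 < d &
  forall r, 0 < r < d -> I (fun x => `|v x - c| * kerK r a x) <= e) -> lpt v a c.
Proof.
move=> lv H; apply/(lpt_I _ _ lv) => e e0.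
have t0 := theta_gt0; have k0 := kap_gt0.
have e1 : 0 < e * kap * theta ^+ n.+1 by rewrite !mulr_gt0// exprn_gt0.
have [d d0 Hd] := H _ e1; exists (theta * d); first by rewrite mulr_gt0.
move=> r /andP[r0 rd]; pose s := r / theta.
have s0 : 0 < s by rewrite divr_gt0.
have sd : s < d by rewrite ltr_pdivrMr// mulrC.
have ts : theta * s = r by rewrite /s mulrCA divff ?mulr1// gt_eqF.
clearbody s.
have lvc := locIntAbs (locIntB c lv); have [_ Iv] := lvc.
have sN : s ^+ n.+1 != 0 by rewrite gt_eqF// exprn_gt0.
apply: le_trans (_ : I (fun x => kap^-1 * s ^+ n.+1 * (`|v x - c| * kerK s a x)) <= _).
  apply: le_I; [exact: Iv (ltW r0)|exact: IntZ (Int_kerK a lvc s0)|move=> x].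
  rewrite [leRHS]mulrCA ler_wpM2l// indicE.
  case: (boolP (x \in _)) => [/set_mem cx|_]; last first.
    by rewrite mulr_ge0 ?kerK_ge0// mulr_ge0 ?exprn_ge0 ?invr_ge0 ?(ltW s0) ?(ltW k0).
  rewrite -mulrA -ler_pdivrMl ?invr_gt0// invrK mulr1 mulrC -ler_pdivrMr ?exprn_gt0//.
  by rewrite -exprVn; apply: kerK_lower; rewrite ?ts.
rewrite (IZ _ (Int_kerK a lvc s0)); apply: le_trans (ler_wpM2l _ (Hd s _)) _.
- by rewrite mulr_ge0 ?exprn_ge0 ?invr_ge0 ?(ltW s0) ?(ltW k0).
- by rewrite s0.
- have kN : kap != 0 by rewrite gt_eqF.
  rewrite -ts exprMn; move: (s ^+ n.+1) (theta ^+ n.+1) => p q.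
  by rewrite [leLHS](_ : _ = e * (q * p))//; field.
Qed.

End kernel_averages.

Section average_estimates.
Context {R : realType} {n : nat}.
Implicit Types (a x y : 'rV[R]_n.+1) (k : nat) (c rho r : R) (u v t : 'rV[R]_n.+1 -> R).
Local Notation mu := (lam n.+1).
Local Notation Int := (rintegrable mu).
Local Notation I := (rint mu).
Local Notation L2 := (L2 mu).
Local Notation mass := (@mass R n).
Local Notation "\1_ A" := (\1_A : 'rV[R]_n.+1 -> R).

Lemma flat2_lip (s t : R) : `|flat 2 s - flat 2 t| <= 36 * `|s - t|.
Proof.
apply: (lipschitz_of_derive (is_derive_flat 2)) => z.
have f3 := flat_ge0 3 z; have g3 := flat_le 3 z; have f4 := flat_ge0 4 z; have g4 := flat_le 4 z.
rewrite (_ : 3`!%:R = 6 :> R)// in g3; rewrite (_ : 4`!%:R = 24 :> R)// in g4.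
by rewrite ler_norml; move: (flat 3 z) (flat 4 z) f3 g3 f4 g4 => p q *; apply/andP; split; lra.
Qed.

(** A Lipschitz constant of the kernel in its center: 36 = 2 * 3! + 4! bounds the derivative of
    [flat 2], and (n + 1) (2 rho + 3) bounds the variation of the squared distance when the center
    moves by at most 1. *)
Definition lipK rho : R := 2 * (rho^-1 ^+ n.+1 * (36 * (rho^-1 ^+ 2 * (n.+1%:R * (2 * rho + 3))))).

Lemma kerK_lip rho x x' y d : 0 < rho -> 0 <= d <= 1 -> cube x d x' ->
  `|kerK rho x y - kerK rho x' y| <= lipK rho * d.
Proof.
move=> r0 /andP[d0 d1] xx'; have u0 : 0 <= rho^-1 by rewrite invr_ge0 ltW.
have L0 : 0 <= lipK rho * d.
  rewrite mulr_ge0// mulr_ge0// mulr_ge0 ?exprn_ge0// mulr_ge0// mulr_ge0 ?exprn_ge0//.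
  by rewrite mulr_ge0// addr_ge0// mulr_ge0// ltW.
have [cy|cy] := pselect (cube x (rho + 1) y); last first.
  have z1 : ~ cube x rho y.
    by apply: contra_not cy => H i; have := H i; move: (x 0 i) (y 0 i) => p q /andP[]; lra.
  have z2 : ~ cube x' rho y.
    apply: contra_not cy => H i; have := H i; have := xx' i.
    by move: (x 0 i) (y 0 i) (x' 0 i) => p q s /andP[? ?] /andP[]; lra.
  by rewrite /kerK !prof_cube// !mulr0 subrr normr0.
have sq : `|sqdist x y - sqdist x' y| <= n.+1%:R * (2 * rho + 3) * d.
  rewrite /sqdist -sumrB; apply: le_trans (ler_norm_sum _ _ _) _.
  rewrite -[X in X%:R](card_ord n.+1) -sum1_card natr_sum !mulr_suml; apply: ler_sum => j _.
  rewrite mul1r /diffc (_ : _ - _ = (2 * y 0 j - x 0 j - x' 0 j) * (x' 0 j - x 0 j)); last by ring.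
  rewrite normrM; have := cy j; have := xx' j.
  move: (x 0 j) (y 0 j) (x' 0 j) => p q s h1 h2.
  apply: ler_pM => //; rewrite ler_norml; move: h1 h2 => /andP[? ?] /andP[? ?]; apply/andP; split; lra.
rewrite /kerK /prof -mulrBr -mulrBr normrM ger0_norm// normrM ger0_norm ?exprn_ge0//.
have -> : lipK rho * d = 2 * (rho^-1 ^+ n.+1 * (36 * (rho^-1 ^+ 2 * (n.+1%:R * (2 * rho + 3) * d)))).
  by rewrite /lipK; ring.
apply: ler_wpM2l => //; apply: ler_wpM2l; first exact: exprn_ge0.
apply: (le_trans (flat2_lip _ _)); apply: ler_wpM2l => //.
rewrite (_ : _ - _ = rho^-1 ^+ 2 * (sqdist x' y - sqdist x y)); last by ring.
rewrite normrM distrC ger0_norm; last exact: exprn_ge0.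
by apply: ler_wpM2l => //; exact: exprn_ge0.
Qed.

Lemma avg_lip u rho x x' d : Int u -> 0 < rho -> 0 <= d <= 1 -> cube x d x' ->
  `|avg u rho x - avg u rho x'| <= lipK rho * d * I (fun y => `|u y|).
Proof.
move=> Iu r0 d01 xx'; have lu := Int_locInt Iu.
have I1 := Int_kerK x lu r0; have I2 := Int_kerK x' lu r0.
rewrite /avg -(IB I1 I2) -(IZ _ (IntAbs Iu)).
apply: le_trans (ler_norm_I (IntB I1 I2)) _.
apply: le_I; [exact: IntAbs (IntB I1 I2)|exact: IntZ (IntAbs Iu)|move=> y].
by rewrite -mulrBr normrM mulrC ler_wpM2r// kerK_lip.
Qed.

Lemma avg_near u rho x e : Int u -> 0 < rho -> 0 < e ->
  exists2 d, 0 < d & forall x', cube x d x' -> `|avg u rho x - avg u rho x'| <= e.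
Proof.
move=> Iu r0 e0; set A := I (fun y => `|u y|).
have A0 : 0 <= A by apply: I_ge0 => y.
have L0 : 0 <= lipK rho.
  have u0 : 0 <= rho^-1 by rewrite invr_ge0 ltW.
  rewrite mulr_ge0// mulr_ge0 ?exprn_ge0// mulr_ge0// mulr_ge0 ?exprn_ge0//.
  by rewrite mulr_ge0// addr_ge0// mulr_ge0// ltW.
pose D := lipK rho * A + 1.
have D0 : 0 < D by rewrite ltr_wpDl// mulr_ge0.
exists (Num.min 1 (e / D)); first by rewrite lt_min ltr01 divr_gt0.
set d := Num.min _ _ => x' xx'.
have d01 : 0 <= d <= 1 by rewrite /d ge_min lexx/= andbT le_min ler01 divr_ge0// ltW.
apply: le_trans (avg_lip Iu r0 d01 xx') _; rewrite -/A.
have dD : d * D <= e by rewrite -ler_pdivlMr// /d ge_min lexx orbT.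
apply: le_trans dD; rewrite /D mulrDr mulr1 mulrAC mulrC.
by have /andP[d0 _] := d01; rewrite lerDl.
Qed.

Lemma measurable_avg u rho : Int u -> 0 < rho -> measurable_fun setT (avg u rho).
Proof.
move=> Iu r0; apply: continuous_measurable.
suff H (x : 'rV[R]_n.+1) : avg u rho y @[y --> x] --> avg u rho x by exact: H.
apply/(@cvgrPdist_le _ _ _ (nbhs x) (nbhs_filter x)) => e e0.
have [d d0 Hd] := avg_near x Iu r0 e0.
have : nbhs x (ball x d) by exact: nbhsx_ballx.
apply: filterS => x' xx'; apply: Hd => i; have := coord_le_norm (x - x') i.
have : `|x - x'| < d by move: xx'; rewrite -ball_normE.
rewrite !mxE => h1 h2; have := le_lt_trans h2 h1.
by rewrite ltr_norml; move: (x 0 i) (x' 0 i) => p q /andP[]; lra.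
Qed.

Lemma sqdistC x y : sqdist x y = sqdist y x.
Proof. by apply: eq_bigr => j _; rewrite /diffc -sqrrN opprB. Qed.

Lemma kerKC rho x y : kerK rho x y = kerK rho y x.
Proof. by rewrite /kerK /prof sqdistC. Qed.

Lemma measurable_kerK2 rho :
  measurable_fun setT (fun p : 'rV[R]_n.+1 * 'rV[R]_n.+1 => kerK rho p.1 p.2).
Proof.
apply: measurable_funM => //; apply: measurable_funM => //.
have mf : measurable_fun setT (flat 2 : R -> R).
  by apply: measurable_realfun.continuous_measurable_fun; exact: continuous_flat.
apply: (measurableT_comp mf); apply: measurable_funB => //; apply: measurable_funM => //.
apply: measurable_sum => j; apply: measurable_funX; apply: measurable_funB.
  exact: measurableT_comp (measurable_rV_coord j) (@measurable_snd _ _ _ _).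
exact: measurableT_comp (measurable_rV_coord j) (@measurable_fst _ _ _ _).
Qed.

(** The kernel is symmetric in its center and its variable, so Tonelli integrates out the center and
    leaves [mass]. *)
Lemma avg_L1 u rho : Int u -> 0 < rho ->
  Int (avg (fun y => `|u y|) rho) /\ I (avg (fun y => `|u y|) rho) = mass * I (fun y => `|u y|).
Proof.
move=> Iu r0; have mu_ := Int_meas Iu; have Iau := IntAbs Iu; have lau := Int_locInt Iau.
have a0 x : 0 <= avg (fun y => `|u y|) rho x.
  by apply: I_ge0 => y; rewrite mulr_ge0// kerK_ge0.
have E : (\int[mu]_x (avg (fun y => `|u y|) rho x)%:E = (mass * I (fun y => `|u y|))%:E)%E.
  transitivity (\int[mu]_x \int[mu]_y (`|u y| * kerK rho x y)%:E)%E.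
    by apply: eq_integral => x _; exact: (esym (IE (Int_kerK x lau r0))).
  have mF : measurable_fun setT (fun p : 'rV[R]_n.+1 * 'rV[R]_n.+1 => (`|u p.2| * kerK rho p.1 p.2)%:E).
    apply/measurable_EFinP; apply: measurable_funM; last exact: measurable_kerK2.
    apply: measurableT_comp => //.
    exact: measurableT_comp mu_ (@measurable_snd _ _ _ _).
  have F0 (p : 'rV[R]_n.+1 * 'rV[R]_n.+1) : (0 <= (`|u p.2| * kerK rho p.1 p.2)%:E)%E.
    by rewrite lee_fin mulr_ge0// kerK_ge0.
  rewrite (fubini_tonelli (m1 := mu) (m2 := mu) _ mF F0) /=.
  transitivity (\int[mu]_y (mass * `|u y|)%:E)%E.
    apply: eq_integral => y _; have Iy := Int_kerK1 y r0.
    transitivity (\int[mu]_x (`|u y| * kerK rho y x)%:E)%E.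
      by apply: eq_integral => x _; rewrite kerKC.
    apply: etrans (IE (IntZ _ Iy)) _; congr EFin.
    by rewrite (IZ _ Iy) I_kerK// mulrC.
  apply: etrans (IE (IntZ _ Iau)) _; congr EFin; exact: IZ.
have Ia : Int (avg (fun y => `|u y|) rho).
  apply/integrableP; split; first by apply/measurable_EFinP; exact: measurable_avg.
  rewrite (_ : (\int[mu]_x _)%E = (\int[mu]_x (avg (fun y => `|u y|) rho x)%:E)%E).
    by rewrite E; exact: ltry.
  by apply: eq_integral => x _; rewrite /= ger0_norm.
by split => //; apply: EFin_inj; rewrite -E; exact: (esym (IE Ia)).
Qed.

Lemma locIntBs u v : locInt u -> locInt v -> locInt (fun x => u x - v x).
Proof.
move=> [mu_ Iu] [mv Iv]; split; first exact: measurable_funB.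
move=> a r r0; have := IntB (Iu a r r0) (Iv a r r0).
by congr rintegrable; apply/funext => x; rewrite mulrBl.
Qed.

Lemma avgD u v rho x : locInt u -> locInt v -> 0 < rho ->
  avg (fun y => u y - v y) rho x = avg u rho x - avg v rho x.
Proof.
move=> lu lv r0; rewrite /avg -(IB (Int_kerK x lu r0) (Int_kerK x lv r0)).
by congr rint; apply/funext => y; rewrite mulrBl.
Qed.

Lemma avg_cst c rho x : 0 < rho -> avg (fun=> c) rho x = mass * c.
Proof. by move=> r0; rewrite /avg (IZ c (Int_kerK1 x r0)) I_kerK// mulrC. Qed.

Lemma avg_le_abs u rho x : locInt u -> 0 < rho -> `|avg u rho x| <= avg (fun y => `|u y|) rho x.
Proof.
move=> lu r0; apply: le_trans (ler_norm_I (Int_kerK x lu r0)) _.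
apply: le_I; [exact: IntAbs (Int_kerK x lu r0)|exact: Int_kerK x (locIntAbs lu) r0|move=> y].
by rewrite normrM (ger0_norm (kerK_ge0 x y r0)).
Qed.

Lemma avg_ae_le u v rho x : locInt u -> locInt v -> 0 < rho ->
  {ae mu, forall y, cube x rho y -> u y <= v y} -> avg u rho x <= avg v rho x.
Proof.
move=> lu lv r0 uv; apply: ae_le_I; [exact: Int_kerK|exact: Int_kerK|].
apply: filterS uv => y uvy; have [cy|cy] := pselect (cube x rho y).
  by rewrite ler_wpM2r ?kerK_ge0// uvy.
by rewrite /kerK prof_cube// !mulr0.
Qed.

Definition rk k : R := k.+1%:R^-1.
Lemma rk_gt0 k : 0 < rk k. Proof. by rewrite invr_gt0. Qed.
Lemma rk_le1 k : rk k <= 1. Proof. by rewrite invf_le1// ler1n. Qed.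
Lemma rk_small d : 0 < d -> exists K : nat, forall k, (K <= k)%N -> rk k < d.
Proof.
move=> d0; have := @near_infty_natSinv_lt R (PosNum d0) => -[K _ HK].
by exists K => k Kk; exact: HK.
Qed.

Section average_convergence.
Variables (Omega : set 'rV[R]_n.+1) (M : R) (M0 : 0 < M) (OM : Omega `<=` cube 0 M).
Local Notation test := (test_function Omega).
Local Notation H10 := (H10 Omega).

Lemma avg_test_cvg phi : test phi ->
  (forall k, Int (fun x => `|mass * phi x - avg phi (rk k) x|)) /\
  I (fun x => `|mass * phi x - avg phi (rk k) x|) @[k --> \oo] --> 0.
Proof.
move=> tp; have [B HB] := test_bounded tp; have Ip := test_Int M0 OM tp; have lp := Int_locInt Ip.
have B0 : 0 <= B by exact: le_trans (HB 0).
have m0 := @mass_gt0 R n; have M10 : 0 <= M + 1 by rewrite addr_ge0// ltW.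
have mA k : measurable_fun setT (fun x => `|mass * phi x - avg phi (rk k) x|).
  apply: measurableT_comp => //; apply: measurable_funB.
    by apply: measurable_funM => //; exact: Int_meas Ip.
  by apply: measurable_avg => //; exact: rk_gt0.
have bA k x : `|mass * phi x - avg phi (rk k) x| <= 2 * mass * B * \1_(cube 0 (M + 1)) x.
  have rk0 := rk_gt0 k; rewrite indicE.
  case: (boolP (x \in _)) => [_|/negP cx].
    rewrite mulr1 (le_trans (ler_normB _ _))// -mulrA mulr_natl mulr2n lerD//.
      by rewrite normrM gtr0_norm// ler_pM2l.
    apply: le_trans (avg_le_abs x lp rk0) _; rewrite -(avg_cst B x rk0).
    apply: (avg_ae_le (locIntAbs lp) (@locInt_cst R n B) rk0).
    by apply: aeW => y _.
  have out y : cube x (rk k) y -> phi y = 0.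
    move=> cy; apply: (test_out tp) => /OM oy; apply: cx; apply/mem_set => i.
    have := oy i; have := cy i; have := rk_le1 k; rewrite !mxE.
    by move: (x 0 i) (y 0 i) (rk k) => p q r ? /andP[? ?] /andP[]; lra.
  have xx : cube x (rk k) x by move=> i; move: (x 0 i) (rk k) rk0 => p q; lra.
  rewrite (out x xx) !mulr0 sub0r normrN /avg (_ : rint _ _ = 0) ?normr0//.
  rewrite -(I0 mu); congr rint; apply/funext => y.
  have [cy|cy] := pselect (cube x (rk k) y); first by rewrite out// mul0r.
  by rewrite /kerK prof_cube// !mulr0.
have Ic : Int (fun x => 2 * mass * B * \1_(cube 0 (M + 1)) x) by apply: IntZ; exact: Int_cube.
split.
  by move=> k; apply: (Int_dom (mA k) Ic); apply: aeW => x; rewrite normr_id.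
have [|||||_ cX] := @DCT _ _ _ mu (fun k x => `|mass * phi x - avg phi (rk k) x|) (fun=> 0)
  (fun x => 2 * mass * B * \1_(cube 0 (M + 1)) x); last by move: cX; rewrite I0.
- exact: mA.
- by [].
- exact: Ic.
- by apply: aeW => x k; rewrite normr_id.
apply: aeW => x; apply/cvgrPdist_le => e e0.
have em : 0 < e / mass by rewrite divr_gt0.
have : nbhs x [set y | `|phi x - phi y| <= e / mass].
  by have /cvgrPdist_le/(_ _ em) := @test_continuous _ _ _ _ tp x.
move=> /nbhs_ballP[d /= d0 Hd]; have [K HK] := rk_small d0.
exists K => // k /= Kk; rewrite sub0r normrN normr_id.
have rk0 := rk_gt0 k; rewrite -(avg_cst (phi x) x rk0) -(avgD x (@locInt_cst R n _) lp rk0).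
have lpx : locInt (fun y => phi x - phi y) by apply: locIntBs => //; exact: locInt_cst.
apply: le_trans (avg_le_abs x lpx rk0) _.
have -> : e = mass * (e / mass) by rewrite mulrCA divff ?mulr1// gt_eqF.
rewrite -(avg_cst _ x rk0); apply: (avg_ae_le (locIntAbs lpx) (@locInt_cst R n _) rk0).
apply: aeW => y cy; apply: Hd; rewrite -ball_normE /=.
apply: le_lt_trans (HK k Kk); rewrite (_ : `|x - y| = mx_norm (x - y))// mx_normrE.
apply: bigmax_le => [|[i0 i] _ /=]; first exact: ltW.
rewrite (ord1 i0) !mxE ler_norml; have := cy i.
by move: (x 0 i) (y 0 i) (rk k) => p q r /andP[? ?]; apply/andP; split; lra.
Qed.

Lemma H10_Int u G : H10 u G -> Int u.
Proof.
move=> uG; have Lu := H10_L2 uG; have Lc : L2 (cutoff M) := L2_cutoff M0.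
apply: (Int_dom (L2_meas Lu) (IntAbs (L2_mul Lu Lc))).
apply: filterS (H10_out M0 OM uG) => x ux; have [Ox|Ox] := pselect (Omega x).
  by rewrite (cutoffE OM Ox) mulr1.
by rewrite ux// normr0.
Qed.

Lemma H10_L1_approx u G e : H10 u G -> 0 < e ->
  exists2 phi, test phi & I (fun x => `|u x - phi x|) <= e.
Proof.
move=> uG e0; have Lc : L2 (cutoff M) := L2_cutoff M0; have Lu := H10_L2 uG.
set A := I (fun x => cutoff M x ^+ 2); have A0 : 0 <= A by apply: I_ge0 => x; exact: sqr_ge0.
have d0 : 0 < e ^+ 2 / (A + 1) by rewrite divr_gt0 ?exprn_gt0// ltr_wpDl.
have [_ _ H] := uG; have [phi tp up] := H _ d0; exists phi => //.
have Lp := test_L2 M0 OM tp; have Lup := L2B Lu Lp.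
have Labs : L2 (fun x => `|u x - phi x|).
  have [m1 I1] := Lup; split; first exact: measurableT_comp.
  by move: I1; congr rintegrable; apply/funext => x; rewrite real_normK ?num_real.
have := CS Labs Lc; have -> : I (fun x => `|u x - phi x| ^+ 2) = sqd u phi.
  by congr rint; apply/funext => x; rewrite real_normK ?num_real.
have -> : I (fun x => `|u x - phi x| * cutoff M x) = I (fun x => `|u x - phi x|).
  apply: ae_eq_I; [exact: Int_meas (L2_mul Labs Lc)|exact: L2_meas Labs|].
  apply: filterS (H10_out M0 OM uG) => x ux; have [Ox|Ox] := pselect (Omega x).
    by rewrite (cutoffE OM Ox) mulr1.
  by rewrite ux// (test_out tp Ox) subrr normr0 mul0r.
have := le_lt_trans (sqd_le_err u G phi (grad phi)) up; have := sqd_ge0 u phi.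
have := I_ge0 mu (fun x => normr_ge0 (u x - phi x)); rewrite -/A.
move: (sqd u phi) (I _) => s J J0 s0 sle JA.
rewrite -(ler_pXn2r (ltn0Sn 1)) ?nnegrE ?(ltW e0)//; apply: (le_trans JA).
apply: (@le_trans _ _ (e ^+ 2 / (A + 1) * A)); first by rewrite ler_wpM2r// ltW.
rewrite mulrAC ler_pdivrMr ?ltr_wpDl// ler_wpM2l ?exprn_ge0 ?(ltW e0)//.
by rewrite lerDl.
Qed.

Lemma avg_cvg_L1 u G e d : H10 u G -> 0 < e -> 0 < d ->
  exists2 r, 0 < r < d & Int (fun x => `|mass * u x - avg u r x|) /\
    I (fun x => `|mass * u x - avg u r x|) <= e.
Proof.
move=> uG e0 d0; have Iu := H10_Int uG; have lu := Int_locInt Iu.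
have m0 := @mass_gt0 R n.
(* The approximation error is paid twice with factor [mass], once for u and once for its average,
   giving e/4 + e/4; the test function takes the remaining e/2. *)
have e1 : 0 < e / (4 * mass) by rewrite divr_gt0// mulr_gt0.
have [phi tp up] := H10_L1_approx uG e1.
have [IA cA] := avg_test_cvg tp.
have Ip := test_Int M0 OM tp; have lp := Int_locInt Ip.
have e2 : 0 < e / 2 by rewrite divr_gt0.
have [K1 HK1] := rk_small d0.
have [K2 _ HK2] : \forall k \near \oo, I (fun x => `|mass * phi x - avg phi (rk k) x|) <= e / 2.
  have /cvgrPdist_le/(_ _ e2) := cA; apply: filterS => k; rewrite sub0r normrN.
  exact: le_trans (ler_norm _).
pose k := maxn K1 K2; pose r := rk k; have r0 : 0 < r := rk_gt0 k.
have rd : r < d by apply: HK1; exact: leq_maxl.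
have Ir : I (fun x => `|mass * phi x - avg phi r x|) <= e / 2 by apply: HK2; exact: leq_maxr.
have Iup := IntB Iu Ip.
have [Ia Ea] := avg_L1 Iup r0.
pose F x := mass * `|u x - phi x| + `|mass * phi x - avg phi r x| + avg (fun y => `|u y - phi y|) r x.
have IF1 := IntZ mass (IntAbs Iup).
have IF : Int F by apply: IntD => //; apply: IntD => //; exact: IA.
have le x : `|mass * u x - avg u r x| <= F x.
  have E : mass * u x - avg u r x = mass * (u x - phi x) + (mass * phi x - avg phi r x)
      - avg (fun y => u y - phi y) r x.
    by rewrite (avgD x lu lp r0); ring.
  rewrite E; apply: le_trans (ler_normB _ _) _; apply: lerD.
    apply: le_trans (ler_normD _ _) _; rewrite lerD2r normrM (gtr0_norm m0)//.
  by apply: avg_le_abs => //; exact: Int_locInt.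
exists r; first by rewrite r0.
have II : Int (fun x => `|mass * u x - avg u r x|).
  apply: (Int_dom _ IF); last by apply: aeW => x; rewrite normr_id.
  apply: measurableT_comp => //; apply: measurable_funB; last exact: measurable_avg.
  by apply: measurable_funM => //; exact: Int_meas Iu.
split => //; apply: le_trans (le_I II IF le) _.
have EF : I F = mass * I (fun x => `|u x - phi x|) + I (fun x => `|mass * phi x - avg phi r x|)
   + mass * I (fun x => `|u x - phi x|).
  apply: etrans (ID (IntD IF1 (IA k)) Ia) _; rewrite Ea; congr (_ + _).
  apply: etrans (ID IF1 (IA k)) _; congr (_ + _); exact: (IZ mass (IntAbs Iup)).
rewrite EF; have : mass * I (fun x => `|u x - phi x|) <= e / 4.
  by rewrite -ler_pdivlMl//; apply: (le_trans up); rewrite invfM mulrA mulrC.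
move: Ir; move: (mass * _) (I _) => p q; lra.
Qed.

End average_convergence.
End average_estimates.

(** * Lebesgue points from almost monotone averages *)

Section lebesgue_values.
Context {R : realType} {n : nat}.
Variables (Omega : set 'rV[R]_n.+1) (M : R) (M0 : 0 < M) (OM : Omega `<=` cube 0 M).
Hypothesis (oO : open Omega).
Implicit Types (a x y : 'rV[R]_n.+1) (k : nat) (c r B : R) (u v t : 'rV[R]_n.+1 -> R).
Local Notation test := (test_function Omega).
Local Notation H10 := (H10 Omega).
Local Notation mu := (lam n.+1).
Local Notation Int := (rintegrable mu).
Local Notation I := (rint mu).
Local Notation mass := (@mass R n).
Local Notation "\1_ A" := (\1_A : 'rV[R]_n.+1 -> R).

Lemma open_cube a : Omega a -> exists2 r, 0 < r & cube a r `<=` Omega.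
Proof.
move=> Oa; have /nbhs_ballP[d /= d0 Hd] : nbhs a Omega by exact: open_nbhs_nbhs.
exists (d / 2); first by rewrite divr_gt0.
move=> y cy; apply: Hd; rewrite -ball_normE /=.
apply: (@le_lt_trans _ _ (d / 2)); last by lra.
rewrite (_ : `|a - y| = mx_norm (a - y))// mx_normrE.
apply: bigmax_le => [|[i0 i] _ /=]; first by rewrite divr_ge0// ltW.
rewrite (ord1 i0) !mxE ler_norml; have := cy i.
by move: (a 0 i) (y 0 i) => p q /andP[? ?]; apply/andP; split; lra.
Qed.

(* [lap_le B t] says that the distribution [Delta t] is at most [B]. *)
Definition lap_le B t := forall phi, test phi -> (forall x, 0 <= phi x) ->
  I (fun x => t x * laplacian phi x) <= B * I phi.

Lemma lap_le_avg t B x s r r' : locInt t -> 0 <= B -> lap_le B t -> cube x s `<=` Omega ->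
  0 < r -> r <= r' -> r' < s ->
  avg t r' x - avg t r x <= B * 2 ^+ n.+1 * (r' ^+ 2 - r ^+ 2).
Proof.
move=> lt B0 tB xs r0 rr' r's.
apply: (avg_mono lt _ _ r0 rr' r's); first by rewrite mulr_ge0// exprn_ge0.
move=> p p0 ps; have xp : cube x p `<=` Omega.
  by apply: subset_trans xs => y cy i; have := cy i; move: (x 0 i) (y 0 i) => b d /andP[]; lra.
apply: le_trans (tB _ (test_kerL p0 xp) _) _; first by move=> y; exact: kerL_ge0.
by rewrite -mulrA ler_wpM2l//; exact: (I_kerL M0 OM).
Qed.

(** A one-sided bound on b replaces |b - c| by an expression affine in b, whose average is
    computable. *)
Lemma abs_arith (p b c : R) : b <= c + 2 * p -> 0 <= p -> `|b - c| <= 4 * p + c - b.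
Proof. by move=> h h0; rewrite ler_norml; apply/andP; split; lra. Qed.

(** avg u r + C r^2 is nondecreasing in r; let L be its infimum at a. Continuity of the average in
    the center, at one radius s, and monotonicity bound all averages of smaller radius at points
    near a, hence mass u itself, by L plus a small error. Averages at a are at least L - C r^2, so u
    oscillates little around L / mass. *)
Lemma lebesgue_pt u G B a : H10 u G -> {ae mu, forall x, 0 <= u x} -> 0 <= B ->
  lap_le B (fun x => - u x) -> Omega a -> exists2 c, 0 <= c & lpt u a c.
Proof.
move=> uG u0 B0 uB Oa; have [r2 r20 cO] := open_cube Oa.
have Iu := H10_Int M0 OM uG; have lu := Int_locInt Iu; have m0 := @mass_gt0 R n.
pose C := B * 2 ^+ n.+1; have C0 : 0 <= C by rewrite mulr_ge0// exprn_ge0.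
pose r1 := r2 / 2; have r10 : 0 < r1 by rewrite divr_gt0.
have mono x r r' : cube a r1 x -> 0 < r -> r <= r' -> r' < r1 ->
    avg u r x <= avg u r' x + C * (r' ^+ 2 - r ^+ 2).
  move=> ax r0 rr' r'1; have r'0 := lt_le_trans r0 rr'.
  have xO : cube x r1 `<=` Omega.
    apply: subset_trans cO => y cy i; have := cy i; have := ax i; rewrite /r1.
    by move: (x 0 i) (y 0 i) (a 0 i) => p q s /andP[? ?] /andP[]; lra.
  have lNu := Int_locInt (IntN Iu).
  have := lap_le_avg lNu B0 uB xO r0 rr' r'1; rewrite -/C.
  have avN s : 0 < s -> avg (fun x => - u x) s x = - avg u s x.
    move=> s0; rewrite /avg -(IN (Int_kerK x lu s0)).
    by congr rint; apply/funext => y; rewrite mulNr.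
  rewrite !avN//; move: (avg u r x) (avg u r' x) (C * _) => p q s; lra.
have aa r : 0 <= r -> cube a r a by move=> r0 i; move: (a 0 i) => p; lra.
have avg0 r x : 0 < r -> 0 <= avg u r x.
  move=> r0; rewrite -(mulr0 mass) -(avg_cst 0 x r0).
  apply: (avg_ae_le (@locInt_cst R n 0) lu r0); apply: filterS u0 => y uy _; exact: uy.
pose S := [set avg u r a + C * r ^+ 2 | r in [set r | 0 < r < r1]].
have S0 : S !=set0.
  by exists (avg u (r1 / 2) a + C * (r1 / 2) ^+ 2), (r1 / 2) => //=; apply/andP; split; lra.
have lbS : lbound S 0.
  by move=> _ [r /andP[r0 _] <-]; rewrite addr_ge0 ?avg0// mulr_ge0// sqr_ge0.
have hS : has_inf S by split => //; exists 0.
pose L := inf S; have L0 : 0 <= L by apply: lb_le_inf.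
have LS r : 0 < r -> r < r1 -> L <= avg u r a + C * r ^+ 2.
  by move=> r0 rr1; apply: ge_inf; [exists 0|exists r => //=; rewrite r0].
exists (L / mass); first by rewrite divr_ge0// ltW.
apply: avg_lpt => // e e0; pose e1 := e / 5; have e10 : 0 < e1 by rewrite divr_gt0.
have [_ [s /andP[s0 sr1] <-] sL] := inf_adherent e10 hS; rewrite -/L in sL.
have [d1 d10 Hd1] := avg_near a Iu s0 e10.
pose d := Num.min d1 r1.
have dd1 : d <= d1 by rewrite /d ge_min lexx.
have dr1 : d <= r1 by rewrite /d ge_min lexx orbT.
have d0 : 0 < d by rewrite /d lt_min d10 r10.
clearbody d.
have sub r r' x : r <= r' -> cube a r x -> cube a r' x.
  by move=> rr' ax i; have := ax i; move: (a 0 i) (x 0 i) => p q /andP[]; lra.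
have bd x r : cube a d x -> 0 < r -> r < s -> avg u r x <= L + 2 * e1.
  move=> ax r0 rs; have := mono x r s (sub _ _ _ dr1 ax) r0 (ltW rs) sr1.
  have := Hd1 x (sub _ _ _ dd1 ax); rewrite ler_norml => /andP[h _].
  have Cr : 0 <= C * r ^+ 2 by rewrite mulr_ge0// sqr_ge0.
  move: sL h Cr; rewrite mulrBr; move: (avg u r x) (avg u s x) (avg u s a) (C * s ^+ 2) (C * r ^+ 2) => p1 p2 p3 p4 p5.
  lra.
have mD : measurable_fun setT (\1_(cube a d)) by apply: measurable_indic; exact: measurable_cube.
(* [g] is the excess of mass u over the bound near a. The averages satisfy the bound, so [g] is at
   most |mass u - avg u r|, whose integral can be made arbitrarily small. *)
pose g x := posf (fun x => mass * u x - (L + 2 * e1)) x * \1_(cube a d) x.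
have ID0 : Int (fun x => (L + 2 * e1) * \1_(cube a d) x) by apply: IntZ; exact: Int_cube (ltW d0).
have mu_ := Int_meas Iu.
have mg : measurable_fun setT g.
  apply: measurable_funM => //; apply: measurable_maxr => //; apply: measurable_funB => //.
  exact: measurable_funM.
have g0 x : 0 <= g x by rewrite mulr_ge0 ?posf_ge0// indicE.
have gle r x : 0 < r -> r < s -> g x <= `|mass * u x - avg u r x|.
  move=> r0 rs; rewrite /g indicE; case: (boolP (x \in _)) => [/set_mem ax|_]; last by rewrite mulr0.
  rewrite mulr1 /posf ge_max normr_ge0 andbT; apply: le_trans (ler_norm _).
  by rewrite lerD2l lerN2 bd.
have Ig : Int g.
  have [r /andP[r0 rs] [II _]] := avg_cvg_L1 M0 OM uG ltr01 s0.
  by apply: (Int_dom mg II); apply: aeW => x; rewrite ger0_norm// gle.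
have Ig0 : I g <= 0.
  apply/ler_addgt0Pl => h h0; rewrite addr0.
  have [r /andP[r0 rs] [II Ih]] := avg_cvg_L1 M0 OM uG h0 s0.
  by apply: le_trans Ih; apply: le_I => // x; exact: gle.
have ub : {ae mu, forall x, cube a d x -> mass * u x <= L + 2 * e1}.
  apply: filterS (I_eq0 Ig (aeW _ g0) Ig0) => x gx ax; move: gx.
  rewrite /g indicE mem_set// mulr1 /posf -subr_le0.
  by case: (leP (_ - _) 0) => // h h'; move: h; rewrite h' ltxx.
have eC : 0 < e1 / (C + 1) by rewrite divr_gt0// ltr_wpDl.
exists (Num.min (Num.min d s) (Num.min 1 (e1 / (C + 1)))).
  by rewrite !lt_min d0 s0 ltr01 eC.
move=> r; rewrite !lt_min => /and3P[r0 /andP[rd rs] /andP[r1_ rC]].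
have Cr : C * r ^+ 2 <= e1.
  rewrite ltr_pdivlMr ?ltr_wpDl// in rC.
  have : C * r ^+ 2 <= C * r by rewrite ler_wpM2l// expr2 ler_piMl// ltW.
  by move: rC; rewrite mulrDr mulr1 mulrC; move: (C * r) (C * r ^+ 2) => p q; lra.
set c := L / mass; have cm : c * mass = L by rewrite /c divfK// gt_eqF.
have lc : locInt (fun x => (4 * e1 / mass + c) - u x) by apply: locIntBs => //; exact: locInt_cst.
have luc := locIntAbs (locIntB c lu).
have := @avg_ae_le _ _ (fun x => `|u x - c|) (fun x => (4 * e1 / mass + c) - u x) r a luc lc r0 _.
rewrite (avgD a (@locInt_cst R n _) lu r0) (avg_cst _ a r0) => H.
apply: le_trans (H _) _.
  apply: filterS ub => x ux ax; have := ux (sub _ _ _ (ltW rd) ax).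
  rewrite mulrC -ler_pdivlMr// mulrDl -/c -[2 * e1 / _]mulrA -[4 * e1 / _]mulrA => h.
  have h0 : 0 <= e1 / mass by rewrite divr_ge0 ?(ltW e10)// ltW.
  exact: abs_arith.
(* The average of the affine majorant is at most 4 e1 + C r^2, and C r^2 <= e1: this is why e1 = e /
   5. *)
have := LS r r0 (lt_trans rs sr1); move: Cr; rewrite mulrDr [mass * c]mulrC cm.
rewrite (_ : mass * (4 * e1 / mass) = 4 * e1); last by field; rewrite gt_eqF.
rewrite /e1; move: (avg u r a) (C * r ^+ 2) => p q h1 h2; clear -h1 h2; lra.
Qed.

Lemma lpt_ae_le u v a : locInt u -> locInt v -> {ae mu, forall x, `|u x| <= `|v x|} ->
  lpt v a 0 -> lpt u a 0.
Proof.
move=> lu lv uv /(lpt_I _ _ lv) H; apply/(lpt_I _ _ lu) => e e0; have [d d0 Hd] := H e e0.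
exists d => // r rd; apply: le_trans (Hd r rd); have /andP[/ltW r0 _] := rd.
have [_ I1] := locIntAbs (locIntB 0 lu); have [_ I2] := locIntAbs (locIntB 0 lv).
apply: ae_le_I; [exact: I1|exact: I2|]; apply: filterS uv => x ux.
by rewrite !subr0 ler_wpM2r// indicE.
Qed.

(* If [t_k -> 0] with [Delta t_k <= B] and [t_k] has the value [- c] at [a] for all [k],
   then [- c + O(s^2) >= avg t_k s a -> 0], so that [c <= 0]. *)
Lemma lpt_limit_le0 (t_ : nat -> 'rV[R]_n.+1 -> R) h B a c : (forall k, Int (t_ k)) -> Int h ->
  {ae mu, forall x, forall k, `|t_ k x| <= h x} -> {ae mu, forall x, t_ k x @[k --> \oo] --> 0} ->
  0 <= B -> (forall k, lap_le B (t_ k)) -> Omega a ->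
  (forall k, lpt (t_ k) a (- c)) -> c <= 0.
Proof.
move=> It Ih th t0 B0 tB Oa tc; have [r2 r20 cO] := open_cube Oa.
pose C := B * 2 ^+ n.+1; have C0 : 0 <= C by rewrite mulr_ge0// exprn_ge0.
have m0 := @mass_gt0 R n.
have lt k := Int_locInt (It k).
have st1 k s : 0 < s -> s < r2 -> avg (t_ k) s a <= - (c * mass) + C * s ^+ 2.
  move=> s0 sr; apply/ler_addgt0Pl => e e0.
  have [d d0 Hd] := lpt_avg (lt k) (tc k) e0.
  pose r := Num.min (d / 2) s.
  have r0 : 0 < r by rewrite lt_min s0 divr_gt0.
  have rs : r <= s by rewrite ge_min lexx orbT.
  have rd : r < d by rewrite gt_min; apply/orP; left; lra.
  have := Hd r; rewrite r0 rd => /(_ isT); rewrite mulNr ler_norml => /andP[_ h1].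
  have := lap_le_avg (lt k) B0 (tB k) cO r0 rs sr; rewrite -/C mulrBr.
  have : 0 <= C * r ^+ 2 by rewrite mulr_ge0// sqr_ge0.
  by move: h1; move: (C * r ^+ 2) (C * s ^+ 2) (avg _ _ _) (avg _ _ _) (c * mass) => p1 p2 p3 p4 p5; lra.
have st2 s : 0 < s -> s < r2 -> c * mass <= C * s ^+ 2.
  move=> s0 sr.
  have [|||||_ cX] := @DCT _ _ _ mu (fun k x => t_ k x * kerK s a x) (fun=> 0)
    (fun x => h x * kerK s a x); last first.
  - rewrite I0 in cX; rewrite -subr_ge0.
    have : 0 <= - (c * mass) + C * s ^+ 2.
      rewrite -(cvg_lim (@Rhausdorff R) cX); apply: limr_le; first exact: cvgP cX.
      by apply: nearW => k; exact: st1.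
    by rewrite addrC.
  - apply: filterS t0 => x tx; rewrite -(mul0r (kerK s a x)); apply: cvgM => //; exact: cvg_cst.
  - apply: filterS th => x tx k; rewrite normrM (ger0_norm (kerK_ge0 a x s0)).
    by rewrite ler_wpM2r// kerK_ge0.
  - exact: Int_kerK (Int_locInt Ih) s0.
  - by [].
  - by move=> k; exact: Int_meas (Int_kerK a (lt k) s0).
rewrite leNgt; apply/negP => c0.
have cm : 0 < c * mass by rewrite mulr_gt0.
(* At this radius C s^2 <= C s < c mass, against [st2]. *)
pose s := Num.min (r2 / 2) (Num.min 1 (c * mass / (2 * (C + 1)))).
have s0 : 0 < s by rewrite !lt_min divr_gt0// ltr01 divr_gt0// mulr_gt0// ltr_wpDl.
have sr : s < r2 by rewrite gt_min; apply/orP; left; lra.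
have s1 : s <= 1 by rewrite !ge_min lexx orbT.
have sC : s <= c * mass / (2 * (C + 1)) by rewrite !ge_min lexx !orbT.
rewrite ler_pdivlMr ?mulr_gt0 ?ltr_wpDl// in sC.
have := st2 s s0 sr; have : C * s ^+ 2 <= C * s by rewrite ler_wpM2l// expr2 ler_piMl// ltW.
have : s * (2 * (C + 1)) = 2 * (C * s) + 2 * s by ring.
by move: sC; move: (s * (2 * _)) (C * s ^+ 2) (C * s) (c * mass) cm => p1 p2 p3 p4; lra.
Qed.

End lebesgue_values.

Section solutions.
Context {R : realType} {n : nat}.
Variables (Omega : set 'rV[R]_n.+1) (M : R) (M0 : 0 < M) (OM : Omega `<=` cube 0 M).
Hypothesis (oO : open Omega).
Variables (q : 'rV[R]_n.+1 -> R) (mq : measurable_fun setT q) (q0 : forall x, 0 <= q x).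
Local Notation mu := (lam n.+1).
Local Notation Int := (rintegrable mu).
Local Notation I := (rint mu).
Local Notation fn := ('rV[R]_n.+1 -> R).
Local Notation vf := ('I_n.+1 -> 'rV[R]_n.+1 -> R).
Local Notation test := (test_function Omega).
Local Notation Sol := (Sol Omega q).
Local Notation Sup := (Sup Omega q).
Local Notation adm := (adm Omega q).
Local Notation E := (energy q).
Implicit Types (phi w v f g : fn) (G H : vf).

Lemma adm_lap w G phi : adm w G -> test phi ->
  I (fun x => w x * laplacian phi x) = I (fun x => q x * w x * phi x) - E w G phi (grad phi).
Proof.
move=> [wG _ _] tp; rewrite (H10_lap M0 OM wG tp) /energy opprD addrCA subrr addr0.
by [].
Qed.

(** The Laplacian of - w is f - q w, which is at most f because w >= 0. *)
Lemma sol_lap_le w G f : Sol w G f -> {ae mu, forall x, 0 <= f x} ->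
  exists2 B, 0 <= B & lap_le Omega B (fun x => - w x).
Proof.
move=> Sw f0; have [aw df Ew] := Sw; have [_ [B fB] _] := df.
have w0 := max_principle M0 OM mq q0 Sw f0.
exists `|B| => // phi tp p0; have [[wG bw] pH] := (adm_HB aw, HB_test M0 OM tp).
have Il : Int (fun x => w x * laplacian phi x).
  by apply: L2_mul; [exact: H10_L2 wG|exact: (test_L2 M0 OM (test_laplacian tp))].
have -> : I (fun x => - w x * laplacian phi x) = - I (fun x => w x * laplacian phi x).
  by rewrite -(IN Il); congr rint; apply/funext => x; rewrite mulNr.
rewrite (adm_lap aw tp) (Ew _ tp) opprB.
have If := Sol_data_Int M0 OM Sw pH.
apply: (@le_trans _ _ (I (fun x => f x * phi x))).
  rewrite gerBl -(I0 mu); apply: ae_le_I; [exact: Int0|exact: (qInt aw pH)|].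
  by apply: filterS w0 => x wx; rewrite mulr_ge0// mulr_ge0.
have Ip := test_Int M0 OM tp.
rewrite -(IZ _ Ip); apply: ae_le_I; [exact: If|exact: IntZ|].
apply: filterS fB => x fx; rewrite ler_wpM2r//.
exact: le_trans (ler_norm _) (le_trans fx (ler_norm _)).
Qed.

Lemma sol_lpt w G f a : Sol w G f -> {ae mu, forall x, 0 <= f x} -> Omega a ->
  exists2 c, 0 <= c & lpt w a c.
Proof.
move=> Sw f0 Oa; have [B B0 wB] := sol_lap_le Sw f0; have [[wG _ _] _ _] := Sw.
have w0 := max_principle M0 OM mq q0 Sw f0.
exact: (lebesgue_pt M0 OM oO wG w0 B0 wB Oa).
Qed.

(** The limit z = th v is a solution, so it has some value c >= 0 at a. The differences t_k = min(v,
    w_k) - z are nonpositive and tend to 0. They have value - c at a, since 0 <= min(v, w_k) <= w_k,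
    and their Laplacians are bounded above: a supersolution minus a solution, plus q t_k <= 0. Then
    [lpt_limit_le0] gives c <= 0. *)
Lemma min_lpt v G g (w_ : nat -> fn) (G_ : nat -> vf) (th : fn) a :
  Sol v G g -> {ae mu, forall x, 0 <= g x} -> {ae mu, forall x, 0 <= v x} ->
  (forall k, Sup (w_ k) (G_ k)) ->
  {ae mu, forall x, forall k, 0 <= w_ k x <= w_ k.+1 x} ->
  measurable_fun setT th ->
  {ae mu, forall x, (th x = 0 /\ forall k, w_ k x = 0) \/
     (th x = 1 /\ exists m, forall k, (m <= k)%N -> v x <= w_ k x)} ->
  Omega a -> (forall k, lpt (w_ k) a 0) -> lpt (fun x => th x * v x) a 0.
Proof.
move=> Sv g0 v0 Sw w0 mth thP Oa wa; have [av dg _] := Sv.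
have zZ := limit_min M0 OM mq q0 Sv g0 v0 Sw w0 mth thP.
have th01 : {ae mu, forall x, th x = 0 \/ th x = 1}.
  by apply: filterS thP => x [[-> _]|[-> _]]; [left|right].
have [Sz _] := split_Sol M0 OM mq Sv g0 v0 th01 zZ.
set z := fun x => th x * v x in zZ Sz *; set Z := fun i x => th x * G i x in zZ Sz.
have gz0 : {ae mu, forall x, 0 <= g x * ind (0 < z x)}.
  by apply: filterS g0 => x gx; rewrite mulr_ge0// /ind.
have [c c0 zc] := sol_lpt Sz gz0 Oa.
have z0 := max_principle M0 OM mq q0 Sz gz0.
suff : c <= 0 by move=> c1; have <- : c = 0; [apply/eqP; rewrite eq_le c1 c0|exact: zc].
pose y k := minf v (w_ k); pose Y k := ming v (w_ k) G (G_ k).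
have Sv' := Sol_Sup M0 OM Sv g0.
have Sy k : Sup (y k) (Y k) by apply: (Sup_min M0 OM mq); [exact: Sv'|exact: Sw].
have ay k : adm (y k) (Y k) := (Sy k).1.
have [az _ _] := Sz.
pose t k := subf (y k) z.
have at_ k : adm (t k) (subg (Y k) Z) by exact: (adm_sub M0 OM).
have yE k x : y k x = Num.min (v x) (w_ k x) by exact: minfE.
have IHu u H : adm u H -> Int u by case=> uH _ _; exact: (H10_Int M0 OM uH).
have lHu u H : adm u H -> locInt u by move=> /IHu /Int_locInt.
have yz : {ae mu, forall x, forall k, 0 <= y k x <= z x}.
  apply: filterS3 v0 w0 thP => x vx wx thx k; have /andP[wk _] := wx k.
  rewrite yE le_min vx wk/= /z; case: thx => [[-> wz]|[-> _]].
    by rewrite mul0r wz ge_min lexx orbT.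
  by rewrite mul1r ge_min lexx.
have yw : {ae mu, forall x, forall k, 0 <= y k x <= w_ k x}.
  apply: filterS2 v0 w0 => x vx wx k; have /andP[wk _] := wx k.
  by rewrite yE le_min vx wk/= ge_min lexx orbT.
have ya k : lpt (y k) a 0.
  apply: (lpt_ae_le (lHu _ _ (ay k)) (lHu _ _ (Sw k).1) _ (wa k)).
  apply: filterS yw => x yx; have /andP[y1 y2] := yx k.
  by rewrite !ger0_norm// (le_trans y1).
have tc k : lpt (t k) a (- c).
  have ly := lHu _ _ (ay k); have lz := lHu _ _ az; have ltk := lHu _ _ (at_ k).
  have Hy := (lpt_I a 0 ly).1 (ya k); have Hz := (lpt_I a c lz).1 zc.
  apply/(lpt_I _ _ ltk) => e e0; have e20 : 0 < e / 2 by rewrite divr_gt0.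
  have [d1 d10 Hd1] := Hy _ e20; have [d2 d20 Hd2] := Hz _ e20.
  exists (Num.min d1 d2); first by rewrite lt_min d10.
  move=> r; rewrite lt_min => /and3P[r0 rd1 rd2]; have r0' := ltW r0.
  have [_ I1] := locIntAbs (locIntB 0 ly); have [_ I2] := locIntAbs (locIntB c lz).
  have [_ I3] := locIntAbs (locIntB (- c) ltk).
  apply: (@le_trans _ _ (I (fun x => `|y k x - 0| * \1_(cube a r) x) + I (fun x => `|z x - c| * \1_(cube a r) x))).
    rewrite -(ID (I1 a r r0') (I2 a r r0')); apply: le_I; [exact: I3|exact: IntD (I1 a r r0') (I2 a r r0')|move=> x].
    rewrite -mulrDl ler_wpM2r//; apply: le_trans (ler_normB _ _); rewrite /t /subf.
    by rewrite (_ : y k x - 0 - (z x - c) = y k x - z x - - c)//; ring.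
  have := Hd1 r; rewrite r0 rd1 => /(_ isT); have := Hd2 r; rewrite r0 rd2 => /(_ isT).
  rewrite mulrAC; move: (I _) (I _) (r ^+ n.+1) => p1 p2 p3; lra.
have [_ [B gB] _] := dg.
have tB k : lap_le Omega `|B| (t k).
  move=> phi tp p0; have pH := HB_test M0 OM tp; have [_ _ Ez] := Sz.
  rewrite (adm_lap (at_ k) tp) (E_subl (ay k) az pH) (Ez _ tp).
  have s1 : 0 <= E (y k) (Y k) phi (grad phi) by apply: (Sy k).2 => //; exact: aeW.
  have Igz := Sol_data_Int M0 OM Sz pH; have Ip := test_Int M0 OM tp.
  have s2 : I (fun x => g x * ind (0 < z x) * phi x) <= `|B| * I phi.
    rewrite -(IZ _ Ip); apply: ae_le_I; [exact: Igz|exact: IntZ|].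
    apply: filterS gB => x gx; rewrite ler_wpM2r// /ind.
    case: (0 < z x); rewrite ?mulr1 ?mulr0//.
    exact: le_trans (ler_norm _) (le_trans gx (ler_norm _)).
  have s3 : I (fun x => q x * t k x * phi x) <= 0.
    rewrite -(I0 mu); apply: ae_le_I; [exact: (qInt (at_ k) pH)|exact: Int0|].
    apply: filterS yz => x yx; have /andP[_ h] := yx k.
    by rewrite mulr_le0_ge0// mulr_ge0_le0// subr_le0.
  move: s1 s2 s3; move: (I _) (I _) (E _ _ _ _) (_ * _) => p1 p2 p3 p4; lra.
apply: (@lpt_limit_le0 _ _ Omega M M0 OM oO t (fun x => z x) `|B| a c _ _ _ _ _ tB Oa tc) => //.
- by move=> k; exact: IHu (at_ k).
- exact: IHu az.
- apply: filterS2 yz z0 => x yx zx k; have /andP[h1 h2] := yx k.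
  by rewrite /t /subf distrC ger0_norm ?subr_ge0// gerBl.
- apply: filterS3 yz v0 thP => x yx vx thx; case: thx => [[t0 wz]|[t1 [m Hm]]].
    apply: (@cvg_eventually0 _ _ 0) => k _; have := yx k.
    rewrite /t /subf /z t0 mul0r => /andP[h1 h2]; rewrite subr0.
    by apply/eqP; rewrite eq_le h1 h2.
  apply: (@cvg_eventually0 _ _ m) => k mk; rewrite /t /subf /z t1 mul1r yE min_l ?subrr//.
  exact: Hm.
Qed.

End solutions.

(** * Precise representatives on lines and connectedness *)

Section liminf.
Context d (T : measurableType d) (R : realType) (mu : {measure set T -> \bar R}).

Lemma ge0_integral0_ae (f : T -> \bar R) : measurable_fun setT f -> (forall x, (0 <= f x)%E) ->
  (\int[mu]_x f x <= 0)%E -> {ae mu, forall x, f x = 0%E}.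
Proof.
move=> mf f0 If; have E : (\int[mu]_(x in setT) `|f x| = 0)%E.
  under eq_integral do rewrite gee0_abs//.
  by apply/eqP; rewrite eq_le If integral_ge0.
have [H _] := ae_eq_integral_abs mu measurableT mf.
by apply: filterS (H E) => x; exact.
Qed.

Lemma limn_einf_lt (u : nat -> \bar R) (e : \bar R) : (limn_einf u < e)%E ->
  forall J : nat, exists2 j, (J <= j)%N & (u j < e)%E.
Proof.
move=> ue J; have : (einfs u J < e)%E.
  apply: le_lt_trans ue; rewrite limn_einf_lim (cvg_lim _ (@cvg_einfs_sup _ u))//.
  by apply: ereal_sup_ubound; exists J.
by rewrite /einfs /= => /ereal_inf_lt[_ [j Jj <-] uj]; exists j.
Qed.

(** By Fatou the lower limit in j has integral at most c k, so its infimum over k vanishes almost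
    everywhere. For averages this gives arbitrarily small good radii with no maximal function. *)
Lemma ae_inf_liminf (a : nat -> nat -> T -> \bar R) (c : nat -> \bar R) :
  (forall k j, measurable_fun setT (a k j)) -> (forall k j x, (0 <= a k j x)%E) ->
  (forall k j, (\int[mu]_x a k j x <= c k)%E) ->
  (forall e : R, 0 < e -> exists k, (c k <= e%:E)%E) ->
  {ae mu, forall x, forall e : R, 0 < e -> exists k, forall J : nat, exists2 j, (J <= j)%N &
    (a k j x < e%:E)%E}.
Proof.
move=> ma a0 ac c0; pose h k x := limn_einf (fun j => a k j x).
have mh k : measurable_fun setT (h k).
  have -> : h k = (fun x => - limn_esup (fun j => - a k j x))%E.
    apply/funext => x; have := @limn_esupN R (fun j => a k j x); rewrite /comp => ->.
    by rewrite oppeK.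
  apply: measurableT_comp => //; apply: measurable_fun_limn_esup => j.
  exact: (measurableT_comp (@oppe_measurable R setT) (ma k j)).
have h0 k x : (0 <= h k x)%E.
  rewrite /h limn_einf_lim; apply: lime_ge; first exact: is_cvg_einfs.
  by apply: nearW => j; apply: le_ereal_inf_tmp => _ [p _ <-].
have hc k : (\int[mu]_x h k x <= c k)%E.
  have Ft := @fatou _ _ _ mu setT measurableT (a k) (ma k) (fun j x _ => a0 k j x).
  apply: (le_trans Ft); rewrite limn_einf_lim; apply: lime_le; first exact: is_cvg_einfs.
  apply: nearW => j; apply: (@le_trans _ _ (\int[mu]_x a k j x)%E) => //.
  by apply: ereal_inf_lbound; exists j => /=.
pose g x := einfs (fun k => h k x) 0.
have mg : measurable_fun setT g by exact: measurable_fun_einfs.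
have g0 x : (0 <= g x)%E by apply: le_ereal_inf_tmp => _ [p _ <-].
have gh k x : (g x <= h k x)%E by apply: ereal_inf_lbound; exists k.
have Ig : (\int[mu]_x g x <= 0)%E.
  apply/lee_addgt0Pr => e e0; rewrite add0e; have [k ck] := c0 e e0.
  apply: le_trans ck; apply: le_trans (hc k); apply: ge0_le_integral => //.
apply: filterS (ge0_integral0_ae mg g0 Ig) => x gx e e0.
have : (g x < e%:E)%E by rewrite gx lte_fin.
rewrite /g /einfs /= => /ereal_inf_lt[_ [k _ <-] hk].
by exists k; exact: limn_einf_lt.
Qed.

End liminf.

Section boxes.
Context {R : realType} {n : nat}.
Implicit Types (y z : 'rV[R]_n) (x : 'rV[R]_n.+1) (i : 'I_n.+1) (r e : R) (k : nat).
Local Notation "\1_ A" := (\1_A : _ -> R).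
Local Notation leb := (@lebesgue_measure R).

Definition bav (F : 'rV[R]_n -> \bar R) r y : \bar R :=
  (((2 * r) ^+ n)^-1%:E * \int[lam n]_z ((\1_(cube y r) z)%:E * F z))%E.

Lemma cube_sym r y z : \1_(cube y r) z = \1_(cube z r) y.
Proof.
rewrite !indicE; congr ((nat_of_bool _)%:R); apply/idP/idP => /set_mem h; apply/mem_set => i; have := h i;
  by move: (y 0 i) (z 0 i) => p q /andP[? ?]; apply/andP; split; lra.
Qed.

Lemma measurable_cube2 r : measurable_fun setT (fun p : 'rV[R]_n * 'rV[R]_n => \1_(cube p.1 r) p.2).
Proof.
rewrite (_ : (fun p => _) = \1_[set p : 'rV[R]_n * 'rV[R]_n | cube p.1 r p.2]); last first.
  by apply/funext => p; rewrite !indicE; congr ((nat_of_bool _)%:R); apply/idP/idP => /set_mem h; apply/mem_set.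
apply: measurable_indic.
rewrite (_ : [set p | _] = \bigcap_(i in [set: 'I_n])
    (fun p : 'rV[R]_n * 'rV[R]_n => p.2 0 i - p.1 0 i) @^-1` `[- r, r]); last first.
  apply/seteqP; split => p /= Hp i; [move=> _|]; have := Hp i.
    by rewrite /= in_itv/=; move: (p.1 0 i) (p.2 0 i) => a b /andP[? ?]; apply/andP; split; lra.
  move=> /(_ Logic.I); rewrite /= in_itv/=; move: (p.1 0 i) (p.2 0 i) => a b /andP[? ?]; apply/andP; split; lra.
apply: fin_bigcap_measurable => // i _; rewrite -[X in measurable X]setTI.
suff m : measurable_fun setT (fun p : 'rV[R]_n * 'rV[R]_n => p.2 0 i - p.1 0 i) by exact: m.
apply: measurable_funB.
  exact: measurableT_comp (measurable_rV_coord i) (@measurable_snd _ _ _ _).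
exact: measurableT_comp (measurable_rV_coord i) (@measurable_fst _ _ _ _).
Qed.

Lemma bav_int (F : 'rV[R]_n -> \bar R) r : measurable_fun setT F -> (forall z, (0 <= F z)%E) -> 0 < r ->
  [/\ measurable_fun setT (bav F r), (forall y, (0 <= bav F r y)%E) &
    (\int[lam n]_y bav F r y = \int[lam n]_z F z)%E].
Proof.
move=> mF F0 r0.
have mH : measurable_fun setT (fun p : 'rV[R]_n * 'rV[R]_n => (\1_(cube p.1 r) p.2)%:E * F p.2)%E.
  apply: emeasurable_funM; first by apply/measurable_EFinP; exact: measurable_cube2.
  exact: measurableT_comp mF (@measurable_snd _ _ _ _).
have H0 (p : 'rV[R]_n * 'rV[R]_n) : (0 <= (\1_(cube p.1 r) p.2)%:E * F p.2)%E.
  by rewrite mule_ge0// lee_fin indicE.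
have c0 : 0 < (2 * r) ^+ n by rewrite exprn_gt0// mulr_gt0.
have mI : measurable_fun setT (fun y => \int[lam n]_z ((\1_(cube y r) z)%:E * F z))%E.
  exact: (measurable_fun_fubini_tonelli_F (m2 := lam n) _ mH H0).
have I0 y : (0 <= \int[lam n]_z ((\1_(cube y r) z)%:E * F z))%E.
  by apply: integral_ge0 => z _; exact: (H0 (y, z)).
split.
- exact: measurable_funeM.
- by move=> y; rewrite mule_ge0// lee_fin invr_ge0 ltW.
rewrite /bav ge0_integralZl//; last by rewrite lee_fin invr_ge0 ltW.
rewrite (fubini_tonelli (m1 := lam n) (m2 := lam n) _ mH H0) /=.
rewrite -ge0_integralZl//; last 3 first.
- exact: (measurable_fun_fubini_tonelli_G (m1 := lam n) _ mH H0).
- by move=> z _; apply: integral_ge0 => y _; exact: (H0 (y, z)).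
- by rewrite lee_fin invr_ge0 ltW.
apply: eq_integral => z _.
have mc : measurable (cube z r) := measurable_cube z r.
have -> : (\int[lam n]_y ((\1_(cube y r) z)%:E * F z) = ((2 * r) ^+ n)%:E * F z)%E.
  have mz : measurable_fun setT (fun y => (\1_(cube z r) y)%:E : \bar R).
    by apply/measurable_EFinP; exact: measurable_indic.
  transitivity (\int[lam n]_y ((\1_(cube z r) y)%:E * F z))%E.
    by apply: eq_integral => y _; rewrite cube_sym.
  rewrite (ge0_integralZr _ measurableT mz) => [|y _|]; [|by rewrite lee_fin indicE|exact: F0].
  by congr (_ * _)%E; rewrite integral_indic// setIT; exact: (lam_cube z (ltW r0)).
by rewrite muleA -EFinM mulVf ?mul1e// gt_eqF.
Qed.

Lemma cube_ins i x r y (t : R) :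
  \1_(cube x r) (ins i y t) = \1_(cube (del i x) r) y * \1_(`[x 0 i - r, x 0 i + r]%classic) t.
Proof.
rewrite !indicE -natrM mulnb; congr ((nat_of_bool _)%:R).
apply/idP/andP => [/set_mem h|[/set_mem h1 /set_mem h2]].
  split; apply/mem_set; last by have := h i; rewrite ins_at /= in_itv.
  by move=> k; have := h (lift i k); rewrite ins_lift mxE.
apply/mem_set => j; have [k ->|->] := unliftP i j.
  by rewrite ins_lift; have := h1 k; rewrite mxE.
by rewrite ins_at; move: h2; rewrite /= in_itv.
Qed.

(** If [H] bounds [f] on every line of direction i, each line of the box contributes at most its
    length 2 r times [H]. *)
Lemma box_line i (f : 'rV[R]_n.+1 -> \bar R) (H : 'rV[R]_n -> \bar R) x r :
  measurable_fun setT f -> (forall x, (0 <= f x)%E) -> measurable_fun setT H ->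
  (forall y t, (f (ins i y t) <= H y)%E) -> 0 < r ->
  (\int[lam n.+1]_z ((\1_(cube x r) z)%:E * f z) <=
   (2 * r)%:E * \int[lam n]_y ((\1_(cube (del i x) r) y)%:E * H y))%E.
Proof.
move=> mf f0 mH fH r0; have mc := measurable_cube x r; have mc' := measurable_cube (del i x) r.
have H0 y : (0 <= H y)%E by exact: le_trans (fH y 0).
have m1 : measurable_fun setT (fun z : 'rV[R]_n.+1 => (\1_(cube x r) z)%:E * f z)%E.
  by apply: emeasurable_funM => //; apply/measurable_EFinP; exact: measurable_indic.
have p1 (z : 'rV[R]_n.+1) : (0 <= (\1_(cube x r) z)%:E * f z)%E by rewrite mule_ge0// lee_fin indicE.
have mJ : measurable_fun setT (fun y => (\1_(cube (del i x) r) y)%:E * H y)%E.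
  by apply: emeasurable_funM => //; apply/measurable_EFinP; exact: measurable_indic.
have J0 y : (0 <= (\1_(cube (del i x) r) y)%:E * H y)%E by rewrite mule_ge0// lee_fin indicE.
rewrite (tonelli_ins i m1 p1) -ge0_integralZl//; last by rewrite lee_fin mulr_ge0// ltW.
apply: ge0_le_integral => //.
- by move=> y _; exact: integral_ge0.
- exact: (measurable_line i m1 p1).
- exact: measurable_funeM.
move=> y _; set D := `[x 0 i - r, x 0 i + r]%classic.
have mD : measurable D by exact: measurable_itv.
have -> : ((2 * r)%:E = \int[leb]_t (\1_D t)%:E)%E.
  have lD : leb D = (2 * r)%:E.
    rewrite /D lebesgue_measure_itv/= lte_fin ifT; last by lra.
    by rewrite -EFinB; congr EFin; ring.
  by rewrite integral_indic// setIT; exact: (esym lD).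
have mDt : measurable_fun setT (fun t => (\1_D t)%:E : \bar R).
  by apply/measurable_EFinP; exact: measurable_indic.
set K := (X in (_ <= _ * X)%E).
have K0 : (0 <= K)%E by exact: J0.
have D0 t : setT t -> (0 <= (\1_D t)%:E :> \bar R)%E by rewrite lee_fin indicE.
have := ge0_integralZr leb measurableT mDt D0 K0 => EZ.
apply: (@le_trans _ _ (\int[leb]_t ((\1_D t)%:E * K))%E); last by rewrite EZ.
apply: ge0_le_integral => //.
- apply: (measurableT_comp m1); exact: measurable_ins2.
- by apply: emeasurable_funM => //; exact: measurable_cst.
move=> t _; rewrite cube_ins -/D mulrC EFinM -muleA /K.
apply: lee_wpmul2l; first by rewrite lee_fin indicE.
by apply: lee_wpmul2l; [rewrite lee_fin indicE|exact: fH].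
Qed.

End boxes.

(** * Uniform approximation on almost every line *)

Section lines.
Context {R : realType} {n : nat}.
Variables (Omega : set 'rV[R]_n.+1) (M : R) (M0 : 0 < M) (OM : Omega `<=` cube 0 M).
Implicit Types (x : 'rV[R]_n.+1) (i : 'I_n.+1) (r e : R) (k : nat) (u : 'rV[R]_n.+1 -> R).
Local Notation test := (test_function Omega).
Local Notation H10 := (H10 Omega).
Local Notation mu := (lam n.+1).
Local Notation Int := (rintegrable mu).
Local Notation I := (rint mu).
Local Notation L2 := (L2 mu).
Local Notation leb := (@lebesgue_measure R).
Local Notation "\1_ A" := (\1_A : _ -> R).

Lemma continuous_cube (f : 'rV[R]_n.+1 -> R) x e : continuous f -> 0 < e ->
  exists2 d, 0 < d & forall y, cube x d y -> `|f x - f y| <= e.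
Proof.
move=> cf e0; have : nbhs x [set y | `|f x - f y| <= e].
  by have /(@cvgrPdist_le _ _ _ (nbhs x) (nbhs_filter x))/(_ _ e0) := cf x.
move=> /nbhs_ballP[d /= d0 Hd]; exists (d / 2); first by rewrite divr_gt0.
move=> y cy; apply: Hd; rewrite -ball_normE /=.
apply: (@le_lt_trans _ _ (d / 2)); last by lra.
rewrite (_ : `|x - y| = mx_norm (x - y))// mx_normrE.
apply: bigmax_le => [|[i0 i] _ /=]; first by rewrite divr_ge0// ltW.
rewrite (ord1 i0) !mxE ler_norml; have := cy i.
by move: (x 0 i) (y 0 i) => p q /andP[? ?]; apply/andP; split; lra.
Qed.

Lemma H10_outg u G i : H10 u G -> {ae mu, forall x, ~ Omega x -> G i x = 0}.
Proof.
move=> uG; have [phi_ [tp _ _ cG]] := H10_seq M0 OM uG.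
apply: filterS (cG i) => x cx Ox; apply: (cvg_unique (@Rhausdorff R) cx).
rewrite (_ : (fun k => _) = (fun=> 0)); first exact: cvg_cst.
by apply/funext => k; exact: (test_out (test_partial i (tp k)) Ox).
Qed.

Lemma L2_L1 (f : 'rV[R]_n.+1 -> R) : L2 f -> {ae mu, forall x, ~ Omega x -> f x = 0} ->
  Int f /\ (I (fun x => `|f x|)) ^+ 2 <= I (fun x => f x ^+ 2) * I (fun x => cutoff M x ^+ 2).
Proof.
move=> Lf f0; have Lc : L2 (cutoff M) := L2_cutoff M0.
have fE : {ae mu, forall x, `|f x| * cutoff M x = `|f x|}.
  apply: filterS f0 => x fx; have [Ox|Ox] := pselect (Omega x).
    by rewrite (cutoffE OM Ox) mulr1.
  by rewrite fx// normr0 mul0r.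
have Labs : L2 (fun x => `|f x|).
  have [m1 I1] := Lf; split; first exact: measurableT_comp.
  by move: I1; congr rintegrable; apply/funext => x; rewrite real_normK ?num_real.
split.
  apply: (Int_dom (L2_meas Lf) (L2_mul Labs Lc)).
  by apply: filterS fE => x ->.
have := CS Labs Lc; have -> : I (fun x => `|f x| ^+ 2) = I (fun x => f x ^+ 2).
  by congr rint; apply/funext => x; rewrite real_normK ?num_real.
rewrite (ae_eq_I _ _ fE)//; [exact: Int_meas (L2_mul Labs Lc)|exact: L2_meas Labs].
Qed.

Lemma L2_L1_cvg (f_ : nat -> 'rV[R]_n.+1 -> R) : (forall k, L2 (f_ k)) ->
  (forall k, {ae mu, forall x, ~ Omega x -> f_ k x = 0}) ->
  I (fun x => f_ k x ^+ 2) @[k --> \oo] --> 0 ->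
  I (fun x => `|f_ k x|) @[k --> \oo] --> 0.
Proof.
move=> Lf f0 c; apply: sqr_cvg0.
have c' : I (fun x => f_ k x ^+ 2) * I (fun x => cutoff M x ^+ 2) @[k --> \oo] --> 0.
  by rewrite -(mul0r (I (fun x => cutoff M x ^+ 2))); apply: cvgM => //; exact: cvg_cst.
apply: (squeeze_cvgr _ (cvg_cst 0) c'); apply: nearW => k.
by rewrite sqr_ge0 (L2_L1 (Lf k) (f0 k)).2.
Qed.

(** Let F k y be the integral of |G_i - d_i phi_k| along the line over y. It bounds the deviation of
    phi_k from u averaged over boxes around points of the line. When averages of F k near y are
    small for arbitrarily small radii, phi_k is close to every Lebesgue value of u on that line. *)
Lemma line_approx u G i : H10 u G -> exists2 phi_ : nat -> 'rV[R]_n.+1 -> R,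
  (forall k, test (phi_ k)) &
  {ae lam n, forall y, forall e, 0 < e -> exists k, forall t c,
    lpt u (ins i y t) c -> `|c - phi_ k (ins i y t)| <= e}.
Proof.
move=> uG; have [phi_ [tp ek _ _]] := H10_seq M0 OM uG; have [su sG] := H10_seq_sqd ek.
exists phi_ => //.
have Iu := H10_Int M0 OM uG; have lu := Int_locInt Iu.
have Ip k := test_Int M0 OM (tp k).
pose f k x := G i x - partial i (phi_ k) x.
have Lf k : L2 (f k) by apply: L2B; [exact: H10_L2g uG|exact: (grad_L2 M0 OM i (tp k))].
have fout k : {ae mu, forall x, ~ Omega x -> f k x = 0}.
  apply: filterS (H10_outg i uG) => x gx Ox.
  by rewrite /f gx// (test_out (test_partial i (tp k)) Ox) subrr.
pose b k := I (fun x => `|u x - phi_ k x|).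
have cb : b k @[k --> \oo] --> 0.
  apply: (L2_L1_cvg (f_ := fun k x => u x - phi_ k x)) => [k|k|].
  - by apply: L2B; [exact: H10_L2 uG|exact: (test_L2 M0 OM (tp k))].
  - by apply: filterS (H10_out M0 OM uG) => x ux Ox; rewrite ux// (test_out (tp k) Ox) subrr.
  - exact: su.
pose c k := I (fun x => `|f k x|).
have cc : c k @[k --> \oo] --> 0 by apply: (L2_L1_cvg Lf fout); exact: sG.
have If k : Int (f k) by exact: (L2_L1 (Lf k) (fout k)).1.
pose F k y := (\int[leb]_s (`|f k (ins i y s)|)%:E)%E.
have mfk k : measurable_fun setT (fun x => (`|f k x|)%:E : \bar R).
  by apply/measurable_EFinP; apply: measurableT_comp => //; exact: Int_meas (If k).
have fk0 k (x : 'rV[R]_n.+1) : (0 <= (`|f k x|)%:E)%E by rewrite lee_fin.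
have mF k : measurable_fun setT (F k) by exact: (measurable_line i (mfk k) (fk0 k)).
have F0 k y : (0 <= F k y)%E by exact: integral_ge0.
have IF k : (\int[lam n]_y F k y = (c k)%:E)%E.
  by rewrite -(IE (IntAbs (If k))) (tonelli_ins i (mfk k) (fk0 k)).
have lineb k l y t : ((`|phi_ l (ins i y t) - phi_ k (ins i y t)|)%:E <= F k y + F l y)%E.
  apply: le_trans (test_line_sup OM i y t (testB (tp l) (tp k))) _.
  have mline (h : 'rV[R]_n.+1 -> R) : measurable_fun setT h -> measurable_fun setT (fun s => (`|h (ins i y s)|)%:E : \bar R).
    move=> mh; apply/measurable_EFinP; apply: measurableT_comp => //.
    exact: measurable_on_line.
  rewrite /F -ge0_integralD//; [|exact: mline (Int_meas (If k))|exact: mline (Int_meas (If l))].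
  apply: ge0_le_integral => //.
  - apply: mline; exact: test_measurable (test_partial i (testB (tp l) (tp k))).
  - by apply: emeasurable_funD; apply: mline; exact: Int_meas (If _).
  move=> s _; rewrite (partialB i (test_dable (tp l)) (test_dable (tp k))) /= lee_fin /f.
  move: (G i _) (partial i (phi_ l) _) (partial i (phi_ k) _) => p q s'.
  by rewrite (_ : q - s' = (p - s') - (p - q)); [exact: ler_normB|ring].
(* Replacing [u] by [phi_ l] costs b l in L^1, and the line bound adds the integral of F l; letting
   l tend to infinity leaves F k alone. *)
have ubox k x r : 0 < r -> ((I (fun z => `|u z - phi_ k z| * \1_(cube x r) z))%:E <=
    (2 * r)%:E * \int[lam n]_y ((\1_(cube (del i x) r) y)%:E * F k y))%E.
  move=> r0; set W := (_ * _)%E.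
  have lukp k' : locInt (fun z => `|u z - phi_ k' z|).
    by apply: locIntAbs; apply: Int_locInt; exact: IntB.
  have lpp l : Int (fun z => `|phi_ l z - phi_ k z| * \1_(cube x r) z).
    have lpl : locInt (fun z => `|phi_ l z - phi_ k z|).
      by apply: locIntAbs; apply: Int_locInt; exact: IntB.
    by have [_ h] := lpl; apply: h; exact: ltW.
  have st l : ((I (fun z => `|u z - phi_ k z| * \1_(cube x r) z))%:E <= (b l + 2 * r * c l)%:E + W)%E.
    have [_ Iuk] := lukp k; have rr := ltW r0.
    apply: (@le_trans _ _ ((b l)%:E + (I (fun z => `|phi_ l z - phi_ k z| * \1_(cube x r) z))%:E)%E).
      have IuL := IntAbs (IntB Iu (Ip l)).
      rewrite -EFinD lee_fin /b -(ID IuL (lpp l)).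
      apply: le_I; [exact: Iuk|exact: IntD|move=> z].
      rewrite indicE; case: (z \in _); rewrite ?mulr1 ?mulr0 ?addr0//.
      move: (u z) (phi_ k z) (phi_ l z) => p q s.
      by rewrite (_ : p - q = (p - s) + (s - q)); [exact: ler_normD|ring].
    rewrite EFinD -addeA leeD2l//.
    rewrite -(IE (lpp l)).
    have mp : measurable_fun setT (fun z => (`|phi_ l z - phi_ k z|)%:E : \bar R).
      by apply/measurable_EFinP; apply: measurableT_comp => //; exact: Int_meas (IntB (Ip l) (Ip k)).
    have mFF : measurable_fun setT (fun y => F k y + F l y)%E by exact: emeasurable_funD.
    have p0 (z : 'rV[R]_n.+1) : (0 <= (`|phi_ l z - phi_ k z|)%:E)%E by rewrite lee_fin.
    have := box_line x mp p0 mFF (lineb k l) r0.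
    rewrite (_ : \int[mu]_z ((\1_(cube x r) z)%:E * (`|phi_ l z - phi_ k z|)%:E) =
        \int[mu]_z (`|phi_ l z - phi_ k z| * \1_(cube x r) z)%:E)%E; last first.
      by apply: eq_integral => z _; rewrite -EFinM mulrC.
    move=> h; apply: (le_trans h).
    have mc : measurable_fun setT (fun y : 'rV[R]_n => (\1_(cube (del i x) r) y)%:E : \bar R).
      by apply/measurable_EFinP; apply: measurable_indic; exact: measurable_cube.
    have i0 (y : 'rV[R]_n) : (0 <= (\1_(cube (del i x) r) y)%:E :> \bar R)%E by rewrite lee_fin indicE.
    have r20 : (0 <= (2 * r)%:E)%E by rewrite lee_fin mulr_ge0.
    under eq_integral do rewrite ge0_muleDr//.
    rewrite ge0_integralD//; [|by move=> y _; rewrite mule_ge0|exact: emeasurable_funM|by move=> y _; rewrite mule_ge0|exact: emeasurable_funM].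
    rewrite ge0_muleDr; [|by apply: integral_ge0 => y _; rewrite mule_ge0|by apply: integral_ge0 => y _; rewrite mule_ge0].
    rewrite [leLHS]addeC; apply: leeD; last first.
      by rewrite /W.
    rewrite (EFinM (2 * r) (c l)); apply: lee_wpmul2l => //; rewrite -IF.
    apply: ge0_le_integral => //.
    - by move=> y _; rewrite mule_ge0.
    - exact: emeasurable_funM.
    move=> y _; rewrite indicE; case: (y \in _); rewrite ?mul1e ?mul0e//.
  apply/lee_addgt0Pr => e e0.
  have cbc : b l + 2 * r * c l @[l --> \oo] --> 0.
    rewrite -(addr0 0) -{2}(mulr0 (2 * r)); apply: cvgD => //; apply: cvgM => //; exact: cvg_cst.
  have /cvgrPdist_le/(_ _ e0)[l _ Hl] := cbc.
  apply: le_trans (st l) _; rewrite addeC leeD2l// lee_fin.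
  by have := Hl l (leqnn l); rewrite /= sub0r normrN; exact: le_trans (ler_norm _).
pose a k j y := bav (F k) (rk j) y.
have Ha k j := bav_int (mF k) (F0 k) (@rk_gt0 R j).
(* The index [k] and the set of good radii depend on [y] only, so one null set of lines serves all
   points of a line. *)
have main : {ae lam n, forall y, forall e : R, 0 < e -> exists k, forall J : nat,
    exists2 j, (J <= j)%N & (a k j y < e%:E)%E}.
  apply: (@ae_inf_liminf _ _ _ (lam n) a (fun k => (c k)%:E)) => [k j|k j y|k j|e e0].
  - by have [] := Ha k j.
  - by have [_ h _] := Ha k j; exact: h.
  - by have [_ _ h] := Ha k j; rewrite h IF.
  - have /cvgrPdist_le/(_ _ e0)[k _ Hk] := cc; exists k; rewrite lee_fin.
    by have := Hk k (leqnn k); rewrite /= sub0r normrN; exact: le_trans (ler_norm _).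
apply: filterS main => y Hy e e0; have [k Hk] := Hy e e0; exists k => t cx xc.
set x := ins i y t in xc *.
apply/ler_addgt0Pr => h h0; have h20 : 0 < h / 2 by rewrite divr_gt0.
have [d1 d10 Hd1] := continuous_cube x (test_continuous (tp k)) h20.
have [d2 d20 Hd2] := (lpt_I x cx lu).1 xc _ h20.
have d0 : 0 < Num.min d1 d2 by rewrite lt_min d10.
have [J HJ] := rk_small d0; have [j /HJ rj aj] := Hk J.
set r := rk j in rj; have r0 : 0 < r := rk_gt0 j.
move: rj; rewrite lt_min => /andP[rd1 rd2].
have := Hd2 r; rewrite r0 rd2 => /(_ isT) h2.
have rN : 0 < (2 * r) ^+ n.+1 by rewrite exprn_gt0// mulr_gt0.
have Ic := Int_cube x (ltW r0).
have lp := Int_locInt (Ip k).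
have [_ Iuc] := locIntAbs (locIntB cx lu).
have [_ Iup] := locIntAbs (locIntBs lu lp).
have st : `|cx - phi_ k x| * (2 * r) ^+ n.+1 <=
   I (fun z => `|u z - cx| * \1_(cube x r) z) + I (fun z => `|u z - phi_ k z| * \1_(cube x r) z)
    + h / 2 * (2 * r) ^+ n.+1.
  rewrite -(I_cube x (ltW r0)) -!(IZ _ Ic) -(ID (Iuc x r (ltW r0)) (Iup x r (ltW r0))).
  rewrite -ID; [|exact: IntD (Iuc x r (ltW r0)) (Iup x r (ltW r0))|exact: IntZ].
  apply: le_I; [exact: IntZ|apply: IntD; [exact: IntD (Iuc x r (ltW r0)) (Iup x r (ltW r0))|exact: IntZ]|move=> z].
  rewrite -!mulrDl indicE; case: (boolP (z \in _)) => [/set_mem zc|_]; last by rewrite !mulr0.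
  rewrite !mulr1.
  have : `|phi_ k x - phi_ k z| <= h / 2.
    apply: Hd1 => m; have /andP[z1 z2] := zc m; clear -z1 z2 rd1.
    by apply/andP; split; lra.
  move: (phi_ k x) (phi_ k z) (u z) => p q s.
  have := ler_normB (s - q) (s - cx); have := ler_normB ((s - q) - (s - cx)) (p - q).
  rewrite (_ : s - q - (s - cx) - (p - q) = cx - p); last by ring.
  by clear; move: (`|_|) (`|_|) (`|_|) (`|_|) (`|_|) => *; lra.
have bx : I (fun z => `|u z - phi_ k z| * \1_(cube x r) z) <= e * (2 * r) ^+ n.+1.
  rewrite -lee_fin; apply: le_trans (ubox k x r r0) _.
  move: aj; rewrite /a /bav -/r => aj.
  have c0 : 0 < (2 * r) ^+ n by rewrite exprn_gt0// mulr_gt0.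
  rewrite /x del_ins exprS mulrCA (EFinM (2 * r) (e * (2 * r) ^+ n)); apply: lee_wpmul2l; first by rewrite lee_fin mulr_ge0// ltW.
  set X := integral _ _ _ in aj *.
  have -> : X = (((2 * r) ^+ n)%:E * (((2 * r) ^+ n)^-1%:E * X))%E.
    by rewrite muleA -EFinM mulfV ?mul1e// gt_eqF.
  rewrite [e * _]mulrC (EFinM ((2 * r) ^+ n) e).
  by apply: lee_wpmul2l; [rewrite lee_fin ltW|exact: ltW].
rewrite -(ler_pM2r rN); apply: (le_trans st).
have rr : r ^+ n.+1 <= (2 * r) ^+ n.+1.
  apply: lerXn2r; rewrite ?nnegrE ?mulr_ge0 ?(ltW r0)//.
  by rewrite mulr_natl mulr2n lerDl ltW.
have h3 : h / 2 * r ^+ n.+1 <= h / 2 * (2 * r) ^+ n.+1 by rewrite ler_wpM2l// ltW.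
rewrite (mulrDl e h); move: h2 bx h3; clear.
rewrite (_ : h * (2 * r) ^+ n.+1 = h / 2 * (2 * r) ^+ n.+1 + h / 2 * (2 * r) ^+ n.+1); last by field.
by move: (I _) (I _) (h / 2 * _) (h / 2 * _) (e * _) => p1 p2 p3 p4 p5 *; lra.
Qed.

End lines.

Lemma ae_imp d (T : measurableType d) (R : realType) (mu : {measure set T -> \bar R})
    (P Q : T -> Prop) : {ae mu, forall x, P x} -> (forall x, P x -> Q x) -> {ae mu, forall x, Q x}.
Proof. by move=> [S [mS S0 PS]] PQ; exists S; split => // x nQ; apply: PS => /PQ. Qed.

Lemma quarter_arith (R : realFieldType) (a b c d : R) : a <= 1 / 4 * c -> b <= 1 / 4 * c ->
  0 < c -> c <= d -> d <= a + b -> False.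
Proof. by move=> *; lra. Qed.

Section line_open.
Context {R : realType} {n : nat}.
Variables (Omega : set 'rV[R]_n.+1) (M : R) (M0 : 0 < M) (OM : Omega `<=` cube 0 M).
Hypothesis (oO : open Omega).
Implicit Types (x a : 'rV[R]_n.+1) (i : 'I_n.+1) (r e : R) (k : nat) (u : 'rV[R]_n.+1 -> R).
Implicit Types (A E : set 'rV[R]_n.+1).
Local Notation H10 := (H10 Omega).
Local Notation mu := (lam n.+1).
Local Notation Int := (rintegrable mu).
Local Notation I := (rint mu).
Local Notation mass := (@mass R n).
Local Notation "\1_ A" := (\1_A : _ -> R).

Lemma lpt_unique u x c c' : locInt u -> lpt u x c -> lpt u x c' -> c = c'.
Proof.
move=> lu H H'; have m0 := @mass_gt0 R n.
suff : c * mass = c' * mass by move/(mulIf (lt0r_neq0 m0)).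
apply/eqP; rewrite -subr_eq0 -normr_le0; apply/ler_addgt0Pl => e e0; rewrite addr0.
have e20 : 0 < e / 2 by rewrite divr_gt0.
have [d d0 Hd] := lpt_avg lu H e20; have [d' d'0 Hd'] := lpt_avg lu H' e20.
pose r := Num.min d d' / 2.
have m_0 : 0 < Num.min d d' by rewrite lt_min d0.
have r0 : 0 < r by rewrite divr_gt0.
have rm : r < Num.min d d' by rewrite ltr_pdivrMr// mulr_natr mulr2n ltrDl.
move: rm; rewrite lt_min => /andP[rd rd'].
have := Hd r; rewrite r0 rd => /(_ isT); have := Hd' r; rewrite r0 rd' => /(_ isT).
move: (avg u r x) (c * mass) (c' * mass) => p q s; rewrite !ler_norml => /andP[? ?] /andP[? ?].
by apply/andP; split; lra.
Qed.

(** Along radii chosen for fast L^1 convergence the averages tend to mass u almost everywhere; at a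
    Lebesgue point with value c the same averages tend to c mass. *)
Lemma lpt_ae_eq u G : H10 u G -> {ae mu, forall x, forall c, lpt u x c -> u x = c}.
Proof.
move=> uG; have m0 := @mass_gt0 R n; have lu := Int_locInt (H10_Int M0 OM uG).
have H k : exists r, [/\ 0 < r, r < rk k, Int (fun x => `|mass * u x - avg u r x|) &
     I (fun x => `|mass * u x - avg u r x|) <= 2^-1 ^+ k].
  have e0 : (0 : R) < 2^-1 ^+ k by rewrite exprn_gt0.
  have [r /andP[r0 rr] [II Ir]] := avg_cvg_L1 M0 OM uG e0 (@rk_gt0 R k).
  by exists r.
have [r_ Hr] := choice H.
have mf k : Int (fun x => mass * u x - avg u (r_ k) x).
  have [r0 _ II _] := Hr k; apply: (Int_dom _ II); last exact: aeW.
  have Iu := H10_Int M0 OM uG; apply: measurable_funB; last exact: measurable_avg.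
  by apply: measurable_funM => //; exact: Int_meas Iu.
have := fast_ae_cvg0 mf (fun k => let: And4 _ _ _ h := Hr k in h).
apply: filterS => x cx c xc.
have c1 : avg u (r_ k) x @[k --> \oo] --> mass * u x.
  have : mass * u x - (mass * u x - avg u (r_ k) x) @[k --> \oo] --> mass * u x - 0.
    by apply: cvgB => //; exact: cvg_cst.
  by rewrite subr0; under eq_fun do rewrite subKr.
have c2 : avg u (r_ k) x @[k --> \oo] --> c * mass.
  apply/cvgrPdist_le => e e0; have [d d0 Hd] := lpt_avg lu xc e0.
  have [K HK] := rk_small d0; exists K => // k /= Kk; rewrite distrC; apply: Hd.
  by have [r0 rr _ _] := Hr k; rewrite r0 (lt_trans rr)// HK.
have E : mass * u x = c * mass by exact: (cvg_unique (@Rhausdorff R) c1 c2).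
by rewrite mulrC in E; exact: (mulIf (lt0r_neq0 m0) E).
Qed.

(* What the connectedness argument uses of a Sobolev-open set; unlike Sobolev-openness,
   it passes trivially to countable unions. *)
Definition lopen A := exists E, [/\ measurable E, {ae mu, forall x, Omega x -> (E x <-> A x)},
  forall a, A a -> lpt (\1_E) a 1 &
  forall i, {ae lam n, forall y, forall t, A (ins i y t) ->
    exists2 d, 0 < d & forall s, `|s - t| < d -> A (ins i y s)}].

Lemma locInt_indic E : measurable E -> locInt (\1_E).
Proof.
move=> mE; have m1 : measurable_fun setT (\1_E) by exact: measurable_indic.
split => // a r r0; have Ic := Int_cube a r0.
apply: (Int_dom _ Ic); first by apply: measurable_funM => //; exact: Int_meas Ic.
by apply: aeW => x; rewrite normrM !indicE; case: (x \in E); case: (x \in cube a r);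
  rewrite ?normr1 ?normr0 ?mul0r ?mul1r.
Qed.

(** Chebyshev: outside E one has u <= 0, hence |u - c| >= c. *)
Lemma lpt_indic_le E u a c : measurable E -> locInt u -> 0 < c -> lpt u a c ->
  {ae mu, forall x, 0 < u x -> E x} -> lpt (\1_E) a 1.
Proof.
move=> mE lu c0 /(lpt_I _ _ lu) H uE; have lE := locInt_indic mE; apply/(lpt_I _ _ lE) => e e0.
have ec : 0 < e * c by rewrite mulr_gt0.
have [d d0 Hd] := H _ ec; exists d => // r rd; have /andP[/ltW r0 _] := rd.
have [_ I1] := locIntAbs (locIntB 1 lE); have [_ I2] := locIntAbs (locIntB c lu).
have := Hd r rd; rewrite mulrAC => h.
rewrite -(ler_pM2r c0); apply: le_trans h; rewrite mulrC -(IZ _ (I1 a r r0)).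
apply: ae_le_I; [exact: IntZ (I1 a r r0)|exact: I2|].
apply: filterS uE => x ux; rewrite mulrA; apply: ler_wpM2r; first by rewrite indicE.
rewrite [\1_E x]indicE; case: (boolP (x \in E)) => [_|/negP xE]; first by rewrite subrr normr0 mulr0.
rewrite sub0r normrN normr1 mulr1.
have ux0 : u x <= 0 by rewrite leNgt; apply/negP => /ux Ex; apply: xE; exact/mem_set.
by rewrite distrC; apply: le_trans (ler_norm _); rewrite lerDl oppr_ge0.
Qed.

Lemma lopen_sob u G : H10 u G -> (forall x, Omega x -> exists c, lpt u x c) ->
  lopen [set x | Omega x /\ exists2 c, lpt u x c & 0 < c].
Proof.
move=> uG ux; have lu := Int_locInt (H10_Int M0 OM uG).
exists [set x | 0 < u x].
have mE : measurable [set x | 0 < u x].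
  rewrite (_ : [set x | _] = u @^-1` `]0, +oo[); last first.
    by apply/seteqP; split => x; rewrite /= in_itv/= andbT.
  by rewrite -[X in measurable X]setTI; apply: (H10_meas uG) => //; exact: measurable_itv.
split => //.
- apply: filterS (lpt_ae_eq uG) => x xE Ox; split => /= [u0|[_ [c xc c0]]]; last by rewrite (xE _ xc).
  by split => //; have [c xc] := ux x Ox; exists c => //; rewrite -(xE _ xc).
- by move=> a [_ [c ac c0]]; apply: (lpt_indic_le mE lu c0 ac); exact: aeW.
move=> i; have [phi_ tp H] := line_approx M0 OM i uG.
(* Three errors of c/4 separate the value at [s] from c: two from approximating the values by
   [phi_ k], one from the continuity of [phi_ k]. The value at [s] is thus at least c/4. *)
apply: filterS H => y Hy t [Ox [c xc c0]]; have c40 : 0 < c / 4 by rewrite divr_gt0.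
have [k Hk] := Hy _ c40.
have [d1 d10 Hd1] := continuous_cube (ins i y t) (test_continuous (tp k)) c40.
have [d2 d20 Hd2] := open_cube oO Ox.
exists (Num.min d1 d2); first by rewrite lt_min d10.
move=> s; rewrite lt_min => /andP[s1 s2].
have cub d : `|s - t| < d -> cube (ins i y t) d (ins i y s).
  move=> sd j; have [m ->|->] := unliftP i j.
    by rewrite !ins_lift; have := normr_ge0 (s - t); move: (y 0 m) => p q; apply/andP; split; lra.
  by rewrite !ins_at; move: sd; rewrite ltr_norml => /andP[? ?]; apply/andP; split; lra.
have Os := Hd2 _ (cub _ s2); split => //; have [c' sc] := ux _ Os; exists c' => //.
have := Hk _ _ xc; have := Hk _ _ sc; have := Hd1 _ (cub _ s1).
move: (phi_ k _) (phi_ k _) => p q; rewrite !ler_norml => /andP[? ?] /andP[? ?] /andP[? ?].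
by lra.
Qed.

Lemma lopen_bigcup (A_ : nat -> set 'rV[R]_n.+1) : (forall k, lopen (A_ k)) ->
  lopen (\bigcup_k A_ k).
Proof.
move=> HA; have [E_ HE] := choice HA; exists (\bigcup_k E_ k).
have mE k : measurable (E_ k) by case: (HE k).
have mU : measurable (\bigcup_k E_ k) by exact: bigcupT_measurable.
split => //.
- have : {ae mu, forall x, forall k, Omega x -> (E_ k x <-> A_ k x)}.
    by apply: ae_foralln => k; case: (HE k).
  apply: filterS => x Hx Ox; split => -[k _ h]; exists k => //; first by rewrite -Hx.
  by rewrite Hx.
- move=> a [k _ ak]; have [_ _ h _] := HE k.
  apply: (lpt_indic_le mU (locInt_indic (mE k)) ltr01 (h a ak)); apply: aeW => x.
  rewrite indicE; case: (boolP (x \in E_ k)) => [/set_mem xk _|_]; last by rewrite ltxx.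
  by exists k.
- move=> i; have : {ae lam n, forall y, forall k, forall t, A_ k (ins i y t) ->
    exists2 d, 0 < d & forall s, `|s - t| < d -> A_ k (ins i y s)}.
    by apply: ae_foralln => k; have [_ _ _ h] := HE k.
  apply: filterS => y Hy t [k _ kt]; have [d d0 Hd] := Hy k t kt; exists d => // s sd.
  by exists k => //; exact: Hd.
Qed.

Lemma ae_lines i (P : 'rV[R]_n.+1 -> Prop) : {ae mu, forall x, P x} ->
  {ae lam n, forall y, {ae lebesgue_measure, forall t : R, P (ins i y t)}}.
Proof.
move=> [S [mS S0 PS]].
have m1 : measurable_fun setT (fun x => (\1_S x)%:E : \bar R).
  by apply/measurable_EFinP; exact: measurable_indic.
have p1 x : (0 <= (\1_S x)%:E :> \bar R)%E by rewrite lee_fin indicE.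
have IS : (\int[lam n]_y \int[lebesgue_measure]_t (\1_S (ins i y t))%:E <= 0)%E.
  by rewrite -(tonelli_ins i m1 p1) integral_indic// setIT; have : (mu S <= 0)%E by rewrite S0.
have := ge0_integral0_ae (measurable_line i m1 p1) (fun y => integral_ge0 _ (fun t _ => p1 _)) IS.
apply: filterS => y Iy; exists [set t | S (ins i y t)].
have mSy : measurable [set t : R | S (ins i y t)].
  by rewrite -[X in measurable X]setTI; exact: (measurable_ins2 i y measurableT mS).
split => //.
- by rewrite -Iy -[X in lebesgue_measure X]setIT -integral_indic.
- by move=> t /= Pt; apply: PS.
Qed.

(** Projection along an axis does not increase distances. A set of diameter D therefore projects
    into a cube of radius D and volume 2^n D^n, so the projection of Z is null. *)
Lemma null_lines (Z : set 'rV[R]_n.+1) i : hausdorff n Z = 0%E ->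
  {ae lam n, forall y, forall t, ~ Z (ins i y t)}.
Proof.
move=> HZ.
have cov e : 0 < e -> exists U : set 'rV[R]_n, [/\ measurable U, (lam n U <= e%:E)%E &
    forall y t, Z (ins i y t) -> U y].
  move=> e0.
  (* The scale 1 is enough: small content already yields small volume, and bounded diameters are
     finite. *)
  have c0 : (hausdorff_content n 1 Z <= 0)%E.
    by rewrite -HZ; apply: ereal_sup_ubound; exists 1 => //=.
  have e20 : (0 < (e / 2 ^+ n)%:E)%E by rewrite lte_fin divr_gt0// exprn_gt0.
  have := le_lt_trans c0 e20; rewrite /hausdorff_content => /ereal_inf_lt[_ [F [ZF F1] <-] Fe].
  have HF k : exists U : set 'rV[R]_n, [/\ measurable U,
      (lam n U <= (2 ^+ n)%:E * hausdorff_gauge n (F k))%E & forall y t, F k (ins i y t) -> U y].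
    rewrite /hausdorff_gauge; case: eqP => [->|/eqP/set0P[x0 Fx0]].
      by exists set0; split => //; rewrite measure0 mule0.
    have d0 : (0 <= eucl_diam (F k))%E.
      apply: ereal_sup_ubound; exists x0 => //; exists x0 => //; congr EFin.
      by rewrite /eucl_dist big1 ?sqrtr0// => j _; rewrite subrr expr0n.
    have dfin : eucl_diam (F k) \is a fin_num.
      by rewrite ge0_fin_numE//; apply: le_lt_trans (F1 k) _; exact: ltry.
    set D := fine (eucl_diam (F k)); have D0 : 0 <= D by exact: fine_ge0.
    have DE : eucl_diam (F k) = D%:E by rewrite fineK.
    exists (cube (del i x0) D); split; first exact: measurable_cube.
      by rewrite (lam_cube _ D0) DE -EFin_expe -EFinM exprMn.
    move=> y t Fy j; have : `|x0 0 (lift i j) - y 0 j| <= D.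
      rewrite -lee_fin -DE; apply: le_trans (_ : (eucl_dist x0 (ins i y t))%:E <= _)%E; last first.
        by apply: ereal_sup_ubound; exists x0 => //; exists (ins i y t).
      rewrite lee_fin -sqrtr_sqr /eucl_dist ler_wsqrtr// (bigD1 (lift i j))//= ins_lift lerDl.
      by apply: sumr_ge0 => m _; exact: sqr_ge0.
    by rewrite mxE ler_norml => /andP[? ?]; apply/andP; split; lra.
  have [U_ HU] := choice HF; exists (\bigcup_k U_ k).
  have mU k : measurable (U_ k) by case: (HU k).
  have mUU : measurable (\bigcup_k U_ k) by exact: bigcupT_measurable.
  split => //.
    have sa := @measure_sigma_subadditive _ _ _ (lam n) (\bigcup_k U_ k) U_ mU mUU (@subset_refl _ _).
    apply: (le_trans sa); apply: (@le_trans _ _ (\sum_(0 <= k <oo) ((2 ^+ n)%:E * hausdorff_gauge n (F k)))%E).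
      by apply: lee_nneseries => k _; case: (HU k).
    rewrite nneseriesZl; last first.
      move=> k _; rewrite /hausdorff_gauge; case: eqP => [//|/eqP/set0P[x0 Fx0]].
      apply: expe_ge0; apply: ereal_sup_ubound; exists x0 => //; exists x0 => //; congr EFin.
      by rewrite /eucl_dist big1 ?sqrtr0// => j _; rewrite subrr expr0n.
    have p2 : 0 < 2 ^+ n :> R by rewrite exprn_gt0.
    have -> : e%:E = ((2 ^+ n)%:E * (e / 2 ^+ n)%:E)%E.
      by rewrite -EFinM mulrCA divff ?mulr1// gt_eqF.
    by apply: lee_wpmul2l; [rewrite lee_fin ltW|exact: ltW].
  move=> y t /ZF[k _ Fk]; exists k => //; have [_ _ h] := HU k; exact: h Fk.
have [U_ HU] := choice (fun k => cov _ (@rk_gt0 R k)).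
exists (\bigcap_k U_ k).
have mU k : measurable (U_ k) by case: (HU k).
have mI : measurable (\bigcap_k U_ k) by exact: bigcapT_measurable.
split => //.
- apply/eqP; rewrite eq_le measure_ge0 andbT; apply/lee_addgt0Pr => e e0; rewrite add0e.
  have [K HK] := rk_small e0; have [_ h _] := HU K.
  apply: (@le_trans _ _ (lam n (U_ K))); first by apply: le_measure; rewrite ?inE// => y; exact.
  by apply: (le_trans h); rewrite lee_fin ltW// HK.
- move=> y /= /existsNP[t /contrapT Zt] k _; have [_ _ h] := HU k; exact: h Zt.
Qed.

Lemma line_dichotomy A B i y (p q : R) :
  (forall t, A (ins i y t) -> exists2 d, 0 < d & forall s, `|s - t| < d -> A (ins i y s)) ->
  (forall t, B (ins i y t) -> exists2 d, 0 < d & forall s, `|s - t| < d -> B (ins i y s)) ->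
  A `&` B = set0 -> (forall s, p <= s <= q -> A (ins i y s) \/ B (ins i y s)) ->
  (forall s, p <= s <= q -> A (ins i y s)) \/ (forall s, p <= s <= q -> ~ A (ins i y s)).
Proof.
move=> HA HB AB cov.
have op (X : set 'rV[R]_n.+1) : (forall t, X (ins i y t) -> exists2 d, 0 < d &
    forall s, `|s - t| < d -> X (ins i y s)) -> open [set t : R | X (ins i y t)].
  move=> HX; rewrite openE => t /= /HX[d d0 Hd]; apply/nbhs_ballP; exists d => //= s.
  by rewrite -ball_normE /= distrC; exact: Hd.
have nAB x : A x -> B x -> False by move=> Ax Bx; have : (A `&` B) x by []; rewrite AB.
have [[s0 [s0J As0]]|no] := pselect (exists s, p <= s <= q /\ A (ins i y s)); last first.
  by right => s sJ As; apply: no; exists s.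
left; have := @segment_connected R p q (`[p, q]%classic `&` [set t | A (ins i y t)]).
move=> H; have E : `[p, q]%classic `&` [set t | A (ins i y t)] = `[p, q]%classic.
  apply: H.
  - by exists s0; split => //=; rewrite in_itv.
  - by exists [set t | A (ins i y t)] => //; exact: op.
  - exists (~` [set t | B (ins i y t)]); first by apply: open_closedC; exact: op.
    apply/seteqP; split => t /= [tJ h]; split => //; first by move=> h'; exact: nAB h h'.
    by case: (cov t) => //; move: tJ; rewrite in_itv.
move=> s sJ; have sI : `[p, q]%classic s by rewrite /= in_itv.
by move: sI; rewrite -E => -[].
Qed.

Section split.
Variables (A B Z E : set 'rV[R]_n.+1).
Hypothesis (AB : A `&` B = set0) (ZAB : Omega `\` Z `<=` A `|` B).
Hypothesis (Znull : forall i, {ae lam n, forall y, forall t, ~ Z (ins i y t)}).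
Hypothesis (mE : measurable E) (EA : {ae mu, forall x, Omega x -> (E x <-> A x)}).
Hypothesis (lA : forall i, {ae lam n, forall y, forall t, A (ins i y t) ->
    exists2 d, 0 < d & forall s, `|s - t| < d -> A (ins i y s)}).
Hypothesis (lB : forall i, {ae lam n, forall y, forall t, B (ins i y t) ->
    exists2 d, 0 < d & forall s, `|s - t| < d -> B (ins i y s)}).

Let w (x : 'rV[R]_n.+1) : R := `|\1_E x - 1|.

Let w_loc : locInt w.
Proof. by apply: locIntAbs; apply: locIntB; exact: locInt_indic. Qed.

(** On almost every line of direction i through the boxes, [w] is almost everywhere 0 or almost
    everywhere 1 along the segment inside the large cube. Sliding a segment of length 2 r along it
    leaves the integral unchanged; centers within rho/2 and r <= rho/2 keep both boxes in the large
    cube. *)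
Lemma box_shift i x0 x x' rho r : cube x0 rho `<=` Omega -> 0 < r -> 2 * r <= rho ->
  cube x0 (rho / 2) x -> cube x0 (rho / 2) x' -> del i x = del i x' ->
  I (fun z => w z * \1_(cube x r) z) = I (fun z => w z * \1_(cube x' r) z).
Proof.
move=> cO r0 rr cx cx' dd; have [mw Iw] := w_loc.
have mwc a : measurable_fun setT (fun z => (w z * \1_(cube a r) z)%:E : \bar R).
  by apply/measurable_EFinP; exact: Int_meas (Iw a r (ltW r0)).
have wc0 a (z : 'rV[R]_n.+1) : (0 <= (w z * \1_(cube a r) z)%:E)%E.
  by rewrite lee_fin; apply: mulr_ge0; [exact: normr_ge0|rewrite indicE].
apply: EFin_inj; apply: etrans (esym (IE (Iw x r (ltW r0)))) _.
apply: etrans _ (IE (Iw x' r (ltW r0))).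
rewrite (tonelli_ins i (mwc x) (wc0 x)) (tonelli_ins i (mwc x') (wc0 x')).
apply: ae_eq_integral => //; [exact: (measurable_line i (mwc x) (wc0 x))|exact: (measurable_line i (mwc x') (wc0 x'))|].
have H := ae_conj (ae_lines i EA) (ae_conj (Znull i) (ae_conj (lA i) (lB i))).
apply: filterS H => y [yE [yZ [yA yB]]] _.
have [cy|cy] := pselect (cube (del i x) r y); last first.
  apply: eq_integral => t _; congr EFin; rewrite !cube_ins -dd.
  by rewrite (_ : \1_(cube (del i x) r) y = 0) ?mul0r ?mulr0// indicE memNset.
pose p := x0 0 i - rho; pose q := x0 0 i + rho.
have inO s : p <= s <= q -> Omega (ins i y s).
  move=> sJ; apply: cO => j; have [k ->|->] := unliftP i j; last by rewrite ins_at.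
  rewrite ins_lift; have := cy k; have := cx (lift i k); rewrite mxE.
  by move: (x 0 _) (x0 0 _) (y 0 _) => a b c /andP[? ?] /andP[? ?]; apply/andP; split; lra.
have cov s : p <= s <= q -> A (ins i y s) \/ B (ins i y s).
  by move=> /inO Os; apply: ZAB; split => //; exact: yZ.
have inJ a s : cube x0 (rho / 2) a -> a 0 i - r <= s <= a 0 i + r -> p <= s <= q.
  move=> ca; have := ca i; rewrite /p /q; move: (a 0 i) (x0 0 i) => b c /andP[? ?] /andP[? ?].
  by apply/andP; split; lra.
(* The line integral is c times 2 r whatever the position of the box, so equal projections give
   equal integrals. *)
have calc (c : R) : {ae lebesgue_measure, forall s : R, p <= s <= q -> w (ins i y s) = c} ->
    forall a, cube x0 (rho / 2) a -> del i a = del i x ->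
    (\int[lebesgue_measure]_t (w (ins i y t) * \1_(cube a r) (ins i y t))%:E = (c * (2 * r))%:E)%E.
  move=> wE a ca da.
  set D := `[a 0 i - r, a 0 i + r]%classic.
  have mD : measurable D by exact: measurable_itv.
  have lD : lebesgue_measure D = (2 * r)%:E.
    rewrite /D lebesgue_measure_itv/= lte_fin ifT; last by lra.
    by rewrite -EFinB; congr EFin; ring.
  transitivity (\int[lebesgue_measure]_t (c%:E * (\1_D t)%:E))%E.
    apply: ae_eq_integral => //.
    - exact: (measurableT_comp (mwc a) (measurable_ins2 i y)).
    - by apply: emeasurable_funM => //; apply/measurable_EFinP; exact: measurable_indic.
    suff : {ae lebesgue_measure, forall s : R, setT s ->
        (w (ins i y s) * \1_(cube a r) (ins i y s))%:E = (c%:E * (\1_D s)%:E)%E} by exact.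
    apply: (ae_imp wE) => s ws _; rewrite -EFinM; congr EFin; rewrite cube_ins -/D da.
    rewrite (_ : \1_(cube (del i x) r) y = 1) ?mul1r; last by rewrite indicE mem_set.
    rewrite indicE; case: (boolP (s \in D)) => [/set_mem sD|_]; last by rewrite !mulr0.
    by rewrite ws//; apply: (inJ a) => //; move: sD; rewrite /D /= in_itv.
  rewrite integralZl//; last first.
    apply/integrableP; split; first by apply/measurable_EFinP; exact: measurable_indic.
    under eq_integral do rewrite /= ger0_norm ?indicE//.
    rewrite (_ : (\int[_]_x _)%E = (2 * r)%:E) ?ltry//.
    by rewrite -lD -[X in lebesgue_measure X]setIT -integral_indic.
  by rewrite integral_indic// setIT EFinM; congr (_ * _)%E.
have wv x1 : w x1 = if x1 \in E then 0 else 1.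
  by rewrite /w indicE; case: (x1 \in E); rewrite ?subrr ?normr0// sub0r normrN normr1.
have [allA|noA] := line_dichotomy yA yB AB cov.
  have wE : {ae lebesgue_measure, forall s : R, p <= s <= q -> w (ins i y s) = 0}.
    by apply: (ae_imp yE) => s Es sJ; rewrite wv mem_set//; apply/(Es (inO _ sJ)); exact: allA.
  by rewrite (calc 0 wE x)// (calc 0 wE x').
have wE : {ae lebesgue_measure, forall s : R, p <= s <= q -> w (ins i y s) = 1}.
  by apply: (ae_imp yE) => s Es sJ; rewrite wv memNset// => /(Es (inO _ sJ)); exact: noA.
by rewrite (calc 1 wE x)// (calc 1 wE x').
Qed.

Lemma box_const x0 x rho r : cube x0 rho `<=` Omega -> 0 < r -> 2 * r <= rho ->
  cube x0 (rho / 2) x -> I (fun z => w z * \1_(cube x r) z) = I (fun z => w z * \1_(cube x0 r) z).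
Proof.
move=> cO r0 rr cx; have rho0 : 0 < rho by apply: lt_le_trans rr; rewrite mulr_gt0.
(* [m k] has the first k coordinates of [x] and the others of [x0]; consecutive points differ in one
   coordinate, as [box_shift] requires. *)
pose m k : 'rV[R]_n.+1 := \row_j (if (j < k)%N then x 0 j else x0 0 j).
have cm k : cube x0 (rho / 2) (m k).
  move=> j; rewrite mxE; case: ifP => _; first exact: cx.
  by move: (x0 0 j) => a; apply/andP; split; lra.
have <- : m n.+1 = x by apply/rowP => j; rewrite mxE ltn_ord.
have <- : m 0 = x0 by apply/rowP => j; rewrite mxE.
suff H k : (k <= n.+1)%N -> I (fun z => w z * \1_(cube (m k) r) z) =
    I (fun z => w z * \1_(cube (m 0) r) z) by exact: H.
elim: k => // k IH kn; rewrite -IH; last exact: ltnW.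
apply: (@box_shift (Ordinal kn) x0 _ _ rho r cO r0 rr (cm _) (cm _)).
apply/rowP => j; rewrite !mxE ltnS leq_eqVlt.
have : lift (Ordinal kn) j != k :> nat.
  by have := neq_lift (Ordinal kn) j; rewrite eq_sym -val_eqE.
by move=> /negbTE ->.
Qed.

Lemma lpt_const x0 x rho : 0 < rho -> cube x0 rho `<=` Omega -> cube x0 (rho / 2) x ->
  lpt (\1_E) x 1 <-> lpt (\1_E) x0 1.
Proof.
move=> rho0 cO cx; have lE := locInt_indic mE.
have K r : 0 < r -> 2 * r <= rho ->
    I (fun z => `|\1_E z - 1| * \1_(cube x r) z) = I (fun z => `|\1_E z - 1| * \1_(cube x0 r) z).
  by move=> r0 rr; exact: (@box_const x0 x rho r cO r0 rr cx).
by split => /(lpt_I _ _ lE) H; apply/(lpt_I _ _ lE) => e e0; have [d d0 Hd] := H e e0;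
  (exists (Num.min d (rho / 2)); first by rewrite lt_min d0 divr_gt0);
  move=> r; rewrite lt_min => /and3P[r0 rd rr]; [rewrite -K//|rewrite K//]; try lra;
  apply: Hd; rewrite r0.
Qed.

(** By [lpt_const] the points of density 1 of E, and the others as well, form open subsets of Omega,
    which is connected. *)
Lemma lpt_propagate a b : connected Omega -> Omega a -> Omega b ->
  lpt (\1_E) a 1 -> lpt (\1_E) b 1.
Proof.
move=> cO Oa Ob Ha.
have op (P : 'rV[R]_n.+1 -> Prop) : (forall x0 x rho, 0 < rho -> cube x0 rho `<=` Omega ->
    cube x0 (rho / 2) x -> P x0 -> P x) -> open [set x | Omega x /\ P x].
  move=> HP; rewrite openE => x0 [Ox0 Px0]; have [rho rho0 c0] := open_cube oO Ox0.
  apply/nbhs_ballP; exists (rho / 2) => /=; first by rewrite divr_gt0.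
  move=> x; rewrite -ball_normE /= => xx0.
  have cx : cube x0 (rho / 2) x.
    move=> i; have := le_lt_trans (coord_le_norm (x0 - x) i) xx0; rewrite !mxE ltr_norml.
    by move: (x0 0 i) (x 0 i) => p q /andP[? ?]; apply/andP; split; lra.
  split; last exact: HP cx Px0.
  by apply: c0 => i; have := cx i; move: (x0 0 i) (x 0 i) => p q /andP[? ?]; apply/andP; split; lra.
pose S := [set x | Omega x /\ lpt (\1_E) x 1].
have oS : open S by apply: op => x0 x rho r0 c0 cx h; apply/(lpt_const r0 c0 cx).
have oN : open [set x | Omega x /\ ~ lpt (\1_E) x 1].
  by apply: op => x0 x rho r0 c0 cx h; rewrite (lpt_const r0 c0 cx).
have SE : S = Omega.
  apply: cO; first by exists a.
  - by exists S => //; apply/seteqP; split => x // [].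
  - exists (~` [set x | Omega x /\ ~ lpt (\1_E) x 1]); first exact: open_closedC.
    apply/seteqP; split => x [Ox h]; split => //; first by move=> [].
    by apply: contrapT => h'; apply: h.
have : S b by rewrite SE.
by case.
Qed.

End split.

(** Density of E propagates from a to b, where F also has density 1. But E and F are almost disjoint
    inside Omega, so near b the cube, of volume at least r^N, would be covered by two defects of at
    most r^N / 4 each. *)
Theorem no_split A B Z : connected Omega -> A `<=` Omega -> B `<=` Omega -> lopen A -> lopen B ->
  A `&` B = set0 -> hausdorff n Z = 0%E -> Omega `\` Z `<=` A `|` B ->
  forall a b, A a -> B b -> False.
Proof.
move=> cO AO BO [E [mE EA dA lA]] [F [mF FB dB lB]] AB Z0 ZAB a b Aa Bb.
have Eb : lpt (\1_E) b 1.
  apply: (lpt_propagate AB ZAB (fun i => null_lines i Z0) mE EA lA lB cO (AO _ Aa) (BO _ Bb)).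
  exact: dA.
have Fb := dB _ Bb; have lE := locInt_indic mE; have lF := locInt_indic mF.
have e0 : (0 : R) < 1 / 4 by rewrite divr_gt0.
have [d1 d10 H1] := (lpt_I _ _ lE).1 Eb _ e0; have [d2 d20 H2] := (lpt_I _ _ lF).1 Fb _ e0.
have [d3 d30 H3] := open_cube oO (BO _ Bb).
pose r := Num.min (Num.min d1 d2) d3 / 2.
have m0 : 0 < Num.min (Num.min d1 d2) d3 by rewrite !lt_min d10 d20.
have r0 : 0 < r by rewrite divr_gt0.
have : r < Num.min (Num.min d1 d2) d3 by rewrite ltr_pdivrMr// mulr_natr mulr2n ltrDl.
rewrite !lt_min => /andP[/andP[r1 r2] r3].
have := H1 r; rewrite r0 r1 => /(_ isT) h1; have := H2 r; rewrite r0 r2 => /(_ isT) h2.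
have [_ I1] := locIntAbs (locIntB 1 lE); have [_ I2] := locIntAbs (locIntB 1 lF).
have rr := ltW r0; have Ic := Int_cube b rr.
have : I (\1_(cube b r)) <= I (fun x => `|\1_E x - 1| * \1_(cube b r) x + `|\1_F x - 1| * \1_(cube b r) x).
  apply: ae_le_I; [exact: Ic|exact: IntD (I1 b r rr) (I2 b r rr)|].
  apply: filterS2 EA FB => x xE xF; rewrite [\1_(cube b r) x]indicE.
  case: (boolP (x \in _)) => [/set_mem cx|_]; last by rewrite !mulr0 addr0.
  have Ox : Omega x.
    apply: H3 => i; have := cx i; move: (x 0 i) (b 0 i) => p q /andP[? ?]; apply/andP; split; lra.
  rewrite !mulr1 !indicE; case: (boolP (x \in E)) => [/set_mem/(xE Ox) Ax|_]; last first.
    by rewrite sub0r normrN normr1 lerDl.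
  case: (boolP (x \in F)) => [/set_mem/(xF Ox) Bx|_]; last by rewrite [X in _ + `|X|]sub0r normrN normr1 lerDr.
  by have : (A `&` B) x by []; rewrite AB.
rewrite (ID (I1 b r rr) (I2 b r rr)) (I_cube b rr).
have p0 : 0 < r ^+ n.+1 by rewrite exprn_gt0.
have : r ^+ n.+1 <= (2 * r) ^+ n.+1.
  apply: lerXn2r; [by rewrite nnegrE|by rewrite nnegrE mulr_ge0|].
  by rewrite mulr_natl mulr2n lerDl.
exact: quarter_arith h1 h2 p0.
Qed.

End line_open.

(** * Zero sets of solutions *)

Section lebesgue_points.
Context {R : realType} {n : nat}.
Implicit Types (u v : 'rV[R]_n.+1 -> R) (a : 'rV[R]_n.+1).
Local Notation mu := (lam n.+1).
Local Notation I := (rint mu).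

Lemma lpt0Z u a c : locInt u -> lpt u a 0 -> lpt (scf c u) a 0.
Proof.
move=> lu; have lc : locInt (scf c u).
  have [mu0 Iu] := lu; split; first exact: measurable_funM.
  move=> b r r0; have -> : (fun x => scf c u x * \1_(cube b r) x) =
    (fun x => c * (u x * \1_(cube b r) x)) by apply/funext => x; rewrite /scf mulrA.
  exact: IntZ (Iu b r r0).
move=> /(lpt_I _ _ lu) H; apply/(lpt_I _ _ lc) => e e0.
have c1 : 0 < `|c| + 1 by rewrite ltr_wpDl.
have ec : 0 < e / (`|c| + 1) by rewrite divr_gt0.
have [d d0 Hd] := H _ ec; exists d => // r rd; have /andP[/ltW r0 _] := rd.
have [_ I1] := locIntAbs (locIntB 0 lc); have [_ I2] := locIntAbs (locIntB 0 lu).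
have h := Hd r rd.
have : I (fun x => `|scf c u x - 0| * \1_(cube a r) x) <=
    I (fun x => (`|c| + 1) * (`|u x - 0| * \1_(cube a r) x)).
  apply: le_I; [exact: I1|exact: IntZ (I2 a r r0)|] => x.
  by rewrite !subr0 /scf normrM mulrA ler_wpM2r ?indicE// ler_wpM2r// lerDl.
rewrite (IZ _ (I2 a r r0)) => h'; apply: le_trans h' _.
apply: le_trans (ler_wpM2l (ltW c1) h) _.
by rewrite mulrA (mulrC (`|c| + 1)) divfK// lt0r_neq0.
Qed.

Lemma lptD0 u v a : locInt u -> locInt v -> lpt u a 0 -> lpt v a 0 ->
  lpt (fun x => u x + v x) a 0.
Proof.
move=> lu lv; have lc : locInt (fun x => u x + v x).
  have [mu0 Iu] := lu; have [mv Iv] := lv; split; first exact: measurable_funD.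
  move=> b r r0; have -> : (fun x => (u x + v x) * \1_(cube b r) x) =
    (fun x => u x * \1_(cube b r) x + v x * \1_(cube b r) x) by apply/funext => x; rewrite mulrDl.
  exact: IntD (Iu b r r0) (Iv b r r0).
move=> /(lpt_I _ _ lu) H /(lpt_I _ _ lv) H'; apply/(lpt_I _ _ lc) => e e0.
have e20 : 0 < e / 2 by rewrite divr_gt0.
have [d d0 Hd] := H _ e20; have [d' d'0 Hd'] := H' _ e20.
exists (Num.min d d'); first by rewrite lt_min d0.
move=> r; rewrite lt_min => /and3P[r0 rd rd'].
have [_ I1] := locIntAbs (locIntB 0 lc); have [_ I2] := locIntAbs (locIntB 0 lu).
have [_ I3] := locIntAbs (locIntB 0 lv).
have h := Hd r; have h' := Hd' r; rewrite r0 rd in h; rewrite r0 rd' in h'.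
have {}h := h isT; have {}h' := h' isT; have r0' := ltW r0.
have : I (fun x => `|u x + v x - 0| * \1_(cube a r) x) <=
    I (fun x => `|u x - 0| * \1_(cube a r) x + `|v x - 0| * \1_(cube a r) x).
  apply: le_I; [exact: I1|exact: IntD (I2 a r r0') (I3 a r r0')|] => x.
  by rewrite !subr0 -mulrDl ler_wpM2r ?indicE// ler_normD.
rewrite (ID (I2 a r r0') (I3 a r r0')) => h2; apply: le_trans h2 _.
by apply: le_trans (lerD h h') _; rewrite -mulrDl -splitr.
Qed.

Lemma lpt_density_disjoint (E : set 'rV[R]_n.+1) a : measurable E ->
  lpt (\1_E) a 1 -> lpt (\1_(~` E)) a 1 -> False.
Proof.
move=> mE H /(lpt_I _ _ (locInt_indic (measurableC mE))) H'.
have : lpt (\1_E) a 0.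
  apply/(lpt_I _ _ (locInt_indic mE)) => e /H'[d d0 Hd]; exists d => // r /Hd.
  congr (_ <= _); congr I; apply/funext => x; congr (_ * _).
  rewrite !indicE in_setC; case: (x \in E) => /=; first by rewrite sub0r normrN subr0.
  by rewrite !subrr.
by move/(lpt_unique (locInt_indic mE) H)/eqP; rewrite oner_eq0.
Qed.

End lebesgue_points.

Section zero_sets.
Context {R : realType} {n : nat}.
Variables (Omega : set 'rV[R]_n.+1) (M : R) (M0 : 0 < M) (OM : Omega `<=` cube 0 M).
Hypotheses (oO : open Omega) (cO : connected Omega).
Variables (q : 'rV[R]_n.+1 -> R) (mq : measurable_fun setT q) (q0 : forall x, 0 <= q x).
Variable (T : set 'rV[R]_n.+1).
Implicit Types (u w f : 'rV[R]_n.+1 -> R) (G H : 'I_n.+1 -> 'rV[R]_n.+1 -> R).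
Local Notation mu := (lam n.+1).
Local Notation I := (rint mu).
Local Notation Int := (rintegrable mu).

(** [T] is meant for the set where the original potential is infinite, [q] for its finite part. *)
Definition nnsol w G f := [/\ Sol Omega q w G f, {ae mu, forall x, 0 <= f x} &
  {ae mu, forall x, T x -> w x = 0}].

Lemma nnsol_ge0 w G f : nnsol w G f -> {ae mu, forall x, 0 <= w x}.
Proof. by move=> [Sw f0 _]; exact: (max_principle M0 OM mq q0 Sw f0). Qed.

Lemma nnsol_H10 w G f : nnsol w G f -> H10 Omega w G.
Proof. by move=> [[[]]]. Qed.

Lemma nnsol_meas w G f : nnsol w G f -> measurable_fun setT w.
Proof. by move=> /nnsol_H10/H10_meas. Qed.

Lemma nnsol_loc w G f : nnsol w G f -> locInt w.
Proof. by move=> /nnsol_H10 h; exact: Int_locInt (H10_Int M0 OM h). Qed.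

Lemma nnsolD w G f u H g : nnsol w G f -> nnsol u H g ->
  nnsol (fun x => w x + u x) (fun i x => G i x + H i x) (fun x => f x + g x).
Proof.
move=> [Sw f0 wT] [Su g0 uT]; split; first exact: (Sol_add M0 OM Sw Su).
  by apply: filterS (ae_conj f0 g0) => x [? ?]; exact: addr_ge0.
by apply: filterS (ae_conj wT uT) => x [h1 h2] Tx; rewrite h1// h2// addr0.
Qed.

Lemma nnsol_sup w G f k : nnsol w G f -> Sup Omega q (scf k%:R w) (scg k%:R G).
Proof.
move=> [Sw f0 _]; apply: (Sol_Sup M0 OM (Sol_sc M0 OM k%:R Sw)).
by apply: filterS f0 => x ?; rewrite /scf mulr_ge0.
Qed.

Definition pos_ind u x : R := ind (0 < u x).

Lemma meas_pos u : measurable_fun setT u -> measurable [set x | 0 < u x].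
Proof.
move=> mu0; rewrite (_ : [set x | _] = u @^-1` `]0, +oo[); last first.
  by apply/seteqP; split => x; rewrite /= in_itv/= andbT.
by rewrite -[X in measurable X]setTI; apply: mu0 => //; exact: measurable_itv.
Qed.

Lemma pos_indE u : pos_ind u = \1_[set x | 0 < u x].
Proof. by apply/funext => x; rewrite /pos_ind /ind indicE; case: (boolP (0 < u x)) => h;
  [rewrite mem_set|rewrite memNset//=; exact/negP]. Qed.

Lemma pos_ind_Int w G f : nnsol w G f -> Int (pos_ind w).
Proof.
move=> Sw; have mw := nnsol_meas Sw.
have Ic : Int (\1_(cube 0 M) : 'rV[R]_n.+1 -> R) by exact: Int_cube (ltW M0).
apply: (Int_dom _ Ic); first by rewrite pos_indE; exact: measurable_indic (meas_pos mw).
apply: filterS (H10_out M0 OM (nnsol_H10 Sw)) => x H.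
rewrite /pos_ind /ind indicE; have [Ox|nO] := pselect (Omega x).
  by rewrite mem_set; [case: (0 < w x); rewrite ?normr1 ?normr0|exact: OM].
by rewrite (H nO) ltxx normr0.
Qed.

(** Positivity sets have bounded measure, because they lie in the cube up to null sets. The v_k are
    partial sums of solutions whose positivity sets nearly attain the supremum of these measures. *)
Lemma exhaustion w0 G0 f0 : nnsol w0 G0 f0 -> exists (v_ : nat -> 'rV[R]_n.+1 -> R)
  (G_ : nat -> 'I_n.+1 -> 'rV[R]_n.+1 -> R) (f_ : nat -> 'rV[R]_n.+1 -> R),
  [/\ forall k, nnsol (v_ k) (G_ k) (f_ k),
      {ae mu, forall x, forall k : nat, 0 <= v_ k x <= v_ k.+1 x} &
      forall u H g, nnsol u H g -> {ae mu, forall x, 0 < u x -> exists k : nat, 0 < v_ k x}].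
Proof.
move=> S0.
pose m u := I (pos_ind u).
pose V := [set r : R | exists u H g, nnsol u H g /\ r = m u].
have hV : has_sup V.
  split; first by exists (m w0), w0, G0, f0.
  exists (I (\1_(cube 0 M))) => _ [u [H [g [Su ->]]]].
  have Ic : Int (\1_(cube 0 M) : 'rV[R]_n.+1 -> R) by exact: Int_cube (ltW M0).
  apply: ae_le_I => //; first exact: pos_ind_Int Su.
  apply: filterS (H10_out M0 OM (nnsol_H10 Su)) => x h.
  rewrite /pos_ind /ind indicE; have [Ox|nO] := pselect (Omega x).
    by rewrite mem_set; [case: (0 < u x)|exact: OM].
  by rewrite (h nO) ltxx.
have app k : exists t : ('rV[R]_n.+1 -> R) * ('I_n.+1 -> 'rV[R]_n.+1 -> R) * ('rV[R]_n.+1 -> R),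
    nnsol t.1.1 t.1.2 t.2 /\ sup V - rk k < m t.1.1.
  have [_ [u [H [g [Su ->]]]] h] := sup_adherent (@rk_gt0 R k) hV.
  by exists (u, H, g).
have [t Ht] := choice app.
pose v_ := fix v_ k x : R := if k is j.+1 then v_ j x + (t j.+1).1.1 x else (t 0%N).1.1 x.
pose G_ := fix G_ k i x : R := if k is j.+1 then G_ j i x + (t j.+1).1.2 i x else (t 0%N).1.2 i x.
pose f_ := fix f_ k x : R := if k is j.+1 then f_ j x + (t j.+1).2 x else (t 0%N).2 x.
have Sv k : nnsol (v_ k) (G_ k) (f_ k).
  elim: k => [|k IH]; first by have [] := Ht 0%N.
  by have [h _] := Ht k.+1; exact: (nnsolD IH h).
have v0 : {ae mu, forall x, forall k : nat, 0 <= v_ k x} by apply: ae_foralln => k; exact: nnsol_ge0 (Sv k).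
have t0 : {ae mu, forall x, forall k : nat, 0 <= (t k).1.1 x}.
  by apply: ae_foralln => k; have [h _] := Ht k; exact: nnsol_ge0 h.
exists v_, G_, f_; split => //.
  by apply: filterS (ae_conj v0 t0) => x [h1 h2] k; rewrite h1 /= lerDl.
move=> u H g Su; have mu0 := nnsol_meas Su.
pose P := [set x | exists k, 0 < v_ k x].
have mP : measurable P.
  rewrite (_ : P = \bigcup_k [set x | 0 < v_ k x]).
    by apply: bigcupT_measurable => k; exact: meas_pos (nnsol_meas (Sv k)).
  by apply/seteqP; split => x [k] //=; [exists k|move=> _; exists k].
pose h x := pos_ind u x * \1_(~` P) x.
have h0 x : 0 <= h x by rewrite mulr_ge0// ?indicE// /pos_ind /ind.
have Ih : Int h.
  apply: (Int_dom _ (pos_ind_Int Su)).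
    rewrite /h; apply: measurable_funM; first exact: Int_meas (pos_ind_Int Su).
    exact: measurable_indic (measurableC mP).
  apply: aeW => x; rewrite ger0_norm// /h indicE; case: (_ \in _); rewrite ?mulr1// mulr0.
  by rewrite /pos_ind /ind.
(* The sum of u and v_k competes for the supremum, and its positivity set contains both {t_k > 0}
   and the part of {u > 0} outside P, which are disjoint; so this part has measure at most the gap
   [rk k]. *)
have hk k : I h <= rk k.
  have [St mt] := Ht k; have It := pos_ind_Int St.
  have Sa := nnsolD Su (Sv k); have Ia := pos_ind_Int Sa.
  have ub : m (fun x => u x + v_ k x) <= sup V.
    by apply: ub_le_sup; [case: hV|exists (fun x => u x + v_ k x), (fun i x => H i x + G_ k i x), (fun x => g x + f_ k x)].
  have : I (fun x => h x + pos_ind (t k).1.1 x) <= m (fun x => u x + v_ k x).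
    apply: ae_le_I; [exact: IntD|exact: Ia|].
    apply: filterS (ae_conj (ae_conj v0 t0) (nnsol_ge0 Su)) => x [[h1 h2] h3].
    have tv : (t k).1.1 x <= v_ k x by case: (k) => [|j]//=; rewrite lerDr.
    rewrite /h /pos_ind /ind indicE; case: (ltP 0 ((t k).1.1 x)) => ht.
      have Px : P x by exists k; exact: lt_le_trans ht tv.
      rewrite memNset; last by move=> /(_ Px).
      by rewrite mulr0 add0r ltr_wpDl// (lt_le_trans ht tv).
    rewrite addr0; case: (ltP 0 (u x)) => hu; last by rewrite mul0r.
    by rewrite ltr_pwDl// mul1r; case: (_ \in _).
  rewrite (ID Ih It) => hh; move: (le_trans hh ub) mt; rewrite /m.
  move: (I h) (I (pos_ind _)) (sup V) (rk k : R) => a b c d; clear => h1 h2.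
  by apply/ltW; rewrite -(ltrD2r b); apply: le_lt_trans h1 _; rewrite addrC -ltrBlDr.
have Ih0 : I h <= 0.
  apply/ler_addgt0Pl => e e0; rewrite addr0; have [K HK] := rk_small e0.
  exact: le_trans (hk K) (ltW (HK K (leqnn K))).
apply: filterS (I_eq0 Ih (aeW _ h0) Ih0) => x hx ux; apply: contrapT => nP.
move: hx; rewrite /h /pos_ind /ind ux indicE mem_set; last exact: nP.
by rewrite mulr1 => /eqP; rewrite oner_eq0.
Qed.

Definition univ_zero := [set x | Omega x /\ forall w G f, nnsol w G f -> lpt w x 0].

Definition pos_set u := [set x | Omega x /\ exists2 c, lpt u x c & 0 < c].

Lemma nnsol_lpt w G f x : nnsol w G f -> Omega x -> lpt w x 0 \/ pos_set w x.
Proof.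
move=> [Sw f0 _] Ox; have [c c0 xc] := sol_lpt M0 OM oO mq q0 Sw f0 Ox.
have [E0|cn0] := eqVneq c 0; first by left; rewrite E0 in xc.
by right; split => //; exists c => //; rewrite lt_def cn0.
Qed.

Lemma not_pos_set w G f x : nnsol w G f -> lpt w x 0 -> ~ pos_set w x.
Proof.
move=> Sw x0 [_ [c xc c0]]; move: c0.
by rewrite -(lpt_unique (nnsol_loc Sw) x0 xc) ltxx.
Qed.

Lemma lopen_pos_set w G f : nnsol w G f -> lopen Omega (pos_set w).
Proof.
move=> Sw; apply: (lopen_sob M0 OM oO (nnsol_H10 Sw)) => x Ox.
by have [?|[_ [c ? _]]] := nnsol_lpt Sw Ox; [exists 0|exists c].
Qed.

Lemma scaled_dominates (a b : R) : 0 < b -> exists m : nat, forall k, (m <= k)%N -> a <= k%:R * b.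
Proof.
move=> b0; exists (Num.bound `|a / b|) => k mk; rewrite -ler_pdivrMr//.
have kR : (Num.bound `|a / b|)%:R <= k%:R :> R by rewrite ler_nat.
apply: le_trans _ kR; apply: ltW; exact: (le_lt_trans (ler_norm _) (archi_boundP (normr_ge0 (a / b)))).
Qed.

Lemma pos_set_cover (v_ : nat -> 'rV[R]_n.+1 -> R)
    (G_ : nat -> 'I_n.+1 -> 'rV[R]_n.+1 -> R) (f_ : nat -> 'rV[R]_n.+1 -> R) x :
  (forall k, nnsol (v_ k) (G_ k) (f_ k)) ->
  {ae mu, forall x, forall k : nat, 0 <= v_ k x <= v_ k.+1 x} ->
  (forall u H g, nnsol u H g -> {ae mu, forall x, 0 < u x -> exists k : nat, 0 < v_ k x}) ->
  Omega x -> ~ univ_zero x -> exists k, pos_set (v_ k) x.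
Proof.
move=> Sv mono exh Ox; apply: contra_notP => npos; split => // u H g Su.
have v0 k : lpt (v_ k) x 0.
  by have [//|h] := nnsol_lpt (Sv k) Ox; case: npos; exists k.
pose P := [set x | exists k, 0 < v_ k x].
have mP : measurable P.
  rewrite (_ : P = \bigcup_k [set x | 0 < v_ k x]).
    by apply: bigcupT_measurable => k; exact: meas_pos (nnsol_meas (Sv k)).
  by apply/seteqP; split => z [k] //=; [exists k|move=> _; exists k].
have [Sol_u g0 _] := Su; have u0 := nnsol_ge0 Su.
have mt : measurable_fun setT (\1_P : 'rV[R]_n.+1 -> R) by exact: measurable_indic.
have Sk k : Sup Omega q (scf k%:R (v_ k)) (scg k%:R (G_ k)) by exact: nnsol_sup (Sv k).
(* The factor k forces the multiples of v_k to exceed any given value on P, although the v_k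
   themselves may stay bounded there. *)
have monok : {ae mu, forall x, forall k : nat,
    0 <= scf k%:R (v_ k) x <= scf k.+1%:R (v_ k.+1) x}.
  apply: filterS mono => z h k; have /andP[h1 h2] := h k; rewrite /scf mulr_ge0//=.
  by apply: ler_pM => //; rewrite ler_nat.
have dich : {ae mu, forall x, \1_P x = 0 :> R /\ (forall k : nat, scf k%:R (v_ k) x = 0) \/
    \1_P x = 1 :> R /\ (exists m : nat, forall k : nat, (m <= k)%N -> u x <= scf k%:R (v_ k) x)}.
  apply: filterS mono => z h.
  have hm k l : (k <= l)%N -> v_ k z <= v_ l z.
    elim: l => [|l IH]; first by rewrite leqn0 => /eqP ->.
    rewrite leq_eqVlt => /orP[/eqP ->//|]; rewrite ltnS => /IH kl; apply: le_trans kl _.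
    by have /andP[] := h l.
  have [[k0 hk0]|nP] := pselect (P z); [right|left]; split.
  - by rewrite indicE mem_set//; exists k0.
  - have [m Hm] := scaled_dominates (u z) hk0; exists (maxn m k0) => k.
    rewrite geq_max => /andP[mk kk]; apply: le_trans (Hm k mk) _.
    by rewrite /scf ler_wpM2l// hm.
  - by rewrite indicE memNset.
  - move=> k; have /andP[h1 _] := h k; rewrite /scf; apply/eqP; rewrite mulf_eq0; apply/orP; right.
    by rewrite eq_le h1 andbT leNgt; apply/negP => h2; apply: nP; exists k.
have H0 : lpt (fun z => \1_P z * u z) x 0.
  apply: (min_lpt M0 OM oO mq q0 Sol_u g0 u0 Sk monok mt dich Ox) => k.
  exact: lpt0Z (nnsol_loc (Sv k)) (v0 k).
have lu := nnsol_loc Su.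
apply: (lpt_ae_le lu _ _ H0).
  have [mu0 Iu] := lu; split => [|a r r0]; first exact: measurable_funM.
  apply: (Int_dom _ (IntAbs (Iu a r r0))).
    by apply: measurable_funM; [exact: measurable_funM|exact: measurable_indic (measurable_cube a r)].
  apply: aeW => z; rewrite -mulrA normrM indicE; case: (_ \in P); rewrite ?normr1 ?normr0 ?mul1r// mul0r.
  exact: normr_ge0.
apply: filterS (ae_conj (exh _ _ _ Su) u0) => z [h1 h2].
move: h2; rewrite le_eqVlt => /orP[/eqP <-|h]; first by rewrite normr0.
by rewrite indicE mem_set ?mul1r//; exact: h1.
Qed.

Lemma splitting w G f v H g : nnsol w G f -> nnsol v H g -> exists z K k y L l,
  [/\ nnsol z K k, nnsol y L l, v = (fun x => z x + y x),
      {ae mu, forall x, 0 < y x -> ~ 0 < w x} &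
      forall x, Omega x -> lpt w x 0 -> lpt z x 0].
Proof.
move=> Sw Sv; have [Solw f0 wT] := Sw; have [Solv g0 vT] := Sv.
pose P := [set x | 0 < w x]; pose th : 'rV[R]_n.+1 -> R := \1_P.
have mP : measurable P by exact: meas_pos (nnsol_meas Sw).
have mt : measurable_fun setT th by exact: measurable_indic.
have w0 := nnsol_ge0 Sw; have v0 := nnsol_ge0 Sv.
have Sk k : Sup Omega q (scf k%:R w) (scg k%:R G) by exact: nnsol_sup Sw.
have monok : {ae mu, forall x, forall k : nat, 0 <= scf k%:R w x <= scf k.+1%:R w x}.
  by apply: filterS w0 => z h k; rewrite /scf mulr_ge0//= ler_wpM2r// ler_nat.
have dich : {ae mu, forall x, th x = 0 /\ (forall k : nat, scf k%:R w x = 0) \/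
    th x = 1 /\ (exists m : nat, forall k : nat, (m <= k)%N -> v x <= scf k%:R w x)}.
  apply: filterS w0 => z h; rewrite /th indicE.
  have [Pz|nP] := pselect (P z); [right; rewrite mem_set//|left; rewrite memNset//]; split => //.
    exact: scaled_dominates.
  by move=> k; rewrite /scf (_ : w z = 0) ?mulr0//; apply/eqP; rewrite eq_le h andbT leNgt; apply/negP.
have th01 : {ae mu, forall x, th x = 0 \/ th x = 1}.
  by apply: aeW => x; rewrite /th indicE; case: (_ \in _); [right|left].
have zH := limit_min M0 OM mq q0 Solv g0 v0 Sk monok mt dich.
have [S1 S2] := split_Sol M0 OM mq Solv g0 v0 th01 zH.
have dat (b : 'rV[R]_n.+1 -> bool) : {ae mu, forall x, 0 <= g x * ind (b x)}.
  by apply: filterS g0 => x ?; rewrite mulr_ge0.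
exists (fun x => th x * v x), (fun i x => th x * H i x), (fun x => g x * ind (0 < th x * v x)).
exists (fun x => (1 - th x) * v x), (fun i x => (1 - th x) * H i x),
  (fun x => g x * ind (0 < (1 - th x) * v x)); split.
- split; [exact: S1|exact: (dat (fun x => 0 < th x * v x))|].
  by apply: filterS vT => x h Tx; rewrite h// mulr0.
- split; [exact: S2|exact: (dat (fun x => 0 < (1 - th x) * v x))|].
  by apply: filterS vT => x h Tx; rewrite h// mulr0.
- by apply/funext => x; rewrite mulrBl mul1r addrC subrK.
- apply: aeW => x; rewrite /th indicE => + Px; rewrite mem_set//.
  by rewrite subrr mul0r ltxx.
- move=> x Ox x0; apply: (min_lpt M0 OM oO mq q0 Solv g0 v0 Sk monok mt dich Ox) => k.
  exact: lpt0Z (nnsol_loc Sw) x0.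
Qed.

Lemma zero_set_universal w G f x : hausdorff n univ_zero = 0%E -> nnsol w G f ->
  ~ {ae mu, forall y, w y = 0} -> Omega x -> lpt w x 0 -> univ_zero x.
Proof.
move=> HZ Sw wn0 Ox x0; apply: contrapT => nZ.
have [v_ [G_ [f_ [Sv mono exh]]]] := exhaustion Sw.
have sp k := splitting Sw (Sv k).
have [z_ Hz] := choice sp; have [K_ {}Hz] := choice Hz; have [k_ {}Hz] := choice Hz.
have [y_ {}Hz] := choice Hz; have [L_ {}Hz] := choice Hz; have [l_ {}Hz] := choice Hz.
pose B := \bigcup_k pos_set (y_ k).
(* Both {w > 0} and its complement would have density 1 at y, since y_k is positive only outside {w
   > 0}. *)
have AB y : pos_set w y -> B y -> False.
  move=> [_ [c wc c0]] [k _ [_ [c' yc c'0]]]; have [_ Sy _ disj _] := Hz k.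
  have mP : measurable [set x | 0 < w x] by exact: meas_pos (nnsol_meas Sw).
  apply: (lpt_density_disjoint mP).
    by apply: (lpt_indic_le mP (nnsol_loc Sw) c0 wc); exact: aeW.
  exact: (lpt_indic_le (measurableC mP) (nnsol_loc Sy) c'0 yc disj).
have cov : Omega `\` univ_zero `<=` pos_set w `|` B.
  move=> y [Oy nZy]; have [w0|Ay] := nnsol_lpt Sw Oy; [right|by left].
  have [k vk] := pos_set_cover Sv mono exh Oy nZy; exists k => //.
  have [Sz Sy Ev _ zl] := Hz k; have [y0|//] := nnsol_lpt Sy Oy.
  exfalso; apply: (not_pos_set (Sv k) _ vk); rewrite Ev.
  exact: lptD0 (nnsol_loc Sz) (nnsol_loc Sy) (zl y Oy w0) y0.
(* If w had value 0 at every point, it would vanish almost everywhere by [lpt_ae_eq]. *)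
have [a Aa] : exists a, pos_set w a.
  apply: contrapT => nA; apply: wn0.
  apply: filterS (ae_conj (H10_out M0 OM (nnsol_H10 Sw)) (lpt_ae_eq M0 OM (nnsol_H10 Sw))) => y [h1 h2].
  have [Oy|/h1//] := pselect (Omega y).
  by have [/h2//|h] := nnsol_lpt Sw Oy; case: nA; exists y.
have [Ax|Bx] := cov x (conj Ox nZ); first exact: (not_pos_set Sw x0 Ax).
apply: (@no_split R n Omega oO (pos_set w) B _ cO _ _ _ _ _ HZ cov _ _ Aa Bx).
- by move=> y [].
- by move=> y [k _ []].
- exact: lopen_pos_set Sw.
- by apply: lopen_bigcup => k; have [_ Sy _ _ _] := Hz k; exact: lopen_pos_set Sy.
- by apply/seteqP; split => // y [Ay By]; exact: (AB y Ay By).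
Qed.

End zero_sets.

(** * Passage to functions on the domain *)

Section Lfun_criteria.
Context d (T : measurableType d) (R : realType) (mu : {measure set T -> \bar R}).
Implicit Type f : T -> R.

Lemma Lfun2P f : f \in Lfun mu 2%:E <-> L2 mu f.
Proof.
split=> [h|[mf If]].
  split; last exact: Lfun2_integrable_sqr.
  by move: h; rewrite inE => /andP[]; rewrite inE.
rewrite inE; apply/andP; split; rewrite inE/=; first exact: mf.
rewrite /finite_norm unlock poweR_lty//.
have -> : (\int[mu]_x `|(EFin \o f) x| `^ 2)%E = (\int[mu]_x (f x ^+ 2)%:E)%E.
  by apply: eq_integral => x _ /=; rewrite powR_mulrn// real_normK// num_real.
by rewrite (IE If) ltry.
Qed.

Lemma LfunyP f : f \in Lfun mu +oo%E <->
  measurable_fun setT f /\ exists B : R, {ae mu, forall x, `|f x| <= B}.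
Proof.
split=> [|[mf [B fB]]].
  rewrite inE => /andP[]; rewrite inE => mf; rewrite inE/= => fn; split; first exact: mf.
  move: fn; rewrite /finite_norm unlock /Lnorm; case: ifPn => [m0 fn|].
    have [B eB] : exists B : R, (ess_sup_inf.ess_sup mu (abse \o (EFin \o f)) <= B%:E)%E.
      move: fn; case: (ess_sup_inf.ess_sup _ _) => [r _||_]; [by exists r|by []|by exists 0; rewrite leNye].
    exists B; apply: filterS (ess_sup_inf.ess_sup_ge mu (abse \o (EFin \o f))) => x h.
    by have := le_trans h eB; rewrite /= lee_fin.
  (* The norm is 0 by convention when the whole space is null, and then any bound holds almost
     everywhere. *)
  rewrite -leNgt => m0 _; exists 0; exists setT; split => //.
  by apply/eqP; rewrite eq_le m0 measure_ge0.
rewrite inE; apply/andP; split; rewrite inE/=; first exact: mf.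
rewrite /finite_norm unlock /Lnorm; case: ifPn => // m0.
apply: le_lt_trans (ltry B); apply/ess_sup_inf.ess_supP.
by apply: filterS fB => x; rewrite /= lee_fin.
Qed.

End Lfun_criteria.

Section restriction.
Context {R : realType} {n : nat}.
Variables (Omega : set 'rV[R]_n.+1) (M : R) (M0 : 0 < M) (OM : Omega `<=` cube 0 M).
Hypothesis (oO : open Omega).
Implicit Types (u v w f : 'rV[R]_n.+1 -> R) (V : 'rV[R]_n.+1 -> \bar R) (x : 'rV[R]_n.+1).
Local Notation test := (test_function Omega).
Local Notation mu := (lam n.+1).
Local Notation I := (rint mu).
Local Notation Int := (rintegrable mu).
Local Notation L2 := (L2 mu).

Let mO : measurable Omega.
Proof. exact: open_measurable_rV. Qed.

Lemma res_in v x : Omega x -> (v \_ Omega) x = v x.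
Proof. by move=> Ox; rewrite patchE mem_set. Qed.

Lemma res_out v x : ~ Omega x -> (v \_ Omega) x = 0.
Proof. by move=> Ox; rewrite patchE memNset. Qed.

Lemma integral_res (F : 'rV[R]_n.+1 -> \bar R) (h : 'rV[R]_n.+1 -> R) : Int h ->
  (forall x, Omega x -> F x = (h x)%:E) -> (forall x, ~ Omega x -> h x = 0) ->
  (\int[mu]_(x in Omega) F x = (I h)%:E)%E.
Proof.
move=> Ih Fh h0; rewrite -(IE Ih) [LHS]integral_mkcond.
apply: eq_integral => x _.
rewrite patchE; have [Ox|nO] := pselect (Omega x); first by rewrite mem_set// Fh.
by rewrite memNset// h0.
Qed.

(** Extension by 0 outside Omega; test functions vanish there, so the approximation errors are
    unchanged. *)
Lemma W12_0_H10 w : W12_0 Omega w -> exists G, H10 Omega (w \_ Omega) G.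
Proof.
move=> [g [/Lfun2P Lw Hg] dens]; exists (fun i => g i \_ Omega).
have Lg i : L2 (g i \_ Omega) by have [/Lfun2P] := Hg i.
split => // eps /dens[phi tp b]; exists phi => //.
rewrite -lte_fin; apply: le_lt_trans b; rewrite le_eqVlt; apply/orP; left; apply/eqP.
have sq u psi : L2 (u \_ Omega) -> test psi ->
    (\int[mu]_(x in Omega) ((u x - psi x) ^+ 2)%:E = (sqd (u \_ Omega) psi)%:E)%E.
  move=> Lu tpsi; have [_ Is] := L2B Lu (test_L2 M0 OM tpsi).
  apply: integral_res Is _ _ => x Ox; first by rewrite res_in.
  by rewrite res_out// (test_out tpsi Ox) subrr expr0n.
rewrite /err EFinD; congr (_ + _)%E; first by rewrite [RHS]sq.
by rewrite -sumEFin; apply: eq_bigr => i _; rewrite [RHS]sq//; exact: test_partial.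
Qed.

Lemma L2_res u : L2 u -> L2 (u \_ Omega).
Proof.
move=> Lu; apply: (L2_dom _ Lu).
  by apply/(measurable_restrict _ mO measurableT); rewrite setTI; apply: measurable_funTS; case: Lu.
apply: aeW => x; have [Ox|nO] := pselect (Omega x); first by rewrite res_in.
by rewrite res_out// normr0.
Qed.

Lemma H10_W12_0 w G : H10 Omega w G -> W12_0 Omega w.
Proof.
move=> wG; have Lw := H10_L2 wG; have Lg i := H10_L2g i wG.
exists G.
  split; first by apply/Lfun2P; exact: L2_res.
  move=> i; split; first by apply/Lfun2P; exact: L2_res.
  move=> phi tp; have tpi := test_partial i tp.
  rewrite (@integral_res _ (fun x => w x * partial i phi x))//; first last.
  - by move=> x Ox; rewrite (test_out tpi Ox) mulr0.
  - exact: L2_mul Lw (test_L2 M0 OM tpi).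
  rewrite (@integral_res _ (fun x => G i x * phi x))//; first last.
  - by move=> x Ox; rewrite (test_out tp Ox) mulr0.
  - exact: L2_mul (Lg i) (test_L2 M0 OM tp).
  by rewrite (H10_ibp M0 OM i wG tp) EFinN oppeK.
move=> eps e0; have [_ _ /(_ _ e0)[phi tp he]] := wG; exists phi => //.
have sq u psi : L2 u -> L2 psi ->
    (\int[mu]_(x in Omega) ((u x - psi x) ^+ 2)%:E <= (sqd u psi)%:E)%E.
  move=> Lu Lp; have [_ Is] := L2B Lu Lp; rewrite -(IE Is).
  apply: ge0_subset_integral => //; first by apply/measurable_EFinP; exact: Int_meas Is.
  by move=> x _; rewrite lee_fin sqr_ge0.
apply: (@le_lt_trans _ _ (err w G phi (grad phi))%:E); last by rewrite lte_fin.
rewrite /err EFinD; apply: leeD; first exact: sq Lw (test_L2 M0 OM tp).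
rewrite -sumEFin; apply: lee_sum => i _; apply: sq => //.
exact: (test_L2 M0 OM (test_partial i tp)).
Qed.

Lemma precise_res w x c : Omega x -> precise_value w x c <-> precise_value (w \_ Omega) x c.
Proof.
move=> Ox; have [s s0 cs] := open_cube oO Ox.
have H : \forall r \near 0^'+,
    ((mu (eucl_ball x r))^-1 * \int[mu]_(y in eucl_ball x r) (`|w y - c|)%:E)%E =
    ((mu (eucl_ball x r))^-1 * \int[mu]_(y in eucl_ball x r) (`|(w \_ Omega) y - c|)%:E)%E.
  near=> r; congr (_ * _)%E; apply: eq_integral => y; rewrite inE => xy.
  have rs : r <= s by apply/ltW; near: r; exact: nbhs_right_lt.
  rewrite res_in//; apply: cs => i; have := ball_sub_cube xy i.
  move: rs; clear; move: (x 0 i) (y 0 i) => a b rs /andP[h1 h2]; apply/andP; split; lra.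
rewrite /precise_value; split; apply: cvg_trans; apply: near_eq_cvg => //.
by near=> r; apply/esym; near: r.
Unshelve. all: by end_near.
Qed.

Section potential.
Variable V : 'rV[R]_n.+1 -> \bar R.
Hypotheses (mV : measurable_fun Omega V) (V0 : forall x, Omega x -> (0 <= V x)%E).

(* [V w] is integrable iff [w = 0] a.e. on [{V = +oo}] and [q w] is integrable, where [q] is
   the finite part of [V]; the solutions for [V] are thus those for [q] that vanish there. *)
Definition finite_potential : 'rV[R]_n.+1 -> R := (fine \o V) \_ Omega.
Definition infinite_potential := [set x | Omega x /\ V x = +oo%E].
Local Notation q := finite_potential.
Local Notation T := infinite_potential.

Lemma measurable_res u : measurable_fun Omega u -> measurable_fun setT (u \_ Omega).
Proof. by move=> h; apply/(measurable_restrict _ mO measurableT); rewrite setTI. Qed.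

Lemma measurable_finite_potential : measurable_fun setT q.
Proof. by apply: measurable_res; exact: measurableT_comp. Qed.

Lemma finite_potential_ge0 x : 0 <= q x.
Proof.
rewrite /q; have [Ox|nO] := pselect (Omega x); last by rewrite res_out.
by rewrite res_in//; apply: fine_ge0; exact: V0.
Qed.

Lemma times_potentialE w : {ae mu, forall x, T x -> w x = 0} ->
  {ae mu, forall x, Omega x -> times_potential V w x = (q x * w x)%:E}.
Proof.
apply: filterS => x wx Ox; rewrite /times_potential /q res_in//=.
case E : (V x) => [r||]//=; first by rewrite wx ?mule0 ?mulr0.
by have := V0 Ox; rewrite E.
Qed.

Lemma times_potential_res w x : Omega x -> times_potential V w x = times_potential V (w \_ Omega) x.
Proof. by move=> Ox; rewrite /times_potential res_in. Qed.

Lemma integral_potential w phi : measurable_fun setT w -> measurable_fun Omega (times_potential V w) ->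
  Int (fun x => q x * w x) ->
  {ae mu, forall x, T x -> w x = 0} -> test phi ->
  (\int[mu]_(x in Omega) (times_potential V w x * (phi x)%:E) = (I (fun x => q x * w x * phi x))%:E)%E.
Proof.
move=> mw mt Iq wT tp; have [B phiB] := test_bounded tp.
have mphi := test_measurable tp.
have Iqp : Int (fun x => q x * w x * phi x).
  apply: (Int_dom _ (IntZ B (IntAbs Iq))).
    by apply: measurable_funM mphi; exact: Int_meas Iq.
  by apply: aeW => x; rewrite normrM mulrC ler_wpM2r.
transitivity (\int[mu]_(x in Omega) (q x * w x * phi x)%:E)%E; last first.
  by apply: integral_res => // x Ox; rewrite (test_out tp Ox) mulr0.
apply: ae_eq_integral => //.
- by apply: emeasurable_funM => //; apply/measurable_EFinP; exact: measurable_funTS.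
- by apply/measurable_EFinP; apply: measurable_funTS; exact: Int_meas Iqp.
- by apply: filterS (times_potentialE wT) => x h Ox; rewrite h.
Qed.

Lemma adm_distr w G f phi : adm Omega q w G -> Int (fun x => f x * phi x) ->
  measurable_fun Omega (times_potential V w) -> {ae mu, forall x, T x -> w x = 0} -> test phi ->
  ((- (\int[mu]_(x in Omega) (w x * laplacian phi x)%:E)
     + (\int[mu]_(x in Omega) (times_potential V w x * (phi x)%:E)) =
     \int[mu]_(x in Omega) (f x * phi x)%:E)%E) <-> energy q w G phi (grad phi) = I (fun x => f x * phi x).
Proof.
move=> aw If mt wT tp; have [wG _ Iq] := aw; have tl := test_laplacian tp.
rewrite (integral_potential (H10_meas wG) mt Iq wT tp).
rewrite (@integral_res _ (fun x => w x * laplacian phi x))//; first last.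
- by move=> x Ox; rewrite (test_out tl Ox) mulr0.
- exact: L2_mul (H10_L2 wG) (test_L2 M0 OM tl).
rewrite (@integral_res _ (fun x => f x * phi x))//; last first.
  by move=> x Ox; rewrite (test_out tp Ox) mulr0.
rewrite (adm_lap M0 OM aw tp) -EFinN -EFinD opprB subrK.
by split => [[]|->].
Qed.

Lemma solution_nnsol w f : Lp Omega +oo%E f -> nonneg_on Omega f -> solution Omega V w f ->
  exists G, nnsol Omega q T (w \_ Omega) G (f \_ Omega).
Proof.
move=> /LfunyP[mf bf] f0 [/W12_0_H10[G wG] /LfunyP[mw bw] It eqw]; exists G.
have wT : {ae mu, forall x, T x -> (w \_ Omega) x = 0}.
  apply: filterS (integrable_ae mO It) => x h [Ox Vx]; rewrite res_in//.
  have := h Ox; rewrite /times_potential Vx; have [->//|w0] := eqVneq (w x) 0.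
  by move: w0; rewrite neq_lt => /orP[]w0; [rewrite lt0_mulye|rewrite gt0_mulye]; rewrite ?lte_fin.
have It' : mu.-integrable Omega (times_potential V (w \_ Omega)).
  by apply: eq_integrable It => // x; rewrite inE => Ox; rewrite [LHS]times_potential_res.
have Iq : Int (fun x => q x * (w \_ Omega) x).
  have mqw : measurable_fun setT (fun x => q x * (w \_ Omega) x).
    by apply: measurable_funM => //; exact: measurable_finite_potential.
  have := It'; rewrite (integrable_mkcond _ mO) => It2.
  apply: le_integrable It2 => //; first exact/measurable_EFinP.
  move=> x _; have [Ox|nO] := pselect (Omega x); last first.
    by rewrite /= (res_out w nO) mulr0 normr0; exact: abse_ge0.
  rewrite [X in (_ <= `|X|)%E]patchE mem_set// /times_potential /q /= !res_in//=.
  case EV : (V x) => [r||] //=; first by rewrite mul0r normr0; exact: abse_ge0.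
  by have := V0 Ox; rewrite EV.
have df : data Omega (f \_ Omega) by split => // x Ox; exact: res_out.
have aw : adm Omega q (w \_ Omega) G by [].
split => //; last first.
  apply: filterS f0 => x h; have [Ox|nO] := pselect (Omega x); first by rewrite res_in// h.
  by rewrite res_out.
split => // phi tp; have [B phiB] := test_bounded tp.
have Ifp : Int (fun x => (f \_ Omega) x * phi x).
  apply: (Int_dom _ (IntZ B (IntAbs (data_Int M0 OM df)))).
    by apply: measurable_funM => //; exact: test_measurable tp.
  by apply: aeW => x; rewrite normrM mulrC ler_wpM2r.
apply/(adm_distr aw Ifp _ wT tp); first by case/integrableP : It'.
have eqO (F F' : 'rV[R]_n.+1 -> \bar R) : (forall x, Omega x -> F x = F' x) ->
    (\int[mu]_(x in Omega) F x = \int[mu]_(x in Omega) F' x)%E.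
  by move=> h; apply: eq_integral => x; rewrite inE => /h.
rewrite (eqO _ (fun x => (w x * laplacian phi x)%:E)); last by move=> x Ox; rewrite res_in.
rewrite (eqO (fun x => (times_potential V (w \_ Omega) x * (phi x)%:E)%E) (fun x => (times_potential V w x * (phi x)%:E)%E)); last first.
  by move=> x Ox; rewrite -times_potential_res.
rewrite [RHS](eqO _ (fun x => (f x * phi x)%:E)); last by move=> x Ox; rewrite res_in.
exact: eqw.
Qed.

Lemma nnsol_solution w G f : nnsol Omega q T w G f ->
  [/\ Lp Omega +oo%E f, nonneg_on Omega f & solution Omega V w f].
Proof.
move=> [[aw df eqw] f0 wT]; have [wG [B wB] Iq] := aw; have [mf [C fC] _] := df.
have mw := H10_meas wG.
have LpB u : measurable_fun setT u -> (exists B : R, {ae mu, forall x, `|u x| <= B}) -> Lp Omega +oo%E u.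
  move=> mu0 [D uD]; apply/LfunyP; split; first exact: measurable_res (measurable_funTS mu0).
  exists (Num.max D 0); apply: filterS uD => x h.
  have [Ox|nO] := pselect (Omega x); first by rewrite res_in// le_max h.
  by rewrite res_out// normr0 le_max lexx orbT.
have mt : measurable_fun Omega (times_potential V w).
  by apply: emeasurable_funM => //; apply/measurable_EFinP; exact: measurable_funTS.
split; [by apply: LpB => //; exists C|by apply: filterS f0|split].
- exact: H10_W12_0 wG.
- by apply: LpB => //; exists B.
- apply/integrableP; split => //.
  have := Iq => /integrableP[_ Iq2]; apply: le_lt_trans Iq2.
  have mqe : measurable_fun setT (fun x => `|(q x * w x)%:E|%E).
    by apply: measurableT_comp => //; apply/measurable_EFinP; exact: Int_meas Iq.
  apply: (@le_trans _ _ (\int[mu]_(x in Omega) `|(q x * w x)%:E|)%E); last first.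
    by apply: ge0_subset_integral.
  rewrite le_eqVlt; apply/orP; left; apply/eqP; apply: ae_eq_integral => //.
  - by apply: measurableT_comp.
  - exact: measurable_funTS.
  - by apply: filterS (times_potentialE wT) => x h Ox; rewrite h.
- move=> phi tp; apply/(adm_distr aw _ mt wT tp); last exact: eqw.
  exact: (Sol_data_Int M0 OM (And3 aw df eqw) (HB_test M0 OM tp)).
Qed.

End potential.
End restriction.

(** * Nonzero data give nonzero solutions *)

Section positivity.
Context {R : realType} {n : nat}.
Variables (Omega : set 'rV[R]_n.+1) (M : R) (M0 : 0 < M) (OM : Omega `<=` cube 0 M).
Hypothesis (oO : open Omega).
Implicit Types (f w : 'rV[R]_n.+1 -> R) (x a : 'rV[R]_n.+1).
Local Notation test := (test_function Omega).
Local Notation mu := (lam n.+1).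
Local Notation I := (rint mu).
Local Notation Int := (rintegrable mu).

(** Provides a countable family of cubes, so that the exceptional sets in [data_eq0] add up to a
    null set. *)
Lemma rational_cube x : Omega x -> exists (k : nat) (c : 'rV[rat]_n.+1),
  let a : 'rV[R]_n.+1 := \row_j ratr (c 0 j) in
  cube a (rk k) `<=` Omega /\ cube a (theta (n := n) * rk k) x.
Proof.
move=> Ox; have [s s0 cs] := open_cube oO Ox.
have s20 : 0 < s / 2 by rewrite divr_gt0.
have [k /(_ k (leqnn k)) ks] := rk_small s20; exists k => /=; have k0 := @rk_gt0 R k.
have [d [d0 dk dE]] : exists d : R, [/\ 0 < d, d <= rk k & theta (n := n) * rk k = d].
  exists (theta (n := n) * rk k); split => //; first by rewrite mulr_gt0// theta_gt0.
  by rewrite ler_piMl// ?(ltW k0)// invf_le1 ?mulr_gt0// mulr_ege1// ler1n.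
rewrite dE; have xq j : exists q : rat, `|ratr q - x 0 j| < d.
  have [q] : exists q : rat, ratr q \in `]x 0 j - d, x 0 j + d[.
    by apply: rat_in_itvoo; rewrite ltrD2l gtrN.
  by rewrite in_itv/= => qx; exists q; rewrite ltr_distl.
have [q qx] := choice xq; exists (\row_j q j); split.
  move=> y ya; apply: cs => i; have := ya i; have := qx i; rewrite !mxE ltr_distl.
  move: (rk k) (x 0 i) (y 0 i) (ratr (q i)) ks dk => e b c g ks dk.
  by move=> /andP[h1 h2] /andP[h3 h4]; apply/andP; split; lra.
move=> i; have := qx i; rewrite !mxE ltr_distl => /andP[h1 h2].
by move: (x 0 i) (ratr (q i)) h1 h2 => b c h1 h2; apply/andP; split; lra.
Qed.

Lemma data_eq0 f : data Omega f -> {ae mu, forall x, 0 <= f x} ->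
  (forall phi, test phi -> I (fun x => f x * phi x) = 0) -> {ae mu, forall x, f x = 0}.
Proof.
move=> df f0 Hf; have [mf _ fout] := df.
pose P (ck : 'rV[rat]_n.+1 * nat) x := let a : 'rV[R]_n.+1 := \row_j ratr (ck.1 0 j) in
  cube a (rk ck.2) `<=` Omega -> cube a (theta (n := n) * rk ck.2) x -> f x = 0.
have aP ck : {ae mu, forall x, P ck x}.
  rewrite /P; set a := (\row_j _ : 'rV[R]_n.+1); set r : R := rk ck.2 => /=.
  have r0 : 0 < r by exact: rk_gt0.
  have [cO|nc] := pselect (cube a r `<=` Omega); last by apply: aeW => x /nc.
  have tp := test_prof 2 r0 cO; have [B pB] := test_bounded tp.
  have p0 x : 0 <= prof 2 (r^-1 ^+ 2) a x by exact: flat_ge0.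
  have Ip : Int (fun x => f x * prof 2 (r^-1 ^+ 2) a x).
    apply: (Int_dom _ (IntZ B (IntAbs (data_Int M0 OM df)))).
      by apply: measurable_funM => //; exact: test_measurable tp.
    by apply: aeW => x; rewrite normrM mulrC ler_wpM2r.
  have fp0 : {ae mu, forall x, 0 <= f x * prof 2 (r^-1 ^+ 2) a x}.
    by apply: filterS f0 => x ?; rewrite mulr_ge0.
  have := I_eq0 Ip fp0; rewrite (Hf _ tp) => /(_ (lexx 0)).
  (* On the smaller cube the bump is bounded below by [kerK_lower], so the vanishing product forces
     f = 0. *)
  apply: filterS => x h _ cx; apply/eqP; move/eqP: h; rewrite mulf_eq0 => /orP[//|/eqP px].
  have := kerK_lower r0 cx; rewrite /kerK px !mulr0 leNgt mulr_gt0 ?kap_gt0//.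
  by rewrite exprn_gt0// invr_gt0.
have : {ae mu, forall x, forall k : nat, if unpickle k is Some ck then P ck x else True}.
  by apply: ae_foralln => k; case: (unpickle k) => [ck|]; [exact: aP|exact: aeW].
apply: filterS => x h; have [Ox|/fout//] := pselect (Omega x).
have [k [c [h1 h2]]] := rational_cube Ox.
by have := h (pickle (c, k)); rewrite pickleK; exact.
Qed.

(** If w vanished almost everywhere, so would its gradient by [H10_grad0]; the equation would then
    make f orthogonal to all test functions. *)
Lemma nnsol_neq0 q T w G f : nnsol Omega q T w G f -> 0 < I f -> ~ {ae mu, forall x, w x = 0}.
Proof.
move=> Sw If0 w0; have [[[wG _ _] df eqf] f0 _] := Sw.
suff : {ae mu, forall x, f x = 0}.
  have [mf _ _] := df; move=> h; move: If0.
  by rewrite (ae_eq_I mf (measurable_cst (0 : R)) h) I0 ltxx.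
apply: data_eq0 => // phi tp; rewrite -(eqf phi tp) /energy.
have wf : HB Omega phi (grad phi) := HB_test M0 OM tp.
have ae0 (h : 'rV[R]_n.+1 -> R) : Int h -> {ae mu, forall x, h x = 0} -> I h = 0.
  by move=> /Int_meas mh h0; rewrite (ae_eq_I mh (measurable_cst (0 : R)) h0) I0.
have aw : adm Omega q w G by have [[]] := Sw.
rewrite big1 ?add0r => [|i _]; apply: ae0; [exact: qInt aw wf| |exact: gInt (adm_HB aw) wf|].
  by apply: filterS w0 => x ->; rewrite mulr0 mul0r.
by apply: filterS (ae_conj w0 (H10_grad0 M0 OM i wG)) => x [h1 h2]; rewrite h2// mul0r.
Qed.

End positivity.

Section sobolev_connectedness.
Context {R : realType} {n : nat}.
Variables (Omega : set 'rV[R]_n.+1) (M : R) (M0 : 0 < M) (OM : Omega `<=` cube 0 M).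
Hypotheses (oO : open Omega) (cO : connected Omega).
Variable V : 'rV[R]_n.+1 -> \bar R.
Hypotheses (mV : measurable_fun Omega V) (V0 : forall x, Omega x -> (0 <= V x)%E).
Implicit Types (f w : 'rV[R]_n.+1 -> R) (A : set 'rV[R]_n.+1).
Local Notation mu := (lam n.+1).
Local Notation q := (finite_potential Omega V).
Local Notation T := (infinite_potential Omega V).

Lemma lpt_precise_res w x c : Lp Omega 2%:E w \/ Lp Omega +oo%E w -> Omega x ->
  precise_value w x c <-> lpt (w \_ Omega) x c.
Proof.
move=> Lw Ox; have mw : measurable_fun setT (w \_ Omega).
  by case: Lw => [/Lfun2P[]|/LfunyP[]].
by rewrite (precise_res oO w c Ox) lpt_precise.
Qed.

Lemma universal_zero_setE : universal_zero_set Omega V = univ_zero Omega q T.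
Proof.
apply/seteqP; split => x [Ox H]; split => // w; last first.
  move=> f Lf f0 Sw; have [G Sw'] := solution_nnsol M0 OM oO mV V0 Lf f0 Sw.
  by apply/(lpt_precise_res _ _ Ox); [right; case: Sw|exact: H Sw'].
move=> G f Sw; have [Lf f0 Sw'] := nnsol_solution M0 OM oO mV V0 Sw.
have := H w f Lf f0 Sw'; rewrite lpt_precise//; exact: nnsol_meas Sw.
Qed.

Lemma sobolev_open_lopen A : sobolev_open Omega A -> lopen Omega A.
Proof.
move=> [_ [xi [W _ xp ->]]]; have [G xG] := W12_0_H10 M0 OM W.
have Lx : Lp Omega 2%:E xi \/ Lp Omega +oo%E xi by left; case: W => g [].
rewrite (_ : [set x | _] = [set x | Omega x /\ exists2 c, lpt (xi \_ Omega) x c & 0 < c]).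
  apply: (lopen_sob M0 OM oO xG) => x Ox; have [c xc] := xp x Ox; exists c.
  exact/(lpt_precise_res _ Lx Ox).
by apply/seteqP; split => x [Ox [c xc c0]]; split => //; exists c => //;
  apply/(lpt_precise_res _ Lx Ox).
Qed.

Lemma sobolev_connected_complement (Z : set 'rV[R]_n.+1) : hausdorff n Z = 0%E ->
  sobolev_connected Omega (Omega `\` Z).
Proof.
move=> HZ; split; first by move=> x [].
move=> A B oA oB AB cov; have [AO _] := oA; have [BO _] := oB.
have [|/existsNP[a /not_implyP[Da nAa]]] := pselect (Omega `\` Z `<=` A); first by left.
right => b Db; have [Ab|//] := cov b Db; have [//|Ba] := cov a Da.
by have := no_split oO cO AO BO (sobolev_open_lopen oA) (sobolev_open_lopen oB) AB HZ cov Ab Ba.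
Qed.

Lemma precise_value0_universal w f x : hausdorff n (universal_zero_set Omega V) = 0%E ->
  Lp Omega +oo%E f -> nonneg_on Omega f -> (0 < \int[mu]_(x in Omega) (f x)%:E)%E ->
  solution Omega V w f -> Omega x -> precise_value w x 0 <-> universal_zero_set Omega V x.
Proof.
move=> HZ Lf f0 If Sw Ox; split=> [wx|[_ Zx]]; last exact: Zx Lf f0 Sw.
have [G Sw'] := solution_nnsol M0 OM oO mV V0 Lf f0 Sw.
have [[_ df _] _ _] := Sw'; rewrite universal_zero_setE in HZ *.
apply: (zero_set_universal M0 OM oO cO (measurable_finite_potential oO mV)
  (finite_potential_ge0 V0) HZ Sw' _ Ox).
  apply: (nnsol_neq0 M0 OM oO Sw').
  rewrite -lte_fin -(@integral_res _ _ Omega (fun x => (f x)%:E) _ (data_Int M0 OM df))//.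
    by move=> y Oy; rewrite res_in.
  by move=> y Oy; rewrite res_out.
by apply/(lpt_precise_res _ _ Ox) => //; right; case: Sw.
Qed.

End sobolev_connectedness.

Lemma bounded_in_cube (R : realType) (n : nat) (Omega : set 'rV[R]_n) : bounded_set Omega ->
  exists2 M : R, 0 < M & Omega `<=` cube 0 M.
Proof.
move=> [M0 [_ HM]]; exists (`|M0| + 1); first by rewrite ltr_wpDl.
move=> x Ox i; have h : M0 < `|M0| + 1 by rewrite ltr_pwDr// ler_norm.
have := le_trans (coord_le_norm x i) (HM _ h x Ox).
by rewrite mxE sub0r add0r ler_norml.
Qed.

Unset Implicit Arguments.

Theorem corollary1p2 (R : realType) (N : nat) (Omega : set 'rV[R]_N)
    (V : 'rV[R]_N -> \bar R) :
  (0 < N)%N ->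
  smooth_domain Omega ->
  measurable_fun Omega V ->
  (forall x, Omega x -> (0 <= V x)%E) ->
  hausdorff N.-1 (universal_zero_set Omega V) = 0%E ->
  sobolev_connected Omega (Omega `\` universal_zero_set Omega V) /\
  (forall w1 f1 w2 f2 : 'rV[R]_N -> R,
     Lp Omega +oo%E f1 -> nonneg_on Omega f1 ->
     (0 < \int[lebesgueN N]_(x in Omega) (f1 x)%:E)%E ->
     solution Omega V w1 f1 ->
     Lp Omega +oo%E f2 -> nonneg_on Omega f2 ->
     (0 < \int[lebesgueN N]_(x in Omega) (f2 x)%:E)%E ->
     solution Omega V w2 f2 ->
     zero_set Omega w1 = zero_set Omega w2) /\
  (forall w f : 'rV[R]_N -> R,
     Lp Omega +oo%E f -> nonneg_on Omega f ->
     (0 < \int[lebesgueN N]_(x in Omega) (f x)%:E)%E ->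
     solution Omega V w f ->
     forall x, Omega x ->
       precise_value w x 0 <-> universal_zero_set Omega V x).
Proof.
case: N Omega V => // n Omega V _ [oO /bounded_in_cube[M M0 OM] cO _] mV V0 HZ.
have zP w f (Lf : Lp Omega +oo%E f) (f0 : nonneg_on Omega f)
    (If : (0 < \int[lebesgueN n.+1]_(x in Omega) (f x)%:E)%E) (Sw : solution Omega V w f) x (Ox : Omega x) :
    precise_value w x 0 <-> universal_zero_set Omega V x.
  exact: (precise_value0_universal M0 OM oO cO mV V0 HZ Lf f0 If Sw Ox).
split; first exact: (sobolev_connected_complement M0 OM oO cO HZ).
split; last exact: zP.
move=> w1 f1 w2 f2 L1 p1 I1 S1 L2 p2 I2 S2; apply/seteqP; split => x [Ox H]; split => //.
  by apply/(zP _ _ L2 p2 I2 S2 x Ox)/(zP _ _ L1 p1 I1 S1 x Ox).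
by apply/(zP _ _ L1 p1 I1 S1 x Ox)/(zP _ _ L2 p2 I2 S2 x Ox).
Qed.
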